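(* Assume that the nearest-neighbour conductances $\omega$ are sampled from an ergodic translation-invariant probability measure $\mathbb{P}$ such that (1) $\mathbb{P}$-almost every sample $\omega$ has exactly one infinite connected component, denoted $\mathcal{C}(\omega)$, and (2) they satisfy the moment condition $\mathbb{E}[\omega(x,y)^{d/2}]<\infty$, $x,y\in\mathbb{Z}^d$. Then the following statements hold for $\mathbb{P}$-almost every $\omega$. (i) There is a well-defined semigroup $(T^\omega_t)_{t\ge0}$ associated to the SDE $$d\phi_t(x)=\sum_{y\sim x}\omega(x,y)(\phi_t(y)-\phi_t(x))\,dt+\sqrt2\,dB_t(x),\qquad x\in\mathcal{C}(\omega),$$ with conductances $\omega$. (ii) For all $\lambda\in\mathbb{C}\setminus[0,\infty)$ there are no non-trivial solutions $\psi\in\mathcal{S}'(\mathcal{C}(\omega))$ (complex-valued) to the eigenvalue equation $\Delta_\omega\psi=\lambda\psi$, and in particular there are no $(P^\omega_t)_{t\ge0}$-invariant probability measures $\varrho$ on $\mathcal{S}'(\mathcal{C}(\omega))$ that satisfy both $$\varrho(\{\xi\in\mathcal{S}':P^\omega_T\xi=\xi\})<1$$ for some $T>0$ and the moment condition $$\varrho\big[\|\xi\|^2_{H_{-N}}\big]=\sum_x\langle x\rangle^{-2N}\varrho\big[|\xi(x)|^2\big]<\infty$$ for some $N\ge0$.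
   Context: Let $d\ge1$; $x\sim y$ means that $x,y\in\mathbb{Z}^d$ are nearest neighbours. Conductances $\omega=(\omega(x,y))_{x,y\in\mathbb{Z}^d}$ are non-negative, symmetric and vanish unless $x\sim y$; connected components refer to the graph on $\mathbb{Z}^d$ whose edges are the pairs $\{x,y\}$ with $\omega(x,y)>0$. $\mathbb{P}$ is a probability measure on such $\omega$, with expectation $\mathbb{E}$; translation-invariance and ergodicity refer to the action of $\mathbb{Z}^d$ by shifts. $(B_t(x))$ are independent standard Brownian motions. The formal Laplacian is $(\Delta_\omega u)(x)=\sum_{y\sim x}\omega(x,y)[u(x)-u(y)]$. The variable speed random walk is the continuous-time Markov chain $(X_t)_{t\ge0}$ on $\mathcal{C}(\omega)$ with generator $-\Delta_\omega$, and $p^\omega_t(x,y)=\mathbf{P}^\omega_x[X_t=y,\zeta>t]$, with $\zeta$ the explosion time. Write $\langle x\rangle=(1+|x|^2)^{1/2}$. For $N\ge0$, $H_{-N}$ is the space of functions $f$ on $\mathcal{C}(\omega)$ with $\|f\|_{H_{-N}}^2=\sum_x\langle x\rangle^{-2N}|f(x)|^2<\infty$; $\mathcal{S}'=\mathcal{S}'(\mathcal{C}(\omega))=\bigcup_{N\ge0}H_{-N}$ (real-valued functions, or complex-valued ones where indicated). The random walk semigroup acts on $\mathcal{S}'$ by $(P^\omega_t\xi)(x)=\sum_yp^\omega_t(x,y)\xi(y)$; $\varrho$ is $(P^\omega_t)_{t\ge0}$-invariant if $\varrho\circ(P^\omega_t)^{-1}=\varrho$ for all $t\ge0$. The notation $\varrho[F(\xi)]$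 means $\int F\,d\varrho$. That the semigroup $(T_t^\omega)$ is well-defined means that the SDE is well-posed in the following sense: the variable speed random walk is non-explosive, and for every $\phi_0\in\mathcal{S}'$ there is a unique adapted process $\phi\in C([0,\infty);\mathcal{S}')$ such that for some $N\in\mathbb{N}$ almost surely $\phi\in C([0,\infty);H_{-N})$ and $\phi_t=\phi_0-\int_0^t\Delta_\omega\phi_s\,ds+\sqrt2B_t$ for all $t\ge0$ in $H_{-(N+2)}$; it is given by $\phi_t(x)=(P^\omega_t\phi_0)(x)+\sqrt2\sum_y\int_0^tp^\omega_{t-s}(x,y)\,dB_s(y)$. Then $T^\omega_tF(\phi)=\mathbb{E}_\phi[F(\phi_t)]$ for bounded measurable $F:\mathcal{S}'\to\mathbb{R}$, where $\mathbb{E}_\phi$ is expectation for the solution with $\phi_0=\phi$. *)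

(* Defs.v *)
From HB Require Import structures.
From mathcomp Require Export all_boot all_order all_algebra.
From mathcomp Require Export all_classical all_reals all_analysis.
From mathcomp.real_closed Require Export complex.

Set Implicit Arguments.
Unset Strict Implicit.
Unset Printing Implicit Defensive.

Import Order.TTheory GRing.Theory Num.Theory.
Import numFieldNormedType.Exports.

Local Open Scope classical_set_scope.
Local Open Scope ring_scope.

Definition Zd (d : nat) : Type := 'rV[int]_d.
HB.instance Definition _ d := GRing.Zmodule.on (Zd d).

Definition adj d (x y : Zd d) : bool := \sum_(i < d) `|x 0 i - y 0 i| == 1.

Record conductances (d : nat) (R : realType) := Conductances {
  cond :> Zd d -> Zd d -> R;
  cond_ge0 : forall x y, 0 <= cond x y;
  cond_sym : forall x y, cond x y = cond y x;
  cond_nn : forall x y, ~~ adj x y -> cond x y = 0 }.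

Definition cylinders (R : realType) (I T : Type) (ev : I -> T -> R) :
  set (set T) := [set A | exists i (B : set R), measurable B /\ A = ev i @^-1` B].

Section configuration_space.
Variables (d : nat) (R : realType).

HB.instance Definition _ := gen_eqMixin (conductances d R).
HB.instance Definition _ := gen_choiceMixin (conductances d R).

Definition cond0 : conductances d R :=
  @Conductances d R (fun _ _ => 0) (fun _ _ => lexx 0) (fun _ _ => erefl)
    (fun _ _ _ => erefl).
HB.instance Definition _ := isPointed.Build (conductances d R) cond0.

(* product sigma-algebra *)
Definition cond_cylinders : set (set (conductances d R)) :=
  cylinders (fun (xy : Zd d * Zd d) (w : conductances d R) => w xy.1 xy.2).
HB.instance Definition _ := Measurable.copy (conductances d R)
  (g_sigma_algebraType cond_cylinders).

Lemma shift_subproof (z : Zd d) (w : conductances d R) (x y : Zd d) :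
  ~~ adj x y -> w (x + z) (y + z) = 0.
Proof.
move=> xy; apply: cond_nn; rewrite /adj; move: xy; congr (~~ (_ == _)).
by apply: eq_bigr => i _; rewrite !mxE opprD addrACA subrr addr0.
Qed.

Definition shift (z : Zd d) (w : conductances d R) : conductances d R :=
  @Conductances d R (fun x y => w (x + z) (y + z))
    (fun x y => cond_ge0 w (x + z) (y + z))
    (fun x y => cond_sym w (x + z) (y + z)) (shift_subproof z w).

Definition translation_invariant (P : probability (conductances d R) R) :=
  forall z A, measurable A -> P (shift z @^-1` A) = P A.

Definition ergodic (P : probability (conductances d R) R) :=
  forall A, measurable A -> (forall z, shift z @^-1` A = A) ->
    P A = 0%E \/ P A = 1%E.

End configuration_space.

Section cluster.
Variables (d : nat) (R : realType) (w : conductances d R).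

Definition connected_to (x y : Zd d) : Prop :=
  exists2 p : seq (Zd d), path (fun a b => 0 < w a b) x p & last x p = y.

Definition component (x : Zd d) : set (Zd d) := [set y | connected_to x y].

Definition infinite_component (C : set (Zd d)) : Prop :=
  (exists x, C = component x) /\ infinite_set C.

(* The infinite component, whenever there is exactly one. *)
Definition cluster : set (Zd d) := [set x | infinite_set (component x)].

Definition vertex : Type := set_type cluster.
HB.instance Definition _ := Choice.on vertex.

Definition nbr (x : vertex) : set vertex := [set y | adj (\val x) (\val y)].

(* To be used with E := R and E := Rcomplex R, i.e. R[i] as a normed R-module. *)
Definition laplacian (E : lmodType R) (u : vertex -> E) (x : vertex) : E :=
  \sum_(y \in nbr x) w (\val x) (\val y) *: (u x - u y).

Definition total_rate (x : vertex) : R :=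
  \sum_(y \in nbr x) w (\val x) (\val y).

Definition bracket (x : Zd d) : R :=
  Num.sqrt (1 + \sum_(i < d) (x 0 i)%:~R ^+ 2).

Definition sqnormH (E : normedZmodType R) (N : R) (f : vertex -> E) : \bar R :=
  (\esum_(x in [set: vertex])
     (bracket (\val x) `^ (- (2 * N)) * `|f x| ^+ 2)%:E)%E.

Definition is_tempered (E : normedZmodType R) (f : vertex -> E) : Prop :=
  exists2 N : R, 0 <= N & (sqnormH N f < +oo)%E.

Record tempered := Tempered {
  tval :> vertex -> R;
  temperedP : is_tempered tval }.

HB.instance Definition _ := gen_eqMixin tempered.
HB.instance Definition _ := gen_choiceMixin tempered.

Lemma is_tempered0 : is_tempered (fun _ : vertex => 0 : R).
Proof.
exists 0 => //; rewrite /sqnormH esum1// => x _.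
by rewrite normr0 expr0n mulr0.
Qed.

HB.instance Definition _ := isPointed.Build tempered (Tempered is_tempered0).

(* The sigma-algebra generated by the evaluations; it is the Borel
   sigma-algebra of the inductive limit topology below. *)
Definition tempered_cylinders : set (set tempered) :=
  cylinders (fun (x : vertex) (xi : tempered) => xi x).
HB.instance Definition _ := Measurable.copy tempered
  (g_sigma_algebraType tempered_cylinders).

Definition cont_H (N : R) (f : R -> vertex -> R) : Prop :=
  (forall t : R, 0 <= t -> (sqnormH N (f t) < +oo)%E) /\
  (forall t : R, 0 <= t ->
     sqnormH N (f s \- f t) @[s --> within `[0, +oo[ (nbhs t)] --> 0%E).

(* S' is the locally convex inductive limit of the spaces H_{-N}: the
   absolutely convex sets whose trace on every H_{-N} is a neighbourhood of 0
   there form a basis of neighbourhoods of 0. *)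
Definition tempered_nbhs0 (U : set (vertex -> R)) : Prop :=
  (forall f g a b, U f -> U g -> `|a| + `|b| <= 1 ->
     U (fun x => a * f x + b * g x)) /\
  (forall N : R, 0 <= N ->
     exists2 e : R, 0 < e & forall f, (sqnormH N f < e%:E)%E -> U f).

Definition cont_tempered (f : R -> tempered) : Prop :=
  forall t : R, 0 <= t -> forall U, tempered_nbhs0 U ->
    \forall s \near (within `[0, +oo[ (nbhs t)), U (f s \- f t).

(* I is the Bochner integral over [0, t] of the H_{-N}-valued function f:
   H_{-N} is a separable Hilbert space in which the evaluations are continuous
   and total, hence f is strongly measurable iff it is coordinatewise
   measurable, and its integral is computed coordinatewise. *)
Definition is_Hintegral (N t : R) (f : R -> vertex -> R) (I : vertex -> R) :=
  [/\ forall x, measurable_fun `[0, t] (fun s => f s x),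
      forall s : R, s \in `[0, t] -> (sqnormH N (f s) < +oo)%E,
      (\int[lebesgue_measure]_(s in `[0%R, t])
         (Num.sqrt (fine (sqnormH N (f s))))%:E < +oo)%E
    & forall x, I x = \int[lebesgue_measure]_(s in `[0, t]) f s x].

End cluster.

Section walk.
Variables (d : nat) (R : realType) (w : conductances d R).
Local Notation V := (vertex w).

(* The continuous-time Markov chain with generator minus the Laplacian, by its
   jump chain and holding times: from x it jumps to y with probability
   w x y / total_rate x, after an exponential time of rate total_rate x. *)
Record vsrw := VSRW {
  rw_disp : measure_display;
  rw_space : measurableType rw_disp;
  rw_law : V -> probability rw_space R;
  rw_jump : nat -> rw_space -> V;
  rw_hold : nat -> rw_space -> R;
  rw_jump_measurable : forall n y, measurable [set o | rw_jump n o = y];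
  rw_hold_measurable : forall n, measurable_fun [set: rw_space] (rw_hold n);
  rw_hold_gt0 : forall n o, 0 < rw_hold n o;
  rw_lawE : forall (x : V) (n : nat) (y : nat -> V) (s : nat -> R),
    (forall i, 0 <= s i) ->
    rw_law x [set o | forall i, (i <= n)%N ->
                        rw_jump i o = y i /\ s i < rw_hold i o] =
    ((y 0%N == x)%:R *
     \prod_(i < n) (w (\val (y i)) (\val (y i.+1)) / total_rate (y i)) *
     \prod_(i < n.+1) expR (- (total_rate (y i) * s i)))%:E }.

Variable X : vsrw.

Definition jump_time (n : nat) (o : rw_space X) : R :=
  \sum_(i < n) rw_hold i o.

Definition explosion_time (o : rw_space X) : \bar R :=
  ereal_sup (range (fun n => (jump_time n o)%:E)).

Definition nonexplosive : Prop :=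
  forall x, {ae rw_law X x, forall o, explosion_time o = +oo%E}.

(* the event that t < explosion_time and the walk is at y at time t *)
Definition walk_at (t : R) (y : V) : set (rw_space X) :=
  [set o | exists2 n, jump_time n o <= t < jump_time n.+1 o & rw_jump n o = y].

Definition heat_kernel (t : R) (x y : V) : R :=
  fine (rw_law X x (walk_at t y)).

Definition vsum (f : V -> R) : R :=
  fine (\esum_(y in [set: V]) (Num.max (f y) 0)%:E)%E -
  fine (\esum_(y in [set: V]) (Num.max (- f y) 0)%:E)%E.

Definition rw_semigroup (t : R) (u : V -> R) (x : V) : R :=
  vsum (fun y => heat_kernel t x y * u y).

Definition rw_acts_on_tempered : Prop :=
  forall t : R, 0 <= t -> forall xi : tempered w,
    (forall x, summable [set: V] (fun y => (heat_kernel t x y * xi y)%:E)) /\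
    is_tempered (rw_semigroup t xi).

Definition rw_invariant (rho : probability (tempered w) R) : Prop :=
  forall t : R, 0 <= t -> forall A : set (tempered w), measurable A ->
    rho [set xi : tempered w |
           exists2 eta : tempered w, A eta & rw_semigroup t xi = eta] = rho A.

End walk.

Section noise.
Variables (d : nat) (R : realType).
Variables (dO : measure_display) (Omega : measurableType dO).
Variable Q : probability Omega R.

Definition complete_filtration (F : R -> set (set Omega)) : Prop :=
  [/\ forall t : R, 0 <= t -> sigma_algebra setT (F t),
      forall t : R, 0 <= t -> F t `<=` measurable,
      forall s t : R, 0 <= s -> s <= t -> F s `<=` F t
    & forall A, measurable A -> Q A = 0%E -> F 0 A].

(* The last condition says at once that the increments of the B x over [s, t]
   are centred Gaussian of variance t - s, mutually independent over x, and
   independent of F s. *)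
Definition brownian_motions (F : R -> set (set Omega))
    (B : Zd d -> R -> Omega -> R) : Prop :=
  [/\ forall x (t : R) (A : set R), 0 <= t -> measurable A -> F t (B x t @^-1` A),
      forall x, {ae Q, forall o, B x 0 o = 0},
      forall x, {ae Q, forall o, {within `[0, +oo[, continuous (B x ^~ o)}}
    & forall s t : R, 0 <= s -> s < t ->
      forall (G : set Omega) (xs : seq (Zd d)) (A : Zd d -> set R),
        F s G -> uniq xs -> (forall x, measurable (A x)) ->
        Q (G `&` [set o | forall x, x \in xs -> A x (B x t o - B x s o)]) =
        (Q G * (\prod_(x <- xs) fine (normal_prob 0 (Num.sqrt (t - s)) (A x)))%:E)%E].

(* A step function is a list of ((a, b), c), standing for the sum of the
   c * 1_(a, b]. *)
Definition step_fun (h : seq (R * R * R)) (s : R) : R :=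
  \sum_(c <- h) c.2 * \1_(`]c.1.1, c.1.2]) s.

Definition step_integral (b : R -> Omega -> R) (h : seq (R * R * R))
    (o : Omega) : R :=
  \sum_(c <- h) c.2 * (b c.1.2 o - b c.1.1 o).

(* I is (a version of) the stochastic integral over [0, t] of the deterministic
   integrand g with respect to the Brownian motion b *)
Definition is_wiener_integral (b : R -> Omega -> R) (t : R) (g : R -> R)
    (I : Omega -> R) : Prop :=
  measurable_fun setT I /\
  exists h : nat -> seq (R * R * R),
    [/\ forall n c, c \in h n -> 0 <= c.1.1 /\ c.1.1 <= c.1.2 <= t,
        (\int[lebesgue_measure]_(s in `[0%R, t])
            ((step_fun (h n) s - g s) ^+ 2)%:E)%E @[n --> \oo] --> 0%E
      & (\int[Q]_o ((I o - step_integral b (h n) o) ^+ 2)%:E)%E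
          @[n --> \oo] --> 0%E].

Definition is_L2_sum (T : choiceType) (I : T -> Omega -> R) (Z : Omega -> R) :=
  measurable_fun setT Z /\
  forall e : R, 0 < e -> exists2 A0 : set T, finite_set A0 &
    forall A, finite_set A -> A0 `<=` A ->
      (\int[Q]_o ((Z o - (\sum_(y \in A) I y o)%R) ^+ 2)%:E < e%:E)%E.

Variables (w : conductances d R) (X : vsrw w).
Variables (F : R -> set (set Omega)) (B : Zd d -> R -> Omega -> R).
Local Notation V := (vertex w).

Definition sde_in_H (N : R) (phi0 : tempered w) (phi : R -> tempered w)
    (b : R -> V -> R) : Prop :=
  forall t : R, 0 <= t -> (sqnormH N (b t) < +oo)%E /\
    exists2 I : V -> R, is_Hintegral N t (fun s => laplacian (phi s)) I &
      forall x, phi t x = phi0 x - I x + Num.sqrt 2 * b t x.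

Definition sde_solution (phi0 : tempered w) (phi : R -> Omega -> tempered w) :=
  [/\ forall (t : R) (A : set (tempered w)), 0 <= t ->
        measurable A -> F t (phi t @^-1` A),
      forall o, cont_tempered (phi ^~ o)
    & exists N : nat, {ae Q, forall o,
        cont_H N%:R (fun t => phi t o : V -> R) /\
        sde_in_H (N + 2)%:R phi0 (phi ^~ o) (fun t x => B (\val x) t o)}].

Definition mild_formula (phi0 : tempered w) (phi : R -> Omega -> tempered w) :=
  forall (t : R) (x : V), 0 <= t ->
    exists (I : V -> Omega -> R) (Z : Omega -> R),
      [/\ forall y, is_wiener_integral (B (\val y)) t
                      (fun s => heat_kernel X (t - s) x y) (I y),
          is_L2_sum I Z
        & {ae Q, forall o, phi t o x =
                   rw_semigroup X t phi0 x + Num.sqrt 2 * Z o}].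

Definition sde_well_posed : Prop :=
  [/\ nonexplosive X,
      rw_acts_on_tempered X
    & forall phi0 : tempered w, exists phi,
        [/\ sde_solution phi0 phi,
            forall phi', sde_solution phi0 phi' ->
              {ae Q, forall o, forall t : R, 0 <= t -> phi' t o = phi t o}
          & mild_formula phi0 phi]].

Definition bounded_measurable (G : tempered w -> R) : Prop :=
  measurable_fun setT G /\ exists M : R, forall xi, `|G xi| <= M.

Definition sde_semigroup (T : R -> (tempered w -> R) -> tempered w -> R) :=
  [/\ forall (t : R) G phi0 phi, 0 <= t -> bounded_measurable G ->
        sde_solution phi0 phi ->
        ((T t G phi0)%:E = \int[Q]_o (G (phi t o))%:E)%E,
      forall (t : R) G, 0 <= t -> bounded_measurable G -> bounded_measurable (T t G),
      forall G, bounded_measurable G -> T 0 G = G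
    & forall (s t : R) G, 0 <= s -> 0 <= t -> bounded_measurable G ->
        T (s + t) G = T s (T t G)].

Definition well_defined_semigroup : Prop :=
  sde_well_posed /\ exists T, sde_semigroup T.

End noise.

(* Main.v *)
(** Translation invariance and the moment condition give, by Borel-Cantelli over
    the sites, [w x y = o(|x|^2)] almost surely.  For such conductances energy
    estimates with the weights [(r + |x|)^(-n)] close, because the squared
    gradient of a weight times the conductance is a small multiple of the squared
    weight when [r] is large.  They give uniqueness of polynomially growing
    solutions of the heat equation, polynomial decay of the heat kernel,
    non-explosion, and the absence of tempered eigenfunctions off [[0, +oo[].

    For an invariant measure with finite second moments, differentiating
    [E[P_t xi (x) P_t xi (y)]] at [t = 0] shows that
    [E[Delta xi (x) xi (y)] = - E[xi (x) Delta xi (y)]]; the same weighted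
    estimates, applied under the expectation, then force [Delta xi = 0], hence
    [P_t xi = xi], almost surely.

    The SDE is solved path by path.  Kolmogorov's inequality bounds the Brownian
    motions on compact time intervals by a multiple of [|x|^d], so that their
    discretisations on dyadic grids converge in a weighted uniform norm.  The
    response to a discretised path is a finite sum of heat kernels, its limit is
    the solution, and weighted uniqueness identifies any other one.  Orthogonality
    of increments turns these sums into Wiener integrals; the Markov property
    holds because after time [s] the solution is a function of its value at [s]
    and of the later increments, which are independent of the past. *)
From HB Require Import structures.
Require Import Defs.
Set Implicit Arguments.
Unset Strict Implicit.
Unset Printing Implicit Defensive.
Import Order.TTheory GRing.Theory Num.Theory.
Import numFieldNormedType.Exports.
From mathcomp Require Import ring lra zify measurable_realfun.
Local Open Scope classical_set_scope.
Local Open Scope ring_scope.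

(** Every estimate has the same shape: testing with a truncated weight bounds a cut-off sum by half
    of the full sum plus the data, and iterating removes the full sum. The full sum must be finite
    beforehand, but its size is irrelevant. Finiteness is the recurring obstacle, since the decay
    known a priori may call for a far larger exponent than the bound that is wanted. It is bought
    with a factor [D + gbr x] to a negative power, which is given back as [D] tends to infinity; the
    constants do not depend on [D], nor, where unboundedly many exponents occur, on the exponent.
    They do occur for an invariant law: antisymmetry makes the second moments of the iterated
    Laplacians log-convex in the order, whereas small gradient constants let them decay at any
    geometric rate, so that of order one vanishes. The other obstacle is that the noise is not
    differentiable in time. A path therefore enters through finitely many jumps, and it is the
    response minus the path that is continuous and solves a heat equation with forcing. *)

Lemma exists_nat_gt {R : realType} (x : R) : exists n : nat, x < n%:R.
Proof. by exists (Num.truncn x).+1; exact: Num.Theory.truncnS_gt. Qed.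

(** The interface through which the analysis sees the cluster. [gbr] plays the role of the bracket
    and [gbox] lists its sublevel sets; [gw_sub] is the subquadratic bound on the rates, with [e]
    arbitrary, and [gsummable] is polynomial volume growth. *)
Record wgraph (R : realType) := WGraph {
  gV :> choiceType;
  gw : gV -> gV -> R;
  gnb : gV -> seq gV;
  gbr : gV -> R;
  gbox : nat -> seq gV;
  gw_ge0 : forall x y, 0 <= gw x y;
  gw_sym : forall x y, gw x y = gw y x;
  gw_nb : forall x y, y \notin gnb x -> gw x y = 0;
  gnb_uniq : forall x, uniq (gnb x);
  gbr_ge1 : forall x, 1 <= gbr x;
  gbr_lip : forall x y, y \in gnb x -> `|gbr x - gbr y| <= 1;
  gbox_uniq : forall n, uniq (gbox n);
  gboxE : forall n x, (x \in gbox n) = (gbr x <= n%:R);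
  gw_sub : forall e : R, 0 < e -> exists2 r : R, 1 <= r &
    forall x, \sum_(y <- gnb x) gw x y <= e * (r + gbr x) ^+ 2;
  gsummable : exists (m : nat) (K : R), forall s : seq gV, uniq s ->
    \sum_(x <- s) (gbr x ^+ m)^-1 <= K }.

(** * Weighted graphs *)

Section graph.
Context {R : realType} {G : wgraph R}.
Implicit Types (x y : G) (u v f th : G -> R) (s : seq G).

Definition lap u x : R := \sum_(y <- gnb x) gw x y * (u x - u y).
Definition rate x : R := \sum_(y <- gnb x) gw x y.

(** For nonnegative [f] this is the bound [S] on the full series; quantifying over finite lists
    avoids any notion of summability. *)
Definition sum_le f (S : R) := forall s, uniq s -> \sum_(x <- s) f x <= S.

Lemma sum_sub_le f s s' : (forall x, 0 <= f x) -> uniq s ->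
  {subset s <= s'} -> \sum_(x <- s) f x <= \sum_(x <- s') f x.
Proof.
move=> f0; elim: s s' => [|a s IH] s' /= us ss.
  by rewrite big_nil sumr_ge0.
move: us => /andP[as_ us].
have as' : a \in s' by apply: ss; rewrite mem_head.
rewrite big_cons (perm_big _ (perm_to_rem as')) /= big_cons lerD2l.
apply: IH => // x xs; have xa : x != a by apply: contraNneq as_ => <-.
have := ss x; rewrite inE xs orbT => /(_ isT) xs'.
by have := perm_mem (perm_to_rem as') x; rewrite xs' inE (negPf xa) /= => <-.
Qed.

Lemma sum_le_weak f S S' : S <= S' -> sum_le f S -> sum_le f S'.
Proof. by move=> SS h s us; apply: le_trans (h s us) SS. Qed.

Lemma sum_le_mono f f' S : (forall x, f x <= f' x) -> sum_le f' S -> sum_le f S.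
Proof. by move=> ff h s us; apply: le_trans (h s us); apply: ler_sum. Qed.

Lemma sum_le_ge0 f S : sum_le f S -> 0 <= S.
Proof. by move=> /(_ [::] isT); rewrite big_nil. Qed.

Lemma sum_le_pt f S x : sum_le f S -> f x <= S.
Proof. by move=> /(_ [:: x] isT); rewrite big_seq1. Qed.

Lemma sum_leZ a f S : 0 <= a -> sum_le f S -> sum_le (fun x => a * f x) (a * S).
Proof. by move=> a0 h s us; rewrite -mulr_sumr ler_wpM2l ?h. Qed.

Lemma sum_nb_in x s f : uniq s -> (forall y, y \in gnb x -> y \in s) ->
  \sum_(y <- gnb x) gw x y * f y = \sum_(y <- s) gw x y * f y.
Proof.
move=> us ss; rewrite [RHS](bigID (mem (gnb x))) /=.
rewrite [X in _ + X]big1 ?addr0; last by move=> y /gw_nb ->; rewrite mul0r.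
rewrite -[RHS]big_filter; apply: perm_big; apply: uniq_perm.
- exact: gnb_uniq.
- exact: filter_uniq.
by move=> y; rewrite mem_filter /=; case: (boolP (y \in gnb x)) => //= /ss ->.
Qed.

Lemma sum_nb_le x s f : uniq s -> (forall y, 0 <= f y) ->
  \sum_(y <- s) gw x y * f y <= \sum_(y <- gnb x) gw x y * f y.
Proof.
move=> us f0; rewrite (bigID (mem (gnb x))) /=.
rewrite [X in _ + X]big1 ?addr0; last by move=> y /gw_nb ->; rewrite mul0r.
rewrite -big_filter; apply: sum_sub_le; last by move=> y; rewrite mem_filter => /andP[].
- by move=> y; rewrite mulr_ge0 ?gw_ge0.
- exact: filter_uniq.
Qed.

Lemma lapE u x s : uniq s -> (forall y, y \in gnb x -> y \in s) ->
  lap u x = \sum_(y <- s) gw x y * (u x - u y).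
Proof. by move=> us ss; exact: sum_nb_in. Qed.

Lemma nb_box n x y : x \in gbox G n -> y \in gnb x -> y \in gbox G n.+1.
Proof.
rewrite !gboxE => xn /gbr_lip; rewrite ler_norml -natr1 => /andP[h1 h2].
lra.
Qed.

Lemma box_sub n m : (n <= m)%N -> {subset gbox G n <= gbox G m}.
Proof. by move=> nm x; rewrite !gboxE => /le_trans; apply; rewrite ler_nat. Qed.

Definition dsum s (F : G -> G -> R) :=
  \sum_(x <- s) \sum_(y <- s) gw x y * F x y.

Lemma dsum_swap s F : dsum s F = dsum s (fun x y => F y x).
Proof.
rewrite /dsum exchange_big; apply: eq_bigr => x _; apply: eq_bigr => y _.
by rewrite gw_sym.
Qed.

Lemma eq_dsum s F F' : (forall x y, F x y = F' x y) -> dsum s F = dsum s F'.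
Proof. by move=> h; apply: eq_bigr => x _; apply: eq_bigr => y _; rewrite h. Qed.

Lemma le_dsum s F F' : (forall x y, F x y <= F' x y) -> dsum s F <= dsum s F'.
Proof.
by move=> h; apply: ler_sum => x _; apply: ler_sum => y _; rewrite ler_wpM2l ?gw_ge0.
Qed.

Lemma dsum_ge0 s F : (forall x y, 0 <= F x y) -> 0 <= dsum s F.
Proof.
by move=> h; apply: sumr_ge0 => x _; apply: sumr_ge0 => y _; rewrite mulr_ge0 ?gw_ge0.
Qed.

Lemma dsumD s F F' : dsum s (fun x y => F x y + F' x y) = dsum s F + dsum s F'.
Proof.
rewrite /dsum -big_split; apply: eq_bigr => x _; rewrite -big_split.
by apply: eq_bigr => y _; rewrite mulrDr.
Qed.

Lemma dsumZ s a F : dsum s (fun x y => a * F x y) = a * dsum s F.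
Proof.
rewrite /dsum mulr_sumr; apply: eq_bigr => x _; rewrite mulr_sumr.
by apply: eq_bigr => y _; rewrite mulrCA.
Qed.

Lemma dsumB s F F' : dsum s (fun x y => F x y - F' x y) = dsum s F - dsum s F'.
Proof.
rewrite -[- _]mulN1r -dsumZ -dsumD; apply: eq_dsum => x y; by rewrite mulN1r.
Qed.

(** All edges at the support of [f] stay inside the next box, so truncating the inner sum to that
    box loses nothing; this is why sums run over [gbox G n.+1]. *)
Lemma green1 n f u : (forall x, x \notin gbox G n -> f x = 0) ->
  \sum_(x <- gbox G n.+1) f x * lap u x =
  dsum (gbox G n.+1) (fun x y => f x * (u x - u y)).
Proof.
move=> f0; apply: eq_bigr => x _; case: (boolP (x \in gbox G n)) => xn.
  rewrite (@lapE _ _ (gbox G n.+1)) ?gbox_uniq//; last by move=> y; exact: nb_box.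
  by rewrite mulr_sumr; apply: eq_bigr => y _; rewrite mulrCA.
by rewrite f0// mul0r big1// => y _; rewrite mul0r mulr0.
Qed.

Lemma green2 n f u : (forall x, x \notin gbox G n -> f x = 0) ->
  2 * \sum_(x <- gbox G n.+1) f x * lap u x =
  dsum (gbox G n.+1) (fun x y => (f x - f y) * (u x - u y)).
Proof.
move=> f0; rewrite mulrDl mul1r {1}green1// green1// {2}dsum_swap -dsumD.
by apply: eq_dsum => x y; ring.
Qed.

(* The weighted gradient of [th] is dominated by [eta]; used with [th] a
   compactly supported truncation of [eta]. *)
Definition grad_le th (eta : G -> R) (C : R) := forall x,
  \sum_(y <- gnb x) gw x y * (th x - th y) ^+ 2 <= C * eta x ^+ 2.

Lemma dsum_grad s th eta C h : uniq s -> grad_le th eta C -> (forall x, 0 <= h x) ->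
  dsum s (fun x y => (th x - th y) ^+ 2 * h x) <=
  C * \sum_(x <- s) eta x ^+ 2 * h x.
Proof.
move=> us hg h0; rewrite mulr_sumr; apply: ler_sum => x _.
under eq_bigr do rewrite mulrA.
rewrite -mulr_suml mulrA ler_wpM2r//; apply: le_trans (hg x).
by apply: sum_nb_le => // y; rewrite sqr_ge0.
Qed.

(** A Caccioppoli inequality: the form of [th * u] exceeds the pairing of [th ^+ 2 * u] with [lap u]
    by at most a commutator, which carries the squared gradient of [th] but none of [u]; [grad_le]
    absorbs it. *)
Lemma energy_id n th eta C u :
  (forall x, x \notin gbox G n -> th x = 0) -> grad_le th eta C ->
  dsum (gbox G n.+1) (fun x y => (th x * u x - th y * u y) ^+ 2) <=
  2 * (\sum_(x <- gbox G n.+1) th x ^+ 2 * u x * lap u x) +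
  C * \sum_(x <- gbox G n.+1) eta x ^+ 2 * u x ^+ 2.
Proof.
move=> th0 hg; rewrite green2; last by move=> x xn; rewrite th0// expr0n /= !mul0r.
have us := @gbox_uniq _ G n.+1.
have := dsum_grad us hg (fun x => sqr_ge0 (u x)).
set D1 := dsum _ _ => hD1; apply: le_trans (lerD (lexx _) hD1).
have -> : D1 = dsum (gbox G n.+1) (fun x y => (th x - th y) ^+ 2 * ((u x ^+ 2 + u y ^+ 2) / 2)).
  have -> : D1 = 2^-1 * (D1 + D1) by field.
  rewrite {2}/D1 dsum_swap /D1 -dsumD -dsumZ; apply: eq_dsum => x y.
  by rewrite -[th y - th x]opprB sqrrN; field.
rewrite -dsumD; apply: le_dsum => x y; rewrite -subr_ge0.
set a := u x; set b := u y; set s := th x; set t := th y.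
have -> : (s ^+ 2 * a - t ^+ 2 * b) * (a - b) + (s - t) ^+ 2 * ((a ^+ 2 + b ^+ 2) / 2)
   - (s * a - t * b) ^+ 2 = (s - t) ^+ 2 * (a - b) ^+ 2 / 2 by field.
by rewrite divr_ge0// mulr_ge0 ?sqr_ge0.
Qed.

Lemma energy n th eta C u :
  (forall x, x \notin gbox G n -> th x = 0) -> grad_le th eta C ->
  - (2 * (\sum_(x <- gbox G n.+1) th x ^+ 2 * u x * lap u x)) <=
  C * \sum_(x <- gbox G n.+1) eta x ^+ 2 * u x ^+ 2.
Proof.
move=> th0 hg; rewrite lerNl -subr_ge0 opprK; apply: le_trans (energy_id u th0 hg).
by apply: dsum_ge0 => x y; rewrite sqr_ge0.
Qed.

Definition cut (L : nat) x : R := Num.max 0 (1 - gbr x / L%:R).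

Lemma cut_ge0 L x : 0 <= cut L x. Proof. by rewrite le_max lexx. Qed.

Lemma cut_le1 L x : cut L x <= 1.
Proof.
by rewrite ge_max ler01 lerBlDr lerDl divr_ge0// (le_trans ler01)// gbr_ge1.
Qed.

Lemma cut_out L x : (0 < L)%N -> x \notin gbox G L -> cut L x = 0.
Proof.
rewrite gboxE -ltNge; case: L => // L _ h; apply/max_idPl.
by rewrite subr_le0 ler_pdivlMr ?ltr0n// mul1r ltW.
Qed.

Lemma cut_lb L x : 1 - gbr x / L%:R <= cut L x.
Proof. by rewrite le_max lexx orbT. Qed.

Lemma cut_lip L x y : y \in gnb x -> `|cut L x - cut L y| <= L%:R^-1.
Proof.
move=> /gbr_lip h; have Li : 0 <= L%:R^-1 :> R by [].
have : `|(1 - gbr x / L%:R) - (1 - gbr y / L%:R)| <= L%:R^-1.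
  have -> : (1 - gbr x / L%:R) - (1 - gbr y / L%:R) = (gbr y - gbr x) / L%:R by ring.
  by rewrite normrM (ger0_norm Li) distrC ler_piMl.
rewrite /cut; move: (1 - _) (1 - _) => a b; rewrite !ler_norml => /andP[h1 h2].
by rewrite /Num.max; case: ltP => ha; case: ltP => hb; apply/andP; split; lra.
Qed.

(** On a fixed finite list the cut-offs are at least [1 - M / L], with [M] a bound on the brackets
    there, so a bound uniform in [L] passes to the limit. Large [L] suffice, which matches the
    threshold in [admissible]. *)
Lemma sum_le_cut f (S : R) (L0 : nat) : (forall x, 0 <= f x) ->
  (forall L, (L0 <= L)%N -> \sum_(x <- gbox G L.+1) cut L x ^+ 2 * f x <= S) ->
  sum_le f S.
Proof.
move=> f0 h s us; set X := \sum_(x <- s) f x.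
pose M : R := \sum_(x <- s) gbr x.
have sM x : x \in s -> gbr x <= M.
  move=> xs; rewrite /M (perm_big _ (perm_to_rem xs)) /= big_cons lerDl.
  by apply: sumr_ge0 => y _; apply: le_trans (gbr_ge1 y).
have M0 : 0 <= M by apply: sumr_ge0 => y _; apply: le_trans (gbr_ge1 y).
have X0 : 0 <= X by apply: sumr_ge0.
rewrite leNgt; apply/negP => SX.
(* Beyond the second threshold the loss caused by the cut-off, at most [2 * M * X / L], is less than
   the supposed excess [X - S]. *)
have [n1 hn1] := exists_nat_gt M; have [n2 hn2] := exists_nat_gt (2 * M * X / (X - S)).
pose L := (L0 + n1 + n2).+1.
have LM : M <= L%:R.
  by apply: ltW; apply: lt_le_trans hn1 _; rewrite ler_nat /L; lia.
have L0' : 0 < L%:R :> R by rewrite ltr0n.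
have hL : 2 * M * X / (X - S) < L%:R.
  by apply: lt_le_trans hn2 _; rewrite ler_nat /L; lia.
move: hL; rewrite ltr_pdivrMr ?subr_gt0// => hL.
have := h L ltac:(rewrite /L; lia) => {}h.
have : (1 - M / L%:R) ^+ 2 * X <= S.
  apply: le_trans h; apply: (@le_trans _ _ (\sum_(x <- s) cut L x ^+ 2 * f x)).
    rewrite mulr_sumr big_seq [leRHS]big_seq; apply: ler_sum => x xs.
    rewrite ler_wpM2r// ler_sqr ?nnegrE ?cut_ge0//; last first.
      by rewrite subr_ge0 ler_pdivrMr// mul1r.
    by apply: le_trans (cut_lb L x); rewrite lerD2l lerN2 ler_wpM2r ?invr_ge0 ?sM.
  apply: sum_sub_le => //; first by move=> x; rewrite mulr_ge0 ?sqr_ge0.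
  move=> x xs; rewrite gboxE; apply: le_trans (sM x xs) (le_trans LM _).
  by rewrite ler_nat.
apply/negP; rewrite -ltNge.
have h1 : M / L%:R * X * 2 < X - S.
  have -> : M / L%:R * X * 2 = (2 * M * X) / L%:R by ring.
  by rewrite ltr_pdivrMr// [ltRHS]mulrC.
have : 0 <= (M / L%:R) ^+ 2 * X by rewrite mulr_ge0 ?sqr_ge0.
move: (M / L%:R) h1 => z h1 h2; nra.
Qed.

End graph.

(** * Admissible weights *)

Section weights.
Context {R : realType} {G : wgraph R}.
Implicit Types (x y : G) (th : G -> R).

(** The logarithmic gradient decays like [k / (r + gbr x)]. Squared and multiplied by a rate of at
    most [e * (r + gbr x) ^+ 2] it leaves the constant [e * k ^+ 2]. For the weights below [k] does
    not depend on [r], so enlarging [r] makes this constant small. *)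
Definition rel_lip (r k : R) th := (forall x, 0 < th x) /\
  forall x y, y \in gnb x -> `|th x - th y| * (r + gbr x) <= k * th x.

Lemma rel_lip1 r k th x y : 1 <= r -> rel_lip r k th -> y \in gnb x ->
  `|th x - th y| <= k * th x.
Proof.
move=> r1 [h0 h] xy; apply: le_trans (h x y xy).
by rewrite ler_peMr// -[leLHS]addr0 lerD// (le_trans ler01)// gbr_ge1.
Qed.

Lemma rel_lip_mul r k1 k2 th1 th2 : 1 <= r -> rel_lip r k1 th1 -> rel_lip r k2 th2 ->
  rel_lip r (k1 + (1 + k1) * k2) (fun x => th1 x * th2 x).
Proof.
move=> r1 h1 h2; split=> [x|x y xy]; first by rewrite mulr_gt0 ?h1.1 ?h2.1.
have a1 := rel_lip1 r1 h1 xy; have b1 := h1.2 x y xy; have b2 := h2.2 x y xy.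
have p1 := h1.1 x; have p2 := h2.1 x; have q1 := h1.1 y.
have q0 : 0 <= r + gbr x by have := gbr_ge1 x; lra.
have y1 : th1 y <= (1 + k1) * th1 x.
  by move: a1; rewrite ler_norml => /andP[]; lra.
have -> : th1 x * th2 x - th1 y * th2 y =
  (th1 x - th1 y) * th2 x + th1 y * (th2 x - th2 y) by ring.
apply: (@le_trans _ _ ((`|th1 x - th1 y| * th2 x + th1 y * `|th2 x - th2 y|) * (r + gbr x))).
  rewrite ler_wpM2r//; apply: le_trans (ler_normD _ _) _.
  by rewrite !normrM (gtr0_norm p2) (gtr0_norm q1).
have -> : (`|th1 x - th1 y| * th2 x + th1 y * `|th2 x - th2 y|) * (r + gbr x) =
  (`|th1 x - th1 y| * (r + gbr x)) * th2 x + th1 y * (`|th2 x - th2 y| * (r + gbr x)) by ring.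
have -> : (k1 + (1 + k1) * k2) * (th1 x * th2 x) =
  (k1 * th1 x) * th2 x + ((1 + k1) * th1 x) * (k2 * th2 x) by ring.
apply: lerD; first by rewrite ler_wpM2r// ltW.
by apply: ler_pM => //; [exact: ltW | rewrite mulr_ge0].
Qed.

Fixpoint rel_lip_pow_cst (k : R) (n : nat) : R :=
  if n is n'.+1 then k + (1 + k) * rel_lip_pow_cst k n' else 0.

Lemma rel_lip_pow r k th n : 1 <= r -> rel_lip r k th ->
  rel_lip r (rel_lip_pow_cst k n) (fun x => th x ^+ n).
Proof.
move=> r1 h; elim: n => [|n IH].
  by split=> [x|x y _]; rewrite ?expr0// subrr normr0 mul0r mul0r.
have := rel_lip_mul r1 h IH => -[h1 h2]; split=> [x|x y xy]; rewrite !exprS.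
  exact: h1.
exact: h2.
Qed.

Lemma rel_lip_lin r : 1 <= r -> rel_lip r 1 (fun x => r + gbr x).
Proof.
move=> r1; split=> [x|x y /gbr_lip xy]; first by have := gbr_ge1 x; lra.
rewrite ler_wpM2r//; first by have := gbr_ge1 x; lra.
by have -> : r + gbr x - (r + gbr y) = gbr x - gbr y by ring.
Qed.

Lemma rel_lip_inv r D : 1 <= r -> r <= D -> rel_lip r 2 (fun x => (D + gbr x)^-1).
Proof.
move=> r1 rD; split=> [x|x y /gbr_lip xy]; first by rewrite invr_gt0; have := gbr_ge1 x; lra.
have := gbr_ge1 x; have := gbr_ge1 y; set a := gbr x; set b := gbr y => b1 a1.
have xa : 0 < D + a by lra. have xb : 0 < D + b by lra.
have -> : (D + a)^-1 - (D + b)^-1 = - ((a - b) / ((D + a) * (D + b))).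
  by field; rewrite !gt_eqF.
have pp : 0 <= ((D + a) * (D + b))^-1 by rewrite invr_ge0; apply: mulr_ge0; exact: ltW.
rewrite normrN normrM (ger0_norm pp).
rewrite mulrAC ler_pdivrMr ?mulr_gt0//.
have -> : 2 / (D + a) * ((D + a) * (D + b)) = 2 * (D + b) by field; rewrite gt_eqF.
have := ler_norml (a - b) 1; rewrite -/a -/b xy => /esym/andP[h1 h2].
by apply: (@le_trans _ _ (1 * (r + a))); [rewrite ler_wpM2r//; lra | lra].
Qed.

Lemma rel_lip_grad (r k e : R) th : 0 <= e -> 1 <= r -> rel_lip r k th ->
  (forall x, rate x <= e * (r + gbr x) ^+ 2) -> grad_le th th (e * k ^+ 2).
Proof.
move=> e0 r1 [h0 h] hr x.
have q0 : 0 < r + gbr x by have := gbr_ge1 x; lra.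
have -> : e * k ^+ 2 * th x ^+ 2 = (e * (r + gbr x) ^+ 2) * ((k * th x) / (r + gbr x)) ^+ 2.
  by field; rewrite gt_eqF.
apply: (@le_trans _ _ (rate x * ((k * th x) / (r + gbr x)) ^+ 2)); last first.
  by rewrite ler_wpM2r ?sqr_ge0.
rewrite /rate mulr_suml [leLHS]big_seq [leRHS]big_seq; apply: ler_sum => y xy.
rewrite ler_wpM2l ?gw_ge0// -real_normK ?num_real// ler_sqr ?nnegrE//.
  by rewrite ler_pdivlMr// h.
by apply: divr_ge0; [apply: le_trans (h x y xy); apply: mulr_ge0|]; rewrite ?normr_ge0// ltW.
Qed.

(** The constant does not deteriorate under truncation, provided the truncation is far enough
    out. *)
Definition admissible th (C : R) := (forall x, 0 < th x) /\
  exists L0 : nat, forall L : nat, (L0 <= L)%N ->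
    grad_le (fun x => th x * cut L x) th C.

(** The slope [1 / L] of the cut-off is felt only where [gbr x <= L + 1], and there the rate is at
    most [e * (2 * L) ^+ 2]: the cut-off costs [4 * e] whatever [L]. The factors 2 come from
    splitting the square of a sum. *)
Lemma grad_admissible r c e th : 0 <= e -> 1 <= r -> (forall x, 0 < th x) -> grad_le th th c ->
  (forall x, rate x <= e * (r + gbr x) ^+ 2) -> admissible th (2 * c + 8 * e).
Proof.
move=> e0 r1 th0 hg hr; split=> //.
have [L0 hL0] := exists_nat_gt (r + 1); exists L0 => L L0L x.
have LL : r + 1 < L%:R by apply: lt_le_trans hL0 _; rewrite ler_nat.
have Lp : 0 < L%:R :> R by lra.
have hc : \sum_(y <- gnb x) gw x y * (cut L x - cut L y) ^+ 2 <= 4 * e.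
  have [xL|xL] := leP (gbr x) (L%:R + 1); last first.
    rewrite big_seq big1 ?mulr_ge0// => y xy.
    have Ln : (0 < L)%N by rewrite -(ltr_nat R).
    rewrite !cut_out// ?subrr ?expr0n ?mulr0// gboxE -ltNge; last by lra.
    by have := gbr_lip xy; rewrite ler_norml => /andP[h1 h2]; lra.
  apply: (@le_trans _ _ (rate x * (L%:R^-1) ^+ 2)).
    rewrite /rate mulr_suml [leLHS]big_seq [leRHS]big_seq; apply: ler_sum => y xy.
    rewrite ler_wpM2l ?gw_ge0// -real_normK ?num_real// ler_sqr ?nnegrE ?invr_ge0//.
    exact: cut_lip.
  rewrite exprVn ler_pdivrMr ?exprn_gt0//; apply: le_trans (hr x) _.
  have -> : 4 * e * L%:R ^+ 2 = e * (2 * L%:R) ^+ 2 by ring.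
  rewrite ler_wpM2l// ler_sqr ?nnegrE; have := gbr_ge1 x; lra.
apply: (@le_trans _ _ (2 * (\sum_(y <- gnb x) gw x y * (th x - th y) ^+ 2) +
   2 * th x ^+ 2 * \sum_(y <- gnb x) gw x y * (cut L x - cut L y) ^+ 2)).
  rewrite !mulr_sumr -big_split; apply: ler_sum => y _ /=.
  have -> : 2 * (gw x y * (th x - th y) ^+ 2) + 2 * th x ^+ 2 * (gw x y * (cut L x - cut L y) ^+ 2)
   = gw x y * (2 * (th x - th y) ^+ 2 + 2 * th x ^+ 2 * (cut L x - cut L y) ^+ 2) by ring.
  rewrite ler_wpM2l ?gw_ge0//.
  have c0 := cut_ge0 L y; have c1 := cut_le1 L y.
  set a := th x - th y; set b := th x * (cut L x - cut L y).
  have -> : th x * cut L x - th y * cut L y = a * cut L y + b by rewrite /a /b; ring.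
  have -> : 2 * th x ^+ 2 * (cut L x - cut L y) ^+ 2 = 2 * b ^+ 2 by rewrite /b; ring.
  apply: (@le_trans _ _ (2 * (a * cut L y) ^+ 2 + 2 * b ^+ 2)).
    have := sqr_ge0 (a * cut L y - b); move: (a * cut L y) => z; nra.
  rewrite lerD2r ler_wpM2l// exprMn ler_piMr ?sqr_ge0//.
  by rewrite expr_le1.
have := hg x; have := sqr_ge0 (th x); nra.
Qed.

Lemma rel_lip_admissible (r k e : R) th : 0 <= e -> 1 <= r -> rel_lip r k th ->
  (forall x, rate x <= e * (r + gbr x) ^+ 2) ->
  admissible th (2 * (e * k ^+ 2) + 8 * e).
Proof.
move=> e0 r1 hl hr; apply: (grad_admissible e0 r1 hl.1 _ hr).
exact: rel_lip_grad hl hr.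
Qed.

(** The three powers have separate purposes: [a] measures decay, [b] compensates tempered growth,
    and [m], with its own scale [D], provides summability that is given back as [D] tends to
    infinity. *)
Definition weight (r D : R) (a b m : nat) x : R :=
  (r + gbr x) ^+ a * (((r + gbr x)^-1) ^+ b * ((D + gbr x)^-1) ^+ m).

Lemma weight_rel_lip a b m : exists k, forall r D, 1 <= r -> r <= D ->
  rel_lip r k (weight r D a b m).
Proof.
exists (rel_lip_pow_cst 1 a + (1 + rel_lip_pow_cst 1 a) *
  (rel_lip_pow_cst 2 b + (1 + rel_lip_pow_cst 2 b) * rel_lip_pow_cst 2 m)).
move=> r D r1 rD; apply: rel_lip_mul => //.
  by apply: rel_lip_pow => //; exact: rel_lip_lin.
by apply: rel_lip_mul => //; apply: rel_lip_pow => //; exact: rel_lip_inv.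
Qed.

(** [k] depends on the exponents only, so [e] can be adjusted to any target [C] before the radius
    [r] is taken from [gw_sub]; a scale [D] larger than [r] only flattens the weight. *)
Lemma weight_admissible a b m C : 0 < C -> exists2 r, 1 <= r &
  forall D, r <= D -> admissible (weight r D a b m) C.
Proof.
move=> C0; have [k hk] := weight_rel_lip a b m.
pose e := C / (2 * k ^+ 2 + 8).
have d0 : 0 < 2 * k ^+ 2 + 8 by have := sqr_ge0 k; lra.
have e0 : 0 < e by rewrite divr_gt0.
have [r r1 hr] := gw_sub G e0; exists r => // D rD.
have := rel_lip_admissible (ltW e0) r1 (hk r D r1 rD) hr.
by have -> : 2 * (e * k ^+ 2) + 8 * e = C by rewrite /e; field; rewrite gt_eqF.
Qed.

Lemma rel_lip_ratio r c th x y : 1 <= r -> rel_lip r c th -> y \in gnb x ->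
  (th x - th y) ^+ 2 <= (c * th x / (r + gbr x)) ^+ 2.
Proof.
move=> r1 [th0 h] xy; have r0 : 0 < r + gbr x by have := gbr_ge1 x; lra.
have h1 : `|th x - th y| <= c * th x / (r + gbr x) by rewrite ler_pdivlMr// h.
by rewrite -real_normK ?num_real// ler_sqr ?nnegrE// (le_trans _ h1).
Qed.

(* The constant [r] does not depend on [m]: far out, the factor of exponent [m] sees
   a smaller constant in the subquadratic bound on the rates. *)
Lemma weight_admissible_unif b C : 0 < C -> exists2 r, 1 <= r &
  forall m, exists2 D0, r <= D0 & forall D, D0 <= D -> admissible (weight r D 0 b m) C.
Proof.
(* Half of [C] pays for the factor of exponent [b] and for the cut-off, through [e]; the other half
   pays for the factor of exponent [m], through [e'] below. *)
move=> C0; pose k : R := rel_lip_pow_cst 2 b; pose e := C / 2 / (4 * k ^+ 2 + 8).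
have k0 := sqr_ge0 k.
have d0 : 0 < 4 * k ^+ 2 + 8 by lra.
have e0 : 0 < e by rewrite !divr_gt0.
have [r r1 hr] := gw_sub G e0; exists r => // m.
pose k' : R := rel_lip_pow_cst 2 m; pose c := (1 + k) ^+ 2 * k' ^+ 2.
have c0 : 0 <= c by rewrite mulr_ge0 ?sqr_ge0.
pose e' := C / 2 / (4 * c + 1); have d'0 : 0 < 4 * c + 1 by lra.
have e'0 : 0 < e' by rewrite !divr_gt0.
have [r' r'1 hr'] := gw_sub G e'0; exists (r + r'); first lra.
move=> D hD.
have hg : rel_lip r k (fun x => (r + gbr x)^-1 ^+ b) by apply: rel_lip_pow => //; exact: rel_lip_inv.
have hh : rel_lip D k' (fun x => (D + gbr x)^-1 ^+ m).
  by apply: rel_lip_pow; [lra|apply: rel_lip_inv; lra].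
have wE x : weight r D 0 b m x = (r + gbr x)^-1 ^+ b * (D + gbr x)^-1 ^+ m by rewrite /weight expr0 mul1r.
have -> : C = 2 * ((C - 8 * e) / 2) + 8 * e by lra.
have hC : 2 * (k ^+ 2 * e + c * e') <= (C - 8 * e) / 2.
  have h1 : e * (4 * k ^+ 2 + 8) = C / 2 by rewrite divfK// gt_eqF.
  have h2 : e' * (4 * c + 1) = C / 2 by rewrite divfK// gt_eqF.
  lra.
apply: (@grad_admissible r) => //; first exact: ltW.
  by move=> x; rewrite wE mulr_gt0 ?hg.1 ?hh.1.
move=> x; rewrite !wE.
set g := fun x => (r + gbr x)^-1 ^+ b in hg *; set h := fun x => (D + gbr x)^-1 ^+ m in hh *.
have b1 := gbr_ge1 x; have D1 : 1 <= D by lra.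
have g0 := hg.1 x; have h0 := hh.1 x.
have rp : 0 < r + gbr x by lra.
have Dp : 0 < D + gbr x by lra.
apply: (@le_trans _ _ (2 * (k ^+ 2 * e + c * e') * (g x * h x) ^+ 2)); last first.
  by rewrite ler_wpM2r// sqr_ge0.
pose A := (k * g x / (r + gbr x)) ^+ 2; pose B := (k' * h x / (D + gbr x)) ^+ 2.
have A0 : 0 <= A by exact: sqr_ge0.
have B0 : 0 <= B by exact: sqr_ge0.
apply: (@le_trans _ _ (\sum_(y <- gnb x) gw x y * (2 * (A * h x ^+ 2 + ((1 + k) * g x) ^+ 2 * B)))).
  rewrite big_seq [leRHS]big_seq; apply: ler_sum => y xy; rewrite ler_wpM2l ?gw_ge0//.
  have h1 := rel_lip_ratio r1 hg xy; have h2 := rel_lip_ratio D1 hh xy.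
  rewrite -/A in h1; rewrite -/B in h2.
  have gy : g y ^+ 2 <= ((1 + k) * g x) ^+ 2.
    have := rel_lip1 r1 hg xy; rewrite ler_norml => /andP[h3 h4].
    have gy0 := hg.1 y.
    by rewrite ler_sqr ?nnegrE; lra.
  rewrite wE -/(g y) -/(h y).
  have -> : g x * h x - g y * h y = (g x - g y) * h x + g y * (h x - h y) by ring.
  apply: (@le_trans _ _ (2 * ((g x - g y) ^+ 2 * h x ^+ 2 + g y ^+ 2 * (h x - h y) ^+ 2))).
    have := sqr_ge0 ((g x - g y) * h x - g y * (h x - h y)).
    move: ((g x - g y)) (h x) (g y) (h x - h y) => a1 a2 a3 a4; nra.
  rewrite ler_wpM2l//; apply: lerD; first by rewrite ler_wpM2r// sqr_ge0.
  by apply: ler_pM => //; exact: sqr_ge0.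
rewrite -mulr_suml -/(rate x).
have rx := hr x; have rx' : rate x <= e' * (D + gbr x) ^+ 2.
  apply: le_trans (hr' x) _; rewrite ler_wpM2l ?(ltW e'0)// ler_sqr ?nnegrE; lra.
have AE : e * (r + gbr x) ^+ 2 * A = k ^+ 2 * e * g x ^+ 2.
  by rewrite /A; field; rewrite gt_eqF.
have BE : e' * (D + gbr x) ^+ 2 * B = k' ^+ 2 * e' * h x ^+ 2.
  by rewrite /B; field; rewrite gt_eqF.
have hA : rate x * A <= k ^+ 2 * e * g x ^+ 2 by rewrite -AE ler_wpM2r.
have hB : rate x * B <= k' ^+ 2 * e' * h x ^+ 2 by rewrite -BE ler_wpM2r.
have -> : rate x * (2 * (A * h x ^+ 2 + ((1 + k) * g x) ^+ 2 * B)) =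
  2 * ((rate x * A) * h x ^+ 2 + ((1 + k) * g x) ^+ 2 * (rate x * B)) by ring.
have -> : 2 * (k ^+ 2 * e + c * e') * (g x * h x) ^+ 2 =
  2 * ((k ^+ 2 * e * g x ^+ 2) * h x ^+ 2 + ((1 + k) * g x) ^+ 2 * (k' ^+ 2 * e' * h x ^+ 2)).
  by rewrite /c; ring.
rewrite ler_wpM2l//; apply: lerD; first by rewrite ler_wpM2r// sqr_ge0.
by rewrite ler_wpM2l// sqr_ge0.
Qed.

End weights.

(** * One-variable calculus on closed intervals *)

Section calculus.
Context {R : realType}.
Implicit Types (f g : R -> R) (a b t : R).

Lemma within_sub (A B : set R) f : B `<=` A -> {within A, continuous f} ->
  {within B, continuous f}.
Proof. by move=> BA; apply: continuous_subspaceW. Qed.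

Lemma within_cst (A : set R) (c : R) : {within A, continuous (fun _ => c)}.
Proof. by apply: continuous_subspaceT => t; exact: cvg_cst. Qed.

Lemma within_D (A : set R) f g : {within A, continuous f} -> {within A, continuous g} ->
  {within A, continuous (fun t => f t + g t)}.
Proof. by move=> cf cg t; exact: (@continuousD _ _ _ (f : subspace A -> R) g t (cf t) (cg t)). Qed.

Lemma within_M (A : set R) f g : {within A, continuous f} -> {within A, continuous g} ->
  {within A, continuous (fun t => f t * g t)}.
Proof. by move=> cf cg t; exact: (@continuousM _ _ (f : subspace A -> R) g t (cf t) (cg t)). Qed.

Lemma within_B (A : set R) f g : {within A, continuous f} -> {within A, continuous g} ->
  {within A, continuous (fun t => f t - g t)}.
Proof. by move=> cf cg t; exact: (@continuousB _ _ _ (f : subspace A -> R) g t (cf t) (cg t)). Qed.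

(** Exceptional times are removed one by one: each splits the interval in two, and continuity at the
    splitting point joins the halves. *)
Lemma nonincr_except f df (D : seq R) a b : a <= b ->
  {within `[a, b], continuous f} ->
  (forall t, a < t < b -> t \notin D -> is_derive t 1 f (df t) /\ df t <= 0) ->
  f b <= f a.
Proof.
elim: D a b => [|c D IH] a b ab cf h.
  have := @ler0_derive1_le_cc R f a b; apply => //; rewrite ?in_itv/= ?lexx ?ab//.
    by move=> t; rewrite in_itv /= => /h/(_ isT)[dt _]; exact: ex_derive.
  move=> t; rewrite in_itv /= => /h/(_ isT)[dt dt0].
  by rewrite derive1E (@derive_val _ _ _ _ _ _ _ dt).
have [/andP[ac cb]|cab] := boolP (a < c < b); last first.
  apply: IH => // t tab tD; apply: h => //; rewrite inE negb_or tD andbT.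
  by apply: contraNneq cab => <-.
apply: (@le_trans _ _ (f c)); apply: IH; rewrite ?ltW//.
- by apply: within_sub cf => t /=; rewrite !in_itv /= => /andP[h1 ->]; rewrite (le_trans (ltW ac) h1).
- move=> t /andP[ct tb] tD; apply: h; first by rewrite tb (lt_trans ac ct).
  by rewrite inE negb_or tD gt_eqF.
- by apply: within_sub cf => t /=; rewrite !in_itv /= => /andP[-> h1]; rewrite (le_trans h1 (ltW cb)).
- move=> t /andP[ct tb] tD; apply: h; first by rewrite ct (lt_trans tb cb).
  by rewrite inE negb_or tD lt_eqF.
Qed.

Lemma within_sum (I : eqType) (s : seq I) (F : I -> R -> R) (A : set R) :
  (forall i, i \in s -> {within A, continuous (F i)}) ->
  {within A, continuous (fun t => \sum_(i <- s) F i t)}.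
Proof.
elim: s => [|i s IH] h.
  have -> : (fun t => \sum_(i <- [::]) F i t) = cst 0 by apply/funext => t; rewrite big_nil.
  exact: within_cst.
have -> : (fun t => \sum_(j <- i :: s) F j t) = F i \+ (fun t => \sum_(j <- s) F j t).
  by apply/funext => t; rewrite big_cons.
apply: within_D; first by apply: h; rewrite mem_head.
by apply: IH => j js; apply: h; rewrite inE js orbT.
Qed.

Lemma is_derive_big (I : eqType) (s : seq I) (F : I -> R -> R) (dF : I -> R) t :
  (forall i, i \in s -> is_derive t 1 (F i) (dF i)) ->
  is_derive t 1 (fun t => \sum_(i <- s) F i t) (\sum_(i <- s) dF i).
Proof.
elim: s => [|i s IH] h.
  have -> : (fun t => \sum_(i <- [::]) F i t) = cst 0 by apply/funext => ?; rewrite big_nil.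
  by rewrite big_nil; exact: is_derive_cst.
have -> : (fun t => \sum_(j <- i :: s) F j t) = F i \+ (fun t => \sum_(j <- s) F j t).
  by apply/funext => ?; rewrite big_cons.
rewrite big_cons; apply: is_deriveD; first by apply: h; rewrite mem_head.
by apply: IH => j js; apply: h; rewrite inE js orbT.
Qed.

Lemma is_derive_expRM k t : is_derive t 1 (fun t => expR (k * t)) (k * expR (k * t)).
Proof.
have h : is_derive t 1 (fun t : R => k * t) k.
  have := @is_deriveZ R R R (@id R) k t 1 1 _.
  by rewrite /GRing.scale/= mulr1; apply.
by have := is_derive1_comp (is_derive_expR (k * t)) h; rewrite mulrC.
Qed.

End calculus.

(** * The heat equation *)

Section heat.
Context {R : realType} {G : wgraph R}.
Implicit Types (x y : G) (u f : R -> G -> R) (eta : G -> R).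

(* [D] collects exceptional times, at which [u] need only be continuous. *)
Definition heat_on (T : R) (D : seq R) u f := forall x,
  {within `[0, T], continuous (fun t => u t x)} /\
  forall t, 0 < t < T -> t \notin D ->
    is_derive t 1 (fun t => u t x) (- lap (u t) x + f t x).

(** The derivative of the truncated energy is at most [C + 1] times the full energy, plus [S1]. If
    the full energy is below [A] times an exponential of rate [2 * (C + 1)], twice as fast,
    integration returns that exponential with [A / 2]. *)
Lemma heat_halving (T : R) D u f eta (C S0 S1 A : R) : 0 <= C -> admissible eta C ->
  heat_on T D u f -> sum_le (fun x => eta x ^+ 2 * u 0 x ^+ 2) S0 ->
  (forall t : R, 0 <= t <= T -> sum_le (fun x => eta x ^+ 2 * f t x ^+ 2) S1) ->
  (forall t : R, 0 <= t <= T -> sum_le (fun x => eta x ^+ 2 * u t x ^+ 2)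
     (A * expR (2 * (C + 1) * t))) ->
  forall t : R, 0 <= t <= T -> sum_le (fun x => eta x ^+ 2 * u t x ^+ 2)
     ((S0 + S1 * T + A / 2) * expR (2 * (C + 1) * t)).
Proof.
move=> C0 [eta0 [L0 hL0]] hu hS0 hS1 hA t /andP[t0 tT].
apply: (@sum_le_cut _ _ _ _ L0.+1); first by move=> x; rewrite mulr_ge0 ?sqr_ge0.
move=> L L0L; have Lp : (0 < L)%N by apply: leq_ltn_trans L0L.
pose s := gbox G L.+1; pose th x := eta x * cut L x.
have us : uniq s by exact: gbox_uniq.
have thout x : x \notin gbox G L -> th x = 0 by move=> h; rewrite /th cut_out// mulr0.
have hg : grad_le th eta C by apply: hL0; exact: ltnW.
have thle x : th x ^+ 2 <= eta x ^+ 2.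
  rewrite /th exprMn ler_piMr ?sqr_ge0// expr_le1 ?cut_ge0 ?cut_le1//.
pose K := C + 1; pose F r := \sum_(x <- s) th x ^+ 2 * u r x ^+ 2.
pose dF r := \sum_(x <- s) th x ^+ 2 * (2 * u r x * (- lap (u r) x + f r x)).
pose H (r : R) := (A / 2) * expR (2 * K * r) + S1 * r.
pose dH (r : R) := (A / 2) * ((2 * K) * expR (2 * K * r)) + S1.
have A0 : 0 <= A by have := hA 0; rewrite lexx mulr0 expR0 mulr1 (le_trans t0 tT) => /(_ isT)/sum_le_ge0.
have S10 : 0 <= S1 by have := hS1 0; rewrite lexx (le_trans t0 tT) => /(_ isT)/sum_le_ge0.
have S00 : 0 <= S0 by exact: sum_le_ge0 hS0.
have E1 : 1 <= expR (2 * K * t) by rewrite -expR0 ler_expR /K !mulr_ge0// addr_ge0.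
have key : F t - H t <= F 0 - H 0.
  apply: (@nonincr_except R (fun r => F r - H r) (fun r => dF r - dH r) D 0 t) => //.
    have cH : {within `[0, t], continuous H}.
      apply: continuous_subspaceT => r; apply: differentiable_continuous.
      apply/derivable1_diffP; apply: (@ex_derive _ _ _ _ _ _ (dH r)).
      apply: is_deriveD.
        by apply: is_deriveZ; exact: is_derive_expRM.
      have := @is_deriveZ R R R (@id R) S1 r 1 1 _.
      by rewrite /GRing.scale/= mulr1; apply.
    have cF : {within `[0, t], continuous F}.
      apply: within_sum => x _; have cu : {within `[0, t], continuous (fun r => u r x)}.
        apply: within_sub (hu x).1 => r /=; rewrite !in_itv /= => /andP[-> h].
        exact: le_trans h tT.
      apply: within_M; first exact: within_cst.
      exact: (within_M cu cu).
    exact: within_B.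
  move=> r /andP[r0 rt] rD; have rT : 0 < r < T by rewrite r0 (lt_le_trans rt).
  have rT' : 0 <= r <= T by case/andP: rT => /ltW -> /ltW.
  split.
    apply: is_deriveB; last first.
      apply: is_deriveD; first by apply: is_deriveZ; exact: is_derive_expRM.
      have := @is_deriveZ R R R (@id R) S1 r 1 1 _.
      by rewrite /GRing.scale/= mulr1; apply.
    apply: is_derive_big => x _; apply: is_deriveZ.
    have := is_deriveX 2 ((hu x).2 r rT rD).
    by rewrite /= expr1.
  have hen := energy (u r) thout hg.
  rewrite -/s in hen.
  have a1 : \sum_(x <- s) eta x ^+ 2 * u r x ^+ 2 <= A * expR (2 * K * r) by apply: hA.
  have a2 : \sum_(x <- s) eta x ^+ 2 * f r x ^+ 2 <= S1 by apply: hS1.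
  have a3 : dF r <= - (2 * (\sum_(x <- s) th x ^+ 2 * u r x * lap (u r) x)) +
     (\sum_(x <- s) eta x ^+ 2 * u r x ^+ 2 + \sum_(x <- s) eta x ^+ 2 * f r x ^+ 2).
    rewrite mulr_sumr -sumrN -!big_split; apply: ler_sum => x _ /=.
    have := thle x; have := sqr_ge0 (th x); have := sqr_ge0 (u r x - f r x).
    have := sqr_ge0 (u r x); have := sqr_ge0 (f r x).
    move: (u r x) (f r x) (th x ^+ 2) (eta x ^+ 2) (lap _ _) => a b c d l h1 h2 h3 h4 h5.
    have : c * (2 * a * b) <= d * (a ^+ 2 + b ^+ 2).
      apply: (@le_trans _ _ (c * (a ^+ 2 + b ^+ 2))); first by rewrite ler_wpM2l//; nra.
      by rewrite ler_wpM2r// addr_ge0.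
    lra.
  have a4 : C * (\sum_(x <- s) eta x ^+ 2 * u r x ^+ 2) <= C * (A * expR (2 * K * r)).
    by rewrite ler_wpM2l.
  rewrite /dH /K in a1 a2 a3 a4 *; move: (expR _) a1 a2 a3 a4 => E a1 a2 a3 a4; lra.
have F0 : F 0 <= S0.
  apply: le_trans (hS0 s us); apply: ler_sum => x _.
  by rewrite ler_wpM2r ?sqr_ge0.
have -> : \sum_(x <- s) cut L x ^+ 2 * (eta x ^+ 2 * u t x ^+ 2) = F t.
  by apply: eq_bigr => x _; rewrite /th; ring.
move: key; rewrite /H mulr0 expR0 mulr1 mulr0 addr0 -/K; move: (expR _) E1 => E E1.
have : S1 * t <= S1 * T by rewrite ler_wpM2l.
have : 0 <= (S0 + S1 * T) * (E - 1).
  by rewrite mulr_ge0 ?subr_ge0// addr_ge0// mulr_ge0// (le_trans t0).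
lra.
Qed.

(** Iterating the halving turns any finite a priori bound [S] into [S / 2 ^+ k], so it disappears
    from the conclusion. The factor 2 is the geometric series of the data terms. *)
Lemma heat_bound (T : R) D u f eta (C S0 S1 S : R) : 0 <= C -> admissible eta C ->
  heat_on T D u f -> sum_le (fun x => eta x ^+ 2 * u 0 x ^+ 2) S0 ->
  (forall t : R, 0 <= t <= T -> sum_le (fun x => eta x ^+ 2 * f t x ^+ 2) S1) ->
  (forall t : R, 0 <= t <= T -> sum_le (fun x => eta x ^+ 2 * u t x ^+ 2) S) ->
  forall t : R, 0 <= t <= T -> sum_le (fun x => eta x ^+ 2 * u t x ^+ 2)
     (2 * (S0 + S1 * T) * expR (2 * (C + 1) * t)).
Proof.
move=> C0 ha hu hS0 hS1 hS t tT; have T0 : 0 <= T by case/andP: tT; exact: le_trans.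
have S00 := sum_le_ge0 (hS 0 ltac:(by rewrite lexx)).
have hk k : forall t : R, 0 <= t <= T -> sum_le (fun x => eta x ^+ 2 * u t x ^+ 2)
     ((2 * (S0 + S1 * T) + S / 2 ^+ k) * expR (2 * (C + 1) * t)).
  have p1 := sum_le_ge0 hS0. have p2 := sum_le_ge0 (hS1 0 ltac:(by rewrite lexx)).
  elim: k => [|k IH] r rT.
    apply: sum_le_weak (hS r rT); rewrite expr0 divr1.
    have : 1 <= expR (2 * (C + 1) * r) by rewrite -expR0 ler_expR !mulr_ge0 ?addr_ge0//; case/andP: rT.
    have := mulr_ge0 p2 T0; nra.
  have := heat_halving C0 ha hu hS0 hS1 IH rT.
  by congr sum_le; congr (_ * _); rewrite exprS; field; rewrite expf_neq0.
move=> s us; set X := \sum_(x <- s) _.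
rewrite leNgt; apply/negP => hX.
set E := expR (2 * (C + 1) * t) in hX.
have E0 : 0 < E by exact: expR_gt0.
have [k hk'] := exists_nat_gt (S * E / (X - 2 * (S0 + S1 * T) * E)).
have := hk k t tT s us; rewrite -/X -/E leNgt => /negP; apply.
rewrite mulrDl -ltrBrDl; move: hk'; rewrite ltr_pdivrMr ?subr_gt0// => hk'.
rewrite mulrAC ltr_pdivrMr ?exprn_gt0//.
apply: lt_le_trans hk' _; rewrite mulrC ler_wpM2l ?subr_ge0 ?(ltW hX)//.
by rewrite -natrX ler_nat; apply: ltnW; exact: ltn_expl.
Qed.

End heat.

(** * Energy inequalities for eigenfunctions and stationary fields *)

Section spectral.
Context {R : realType} {G : wgraph R}.
Implicit Types (x y : G) (a b u v f eta th : G -> R).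

(** The stationary counterpart of the iteration in [heat_bound]: [S] only has to be finite. *)
Lemma sum_le_halving f S0 (S : R) : (forall S', sum_le f S' -> sum_le f (S0 + S' / 2)) ->
  sum_le f S -> sum_le f (2 * S0).
Proof.
move=> h hS; have hk k : sum_le f (2 * S0 + (S - 2 * S0) / 2 ^+ k).
  elim: k => [|k /h IH]; first by rewrite expr0 divr1 addrC subrK.
  by apply: sum_le_weak IH; rewrite le_eqVlt; apply/orP; left; apply/eqP; rewrite exprS; field; rewrite expf_neq0.
move=> s us; rewrite leNgt; apply/negP => hX.
set X := \sum_(x <- s) f x in hX.
have [k hk'] := exists_nat_gt ((S - 2 * S0) / (X - 2 * S0)).
have := hk k s us; rewrite -/X leNgt => /negP; apply.
rewrite -ltrBrDl; move: hk'; rewrite ltr_pdivrMr ?subr_gt0// => hk'.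
rewrite ltr_pdivrMr ?exprn_gt0//.
apply: lt_le_trans hk' _; rewrite mulrC ler_wpM2l ?subr_ge0 ?(ltW hX)//.
by rewrite -natrX ler_nat; apply: ltnW; exact: ltn_expl.
Qed.

Lemma cut_setup eta C (L0 L : nat) :
  (forall L : nat, (L0 <= L)%N -> grad_le (fun x => eta x * cut L x) eta C) ->
  (L0 < L)%N ->
  [/\ forall x, x \notin gbox G L -> eta x * cut L x = 0,
      grad_le (fun x => eta x * cut L x) eta C
    & forall f, (forall x, 0 <= f x) ->
        \sum_(x <- gbox G L.+1) (eta x * cut L x) ^+ 2 * f x <=
        \sum_(x <- gbox G L.+1) eta x ^+ 2 * f x].
Proof.
move=> hL L0L; split=> [x xL| |f f0].
- by rewrite cut_out ?mulr0// (leq_ltn_trans _ L0L).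
- by apply: hL; exact: ltnW.
- apply: ler_sum => x _; rewrite ler_wpM2r// exprMn ler_piMr ?sqr_ge0//.
  by rewrite expr_le1 ?cut_ge0 ?cut_le1.
Qed.

(** For constant [th] the edge terms would cancel by symmetry of the conductances, so every term
    carries a factor [th x - th y]. Young's inequality with parameter [d] balances it against the
    energies of [th * a] and [th * b]. *)
Lemma eigen_id n th eta C (d : R) a b : 0 < d ->
  (forall x, x \notin gbox G n -> th x = 0) -> grad_le th eta C ->
  `|2 * \sum_(x <- gbox G n.+1) th x ^+ 2 * (a x * lap b x - b x * lap a x)| <=
  d / 2 * (dsum (gbox G n.+1) (fun x y => (th x * a x - th y * a y) ^+ 2) +
           dsum (gbox G n.+1) (fun x y => (th x * b x - th y * b y) ^+ 2)) +
  2 / d * (C * \sum_(x <- gbox G n.+1) eta x ^+ 2 * (a x ^+ 2 + b x ^+ 2)).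
Proof.
move=> d0 th0 hg; have us := @gbox_uniq _ G n.+1.
set s := gbox G n.+1.
have th0' f : forall x, x \notin gbox G n -> th x ^+ 2 * f x = 0.
  by move=> x xn; rewrite th0// expr0n mul0r.
have -> : 2 * \sum_(x <- s) th x ^+ 2 * (a x * lap b x - b x * lap a x) =
    dsum s (fun x y => (th x - th y) * ((th x * b x - th y * b y) * (a x + a y) -
                            (th x * a x - th y * a y) * (b x + b y))).
  transitivity (2 * \sum_(x <- s) th x ^+ 2 * a x * lap b x -
    2 * \sum_(x <- s) th x ^+ 2 * b x * lap a x).
    by rewrite -mulrBr -sumrB; congr (_ * _); apply: eq_bigr => x _; ring.
  rewrite /s (green2 b (th0' a)) (green2 a (th0' b)) -dsumB.
  by apply: eq_dsum => x y; ring.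
have hC := dsum_grad us hg (fun x => addr_ge0 (sqr_ge0 (a x)) (sqr_ge0 (b x))).
apply: (@le_trans _ _ (d / 2 * (dsum s (fun x y => (th x * a x - th y * a y) ^+ 2) +
           dsum s (fun x y => (th x * b x - th y * b y) ^+ 2)) +
   2 / d * dsum s (fun x y => (th x - th y) ^+ 2 * (a x ^+ 2 + b x ^+ 2)))); last first.
  by rewrite lerD2l ler_wpM2l// divr_ge0// ltW.
set D1 := dsum s (fun x y => (th x - th y) ^+ 2 * _).
have -> : 2 / d * D1 = d^-1 * dsum s (fun x y => (th x - th y) ^+ 2 *
     ((a x ^+ 2 + b x ^+ 2) + (a y ^+ 2 + b y ^+ 2))).
  have -> : 2 / d * D1 = d^-1 * (D1 + D1) by field; rewrite gt_eqF.
  congr (_ * _); rewrite {2}/D1 dsum_swap -dsumD; apply: eq_dsum => x y.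
  by rewrite -[th y - th x]opprB sqrrN; ring.
rewrite -dsumD -!dsumZ -dsumD.
have pw (p q A B : R) : `|p * (A * q)| <= d / 2 * A ^+ 2 + (2 * d)^-1 * (p * q) ^+ 2.
  have -> : p * (A * q) = A * (p * q) by ring.
  have : forall z, A * z <= d / 2 * A ^+ 2 + (2 * d)^-1 * z ^+ 2.
    move=> z; rewrite -subr_ge0.
    have -> : d / 2 * A ^+ 2 + (2 * d)^-1 * z ^+ 2 - A * z = (2 * d)^-1 * (d * A - z) ^+ 2.
      by field; rewrite gt_eqF.
    by rewrite mulr_ge0 ?sqr_ge0// invr_ge0 mulr_ge0// ltW.
  move=> h; rewrite ler_norml h andbT lerNl -mulrN; apply: le_trans (h _) _.
  by rewrite sqrrN.
have dsum_norm F : `|dsum s F| <= dsum s (fun x y => `|F x y|).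
  apply: le_trans (ler_norm_sum _ _ _) _; apply: ler_sum => x _.
  apply: le_trans (ler_norm_sum _ _ _) _; apply: ler_sum => y _.
  by rewrite normrM ger0_norm ?gw_ge0.
apply: le_trans (dsum_norm _) _; apply: le_dsum => x y.
rewrite mulrBr; apply: le_trans (ler_normB _ _) _.
apply: le_trans (lerD (pw _ _ _ 0) (pw _ _ _ 0)) _.
have dd : 0 < d^-1 by rewrite invr_gt0.
rewrite invfM !exprMn.
set P := (th x - th y) ^+ 2; have P0 : 0 <= P by exact: sqr_ge0.
have h1 : P * (a x + a y) ^+ 2 <= P * (2 * (a x ^+ 2 + a y ^+ 2)).
  by rewrite ler_wpM2l//; have := sqr_ge0 (a x - a y); nra.
have h2 : P * (b x + b y) ^+ 2 <= P * (2 * (b x ^+ 2 + b y ^+ 2)).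
  by rewrite ler_wpM2l//; have := sqr_ge0 (b x - b y); nra.
have h3 := lerD h1 h2.
have : d^-1 / 2 * (P * (a x + a y) ^+ 2 + P * (b x + b y) ^+ 2) <=
  d^-1 / 2 * (P * (2 * (a x ^+ 2 + a y ^+ 2)) + P * (2 * (b x ^+ 2 + b y ^+ 2))).
  by rewrite ler_wpM2l// divr_ge0// ltW.
move: (d^-1) => d'; lra.
Qed.

(** [a] and [b] are the real and imaginary parts of an eigenfunction with eigenvalue [l1 + i l2]. If
    [l2 = 0] then [l1 < 0], and nonnegativity of the energy suffices; otherwise [eigen_id] computes
    [l2] times the truncated mass and the energy bounds its right-hand side. In both cases the
    truncated mass is at most half of the full one. *)
Lemma no_eigenfunction a b (l1 l2 S : R) (N : nat) : ~ (0 <= l1 /\ l2 = 0) ->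
  (forall x, lap a x = l1 * a x - l2 * b x) ->
  (forall x, lap b x = l2 * a x + l1 * b x) ->
  sum_le (fun x => ((gbr x) ^+ N)^-1 ^+ 2 * (a x ^+ 2 + b x ^+ 2)) S ->
  forall x, a x = 0 /\ b x = 0.
Proof.
move=> hl la lb hS.
pose m x := a x ^+ 2 + b x ^+ 2.
have m0 x : 0 <= m x by rewrite addr_ge0 ?sqr_ge0.
suff [eta eta0 h0] : exists2 eta : G -> R, (forall x, 0 < eta x) &
    sum_le (fun x => eta x ^+ 2 * m x) 0.
  move=> x; have := sum_le_pt x h0; rewrite pmulr_rle0 ?exprn_gt0// => hm.
  by have := sqr_ge0 (a x); have := sqr_ge0 (b x); move: hm; rewrite /m;
    split; apply/eqP; rewrite -sqrf_eq0; apply/eqP; lra.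
(* For [l2 != 0] the final estimate bounds twice [|l2|] times the truncated mass by
   [d * (|l1| + 5 / 2)] times the full one, and this [d] makes the latter factor [|l2|]; [C <= 1]
   and [C <= d ^+ 2] enter on the way. *)
pose d : R := `|l2| / (`|l1| + 5 / 2).
have l1p : 0 < `|l1| + 5 / 2 by have := normr_ge0 l1; lra.
pose C : R := if l2 == 0 then `|l1| else Num.min 1 (d ^+ 2).
have C0 : 0 < C.
  rewrite /C; case: eqVneq => [l20|l20].
    by rewrite normr_gt0; apply/eqP => l10; apply: hl; rewrite l10.
  by rewrite lt_min ltr01 exprn_gt0// divr_gt0 ?normr_gt0.
have [r r1 /(_ r (lexx _))[eta0 [L0 hL]]] := @weight_admissible R G 0 N 0 C C0.
set eta := weight r r 0 N 0 in eta0 hL.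
exists eta => //; rewrite -(mulr0 2); apply: (@sum_le_halving _ _ S); last first.
  apply: sum_le_mono hS => x; rewrite ler_wpM2r ?m0// ler_sqr ?nnegrE ?(ltW (eta0 x))//; last first.
    by rewrite invr_ge0 exprn_ge0// (le_trans ler01)// gbr_ge1.
  rewrite /eta /weight !expr0 mul1r mulr1 exprVn.
  have b1 := gbr_ge1 x.
  rewrite lef_pV2 ?posrE ?exprn_gt0//; try lra.
  by rewrite lerXn2r ?nnegrE; lra.
move=> S' hS'; rewrite add0r; have S'0 := sum_le_ge0 hS'.
apply: (@sum_le_cut _ _ _ _ L0.+1); first by move=> x; rewrite mulr_ge0 ?sqr_ge0.
move=> L L0L; have [th0 hg hle] := cut_setup hL L0L.
set s := gbox G L.+1 in hle *; set th := (fun x => eta x * cut L x) in th0 hg.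
have us : uniq s by exact: gbox_uniq.
have hMs : \sum_(x <- s) eta x ^+ 2 * m x <= S' by exact: hS'.
set M := \sum_(x <- s) _.
have ME : M = \sum_(x <- s) th x ^+ 2 * m x by apply: eq_bigr => x _; rewrite /th; ring.
have M0 : 0 <= M by rewrite ME; apply: sumr_ge0 => x _; rewrite mulr_ge0 ?sqr_ge0.
have MS : M <= S' by rewrite ME; exact: le_trans (hle m m0) hMs.
have E1 := @energy_id _ _ L th eta C a th0 hg.
have E2 := @energy_id _ _ L th eta C b th0 hg.
rewrite -/s in E1 E2.
have E12 : dsum s (fun x y => (th x * a x - th y * a y) ^+ 2) +
    dsum s (fun x y => (th x * b x - th y * b y) ^+ 2) <= 2 * l1 * M + C * S'.
  apply: le_trans (lerD E1 E2) _.
  have -> : 2 * l1 * M = 2 * (\sum_(x <- s) th x ^+ 2 * a x * lap a x) +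
     2 * (\sum_(x <- s) th x ^+ 2 * b x * lap b x).
    rewrite ME -mulrA mulr_sumr -mulrDr -big_split; congr (_ * _).
    by apply: eq_bigr => x _ /=; rewrite la lb /m; ring.
  have : C * (\sum_(x <- s) eta x ^+ 2 * a x ^+ 2) + C * (\sum_(x <- s) eta x ^+ 2 * b x ^+ 2)
     <= C * S'.
    rewrite -mulrDr ler_wpM2l ?(ltW C0)// -big_split; apply: le_trans hMs.
    by rewrite le_eqVlt; apply/orP; left; apply/eqP; apply: eq_bigr => x _; rewrite /m mulrDr.
  lra.
have D0 : 0 <= dsum s (fun x y => (th x * a x - th y * a y) ^+ 2) +
    dsum s (fun x y => (th x * b x - th y * b y) ^+ 2).
  by rewrite addr_ge0// dsum_ge0// => x y; rewrite sqr_ge0.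
case: (eqVneq l2 0) => [l20|l20].
  have l10 : l1 < 0 by rewrite ltNge; apply/negP => l10; apply: hl.
  have CE : C = - l1 by rewrite /C l20 eqxx ltr0_norm.
  move: (le_trans D0 E12); rewrite CE => h.
  have : (- l1) * (2 * M) <= (- l1) * S' by lra.
  by rewrite ler_pM2l ?oppr_gt0//; lra.
have d0 : 0 < d by rewrite divr_gt0 ?normr_gt0.
have := @eigen_id L th eta C d a b d0 th0 hg; rewrite -/s.
have -> : \sum_(x <- s) th x ^+ 2 * (a x * lap b x - b x * lap a x) = l2 * M.
  by rewrite ME mulr_sumr; apply: eq_bigr => x _; rewrite la lb /m; ring.
rewrite !normrM (ger0_norm M0) normr_nat => hh.
have C1 : C <= 1 by rewrite /C (negPf l20) ge_min lexx.
have C2 : C <= d ^+ 2 by rewrite /C (negPf l20) ge_min lexx orbT.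
have hlast : 2 * (`|l2| * M) <= d / 2 * ((2 * `|l1| + 1) * S') + 2 / d * (d ^+ 2 * S').
  apply: le_trans hh _; apply: lerD.
    apply: ler_wpM2l; first by rewrite divr_ge0// ltW.
    apply: le_trans E12 _; have -> : (2 * `|l1| + 1) * S' = 2 * `|l1| * S' + 1 * S' by ring.
    rewrite lerD//; last by rewrite ler_wpM2r.
    rewrite -!mulrA ler_wpM2l//; apply: (@le_trans _ _ (`|l1| * M)).
      by rewrite ler_wpM2r// ler_norm.
    by rewrite ler_wpM2l.
  rewrite ler_wpM2l//; first by rewrite divr_ge0// ltW.
  apply: ler_pM => //; first exact: ltW.
  by apply: sumr_ge0 => x _; apply: mulr_ge0; [exact: sqr_ge0|exact: m0].
have e : d / 2 * ((2 * `|l1| + 1) * S') + 2 / d * (d ^+ 2 * S') = d * (`|l1| + 5 / 2) * S'.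
  by field; rewrite gt_eqF.
rewrite e /d divfK ?gt_eqF// in hlast.
have : `|l2| * (2 * M) <= `|l2| * S' by lra.
by rewrite ler_pM2l ?normr_gt0//; lra.
Qed.

(* Under an expectation for which [(x, y) |-> E [u x * lap u y]] is
   antisymmetric, the last term vanishes. *)
Lemma stationary_energy n th eta C u v :
  0 < C -> (forall x, x \notin gbox G n -> th x = 0) -> grad_le th eta C ->
  (forall x, v x = lap u x) ->
  2 * (\sum_(x <- gbox G n.+1) th x ^+ 2 * v x ^+ 2) <=
  C * (2 * (\sum_(x <- gbox G n.+1) th x ^+ 2 * (u x * v x)) +
       C * \sum_(x <- gbox G n.+1) eta x ^+ 2 * u x ^+ 2) +
  \sum_(x <- gbox G n.+1) eta x ^+ 2 * v x ^+ 2 +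
  dsum (gbox G n.+1) (fun x y => th x * th y * (v x * u x + v y * u y) -
    (th x ^+ 2 - th x * th y + th y ^+ 2) * (v x * u y + v y * u x)).
Proof.
move=> C0 th0 hg hv; have us := @gbox_uniq _ G n.+1.
set s := gbox G n.+1.
set N := dsum s _.
have th0' : forall x, x \notin gbox G n -> th x ^+ 2 * v x = 0.
  by move=> x xn; rewrite th0// expr0n mul0r.
have -> : 2 * (\sum_(x <- s) th x ^+ 2 * v x ^+ 2) =
    dsum s (fun x y => (th x - th y) * ((v x + v y) * (th x * u x - th y * u y))) + N.
  transitivity (2 * \sum_(x <- s) th x ^+ 2 * v x * lap u x).
    by congr (_ * _); apply: eq_bigr => x _; rewrite -hv; ring.
  by rewrite /s (green2 u th0') -dsumD; apply: eq_dsum => x y; ring.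
rewrite lerD2r.
have E := energy_id u th0 hg; rewrite -/s in E.
have hC := dsum_grad us hg (fun x => sqr_ge0 (v x)).
apply: (@le_trans _ _ (C * dsum s (fun x y => (th x * u x - th y * u y) ^+ 2) +
  C^-1 * dsum s (fun x y => (th x - th y) ^+ 2 * v x ^+ 2))); last first.
  apply: lerD.
    rewrite ler_wpM2l ?(ltW C0)//; apply: le_trans E _; rewrite lerD2r.
    rewrite le_eqVlt; apply/orP; left; apply/eqP; congr (_ * _).
    by apply: eq_bigr => x _; rewrite -hv; ring.
  by rewrite mulrC ler_pdivrMr// mulrC.
set D1 := dsum s (fun x y => _ * v x ^+ 2).
have -> : D1 = 2^-1 * dsum s (fun x y => (th x - th y) ^+ 2 * (v x ^+ 2 + v y ^+ 2)).
  have -> : D1 = 2^-1 * (D1 + D1) by field.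
  congr (_ * _); rewrite {2}/D1 dsum_swap -dsumD; apply: eq_dsum => x y.
  by rewrite -[th y - th x]opprB sqrrN; ring.
rewrite mulrA -!dsumZ -dsumD; apply: le_dsum => x y.
set p := th x - th y; set q := th x * u x - th y * u y.
set a := v x; set b := v y; rewrite -subr_ge0.
have -> : C * q ^+ 2 + C^-1 / 2 * (p ^+ 2 * (a ^+ 2 + b ^+ 2)) - p * ((a + b) * q) =
  C^-1 * ((C * q - p * (a + b) / 2) ^+ 2 + (p * (a - b) / 2) ^+ 2) by field; rewrite gt_eqF.
by rewrite mulr_ge0 ?invr_ge0 ?(ltW C0)// addr_ge0 ?sqr_ge0.
Qed.

End spectral.

(** * Primitives and limits *)

Section primitive.
Context {R : realType}.
Implicit Types (f g v : R -> R) (T t e : R).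

Lemma le_of_le_add (a b : R) : (forall e, 0 < e -> a <= b + e) -> a <= b.
Proof.
move=> h; rewrite leNgt; apply/negP => ba.
have := h ((a - b) / 2); rewrite divr_gt0 ?subr_gt0// => /(_ isT); lra.
Qed.

Lemma le_of_lim_inv (a b c : R) (n0 : nat) :
  (forall n, (n0 <= n)%N -> a <= b + c / n.+1%:R) -> a <= b.
Proof.
move=> h; apply: le_of_le_add => e e0.
have [n hn] := exists_nat_gt (c / e); pose m := (n0 + n)%N.
apply: le_trans (h m ltac:(by rewrite leq_addr)) _; rewrite lerD2l.
rewrite ler_pdivrMr ?ltr0n// mulrC -ler_pdivrMr//.
by apply: ltW; apply: lt_le_trans hn _; rewrite ler_nat /m; lia.
Qed.

Lemma within_primitive g T : 0 < T -> {within `[0, T], continuous g} ->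
  [/\ {within `[0, T], continuous (fun t => \int[lebesgue_measure]_(s in `[0, t]) g s)},
      forall t, 0 < t < T ->
        is_derive t 1 (fun t => \int[lebesgue_measure]_(s in `[0, t]) g s) (g t)
    & \int[lebesgue_measure]_(s in `[0, 0]) g s = 0].
Proof.
move=> T0 cg; have ig : lebesgue_measure.-integrable `[0, T] (EFin \o g).
  apply: continuous_compact_integrable => //; exact: segment_compact.
split=> [|t /andP[t0 tT]|].
- exact: parameterized_integral_continuous (ltW T0) ig.
- have ct : {for t, continuous g}.
    by apply: within_continuous_continuous T0 cg _; rewrite in_itv /= t0.
  have [d1 d2] := continuous_FTC1_closed tT ig t0 ct.
  rewrite derive1E in d2; exact: DeriveDef d1 d2.
- by rewrite set_itv1 Rintegral_set1.
Qed.

(** [v] minus the primitive of [g] has a derivative of size at most [e] off a finite set, so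
    monotonicity bounds it on both sides. No integrability of [dv] enters; with [e = 0] this is the
    fundamental theorem of calculus with exceptional times. *)
Lemma approx_primitive (v dv g : R -> R) (D : seq R) T e :
  {within `[0, T], continuous v} -> {within `[0, T], continuous g} ->
  (forall t, 0 < t < T -> t \notin D ->
     is_derive t 1 v (dv t) /\ `|dv t - g t| <= e) ->
  forall t, 0 <= t <= T ->
    `|v t - v 0 - \int[lebesgue_measure]_(s in `[0, t]) g s| <= e * t.
Proof.
move=> cv cg h t /andP[t0 tT].
have [T0|T0] := leP T 0.
  have -> : t = 0 by apply/eqP; rewrite eq_le t0 (le_trans tT).
  by rewrite subrr set_itv1 Rintegral_set1 subrr normr0 mulr0.
have [cG dG G0] := within_primitive T0 cg.
pose I t := \int[lebesgue_measure]_(s in `[0, t]) g s.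
have sub : `[0, t] `<=` `[0, T].
  by move=> r /=; rewrite !in_itv /= => /andP[-> /le_trans]; apply.
have dlin (r : R) (c : R) : is_derive r 1 (fun t => c * t) c.
  have := @is_deriveZ R R R (@id R) c r 1 1 _.
  by rewrite /GRing.scale/= mulr1; apply.
have clin (c : R) : {within `[0, t], continuous (fun t => c * t)}.
  apply: within_M; first exact: within_cst.
  by apply: continuous_subspaceT => r; exact: cvg_id.
have cvI : {within `[0, t], continuous (fun t => v t - I t)}.
  by apply: within_sub sub _; exact: within_B.
rewrite ler_norml; apply/andP; split.
  have := @nonincr_except R (fun t => - e * t - (v t - I t)) (fun t => - e - (dv t - g t)) D 0 t t0.
  rewrite /I G0 mulr0 => hh.
  have : - e * t - (v t - \int[lebesgue_measure]_(s in `[0, t]) g s) <= 0 - (v 0 - 0).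
    apply: hh; first exact: within_B.
    move=> r /andP[r0 rt] rD; have [d1 d2] := h r ltac:(by rewrite r0 (lt_le_trans rt)) rD.
    split; last by move: d2; rewrite ler_norml => /andP[]; lra.
    exact: (is_deriveB (dlin r (- e)) (is_deriveB d1 (dG r ltac:(by rewrite r0 (lt_le_trans rt))))).
  lra.
have := @nonincr_except R (fun t => (v t - I t) - e * t) (fun t => (dv t - g t) - e) D 0 t t0.
rewrite /I G0 mulr0 => hh.
have : (v t - \int[lebesgue_measure]_(s in `[0, t]) g s) - e * t <= (v 0 - 0) - 0.
  apply: hh; first exact: within_B.
  move=> r /andP[r0 rt] rD; have [d1 d2] := h r ltac:(by rewrite r0 (lt_le_trans rt)) rD.
  split; last by move: d2; rewrite ler_norml => /andP[]; lra.
  exact: (is_deriveB (is_deriveB d1 (dG r ltac:(by rewrite r0 (lt_le_trans rt)))) (dlin r e)).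
lra.
Qed.

Lemma within_unif_limit (A : set R) f :
  (forall e, 0 < e -> exists2 h : R -> R, {within A, continuous h} &
     forall t, A t -> `|h t - f t| <= e) -> {within A, continuous f}.
Proof.
move=> hf; apply/subspace_continuousP => t At; apply/cvgrPdist_le => e e0.
have e3 : 0 < e / 3 by rewrite divr_gt0.
have [h ch hh] := hf _ e3.
have /subspace_continuousP/(_ t At)/cvgrPdist_le/(_ _ e3) := ch.
rewrite !near_withinE; apply: filterS => s hs As.
have := hs As; rewrite /from_subspace /=; have := hh _ As; have := hh _ At.
rewrite !ler_norml => /andP[a1 a2] /andP[a3 a4] /andP[a5 a6].
by apply/andP; split; move: (f t) (f s) (h t) (h s) a1 a2 a3 a4 a5 a6 => *; lra.
Qed.

Lemma real_cauchy (u : nat -> R) :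
  (forall e, 0 < e -> exists n0 : nat, forall n m, (n0 <= n)%N -> (n0 <= m)%N ->
     `|u n - u m| <= e) -> cvgn u.
Proof.
move=> h; apply: cauchy_cvg; apply/cauchy_exP => e e0.
have [n0 hn] := h (e / 2) ltac:(by rewrite divr_gt0).
exists (u n0); exists n0 => // n /= hn0.
by rewrite /ball /= (le_lt_trans (hn _ _ _ _))//; lra.
Qed.

Lemma cvg_norm_le (u : nat -> R) (l c e : R) (n0 : nat) : u n @[n --> \oo] --> l ->
  (forall n, (n0 <= n)%N -> `|c - u n| <= e) -> `|c - l| <= e.
Proof.
move=> ul h; apply: le_of_le_add => d d0.
have /cvgrPdist_le/(_ d d0)[n1 _ hn1] := ul.
have a1 := h (maxn n0 n1) (leq_maxl _ _).
have a2 := hn1 (maxn n0 n1) (leq_maxr _ _).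
have -> : c - l = (c - u (maxn n0 n1)) - (l - u (maxn n0 n1)) by ring.
by apply: le_trans (ler_normB _ _) _; apply: lerD.
Qed.

Lemma bernoulli (z : R) k : 0 <= z <= 1 -> 1 - k%:R * (1 - z) <= z ^+ k.
Proof.
move=> /andP[z0 z1]; elim: k => [|k IH]; first by rewrite mul0r subr0 expr0.
rewrite exprS -natr1; have : z * (1 - k%:R * (1 - z)) <= z * z ^+ k by rewrite ler_wpM2l.
have : 0 <= k%:R * (1 - z) ^+ 2 by rewrite mulr_ge0 ?sqr_ge0.
nra.
Qed.

End primitive.

(** * Polynomial growth and uniqueness *)

Section growth.
Context {R : realType} {G : wgraph R}.
Implicit Types (x y : G) (u : G -> R).

Definition growth u (A : R) (N : nat) := forall x, `|u x| <= A * gbr x ^+ N.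

Lemma gbr_gt0 x : 0 < gbr x. Proof. exact: lt_le_trans ltr01 (gbr_ge1 x). Qed.

Lemma gbr_pow_ge1 x N : 1 <= gbr x ^+ N.
Proof. by rewrite exprn_ege1// gbr_ge1. Qed.

Lemma growth_weak u A A' N N' : 0 <= A' -> A <= A' -> (N <= N')%N -> growth u A N -> growth u A' N'.
Proof.
move=> A0 AA NN h x; apply: le_trans (h x) _.
apply: (@le_trans _ _ (A' * gbr x ^+ N)).
  by rewrite ler_wpM2r// exprn_ge0// ltW// gbr_gt0.
by rewrite ler_wpM2l// ler_weXn2l// gbr_ge1.
Qed.

Lemma growthD u v A B N : growth u A N -> growth v B N -> growth (fun x => u x + v x) (A + B) N.
Proof.
by move=> hu hv x; apply: le_trans (ler_normD _ _) _; rewrite mulrDl lerD.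
Qed.

Lemma growthB u v A B N : growth u A N -> growth v B N -> growth (fun x => u x - v x) (A + B) N.
Proof.
by move=> hu hv x; apply: le_trans (ler_normB _ _) _; rewrite mulrDl lerD.
Qed.

Lemma growthZ c u A N : growth u A N -> growth (fun x => c * u x) (`|c| * A) N.
Proof. by move=> hu x; rewrite normrM -mulrA ler_wpM2l. Qed.

(** Pointwise growth becomes a weighted square sum at the price of a fixed number [m] of powers,
    given by the volume growth; the converse, [sum_le_growth], costs none. *)
Lemma growth_sum_le : exists (m : nat) (K : R), 0 <= K /\
  forall u A N n r, 0 <= A -> 0 <= r -> (N + m <= n)%N -> growth u A N ->
    sum_le (fun x => ((r + gbr x)^-1 ^+ n) ^+ 2 * u x ^+ 2) (A ^+ 2 * K).
Proof.
have [m [K hK]] := gsummable G; exists m, K; split.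
  by have := hK [::] isT; rewrite big_nil.
move=> u A N n r A0 r0 Nn hu s us.
apply: le_trans (ler_wpM2l (sqr_ge0 A) (hK s us)).
rewrite mulr_sumr; apply: ler_sum => x _.
have b1 := gbr_ge1 x; have b0 := gbr_gt0 x.
have h1 : (r + gbr x)^-1 ^+ n <= (gbr x ^+ (N + m))^-1.
  rewrite exprVn lef_pV2 ?posrE ?exprn_gt0//; last lra.
  apply: (@le_trans _ _ (gbr x ^+ n)); first by rewrite ler_weXn2l.
  by rewrite lerXn2r ?nnegrE; lra.
have h2 : 0 <= (r + gbr x)^-1 ^+ n by rewrite exprn_ge0// invr_ge0; lra.
apply: (@le_trans _ _ ((gbr x ^+ (N + m))^-1 ^+ 2 * (A * gbr x ^+ N) ^+ 2)).
  apply: ler_pM; rewrite ?sqr_ge0//.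
    by rewrite ler_sqr ?nnegrE// invr_ge0 exprn_ge0// ltW.
  rewrite -[u x ^+ 2]real_normK ?num_real// ler_sqr ?nnegrE//.
  by rewrite mulr_ge0// exprn_ge0// ltW.
have -> : (gbr x ^+ (N + m))^-1 ^+ 2 * (A * gbr x ^+ N) ^+ 2 = A ^+ 2 * ((gbr x ^+ m)^-1 ^+ 2).
  by rewrite exprD; field; rewrite !expf_neq0 ?gt_eqF.
rewrite ler_wpM2l ?sqr_ge0// expr2 ler_piMr ?invr_ge0 ?exprn_ge0 ?(ltW b0)//.
by rewrite invf_le1 ?exprn_gt0// gbr_pow_ge1.
Qed.

Lemma sum_le_growth u (r S : R) n : 0 <= r ->
  sum_le (fun x => ((r + gbr x)^-1 ^+ n) ^+ 2 * u x ^+ 2) S ->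
  growth u (Num.sqrt S * (r + 1) ^+ n) n.
Proof.
move=> r0 hS x; have := sum_le_pt x hS.
have b1 := gbr_ge1 x; have rb : 0 < r + gbr x by lra.
have S0 := sum_le_ge0 hS.
rewrite -exprMn => h.
have : `|(r + gbr x)^-1 ^+ n * u x| <= Num.sqrt S.
  by rewrite -sqrtr_sqr ler_wsqrtr.
rewrite normrM ger0_norm ?exprn_ge0 ?invr_ge0 ?(ltW rb)// exprVn mulrC.
rewrite ler_pdivrMr ?exprn_gt0// => {}h; apply: le_trans h _.
rewrite -mulrA -exprMn ler_wpM2l ?sqrtr_ge0// lerXn2r ?nnegrE//; nra.
Qed.

(** Two powers come from the quadratic bound on the rate, and [2 ^+ N] from [gbr y <= 2 * gbr x] for
    neighbours. *)
Lemma lap_growth N : exists K, 0 <= K /\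
  forall u A, 0 <= A -> growth u A N -> growth (lap u) (A * K) (N + 2).
Proof.
have [r r1 hr] := gw_sub G (@ltr01 R).
exists ((r + 1) ^+ 2 * (1 + 2 ^+ N)); split.
  by rewrite mulr_ge0 ?sqr_ge0// addr_ge0// exprn_ge0.
move=> u A A0 hu x; have b1 := gbr_ge1 x; have b0 := gbr_gt0 x.
have hy y : y \in gnb x -> `|u x - u y| <= A * (1 + 2 ^+ N) * gbr x ^+ N.
  move=> /gbr_lip; rewrite ler_norml => /andP[y1 y2].
  apply: le_trans (ler_normB _ _) _.
  rewrite mulrDr mulr1 mulrDl; apply: lerD (hu x) _.
  apply: le_trans (hu y) _; rewrite -mulrA -exprMn ler_wpM2l//.
  by rewrite lerXn2r ?nnegrE; have := gbr_ge1 y; lra.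
apply: le_trans (ler_norm_sum _ _ _) _.
apply: (@le_trans _ _ (rate x * (A * (1 + 2 ^+ N) * gbr x ^+ N))).
  rewrite /rate mulr_suml big_seq [leRHS]big_seq; apply: ler_sum => y xy.
  by rewrite normrM ger0_norm ?gw_ge0// ler_wpM2l ?gw_ge0// hy.
have -> : A * ((r + 1) ^+ 2 * (1 + 2 ^+ N)) * gbr x ^+ (N + 2) =
  ((r + 1) * gbr x) ^+ 2 * (A * (1 + 2 ^+ N) * gbr x ^+ N) by rewrite exprD; ring.
rewrite ler_wpM2r//.
  by rewrite !mulr_ge0 ?addr_ge0 ?exprn_ge0// ltW.
apply: le_trans (hr x) _; rewrite mul1r ler_sqr ?nnegrE; nra.
Qed.

Lemma lapD u v x : lap (fun x => u x + v x) x = lap u x + lap v x.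
Proof. by rewrite /lap -big_split; apply: eq_bigr => y _ /=; ring. Qed.

Lemma lapZ c u x : lap (fun x => c * u x) x = c * lap u x.
Proof. by rewrite /lap mulr_sumr; apply: eq_bigr => y _ /=; ring. Qed.

Lemma lapB u v x : lap (fun x => u x - v x) x = lap u x - lap v x.
Proof. by rewrite /lap -sumrB; apply: eq_bigr => y _ /=; ring. Qed.

Lemma lap_cst c x : lap (fun _ => c) x = 0.
Proof. by rewrite /lap big1// => y _; rewrite subrr mulr0. Qed.

Lemma lap_within (A : set R) (u : R -> G -> R) x :
  (forall y, {within A, continuous (fun t => u t y)}) ->
  {within A, continuous (fun t => lap (u t) x)}.
Proof.
move=> cu; apply: within_sum => y _; apply: within_M; first exact: within_cst.
exact: within_B.
Qed.

(** The growth bound only provides the finite a priori sum that [heat_bound] asks for; the data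
    terms are zero. *)
Lemma heat_unique (T : R) D (u : R -> G -> R) A N : 0 <= A ->
  heat_on T D u (fun _ _ => 0) -> (forall x, u 0 x = 0) ->
  (forall t, 0 <= t <= T -> growth (u t) A N) ->
  forall t x, 0 <= t <= T -> u t x = 0.
Proof.
move=> A0 hu u0 hA t x tT; have [m [K [K0 hK]]] := growth_sum_le.
have [r r1 /(_ r (lexx _)) ha] := @weight_admissible R G 0 (N + m) 0 1 ltr01.
have r0 : 0 <= r by lra.
have wE y : weight r r 0 (N + m) 0 y = (r + gbr y)^-1 ^+ (N + m).
  by rewrite /weight !expr0 mul1r mulr1.
have h0 f : (forall y, f y = 0) -> sum_le (fun y => weight r r 0 (N + m) 0 y ^+ 2 * f y ^+ 2) 0.
  by move=> f0 s us; rewrite big1// => y _; rewrite f0 expr0n mulr0.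
have hb s : 0 <= s <= T -> sum_le (fun y => weight r r 0 (N + m) 0 y ^+ 2 * u s y ^+ 2) (A ^+ 2 * K).
  move=> sT; under eq_fun do rewrite wE.
  exact: hK A0 r0 (leqnn _) (hA s sT).
have := heat_bound ler01 ha hu (h0 _ u0) (fun t _ => h0 _ (fun _ => erefl)) hb tT.
rewrite mul0r addr0 mulr0 mul0r => /(sum_le_pt x).
rewrite pmulr_rle0 ?exprn_gt0 ?ha.1// => h.
by apply/eqP; rewrite -sqrf_eq0 eq_le h sqr_ge0.
Qed.

End growth.

(** What the analysis knows of the walk. Mass at most one and the forward equation, in the second
    variable, are what the jump chain gives; symmetry, decay and conservation of mass are derived
    from them. Vanishing at negative times makes a source silent before its time. *)
Record heat_kernel_spec (R : realType) (G : wgraph R) (p : R -> G -> G -> R) : Prop :=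
  HeatKernelSpec {
  hk_ge0 : forall t x y, 0 <= p t x y;
  hk_neg : forall t x y, t < 0 -> p t x y = 0;
  hk_0 : forall x y, p 0 x y = (x == y)%:R;
  hk_sum : forall t x, sum_le (p t x) 1;
  hk_heat : forall x T, heat_on T [::] (fun t => p t x) (fun _ _ => 0) }.

(** * Heat kernels *)

Section kernel.
Context {R : realType} {G : wgraph R} {p : R -> G -> G -> R}.
Hypothesis hp : heat_kernel_spec p.
Implicit Types (x y z : G) (t T : R).

Lemma hk_le1 t x y : p t x y <= 1.
Proof. exact: sum_le_pt (hk_sum hp t x). Qed.

Lemma hk_sum_sq t x : sum_le (fun y => p t x y ^+ 2) 1.
Proof.
apply: sum_le_mono (hk_sum hp t x) => y.
by rewrite expr2 ler_piMl ?(hk_ge0 hp) ?hk_le1.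
Qed.

Lemma sum_le_delta (f : G -> R) x : (forall y, 0 <= f y) ->
  sum_le (fun y => f y * (x == y)%:R) (f x).
Proof.
move=> f0 s us; have [xs|xs] := boolP (x \in s).
  rewrite (perm_big _ (perm_to_rem xs)) /= big_cons eqxx mulr1 big_seq big1 ?addr0// => y.
  rewrite (mem_rem_uniq _ us) inE => /andP[yx _].
  by rewrite eq_sym (negPf yx) mulr0.
rewrite big_seq big1// => y ys; case: eqP => [xy|_]; last by rewrite mulr0.
by rewrite xy ys in xs.
Qed.

(** The weight [((r + gbr y) / (D + gbr y)) ^+ N] is at most 1, so mass at most one is the a priori
    bound. Multiplied by [D ^+ N] the weights increase to [(r + gbr y) ^+ N] as [D] grows, and the
    bound does not depend on [D]. *)
Lemma hk_decay N : exists r : R, 1 <= r /\ forall x t, 0 <= t ->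
  sum_le (fun y => ((r + gbr y) ^+ N * p t x y) ^+ 2)
    (2 * ((r + gbr x) ^+ N) ^+ 2 * expR (4 * t)).
Proof.
have [r r1 hr] := @weight_admissible R G N 0 N 1 ltr01.
exists r; split=> // x t t0 s us; set B := 2 * _ * _; set X := \sum_(y <- s) _.
pose M := \sum_(y <- s) gbr y.
have sM y : y \in s -> gbr y <= M.
  move=> ys; rewrite /M (perm_big _ (perm_to_rem ys)) /= big_cons lerDl.
  by apply: sumr_ge0 => z _; apply: le_trans (gbr_ge1 z).
have M0 : 0 <= M by apply: sumr_ge0 => y _; apply: le_trans (gbr_ge1 y).
have X0 : 0 <= X by apply: sumr_ge0 => y _; rewrite sqr_ge0.
have [n0 hn0] := exists_nat_gt r.
apply: (@le_of_lim_inv _ _ _ (2 * N%:R * M * X) n0) => n n0n.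
pose D : R := n.+1%:R.
have D0 : 0 < D by rewrite ltr0n.
have rD : r <= D by apply: ltW (lt_le_trans hn0 _); rewrite ler_nat leqW.
have wE y : weight r D N 0 N y = ((r + gbr y) / (D + gbr y)) ^+ N.
  by rewrite /weight expr0 mul1r -exprMn.
have w01 y : 0 <= (r + gbr y) / (D + gbr y) <= 1.
  have b1 := gbr_ge1 y; rewrite divr_ge0 ?ler_pdivrMr; lra.
have := @heat_bound R G t [::] (fun t => p t x) (fun _ _ => 0) (weight r D N 0 N) 1
   (weight r D N 0 N x ^+ 2) 0 1 ler01 (hr D rD) (hk_heat hp x t) _ _ _ t.
rewrite t0 lexx mul0r addr0 -natr1.
have -> : 2 * (1 + 1) = 4 :> R by ring.
move=> /(_ _ _ _ isT) hb.
have {}hb : sum_le (fun y => weight r D N 0 N y ^+ 2 * p t x y ^+ 2)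
    (2 * weight r D N 0 N x ^+ 2 * expR (4 * t)).
  apply: hb.
  - under eq_fun do rewrite (hk_0 hp) -natrX expnS expn1 mulnb andbb.
    by apply: sum_le_delta => y; rewrite sqr_ge0.
  - by move=> q _ s' _; rewrite big1// => y _; rewrite expr0n mulr0.
  - move=> q _; apply: sum_le_mono (hk_sum_sq q x) => y.
    rewrite ler_piMl ?sqr_ge0// wE -exprM exprn_ile1//; by case/andP: (w01 y).
have h2 := hb s us.
have h3 : (D ^+ N) ^+ 2 * \sum_(y <- s) weight r D N 0 N y ^+ 2 * p t x y ^+ 2 <= B.
  apply: le_trans (ler_wpM2l (sqr_ge0 _) h2) _.
  rewrite mulrA /B ler_wpM2r ?expR_ge0// mulrCA ler_wpM2l// -exprMn.
  have b1 := gbr_ge1 x.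
  have q0 : 0 <= D * ((r + gbr x) / (D + gbr x)).
    by rewrite mulr_ge0 ?(ltW D0)//; case/andP: (w01 x).
  rewrite wE -exprMn ler_sqr ?nnegrE ?exprn_ge0//; last lra.
  rewrite lerXn2r ?nnegrE//; first lra.
  rewrite mulrA ler_pdivrMr; last lra.
  by rewrite mulrC ler_wpM2l; lra.
apply: le_trans _ (lerD h3 (lexx _)).
have -> : 2 * N%:R * M * X / n.+1%:R = (2 * N)%:R * (M / D) * X by rewrite natrM; ring.
rewrite -lerBlDr.
have z01 : 0 <= D / (D + M) <= 1 by rewrite divr_ge0 ?ler_pdivrMr; lra.
have hz : 1 - D / (D + M) <= M / D.
  have -> : 1 - D / (D + M) = M / (D + M) by field; lra.
  by rewrite ler_wpM2l// lef_pV2 ?posrE; lra.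
apply: (@le_trans _ _ ((D / (D + M)) ^+ (2 * N) * X)).
  apply: le_trans (ler_wpM2r X0 (bernoulli (2 * N) z01)).
  rewrite mulrBl mul1r lerB// ler_wpM2r// ler_wpM2l//.
rewrite !mulr_sumr big_seq [leRHS]big_seq; apply: ler_sum => y ys.
rewrite mulnC exprM -exprMn mulrA -!exprMn.
have b1 := gbr_ge1 y.
have -> : (D ^+ N * weight r D N 0 N y * p t x y) ^+ 2 =
  ((D / (D + gbr y)) ^+ N * ((r + gbr y) ^+ N * p t x y)) ^+ 2.
  rewrite wE !expr_div_n; congr (_ ^+ 2); field.
  by rewrite expf_neq0//; lra.
have c0 : 0 <= (r + gbr y) ^+ N * p t x y.
  by rewrite mulr_ge0 ?(hk_ge0 hp)// exprn_ge0//; lra.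
have d0 (c : R) : 0 <= c -> 0 <= (D / (D + c)) ^+ N.
  by move=> c0'; rewrite exprn_ge0// divr_ge0//; lra.
have my : D / (D + M) <= D / (D + gbr y).
  by rewrite ler_wpM2l ?(ltW D0)// lef_pV2 ?posrE; have := sM y ys; lra.
rewrite ler_sqr ?nnegrE.
- rewrite ler_wpM2r// lerXn2r ?nnegrE//; last by rewrite divr_ge0//; lra.
  by case/andP: z01.
- by rewrite mulr_ge0// d0.
- by rewrite mulr_ge0// d0//; lra.
Qed.

Definition heaviside (a t : R) : R := (a <= t)%R%:R.

Lemma is_derive_heaviside a t : t != a -> is_derive t 1 (heaviside a) 0.
Proof.
rewrite neq_lt => /orP[ta|at_].
  apply: (near_eq_is_derive _ (is_derive_cst (0 : R) t (1 : R))).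
  near=> s; rewrite /heaviside /= leNgt.
  have -> : s < a by near: s; exact: lt_nbhsl.
  by [].
apply: (near_eq_is_derive _ (is_derive_cst (1 : R) t (1 : R))).
near=> s; rewrite /heaviside /= ltW//.
by near: s; exact: lt_nbhsr.
Unshelve. all: end_near. Qed.

(** The kernel without its jump at time 0: continuous on the whole line and differentiable off 0,
    hence convenient to compose with time shifts and reflections. *)
Definition hkq t x y : R := p t x y - (x == y)%:R * heaviside 0 t.

Lemma hkq_le0 t x y : t <= 0 -> hkq t x y = 0.
Proof.
rewrite le_eqVlt => /predU1P[->|t0].
  by rewrite /hkq /heaviside lexx mulr1 (hk_0 hp) subrr.
by rewrite /hkq /heaviside (hk_neg hp)// leNgt t0 mulr0 subrr.
Qed.

Lemma hkq_norm t x y : `|hkq t x y| <= 1.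
Proof.
have h0 := hk_ge0 hp t x y; have h1 := hk_le1 t x y.
rewrite /hkq /heaviside; case: (x == y); case: (0 <= t); rewrite /= ?mulr1n ?mulr0n ?mulr1 ?mulr0 ?mul0r ler_norml; apply/andP; split; lra.
Qed.

Lemma hkq_derive t x y : t != 0 -> is_derive t 1 (fun t => hkq t x y) (- lap (p t x) y).
Proof.
move=> t0; have -> : - lap (p t x) y = - lap (p t x) y - (x == y)%:R * 0 by rewrite mulr0 subr0.
apply: is_deriveB; last by apply: is_deriveZ; exact: is_derive_heaviside.
move: t0; rewrite neq_lt => /orP[t0|t0].
  have -> : - lap (p t x) y = 0.
    by rewrite /lap big1 ?oppr0// => z _; rewrite !(hk_neg hp)// subrr mulr0.
  apply: (near_eq_is_derive _ (is_derive_cst (0 : R) t (1 : R))).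
  near=> s; rewrite /= (hk_neg hp)//.
  by near: s; exact: lt_nbhsl.
have := (hk_heat hp x (t + 1) y).2 t; rewrite t0 ltrDl ltr01 => /(_ isT isT).
by rewrite addr0.
Unshelve. all: end_near. Qed.

Lemma hkq_continuous x y : continuous (fun t => hkq t x y).
Proof.
move=> t; have [->|t0] := eqVneq t 0; last first.
  by apply: differentiable_continuous; apply/derivable1_diffP; case: (hkq_derive x y t0).
apply/cvgrPdist_le => e e0.
have cp := (hk_heat hp x 1 y).1.
have /subspace_continuousP/(_ 0) := cp; rewrite /= in_itv /= lexx ler01 => /(_ isT).
move=> /cvgrPdist_le/(_ e e0); rewrite near_withinE => h.
rewrite hkq_le0//; near=> s; have [s0|s0] := leP s 0.
  by rewrite hkq_le0// subrr normr0 ltW.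
have s1 : s <= 1 by apply: ltW; near: s; exact: lt_nbhsl.
have hs : `[0, 1]%classic s -> `|p 0 x y - p s x y| <= e by near: s; exact: h.
have := hs ltac:(by rewrite /= in_itv /= (ltW s0)).
by rewrite /hkq /heaviside (ltW s0) mulr1 (hk_0 hp) sub0r opprB.
Unshelve. all: end_near. Qed.

Lemma hk_hkq t x y : 0 <= t -> p t x y = hkq t x y + (x == y)%:R.
Proof. by move=> t0; rewrite /hkq /heaviside t0 mulr1 subrK. Qed.

(** Only the forward equation is at hand. The truncated sum over [y] of [p q x y * p (t - q) z y]
    has a derivative in [q] that would vanish without the cut-off, by symmetry of the conductances,
    and is of order [1 / L] with it; its values at [q = t] and [q = 0] are the two sides, up to the
    cut-off. *)
Lemma hk_sym t x z : p t x z = p t z x.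
Proof.
have [t0|t0] := ltP t 0; first by rewrite !(hk_neg hp).
have [r [r1 hr]] := hk_decay 1.
have [r' r'1 hr'] := gw_sub G (@ltr01 R).
pose E (a : G) : R := 2 * (r + gbr a) ^+ 2 * expR (4 * t).
have hE (s : R) (a : G) : 0 <= s <= t -> sum_le (fun y => ((r + gbr y) * p s a y) ^+ 2) (E a).
  move=> /andP[s0 st]; apply: sum_le_weak (hr a s s0).
  by apply: ler_wpM2l; [rewrite mulr_ge0 ?sqr_ge0|rewrite ler_expR ler_wpM2l].
have E0 (a : G) : 0 <= E a by apply: mulr_ge0 (expR_ge0 _); apply: mulr_ge0 (sqr_ge0 _).
pose K := r' ^+ 2 * (E x + E z) * t.
have hL (L : nat) : (0 < L)%N -> `|cut L z * p t x z - cut L x * p t z x| <= K / L%:R.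
  move=> L0; pose s := gbox G L.+1.
  have us : uniq s by exact: gbox_uniq.
  pose F (q : R) : R := \sum_(y <- s) cut L y * ((hkq q x y + (x == y)%:R) * (hkq (t - q) z y + (z == y)%:R)).
  pose dF (q : R) : R := \sum_(y <- s) cut L y * (p q x y * lap (p (t - q) z) y - p (t - q) z y * lap (p q x) y).
  have Fbd (a : R) : 0 <= a -> 0 <= t - a -> F a = \sum_(y <- s) cut L y * (p a x y * p (t - a) z y).
    by move=> a0 ta; apply: eq_bigr => y _; rewrite -!hk_hkq.
  have pick (a : G) (f : G -> R) : \sum_(y <- s) cut L y * ((a == y)%:R * f y) = cut L a * f a.
    have [as_|as_] := boolP (a \in s).
      rewrite (perm_big _ (perm_to_rem as_)) /= big_cons eqxx mul1r big_seq big1 ?addr0// => y.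
      by rewrite (mem_rem_uniq _ us) inE => /andP[ya _]; rewrite eq_sym (negPf ya) mul0r mulr0.
    rewrite big_seq big1; last first.
      move=> y ys; case: eqP => [ay|_]; last by rewrite mul0r mulr0.
      by rewrite ay ys in as_.
    rewrite cut_out ?mul0r//; apply: contra as_; exact: box_sub.
  have Ft : F t = cut L z * p t x z.
    rewrite (Fbd t) ?subrr// -(pick z).
    by apply: eq_bigr => y _; rewrite (hk_0 hp) [_ * (z == y)%:R]mulrC.
  have F0 : F 0 = cut L x * p t z x.
    rewrite (Fbd 0) ?subr0// -(pick x).
    by apply: eq_bigr => y _; rewrite (hk_0 hp).
  have cF : {within `[0, t], continuous F}.
    apply: within_sum => y _; apply: within_M; first exact: within_cst.
    apply: within_M; apply: within_D; try exact: within_cst.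
      by apply: continuous_subspaceT; exact: hkq_continuous.
    apply: continuous_subspaceT => q.
    apply: (@continuous_comp _ _ _ (fun q => t - q) (fun q => hkq q z y)).
      by apply: cvgB; [exact: cvg_cst|exact: cvg_id].
    exact: hkq_continuous.
  have dFq (q : R) : 0 < q < t -> is_derive q 1 F (dF q).
    move=> /andP[q0 qt]; apply: is_derive_big => y _; apply: is_deriveZ.
    have d1 : is_derive q 1 (fun q => hkq q x y + (x == y)%:R) (- lap (p q x) y + 0).
      by apply: is_deriveD; apply: hkq_derive; rewrite gt_eqF.
    have d2 : is_derive q 1 (fun q => hkq (t - q) z y + (z == y)%:R) (lap (p (t - q) z) y + 0).
      apply: is_deriveD.
      have d3 : is_derive q 1 (fun q => t - q) (0 - 1) by exact: is_deriveB.
      have d4 : is_derive (t - q) 1 (fun t => hkq t z y) (- lap (p (t - q) z) y).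
        by apply: hkq_derive; rewrite subr_eq0 gt_eqF.
      by have := @is_derive1_comp R (fun t => hkq t z y) (fun q => t - q) q _ _ d4 d3; rewrite sub0r mulrN1 opprK.
    have := is_deriveM d1 d2; rewrite /GRing.scale /= -!hk_hkq ?subr_ge0 ?(ltW q0) ?(ltW qt)//.
    by rewrite !addr0 mulrN.
  have bF (q : R) : 0 < q < t -> `|dF q| <= r' ^+ 2 * (E x + E z) / L%:R.
    move=> /andP[q0 qt].
    pose u := p q x; pose v := p (t - q) z.
    have co (f : G -> R) y : y \notin gbox G L -> cut L y * f y = 0.
      by move=> yL; rewrite cut_out// mul0r.
    (* Symmetrising leaves one factor [cut L y - cut L y'] per edge; the rates are paid for by the
       decay of both kernels. *)
    have -> : dF q = 2^-1 * dsum s (fun y y' => (cut L y - cut L y') * (v y * u y' - u y * v y')).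
      rewrite /dF /s; transitivity (\sum_(y <- gbox G L.+1) cut L y * u y * lap v y -
         \sum_(y <- gbox G L.+1) cut L y * v y * lap u y).
        by rewrite -sumrB; apply: eq_bigr => y _; rewrite /u /v; ring.
      rewrite (green1 v (co u)) (green1 u (co v)) -dsumB.
      set D := dsum _ _; have -> : D = 2^-1 * (D + D) by field.
      by congr (_ * _); rewrite {2}/D dsum_swap -dsumD; apply: eq_dsum => y y'; ring.
    rewrite normrM ger0_norm ?invr_ge0//.
    have -> : r' ^+ 2 * (E x + E z) / L%:R = 2^-1 * (2 * L%:R^-1 * (r' ^+ 2 * (E x + E z))) by field; rewrite pnatr_eq0 -lt0n.
    rewrite ler_wpM2l//.
    pose h (y : G) : R := u y ^+ 2 + v y ^+ 2.
    have h0 y : 0 <= h y by rewrite addr_ge0 ?sqr_ge0.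
    have hs : \sum_(y <- s) (r' + gbr y) ^+ 2 * h y <= r' ^+ 2 * (E x + E z).
      have := lerD (hE q x ltac:(by rewrite !ltW) s us) (hE (t - q) z ltac:(by rewrite subr_ge0 (ltW qt) lerBlDr lerDl ltW) s us).
      rewrite -big_split => h1; apply: le_trans (ler_wpM2l (sqr_ge0 r') h1).
      rewrite mulr_sumr; apply: ler_sum => y _.
      rewrite -/u -/v /= !exprMn -mulrDr mulrA ler_wpM2r ?h0// -exprMn.
      have b1 := gbr_ge1 y.
      have m1 : 0 <= (r' - 1) * gbr y by rewrite mulr_ge0 ?subr_ge0//; lra.
      have m2 : 0 <= r' * (r - 1) by rewrite mulr_ge0 ?subr_ge0//; lra.
      by rewrite ler_sqr ?nnegrE; lra.
    have step1 : `|dsum s (fun y y' => (cut L y - cut L y') * (v y * u y' - u y * v y'))| <=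
       L%:R^-1 * dsum s (fun y y' => (h y + h y')).
      rewrite -dsumZ; apply: le_trans (ler_norm_sum _ _ _) _; apply: ler_sum => y _.
      apply: le_trans (ler_norm_sum _ _ _) _; apply: ler_sum => y' _.
      rewrite normrM ger0_norm ?gw_ge0//.
      have [yy|yy] := boolP (y' \in gnb y); last by rewrite gw_nb// !mul0r.
      rewrite ler_wpM2l ?gw_ge0// normrM; apply: ler_pM => //; first exact: cut_lip.
      rewrite /h ler_norml; move: (u y) (u y') (v y) (v y') => a b c d.
      by apply/andP; split; have := sqr_ge0 (a - d); have := sqr_ge0 (a + d); have := sqr_ge0 (b - c); have := sqr_ge0 (b + c); nra.
    apply: le_trans step1 _; rewrite [2 * _]mulrC -mulrA; apply: ler_wpM2l; first by [].
    rewrite dsumD; have -> : dsum s (fun _ y' => h y') = dsum s (fun y _ => h y) by rewrite dsum_swap.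
    have hd : dsum s (fun y _ => h y) <= r' ^+ 2 * (E x + E z).
      apply: le_trans hs; apply: ler_sum => y _; rewrite -mulr_suml ler_wpM2r ?h0//.
      have h3 := hr' y; rewrite mul1r in h3; apply: le_trans h3.
      have := @sum_nb_le _ _ y s (fun _ => 1) us (fun _ => ler01).
      by under eq_bigr do rewrite mulr1; under [leRHS]eq_bigr do rewrite mulr1.
    lra.
  have := @approx_primitive _ F dF (fun _ => 0) [::] t (r' ^+ 2 * (E x + E z) / L%:R) cF (@within_cst R _ 0) _ t.
  rewrite t0 lexx Rintegral_cst// mul0r subr0 Ft F0 => hh.
  have -> : K / L%:R = r' ^+ 2 * (E x + E z) / L%:R * t by rewrite /K; ring.
  apply: hh => // q qt _; split; first exact: dFq.
  by rewrite subr0; exact: bF.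
have px0 := hk_ge0 hp t x z; have px1 := hk_le1 t x z.
have pz0 := hk_ge0 hp t z x; have pz1 := hk_le1 t z x.
have bx := gbr_ge1 x; have bz := gbr_ge1 z.
have K0 : 0 <= K by apply: mulr_ge0 t0; apply: mulr_ge0 (sqr_ge0 _) _; exact: addr_ge0.
have fin (a b ca cb gz gx i : R) : 0 <= a <= 1 -> 0 <= b -> cb <= 1 -> 0 <= i -> 0 <= gz ->
    0 <= gx -> 1 - gz * i <= ca -> ca * a - cb * b <= K * i -> a <= b + (K + gz + gx) * i.
  move=> /andP[a0 a1] b0 cb1 i0 gz0 gx0 hca h.
  have h1 : (1 - gz * i) * a <= ca * a by rewrite ler_wpM2r.
  have h2 : cb * b <= 1 * b by rewrite ler_wpM2r.
  have h3 : gz * i * a <= gz * i by rewrite ler_piMr ?mulr_ge0.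
  have h4 : 0 <= gx * i by rewrite mulr_ge0.
  lra.
apply/eqP; rewrite eq_le; apply/andP; split.
  apply: (@le_of_lim_inv _ _ _ (K + gbr z + gbr x) 0%N) => n _.
  apply: (fin _ _ _ _ _ _ _ _ _ (cut_le1 n.+1 x) _ _ _ (cut_lb n.+1 z)); rewrite ?px0 ?invr_ge0//; try lra.
  by have := hL n.+1 isT; rewrite ler_norml => /andP[_ ].
apply: (@le_of_lim_inv _ _ _ (K + gbr x + gbr z) 0%N) => n _.
apply: (fin _ _ _ _ _ _ _ _ _ (cut_le1 n.+1 z) _ _ _ (cut_lb n.+1 x)); rewrite ?pz0 ?invr_ge0//; try lra.
by have := hL n.+1 isT; rewrite ler_norml lerNl opprB => /andP[].
Qed.

End kernel.

(* A finite sequence of entries [(tau, y, c)] stands for the noise path that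
   jumps by [c] at the vertex [y] at time [tau]. *)
Definition source (R : realType) (G : wgraph R) := seq (R * G * R).

(** * Responses to discretised paths *)

Section source.
Context {R : realType} {G : wgraph R} {p : R -> G -> G -> R}.
Hypothesis hp : heat_kernel_spec p.
Implicit Types (x y z : G) (t T : R) (m : source G).

Definition src_path m t x : R := \sum_(e <- m) e.2 * ((x == e.1.2)%:R * heaviside e.1.1 t).

Definition src_resp m t x : R := \sum_(e <- m) e.2 * p (t - e.1.1) x e.1.2.

Definition src_opp m : source G := [seq (e.1, - e.2) | e <- m].

Lemma src_path_cat m m' t x : src_path (m ++ m') t x = src_path m t x + src_path m' t x.
Proof. by rewrite /src_path big_cat. Qed.

Lemma src_resp_cat m m' t x : src_resp (m ++ m') t x = src_resp m t x + src_resp m' t x.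
Proof. by rewrite /src_resp big_cat. Qed.

Lemma src_path_opp m t x : src_path (src_opp m) t x = - src_path m t x.
Proof. by rewrite /src_path big_map -sumrN; apply: eq_bigr => e _ /=; rewrite mulNr. Qed.

Lemma src_resp_opp m t x : src_resp (src_opp m) t x = - src_resp m t x.
Proof. by rewrite /src_resp big_map -sumrN; apply: eq_bigr => e _ /=; rewrite mulNr. Qed.

Definition src_nonneg m := forall e, e \in m -> 0 <= e.1.1.

(** The response makes the same jumps as the path, so the difference is a combination of the
    continuous kernels [hkq]. *)
Lemma src_diffE m t x : src_resp m t x - src_path m t x =
  \sum_(e <- m) e.2 * hkq (p := p) (t - e.1.1) x e.1.2.
Proof.
rewrite /src_resp /src_path -sumrB; apply: eq_bigr => e _.
by rewrite -mulrBr /hkq /heaviside subr_ge0.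
Qed.

Lemma lap_src_resp m t x : lap (src_resp m t) x =
  \sum_(e <- m) e.2 * lap (fun x => p (t - e.1.1) x e.1.2) x.
Proof.
rewrite /src_resp; elim: m => [|e m IH].
  by under eq_fun do rewrite big_nil; rewrite big_nil lap_cst.
by under eq_fun do rewrite big_cons; rewrite lapD lapZ IH big_cons.
Qed.

Lemma src_diff_derive m t x : t \notin [seq e.1.1 | e <- m] ->
  is_derive t 1 (fun t => src_resp m t x - src_path m t x) (- lap (src_resp m t) x).
Proof.
move=> tm; under eq_fun do rewrite src_diffE.
rewrite lap_src_resp -sumrN; apply: is_derive_big => e em.
rewrite -mulrN; apply: is_deriveZ.
have te : t - e.1.1 != 0.
  by rewrite subr_eq0; apply: contraNneq tm => ->; apply/mapP; exists e.
have d3 : is_derive t 1 (fun q => q - e.1.1) (1 - 0) by exact: is_deriveB.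
have d4 : is_derive (t - e.1.1) 1 (fun t => hkq (p := p) t e.1.2 x) (- lap (p (t - e.1.1) e.1.2) x).
  exact: hkq_derive.
have := @is_derive1_comp R (fun t => hkq (p := p) t e.1.2 x) (fun q => q - e.1.1) t _ _ d4 d3.
rewrite subr0 mulr1.
have -> : (fun x => p (t - e.1.1) x e.1.2) = p (t - e.1.1) e.1.2.
  by apply/funext => z; exact: hk_sym.
rewrite /comp; under eq_fun do rewrite /hkq (hk_sym hp) eq_sym.
by rewrite /hkq.
Qed.

Lemma src_diff_within m (A : set R) x :
  {within A, continuous (fun t => src_resp m t x - src_path m t x)}.
Proof.
under eq_fun do rewrite src_diffE.
apply: within_sum => e _; apply: within_M; first exact: within_cst.
apply: continuous_subspaceT => q.
apply: (@continuous_comp _ _ _ (fun q => q - e.1.1) (fun q => hkq (p := p) q x e.1.2)).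
  by apply: cvgB; [exact: cvg_id|exact: cvg_cst].
exact: hkq_continuous.
Qed.

Lemma src_diff0 m t x : src_nonneg m -> t <= 0 -> src_resp m t x - src_path m t x = 0.
Proof.
move=> m0 t0; rewrite src_diffE big_seq big1// => e /m0 e0.
by rewrite (hkq_le0 hp) ?mulr0// subr_le0 (le_trans t0).
Qed.

Lemma src_diff_norm m t x : `|src_resp m t x - src_path m t x| <= \sum_(e <- m) `|e.2|.
Proof.
rewrite src_diffE; apply: le_trans (ler_norm_sum _ _ _) _; apply: ler_sum => e _.
by rewrite normrM ler_piMr// (hkq_norm hp).
Qed.

(* The response is controlled by the path alone, uniformly over all sources:
   this is what makes the response extend to limits of sources. *)
Lemma src_resp_growth N : exists N', forall T, 0 <= T -> exists K : R, 0 <= K /\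
  forall m (e : R), 0 <= e -> src_nonneg m ->
  (forall t, 0 <= t <= T -> growth (src_path m t) e N) ->
  forall t, 0 <= t <= T -> growth (src_resp m t) (e * K) N'.
Proof.
have [K1 [K10 hK1]] := @lap_growth R G N.
have [m0 [K2 [K20 hK2]]] := @growth_sum_le R G.
pose n := (N + 2 + m0)%N; exists n => T T0.
have [r r1 /(_ r (lexx _)) ha] := @weight_admissible R G 0 n 0 1 ltr01.
have r0 : 0 <= r by lra.
have wE y : weight r r 0 n 0 y = (r + gbr y)^-1 ^+ n.
  by rewrite /weight !expr0 mul1r mulr1.
pose Q : R := 2 * (K1 ^+ 2 * K2 * T) * expR (4 * T).
exists (Num.sqrt Q * (r + 1) ^+ n + 1); split.
  by rewrite addr_ge0// mulr_ge0 ?sqrtr_ge0// exprn_ge0//; lra.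
move=> m e e0 mnn hm t tT; have [t0 tT'] := andP tT.
pose u t x := src_resp m t x - src_path m t x.
have hu : heat_on T [seq e.1.1 | e <- m] u (fun t x => - lap (src_path m t) x).
  move=> x; split; first exact: src_diff_within.
  move=> s _ sD; have -> : - lap (u s) x - lap (src_path m s) x = - lap (src_resp m s) x.
    by rewrite /u lapB; ring.
  exact: src_diff_derive.
have hu0 : sum_le (fun x => weight r r 0 n 0 x ^+ 2 * u 0 x ^+ 2) 0.
  by move=> s _; rewrite big1// => x _; rewrite /u src_diff0// expr0n mulr0.
have hf (s : R) : 0 <= s <= T -> sum_le (fun x => weight r r 0 n 0 x ^+ 2 * (- lap (src_path m s) x) ^+ 2)
    ((e * K1) ^+ 2 * K2).
  move=> sT; under eq_fun do rewrite wE sqrrN.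
  by apply: (hK2 _ _ (N + 2)%N) => //; [exact: mulr_ge0|apply: hK1 => //; exact: hm].
(* This bound depends on the source, but it serves only as the a priori bound in [heat_bound] and
   leaves no trace. *)
pose A : R := \sum_(e <- m) `|e.2|.
have A0 : 0 <= A by exact: sumr_ge0.
have hS (s : R) : 0 <= s <= T -> sum_le (fun x => weight r r 0 n 0 x ^+ 2 * u s x ^+ 2) (A ^+ 2 * K2).
  move=> sT; under eq_fun do rewrite wE.
  have n1 : (0 + m0 <= n)%N by rewrite /n add0n leq_addl.
  apply: (hK2 _ _ _ _ _ A0 r0 n1).
  by move=> x; rewrite expr0 mulr1; exact: src_diff_norm.
have := heat_bound ler01 ha hu hu0 hf hS tT.
under eq_fun do rewrite wE.
move=> h; have {}h := sum_le_growth r0 h.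
have hQ : Num.sqrt (2 * (0 + (e * K1) ^+ 2 * K2 * T) * expR (2 * (1 + 1) * t)) <= e * Num.sqrt Q.
  have -> : e * Num.sqrt Q = Num.sqrt (e ^+ 2 * Q) by rewrite (sqrtrM Q (sqr_ge0 e)) sqrtr_sqr ger0_norm.
  rewrite ler_wsqrtr//.
  rewrite /Q; have -> : 2 * (1 + 1) = 4 :> R by ring.
  have -> : e ^+ 2 * (2 * (K1 ^+ 2 * K2 * T) * expR (4 * T)) =
    2 * (0 + (e * K1) ^+ 2 * K2 * T) * expR (4 * T) by ring.
  apply: ler_wpM2l; last by rewrite ler_expR ler_wpM2l.
  by rewrite add0r; apply: mulr_ge0 => //; apply: mulr_ge0 => //; apply: mulr_ge0 (sqr_ge0 _) _.
have h1 : growth (u t) (e * (Num.sqrt Q * (r + 1) ^+ n)) n.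
  move=> x; apply: le_trans (h x) _; rewrite ler_wpM2r ?exprn_ge0 ?(ltW (gbr_gt0 x))//.
  by rewrite mulrA ler_wpM2r ?exprn_ge0//; lra.
have h2 : growth (src_path m t) e n.
  by apply: growth_weak (hm t tT) => //; rewrite /n -addnA leq_addr.
rewrite mulrDr mulr1 => x; have := growthD h1 h2 x.
by rewrite /u subrK.
Qed.

(** One exponent for all horizons [T]; only the constant depends on [T]. This keeps a solution in a
    single weighted space for all times. *)
Definition resp_exp N : nat := sval (cid (src_resp_growth N)).

Definition src_cvg (ms : nat -> source G) (beta : R -> G -> R) N :=
  (forall n, src_nonneg (ms n)) /\
  forall (T e : R), 0 <= T -> 0 < e -> exists n0 : nat, forall n t, (n0 <= n)%N -> 0 <= t <= T ->
    growth (fun x => src_path (ms n) t x - beta t x) e N.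

Definition src_sol (ms : nat -> source G) t x : R := limn (fun n => src_resp (ms n) t x).

Section limit.
Variables (ms : nat -> source G) (beta : R -> G -> R) (N : nat).
Hypothesis hms : src_cvg ms beta N.

(** The difference of two responses is the response to one source concatenated with the negative of
    the other, and the path of this concatenation is small. *)
Lemma src_cauchy : forall (T e : R), 0 <= T -> 0 < e ->
  exists n0 : nat, forall n k t, (n0 <= n)%N -> (n0 <= k)%N -> 0 <= t <= T ->
    growth (fun x => src_resp (ms n) t x - src_resp (ms k) t x) e (resp_exp N).
Proof.
have hN' := svalP (cid (src_resp_growth N)); move=> T e T0 e0.
set N' := resp_exp N; have [K [K0 hK]] := hN' T T0; rewrite -/(resp_exp N) -/N' in hK.
have e1 : 0 < e / (2 * (K + 1)) by rewrite divr_gt0// mulr_gt0//; lra.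
have [n0 hn0] := hms.2 T _ T0 e1; exists n0 => n k t n0n n0k tT.
have := hK (ms n ++ src_opp (ms k)) (e / (K + 1)).
have nn : src_nonneg (ms n ++ src_opp (ms k)).
  move=> a; rewrite mem_cat => /orP[/(hms.1 n)//|/mapP[b /(hms.1 k) b0 ->]].
  exact: b0.
have e2 : 0 <= e / (K + 1) by rewrite divr_ge0//; lra.
move=> /(_ e2 nn) h; have {}h : growth (src_resp (ms n ++ src_opp (ms k)) t) (e / (K + 1) * K) N'.
  apply: h => // s sT x; rewrite src_path_cat src_path_opp.
  have -> : src_path (ms n) s x - src_path (ms k) s x =
    (src_path (ms n) s x - beta s x) - (src_path (ms k) s x - beta s x) by ring.
  have := growthB (hn0 n s n0n sT) (hn0 k s n0k sT) x.
  by have -> : e / (2 * (K + 1)) + e / (2 * (K + 1)) = e / (K + 1) by field; lra.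
move=> x; have := h x; rewrite src_resp_cat src_resp_opp => /le_trans; apply.
rewrite ler_wpM2r ?exprn_ge0 ?(ltW (gbr_gt0 x))// mulrAC ler_pdivrMr; last lra.
by rewrite ler_wpM2l ?(ltW e0)//; lra.
Qed.

Lemma src_sol_cvg t x : 0 <= t -> src_resp (ms n) t x @[n --> \oo] --> src_sol ms t x.
Proof.
move=> t0; have hN' := src_cauchy; set N' := resp_exp N in hN'.
apply: (real_cauchy (u := fun n => src_resp (ms n) t x)) => e e0.
have b0 : 0 < gbr x ^+ N' by rewrite exprn_gt0// gbr_gt0.
have [n0 hn0] := hN' t _ t0 (divr_gt0 e0 b0); exists n0 => n k n0n n0k.
have := hn0 n k t n0n n0k; rewrite t0 lexx => /(_ isT x).
by rewrite divfK ?gt_eqF.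
Qed.

Lemma src_sol_unif : forall (T e : R), 0 <= T -> 0 < e ->
  exists n0 : nat, forall n t, (n0 <= n)%N -> 0 <= t <= T ->
    growth (fun x => src_resp (ms n) t x - src_sol ms t x) e (resp_exp N).
Proof.
have hN' := src_cauchy; set N' := resp_exp N in hN' *; move=> T e T0 e0.
have [n0 hn0] := hN' T e T0 e0; exists n0 => n t n0n tT x.
have t0 : 0 <= t by case/andP: tT.
apply: (cvg_norm_le (n0 := n0) (src_sol_cvg (x := x) t0)).
by move=> k n0k; exact: hn0.
Qed.

Lemma src_resp_bound (n : nat) T : 0 <= T -> exists A : R, 0 <= A /\
  forall t, 0 <= t <= T -> growth (src_resp (ms n) t) A 0.
Proof.
move=> T0; exists (\sum_(e <- ms n) `|e.2|); split; first exact: sumr_ge0.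
move=> t _ x; rewrite expr0 mulr1; apply: le_trans (ler_norm_sum _ _ _) _.
apply: ler_sum => e _; rewrite normrM ler_piMr// ger0_norm ?(hk_ge0 hp)//.
exact: hk_le1.
Qed.

Lemma src_sol_growth : forall T, 0 <= T -> exists A : R, 0 <= A /\
  forall t, 0 <= t <= T -> growth (src_sol ms t) A (resp_exp N).
Proof.
have hN' := src_sol_unif; set N' := resp_exp N in hN' *; move=> T T0.
have [n0 hn0] := hN' T 1 T0 ltr01.
have [A [A0 hA]] := src_resp_bound n0 T0; exists (A + 1); split; first lra.
move=> t tT x; have h1 := growth_weak A0 (lexx A) (leq0n N') (hA t tT).
have := growthB h1 (hn0 n0 t (leqnn _) tT) x.
by rewrite opprB addrC subrK.
Qed.

Hypothesis cbeta : forall x T, {within `[0, T], continuous (fun t => beta t x)}.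

(** The responses themselves jump. Continuity passes to the uniform limit for response minus path,
    and [beta] is added back. *)
Lemma src_sol_within x T : {within `[0, T], continuous (fun t => src_sol ms t x)}.
Proof.
have [T0|T0] := ltP T 0.
  have -> : `[0, T]%classic = set0 :> set R.
    by apply/seteqP; split=> // t /=; rewrite in_itv /= => /andP[h1 h2]; lra.
  by apply/subspace_continuousP.
have hN' := src_sol_unif; set N' := resp_exp N in hN'.
have -> : (fun t => src_sol ms t x) = (fun t => (src_sol ms t x - beta t x) + beta t x).
  by apply/funext => t; rewrite subrK.
apply: within_D => //; apply: within_unif_limit => e e0.
have b0 : 0 < gbr x ^+ N' by rewrite exprn_gt0// gbr_gt0.
have b1 : 0 < gbr x ^+ N by rewrite exprn_gt0// gbr_gt0.
have e2 : 0 < e / 2 by rewrite divr_gt0.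
have [n0 hn0] := hN' T _ T0 (divr_gt0 e2 b0).
have [n1 hn1] := hms.2 T _ T0 (divr_gt0 e2 b1).
pose n := maxn n0 n1.
exists (fun t => src_resp (ms n) t x - src_path (ms n) t x); first exact: src_diff_within.
move=> t /=; rewrite in_itv /= => tT.
have := hn0 n t (leq_maxl _ _) tT x; have := hn1 n t (leq_maxr _ _) tT x.
rewrite !divfK ?gt_eqF// => h1 h2.
set a := src_resp _ _ _; set b := src_path _ _ _; set c := src_sol _ _ _; set d := beta _ _.
have -> : a - b - (c - d) = (a - c) - (b - d) by ring.
apply: le_trans (ler_normB _ _) _; rewrite -/a -/b -/c -/d in h1 h2; lra.
Qed.

(** Each response satisfies the equation with its own path. [approx_primitive] compares its
    derivative with the Laplacian of the limit, and at the fixed vertex [x] all errors tend to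
    zero. *)
Lemma src_sol_eq t x : 0 <= t -> src_sol ms t x =
  beta t x - \int[lebesgue_measure]_(s in `[0, t]) lap (src_sol ms s) x.
Proof.
move=> t0; have hN' := src_sol_unif; set N' := resp_exp N in hN'.
have [K [K0 hK]] := @lap_growth R G N'.
set I := \int[_]_(s in _) _.
suff : `|(src_sol ms t x - beta t x) + I| <= 0.
  by rewrite normr_le0 => /eqP h; lra.
apply: le_of_le_add => e e0; rewrite add0r.
pose B := gbr x ^+ (N' + 2).
have b0 : 0 < B by rewrite exprn_gt0// gbr_gt0.
have bN : 0 < gbr x ^+ N by rewrite exprn_gt0// gbr_gt0.
have bN' : 0 < gbr x ^+ N' by rewrite exprn_gt0// gbr_gt0.
(* The Laplacian turns an error [d] into [d * K * B]; integrated up to [t] this stays below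
   [e / 3]. *)
pose d := e / (3 * (1 + B * K * t)).
have q0 : 0 < 1 + B * K * t by rewrite ltr_wpDr// mulr_ge0// mulr_ge0// ltW.
have d0 : 0 < d by rewrite divr_gt0// mulr_gt0.
have e3 : 0 < e / 3 by rewrite divr_gt0.
have [n0 hn0] := hN' t _ t0 (divr_gt0 e3 bN').
have [n1 hn1] := hms.2 t _ t0 (divr_gt0 e3 bN).
have [n2 hn2] := hN' t _ t0 d0.
pose n := maxn n0 (maxn n1 n2).
have n0n : (n0 <= n)%N by rewrite leq_maxl.
have n1n : (n1 <= n)%N by rewrite !leq_max leqnn orbT.
have n2n : (n2 <= n)%N by rewrite !leq_max leqnn !orbT.
have tt : 0 <= t <= t by rewrite t0 lexx.
have := @approx_primitive R (fun t => src_resp (ms n) t x - src_path (ms n) t x)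
  (fun t => - lap (src_resp (ms n) t) x) (fun t => -1 * lap (src_sol ms t) x)
  [seq e.1.1 | e <- ms n] t (d * K * B) (@src_diff_within _ _ _).
have cl : {within `[0, t], continuous (fun s => lap (src_sol ms s) x)}.
  by apply: lap_within => y; exact: src_sol_within.
have cl' : {within `[0, t], continuous (fun s => -1 * lap (src_sol ms s) x)}.
  by apply: within_M => //; exact: within_cst.
move=> /(_ cl') h; have {}h : `|src_resp (ms n) t x - src_path (ms n) t x -
   (src_resp (ms n) 0 x - src_path (ms n) 0 x) -
   \int[lebesgue_measure]_(s in `[0, t]) (-1 * lap (src_sol ms s) x)| <= d * K * B * t.
  apply: h => // s /andP[s0 st] sD; split; first exact: src_diff_derive.
  rewrite mulN1r -opprD normrN -lapB.
  by apply: (hK _ d (ltW d0) (hn2 n s n2n _)); rewrite (ltW s0) ltW.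
move: h; rewrite (src_diff0 x (hms.1 n) (lexx 0)) subr0.
have il : lebesgue_measure.-integrable `[0, t] (EFin \o (fun s => lap (src_sol ms s) x)).
  apply: continuous_compact_integrable => //; exact: segment_compact.
rewrite RintegralZl// -/I mulN1r opprK.
have := hn0 n t n0n tt x; have := hn1 n t n1n tt x.
rewrite !divfK ?gt_eqF//.
set a := src_resp _ _ _; set b := src_path _ _ _; set c := src_sol _ _ _; set f := beta _ _.
move=> h1 h2 h3.
have h4 : d * K * B * t <= e / 3.
  rewrite /d; have -> : e / (3 * (1 + B * K * t)) * K * B * t = e / 3 * ((B * K * t) / (1 + B * K * t)).
    by field; rewrite gt_eqF.
  by rewrite ler_piMr ?(ltW e3)// ler_pdivrMr//; lra.
have -> : c - f + I = (a - b + I) - (a - c) + (b - f) by ring.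
apply: le_trans (ler_normD _ _) _.
have := ler_normB (a - b + I) (a - c); lra.
Qed.

End limit.

(** Neither [Phi] nor [beta] has a derivative in general; their difference is a primitive of a
    continuous function. *)
Lemma path_integral_heat (Phi beta : R -> G -> R) :
  (forall x T, {within `[0, T], continuous (fun t => Phi t x)}) ->
  (forall t x, 0 <= t -> Phi t x = beta t x -
     \int[lebesgue_measure]_(s in `[0, t]) lap (Phi s) x) ->
  forall x t, 0 < t -> is_derive t 1 (fun t => Phi t x - beta t x) (- lap (Phi t) x).
Proof.
move=> cP hP x t t0.
have cl T : {within `[0, T], continuous (fun s => lap (Phi s) x)} by exact: lap_within.
have T0 : 0 < t + 1 by lra.
have [_ dI _] := within_primitive T0 (cl (t + 1)).
have dt := dI t ltac:(by rewrite t0 ltrDl ltr01).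
have dn : is_derive t 1 (fun t => - \int[lebesgue_measure]_(s in `[0, t]) lap (Phi s) x) (- lap (Phi t) x).
  exact: is_deriveN.
apply: near_eq_is_derive dn.
near=> s; rewrite /= hP; first by rewrite [beta s x - _]addrC addrK.
by apply: ltW; near: s; exact: lt_nbhsr.
Unshelve. all: end_near. Qed.

Lemma path_integral_unique (Phi Psi beta : R -> G -> R) (T A : R) N :
  0 <= A ->
  (forall x, {within `[0, T], continuous (fun t => Phi t x)}) ->
  (forall x, {within `[0, T], continuous (fun t => Psi t x)}) ->
  (forall t x, 0 <= t <= T -> Phi t x = beta t x -
     \int[lebesgue_measure]_(s in `[0, t]) lap (Phi s) x) ->
  (forall t x, 0 <= t <= T -> Psi t x = beta t x -
     \int[lebesgue_measure]_(s in `[0, t]) lap (Psi s) x) ->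
  (forall t, 0 <= t <= T -> growth (Phi t) A N) ->
  (forall t, 0 <= t <= T -> growth (Psi t) A N) ->
  forall t x, 0 <= t <= T -> Phi t x = Psi t x.
Proof.
move=> A0 cP cQ hP hQ gP gQ t x tT.
apply/eqP; rewrite -subr_eq0; apply/eqP.
have [t0 tT'] := andP tT.
have T0 : 0 <= T by exact: le_trans tT'.
apply: (@heat_unique R G T [::] (fun t x => Phi t x - Psi t x) (A + A) N) => //.
- lra.
- move=> y; split; first exact: within_B.
  move=> s /andP[s0 sT] _; have Tp : 0 < T by exact: lt_trans sT.
  have [_ dP _] := within_primitive Tp (lap_within (x := y) cP).
  have [_ dQ _] := within_primitive Tp (lap_within (x := y) cQ).
  have sb : 0 < s < T by rewrite s0.
  rewrite addr0; have := is_deriveB (dQ s sb) (dP s sb).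
  rewrite lapB opprB => dn; apply: near_eq_is_derive dn; near=> q.
  have q0 : 0 <= q by apply: ltW; near: q; exact: lt_nbhsr.
  have qT : q <= T by apply: ltW; near: q; exact: lt_nbhsl.
  by rewrite fctE hP ?q0// hQ ?q0// opprB [RHS]addrC addrA subrK.
- by move=> y; rewrite hP ?lexx// hQ ?lexx// !set_itv1 !Rintegral_set1 subrr.
- by move=> s sT; apply: growthB; [exact: gP|exact: gQ].
Unshelve. all: end_near. Qed.

End source.

(** * The integral equation along a path and the heat semigroup *)

Section mild.
Context {R : realType} {G : wgraph R} {p : R -> G -> G -> R}.
Hypothesis hp : heat_kernel_spec p.
Implicit Types (x y z : G) (t T s : R) (Phi Psi beta gamma : R -> G -> R) (xi eta : G -> R).

Definition loc_growth beta := exists N : nat, forall T, 0 <= T -> exists A : R, 0 <= A /\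
  forall t, 0 <= t <= T -> growth (beta t) A N.

Definition time_continuous beta :=
  forall x T, {within `[0, T], continuous (fun t => beta t x)}.

(** Initial value and noise enter through [beta] alone, so the heat flow, the stochastic convolution
    and their restarts are instances of one equation, linear in [beta] and uniquely solvable within
    polynomial growth. *)
Definition mild_sol beta Phi := [/\ time_continuous Phi, loc_growth Phi
  & forall t x, 0 <= t -> Phi t x = beta t x -
     \int[lebesgue_measure]_(s in `[0, t]) lap (Phi s) x].

Lemma lap_integrable Phi t x : time_continuous Phi ->
  lebesgue_measure.-integrable `[0, t] (EFin \o (fun s => lap (Phi s) x)).
Proof.
move=> cP; apply: continuous_compact_integrable; first exact: segment_compact.
by apply: lap_within => y; exact: cP.
Qed.

Lemma mild_unique beta Phi Psi : mild_sol beta Phi -> mild_sol beta Psi ->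
  forall t x, 0 <= t -> Phi t x = Psi t x.
Proof.
move=> [cP [N1 gP] eP] [cQ [N2 gQ] eQ] t x t0.
have [A1 [A10 hA1]] := gP t t0; have [A2 [A20 hA2]] := gQ t t0.
apply: (@path_integral_unique R G Phi Psi beta t (A1 + A2) (maxn N1 N2)); last by rewrite t0 lexx.
- lra.
- by move=> y; exact: cP.
- by move=> y; exact: cQ.
- by move=> s y /andP[s0 _]; exact: eP.
- by move=> s y /andP[s0 _]; exact: eQ.
- by move=> s st; apply: growth_weak (hA1 s st); rewrite ?leq_maxl; lra.
- by move=> s st; apply: growth_weak (hA2 s st); rewrite ?leq_maxr; lra.
Qed.

Lemma mild_lin (a b : R) beta gamma Phi Psi : mild_sol beta Phi -> mild_sol gamma Psi ->
  mild_sol (fun t x => a * beta t x + b * gamma t x) (fun t x => a * Phi t x + b * Psi t x).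
Proof.
move=> [cP [N1 gP] eP] [cQ [N2 gQ] eQ]; split.
- move=> x T; apply: within_D; apply: within_M; try exact: within_cst.
    exact: cP.
  exact: cQ.
- exists (maxn N1 N2) => T T0.
  have [A1 [A10 hA1]] := gP T T0; have [A2 [A20 hA2]] := gQ T T0.
  exists (`|a| * A1 + `|b| * A2); split; first by rewrite addr_ge0 ?mulr_ge0.
  move=> t tT; apply: growthD; apply: growthZ.
    by apply: growth_weak (hA1 t tT); rewrite ?leq_maxl.
  by apply: growth_weak (hA2 t tT); rewrite ?leq_maxr.
- move=> t x t0.
  have iP := lap_integrable t x cP; have iQ := lap_integrable t x cQ.
  have cl Xi c : time_continuous Xi -> lebesgue_measure.-integrable `[0, t] (EFin \o (fun s => c * lap (Xi s) x)).
    move=> cX; apply: continuous_compact_integrable; first exact: segment_compact.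
    by apply: within_M; [exact: within_cst|apply: lap_within => y; exact: cX].
  have -> : \int[lebesgue_measure]_(s in `[0, t]) lap (fun x => a * Phi s x + b * Psi s x) x =
    \int[lebesgue_measure]_(s in `[0, t]) (a * lap (Phi s) x + b * lap (Psi s) x).
    by apply: eq_Rintegral => s _; rewrite lapD !lapZ.
  rewrite RintegralD//; [|exact: cl|exact: cl].
  rewrite !RintegralZl// eP// eQ//.
  set I := \int[_]_(_ in _) _; set J := \int[_]_(_ in _) _.
  by move: I J => I J; ring.
Qed.

Lemma eq_mild beta gamma Phi Psi : (forall t x, 0 <= t -> beta t x = gamma t x) ->
  Phi = Psi -> mild_sol beta Phi -> mild_sol gamma Psi.
Proof.
move=> bg <- [cP gP eP]; split=> // t x t0; rewrite -bg//; exact: eP.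
Qed.

Lemma within_shift s T (f : R -> R) : 0 <= s -> {within `[0, s + T], continuous f} ->
  {within `[0, T], continuous (fun t => f (s + t))}.
Proof.
move=> s0 /subspace_continuousP cf; apply/subspace_continuousP => t /=.
rewrite in_itv /= => /andP[t0 tT].
have /cf : `[0, s + T]%classic (s + t) by rewrite /= in_itv /= addr_ge0// lerD2l.
move=> /cvgrPdist_le h; apply/cvgrPdist_le => e e0.
have := h e e0; rewrite !near_withinE => hn.
have sh : (fun q : R => s + q) @ t --> s + t by apply: cvgD; [exact: cvg_cst|exact: cvg_id].
have hn' : \forall q \near t, `[0, s + T]%classic (s + q) -> `|f (s + t) - f (s + q)| <= e by exact: (sh _ hn).
apply: filterS hn' => q hq /=; rewrite in_itv /= => /andP[q0 qT]; apply: hq.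
by rewrite /= in_itv /= addr_ge0// lerD2l.
Qed.

(** Restarting at time [s] replaces the input by its increments after [s] plus the value reached at
    [s]: the pathwise form of the Markov property. *)
Lemma mild_shift beta Phi s : 0 <= s -> time_continuous beta -> mild_sol beta Phi ->
  mild_sol (fun t x => beta (s + t) x - beta s x + Phi s x) (fun t => Phi (s + t)).
Proof.
move=> s0 cb [cP [N gP] eP]; split.
- by move=> x T; apply: (within_shift s0 (f := fun q => Phi q x)); exact: cP.
- exists N => T T0; have [A [A0 hA]] := gP (s + T) (addr_ge0 s0 T0).
  exists A; split=> // t /andP[t0 tT]; apply: hA.
  by rewrite addr_ge0//= lerD2l.
move=> t x t0.
have := @approx_primitive R (fun t => Phi (s + t) x - beta (s + t) x)
  (fun t => - lap (Phi (s + t)) x) (fun t => -1 * lap (Phi (s + t)) x) [::] t 0.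
have c1 : {within `[0, t], continuous (fun t => Phi (s + t) x - beta (s + t) x)}.
  apply: within_B; first by apply: (within_shift s0 (f := fun q => Phi q x)); exact: cP.
  by apply: (within_shift s0 (f := fun q => beta q x)); exact: cb.
have c2 : {within `[0, t], continuous (fun t => lap (Phi (s + t)) x)}.
  by apply: (within_shift s0 (f := fun q => lap (Phi q) x)); apply: lap_within => y; exact: cP.
have i2 : lebesgue_measure.-integrable `[0, t] (EFin \o (fun q => lap (Phi (s + q)) x)).
  by apply: continuous_compact_integrable => //; exact: segment_compact.
move=> /(_ c1 (within_M (@within_cst R _ (-1)) c2)) h.
have {}h : `|Phi (s + t) x - beta (s + t) x - (Phi (s + 0) x - beta (s + 0) x) -
    \int[lebesgue_measure]_(s1 in `[0, t]) (-1 * lap (Phi (s + s1)) x)| <= 0 * t.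
  apply: h; last by rewrite t0 lexx.
  move=> q /andP[q0 qt] _; split; last by rewrite mulN1r subrr normr0.
  have sq : 0 < s + q by lra.
  have d1 := path_integral_heat cP eP x sq.
  have d2 : is_derive q 1 (fun q => s + q) (0 + 1) by exact: is_deriveD.
  have := @is_derive1_comp R (fun t => Phi t x - beta t x) (fun q => s + q) q _ _ d1 d2.
  by rewrite add0r mulr1.
move: h; rewrite mul0r normr_le0 addr0 RintegralZl//.
set I := \int[_]_(_ in _) _; move: I => I /eqP h; lra.
Qed.

Lemma src_sol_mild ms beta N : src_cvg ms beta N -> time_continuous beta ->
  mild_sol beta (src_sol (p := p) ms).
Proof.
move=> hms cb; split.
- by move=> x T; exact: (src_sol_within hp hms cb).
- exists (resp_exp hp N); exact: (src_sol_growth hp hms).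
- by move=> t x t0; exact: (src_sol_eq hp hms cb).
Qed.

(** An initial value is a path that jumps to [xi] at time 0 and stays there, so the construction for
    sources also yields the heat flow. *)
Definition init_src xi (n : nat) : source G := [seq ((0, y), xi y) | y <- gbox G n].

Lemma sum_pick (s : seq G) x (f : G -> R) : uniq s ->
  \sum_(y <- s) f y * (x == y)%:R = (x \in s)%:R * f x.
Proof.
move=> us; have [xs|xs] := boolP (x \in s).
  rewrite (perm_big _ (perm_to_rem xs)) /= big_cons eqxx mulr1 mul1r big_seq big1 ?addr0// => y.
  by rewrite (mem_rem_uniq _ us) inE => /andP[yx _]; rewrite eq_sym (negPf yx) mulr0.
rewrite mul0r big_seq big1// => y ys; case: eqP => [xy|_]; last by rewrite mulr0.
by rewrite xy ys in xs.
Qed.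

Lemma init_src_path xi n t x : 0 <= t ->
  src_path (init_src xi n) t x = (x \in gbox G n)%:R * xi x.
Proof.
move=> t0; rewrite /src_path big_map -sum_pick ?gbox_uniq//.
by apply: eq_bigr => y _; rewrite /heaviside /= t0 mulr1.
Qed.

Lemma init_src_resp xi n t x :
  src_resp (p := p) (init_src xi n) t x = \sum_(y <- gbox G n) p t x y * xi y.
Proof. by rewrite /src_resp big_map; apply: eq_bigr => y _; rewrite /= subr0 mulrC. Qed.

(** Outside the box of size [n] one more power of the bracket is worth a factor [1 / n]. Convergence
    at each vertex together with a growth bound thus becomes weighted uniform convergence with one
    more power. *)
Lemma growth_tail xi (A : R) N n x : 0 <= A -> (0 < n)%N -> `|xi x| <= A * gbr x ^+ N ->
  x \notin gbox G n -> `|xi x| <= A / n%:R * gbr x ^+ N.+1.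
Proof.
move=> A0 n0 hx; rewrite gboxE -ltNge => nx; apply: le_trans hx _.
rewrite exprS mulrA -[A / _ * _]mulrA [n%:R^-1 * _]mulrC ler_wpM2r ?exprn_ge0 ?(ltW (gbr_gt0 x))//.
by rewrite ler_peMr// ler_pdivlMr ?ltr0n// mul1r ltW.
Qed.

Lemma init_src_cvg xi A N : 0 <= A -> growth xi A N ->
  src_cvg (init_src xi) (fun _ => xi) N.+1.
Proof.
move=> A0 hA; split=> [n e /mapP[y _ ->]//|T e T0 e0].
have [n0 hn0] := exists_nat_gt (A / e); exists n0.+1 => n t n0n /andP[t0 _] x.
have np : (0 < n)%N by exact: leq_ltn_trans n0n.
rewrite init_src_path//; have [xn|xn] := boolP (x \in gbox G n).
  by rewrite mul1r subrr normr0 mulr_ge0 ?exprn_ge0 ?(ltW e0) ?(ltW (gbr_gt0 x)).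
rewrite mul0r sub0r normrN; apply: le_trans (growth_tail A0 np (hA x) xn) _.
rewrite ler_wpM2r ?exprn_ge0 ?(ltW (gbr_gt0 x))// ler_pdivrMr ?ltr0n//.
rewrite mulrC -ler_pdivrMr//; apply: ltW; apply: lt_le_trans hn0 _.
by rewrite ler_nat ltnW.
Qed.

Definition heat_sg t xi x : R := src_sol (p := p) (init_src xi) t x.

Definition poly xi := exists (A : R) (N : nat), 0 <= A /\ growth xi A N.

Lemma polyD xi eta : poly xi -> poly eta -> poly (fun x => xi x + eta x).
Proof.
move=> [A [N [A0 hA]]] [B [M [B0 hB]]]; exists (A + B), (maxn N M); split; first lra.
by apply: growthD; [apply: growth_weak hA|apply: growth_weak hB]; rewrite ?leq_maxl ?leq_maxr.
Qed.

Lemma polyZ c xi : poly xi -> poly (fun x => c * xi x).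
Proof.
move=> [A [N [A0 hA]]]; exists (`|c| * A), N; split; first exact: mulr_ge0.
exact: growthZ.
Qed.

Lemma poly_cst c : poly (fun _ => c).
Proof. by exists `|c|, 0%N; split=> // x; rewrite expr0 mulr1. Qed.

Lemma heat_sg_cvg t xi x : poly xi -> 0 <= t ->
  \sum_(y <- gbox G n) p t x y * xi y @[n --> \oo] --> heat_sg t xi x.
Proof.
move=> [A [N [A0 hA]]] t0; have := src_sol_cvg hp (init_src_cvg A0 hA) (x := x) t0.
by under eq_fun do rewrite init_src_resp.
Qed.

Lemma heat_sg_mild xi : poly xi -> mild_sol (fun _ => xi) (fun t => heat_sg t xi).
Proof.
move=> [A [N [A0 hA]]]; apply: src_sol_mild (init_src_cvg A0 hA) _.
by move=> x T; exact: within_cst.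
Qed.

Lemma loc_growth_poly beta t : 0 <= t -> loc_growth beta -> poly (beta t).
Proof.
move=> t0 [N /(_ t t0)[A [A0 hA]]]; exists A, N; split=> //; apply: hA.
by rewrite t0 lexx.
Qed.

Lemma heat_sg_poly t xi : 0 <= t -> poly xi -> poly (heat_sg t xi).
Proof. by move=> t0 /heat_sg_mild[_ h _]; exact: loc_growth_poly. Qed.

Lemma heat_sg_unique xi Phi : poly xi -> mild_sol (fun _ => xi) Phi ->
  forall t, 0 <= t -> Phi t = heat_sg t xi.
Proof.
move=> hx hP t t0; apply/funext => x; exact: mild_unique hP (heat_sg_mild hx) _ _ t0.
Qed.

Lemma mild0 beta Phi x : mild_sol beta Phi -> Phi 0 x = beta 0 x.
Proof. by move=> [_ _ ->//]; rewrite set_itv1 Rintegral_set1 subr0. Qed.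

Lemma heat_sg0 xi : poly xi -> heat_sg 0 xi = xi.
Proof. by move=> hx; apply/funext => x; rewrite (mild0 x (heat_sg_mild hx)). Qed.

(** Conservation of mass: the constant 1 is stationary and of polynomial growth, hence it is the
    only solution. Non-explosion rests on this. *)
Lemma heat_sg1 t : 0 <= t -> heat_sg t (fun _ => 1) = (fun _ => 1).
Proof.
move=> t0; apply/esym.
apply: (heat_sg_unique (poly_cst 1) _ t0 (Phi := fun _ _ => 1)); split.
- by move=> x T; exact: within_cst.
- exists 0%N => T _; exists 1; split=> // q _ x; rewrite normr1 mul1r; exact: gbr_pow_ge1.
- move=> q x q0; under eq_Rintegral do rewrite lap_cst.
  by rewrite Rintegral_cst// mul0r subr0.
Qed.

Lemma heat_sg_bound t xi x : poly xi -> 0 <= t ->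
  exists B : R, sum_le (fun y => `|p t x y * xi y|) B.
Proof.
move=> [A [N [A0 hA]]] t0.
have hx' : poly (fun y => `|xi y|) by exists A, N; split=> // y; rewrite normr_id.
have hc := heat_sg_cvg (x := x) hx' t0; exists (heat_sg t (fun y => `|xi y|) x) => s us.
have [n hn] : exists n, {subset s <= gbox G n}.
  elim: s us => [|a s IH] /= => [_|/andP[_ us]]; first by exists 0%N.
  have [n hn] := IH us; have [k hk] := exists_nat_gt (gbr a).
  exists (maxn n k) => z; rewrite inE => /predU1P[->|/hn].
    by rewrite gboxE (le_trans (ltW hk))// ler_nat leq_maxr.
  by apply: box_sub; rewrite leq_maxl.
pose u k := \sum_(y <- gbox G k) p t x y * `|xi y|.
have -> : \sum_(y <- s) `|p t x y * xi y| = \sum_(y <- s) p t x y * `|xi y|.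
  by apply: eq_bigr => y _; rewrite normrM ger0_norm ?(hk_ge0 hp).
have u0 (y : G) : 0 <= p t x y * `|xi y| by rewrite mulr_ge0 ?(hk_ge0 hp).
apply: (@le_trans _ _ (u n)); first exact: sum_sub_le.
rewrite -(cvg_lim _ hc)//; apply: limr_ge; first by apply/cvg_ex; eexists; exact: hc.
near=> k; apply: sum_sub_le => //; first exact: gbox_uniq.
by apply: box_sub; near: k; exists n.
Unshelve. all: end_near. Qed.

End mild.

(** * The lattice *)

Section lattice.
Context {d : nat} {R : realType}.
Implicit Types (x y z : Zd d).

Lemma bracket_sq x : bracket R x ^+ 2 = 1 + \sum_(i < d) (x 0 i)%:~R ^+ 2.
Proof. by rewrite sqr_sqrtr// addr_ge0// sumr_ge0// => i _; rewrite sqr_ge0. Qed.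

Lemma bracket_ge0 x : 0 <= bracket R x.
Proof. exact: sqrtr_ge0. Qed.

Lemma bracket_ge1 x : 1 <= bracket R x.
Proof.
rewrite -(@ler_sqr R) ?nnegrE ?bracket_ge0// bracket_sq expr1n lerDl.
by apply: sumr_ge0 => i _; rewrite sqr_ge0.
Qed.

Lemma coord_le_bracket x i : `|(x 0 i)%:~R| <= bracket R x.
Proof.
rewrite -(@ler_sqr R) ?nnegrE ?bracket_ge0// real_normK ?num_real// bracket_sq.
rewrite (bigD1 i) //= addrCA lerDl addr_ge0// sumr_ge0// => j _; exact: sqr_ge0.
Qed.

Lemma adj_sum x y : adj x y -> \sum_(i < d) `|(x 0 i)%:~R - (y 0 i)%:~R| = 1 :> R.
Proof.
move=> /eqP/(congr1 (fun k : int => k%:~R : R)); rewrite rmorph_sum /= => h.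
transitivity (1%:~R : R) => //; rewrite -h.
by apply: eq_bigr => i _; rewrite -intrB intr_norm.
Qed.

(** Multiplied by the sum of the brackets, the difference becomes a difference of squares, which can
    be estimated coordinate by coordinate. *)
Lemma bracket_lip x y : adj x y -> `|bracket R x - bracket R y| <= 1.
Proof.
move=> xy; have bx := bracket_ge1 x; have by_ := bracket_ge1 y.
have p0 : 0 < bracket R x + bracket R y by lra.
rewrite -(ler_pM2r p0) mul1r -{1}(gtr0_norm p0) -normrM.
have -> : (bracket R x - bracket R y) * (bracket R x + bracket R y) =
  bracket R x ^+ 2 - bracket R y ^+ 2 by ring.
rewrite !bracket_sq opprD addrACA subrr add0r -sumrB.
apply: le_trans (ler_norm_sum _ _ _) _.
apply: (@le_trans _ _ ((\sum_(i < d) `|(x 0 i)%:~R - (y 0 i)%:~R|) * (bracket R x + bracket R y))); last first.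
  by rewrite adj_sum// mul1r.
rewrite mulr_suml; apply: ler_sum => i _.
rewrite subr_sqr normrM ler_wpM2l//; apply: le_trans (ler_normD _ _) _.
by apply: lerD; exact: coord_le_bracket.
Qed.

(** Functions into an ordinal enumerate the points with coordinates between [-K] and [K], so that
    sums of products over a cube factor through the coordinates. *)
Definition cube (K : nat) (f : {ffun 'I_d -> 'I_(2 * K).+1}) : Zd d :=
  \row_i ((f i : nat)%:Z - K%:Z).

Lemma cube_inj K : injective (@cube K).
Proof.
move=> f g /rowP fg; apply/ffunP => i; apply/val_inj; have := fg i.
by rewrite !mxE => /addIr[].
Qed.

Lemma cubeP (K : nat) x : (forall i, `|x 0 i| <= K%:Z) -> exists f, x = @cube K f.
Proof.
move=> h.
have hi i : (`|(x 0 i + K%:Z)%R| < (2 * K).+1)%N.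
  have := h i; rewrite ler_norml => /andP[]; lia.
exists [ffun i => Ordinal (hi i)]; apply/rowP => i; rewrite !mxE ffunE /=.
have := h i; rewrite ler_norml => /andP[]; lia.
Qed.

Lemma coord_le_nat x (n : nat) i : bracket R x <= n%:R -> `|x 0 i| <= n%:Z.
Proof.
move=> h; have := le_trans (coord_le_bracket x i) h.
by rewrite -intr_norm -[n%:R]/(n%:Z%:~R) ler_int.
Qed.

Lemma finite_ball (n : nat) : finite_set [set x : Zd d | bracket R x <= n%:R].
Proof.
apply: (@sub_finite_set _ _ (range (@cube n))).
  by move=> x /= h; have [f ->] := cubeP (fun i => coord_le_nat i h); exists f.
exact: finite_image.
Qed.

(** The bound telescopes: its consecutive values differ by [4 / ((n + 1) * (n + 2))], which
    dominates the new term. *)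
Lemma sum_inv_sq_le (n : nat) :
  \sum_(0 <= k < n) (1 + (k%:R : R) ^+ 2)^-1 <= 4 * (1 - n.+1%:R^-1).
Proof.
elim: n => [|n IH]; first by rewrite big_geq// invr1 subrr mulr0.
rewrite big_nat_recr //=; apply: le_trans (lerD IH (lexx _)) _.
have e1 : n.+1%:R = n%:R + 1 :> R by rewrite natr1.
have e2 : n.+2%:R = n%:R + 1 + 1 :> R by rewrite !natr1.
rewrite e2 e1; have : 0 <= n%:R :> R by [].
move: (n%:R : R) => t t0.
have -> : 4 * (1 - (t + 1 + 1)^-1) = 4 * (1 - (t + 1)^-1) + 4 / ((t + 1) * (t + 1 + 1)).
  by field; rewrite !gt_eqF; lra.
rewrite lerD2l -[leLHS]mul1r.
have a0 : 0 < 1 + t ^+ 2 by have := sqr_ge0 t; lra.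
have b0 : 0 < (t + 1) * (t + 1 + 1) by apply: mulr_gt0; lra.
rewrite ler_pdivrMr// mulrAC ler_pdivlMr//.
by have := sqr_ge0 (t - 2^-1); nra.
Qed.

Lemma sum_cube_axis_le (K : nat) :
  \sum_(j < (2 * K).+1) (1 + ((j : nat)%:Z - K%:Z)%:~R ^+ 2 : R)^-1 <= 8.
Proof.
rewrite -(big_mkord xpredT (fun j : nat => (1 + (j%:Z - K%:Z)%:~R ^+ 2 : R)^-1)).
rewrite (@big_cat_nat _ _ _ K) //=; last by lia.
have h1 : \sum_(0 <= j < K) (1 + (j%:Z - K%:Z)%:~R ^+ 2 : R)^-1 <= 4.
  rewrite big_nat_rev /= add0n.
  apply: (@le_trans _ _ (\sum_(0 <= k < K) (1 + (k%:R : R) ^+ 2)^-1)).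
    rewrite big_nat [leRHS]big_nat; apply: ler_sum => j /andP[_ jK].
    have -> : ((K - j.+1)%N%:Z - K%:Z)%:~R = - (j%:R + 1) :> R.
      rewrite natr1 -[j.+1%:R]/(j.+1%:Z%:~R) -rmorphN; congr (_%:~R); lia.
    have j0 : 0 <= j%:R :> R by [].
    rewrite sqrrN lef_pV2 ?posrE; last 2 first.
    - by have := sqr_ge0 (j%:R + 1 : R); lra.
    - by have := sqr_ge0 (j%:R : R); lra.
    by rewrite lerD2l ler_sqr ?nnegrE; lra.
  apply: le_trans (sum_inv_sq_le K) _.
  by rewrite -[leRHS]mulr1 ler_wpM2l// gerBl.
have h2 : \sum_(K <= j < (2 * K).+1) (1 + (j%:Z - K%:Z)%:~R ^+ 2 : R)^-1 <= 4.
  rewrite -{1}[K]add0n big_addn.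
  apply: (@le_trans _ _ (\sum_(0 <= k < (2 * K).+1 - K) (1 + (k%:R : R) ^+ 2)^-1)).
    apply: ler_sum => j _.
    have -> : ((j + K)%N%:Z - K%:Z)%:~R = j%:R :> R.
      by rewrite -[j%:R]/(j%:Z%:~R); congr (_%:~R); lia.
    exact: lexx.
  apply: le_trans (sum_inv_sq_le _) _.
  by rewrite -[leRHS]mulr1 ler_wpM2l// gerBl.
lra.
Qed.

Lemma seq_in_cube (s : seq (Zd d)) : exists K : nat, forall x, x \in s ->
  exists f, x = @cube K f.
Proof.
have [K hK] : exists K : nat, forall x, x \in s -> bracket R x <= K%:R.
  elim: s => [|a s [K hK]]; first by exists 0%N.
  have [k hk] := exists_nat_gt (bracket R a).
  exists (maxn K k) => x; rewrite inE => /predU1P[->|/hK h].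
    by rewrite (le_trans (ltW hk))// ler_nat leq_maxr.
  by rewrite (le_trans h)// ler_nat leq_maxl.
by exists K => x xs; apply: cubeP => i; apply: coord_le_nat; exact: hK.
Qed.

Lemma sum_seq_le_cube (K : nat) (s : seq (Zd d)) (F : Zd d -> R) :
  (forall x, 0 <= F x) -> uniq s -> (forall x, x \in s -> exists f, x = @cube K f) ->
  \sum_(x <- s) F x <= \sum_(f : {ffun 'I_d -> 'I_(2 * K).+1}) F (cube f).
Proof.
move=> F0 us hs; rewrite -(big_map (@cube K) xpredT F).
set e := map _ _.
have ue : uniq e by rewrite map_inj_uniq ?index_enum_uniq//; exact: cube_inj.
have se : {subset s <= e}.
  by move=> x /hs[f ->]; rewrite map_f// mem_index_enum.
elim: s e us ue se {hs} => [|a s IH] e /=; first by rewrite big_nil sumr_ge0.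
move=> /andP[as_ us] ue se.
have ae : a \in e by apply: se; rewrite mem_head.
rewrite big_cons (perm_big _ (perm_to_rem ae)) /= big_cons lerD2l.
apply: IH => //; first exact: rem_uniq.
move=> x xs; rewrite (mem_rem_uniq _ ue) inE se ?inE ?xs ?orbT// andbT.
by apply: contraNneq as_ => <-.
Qed.

(** The squared bracket is at least [1 + x_i ^+ 2] for each coordinate, so its [d]-th power
    dominates the product of these factors; the sum over a cube is then a product of [d]
    one-dimensional sums, each at most 8. *)
Lemma bracket_summable (s : seq (Zd d)) : uniq s ->
  \sum_(x <- s) (bracket R x ^+ (2 * d))^-1 <= 8 ^+ d.
Proof.
move=> us; have [K hK] := seq_in_cube s.
apply: le_trans (sum_seq_le_cube _ us hK) _.
  by move=> x; rewrite invr_ge0 exprn_ge0// bracket_ge0.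
pose a (j : 'I_(2 * K).+1) : R := (1 + ((j : nat)%:Z - K%:Z)%:~R ^+ 2)^-1.
have a0 j : 0 < 1 + ((j : nat)%:Z - K%:Z)%:~R ^+ 2 :> R.
  by rewrite ltr_wpDr// sqr_ge0.
apply: (@le_trans _ _ (\sum_(f : {ffun 'I_d -> 'I_(2 * K).+1}) \prod_(i < d) a (f i))).
  apply: ler_sum => f _; rewrite exprM -[in X in _ ^+ X](card_ord d) -prodr_const -prodfV.
  apply: ler_prod => i _; rewrite invr_ge0 sqr_ge0 /= /a lef_pV2 ?posrE//; last first.
    by rewrite exprn_gt0// (lt_le_trans ltr01)// bracket_ge1.
  rewrite bracket_sq lerD2l (bigD1 i) //= mxE lerDl sumr_ge0// => j _; exact: sqr_ge0.
rewrite -(bigA_distr_bigA (fun _ : 'I_d => a)) /=.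
apply: (@le_trans _ _ (\prod_(i < d) 8)); last by rewrite prodr_const card_ord.
apply: ler_prod => i _; rewrite sum_cube_axis_le andbT.
by apply: sumr_ge0 => j _; rewrite invr_ge0 ltW.
Qed.

End lattice.

(** * The infinite cluster as a weighted graph *)

Section vertex_graph.
Context {d : nat} {R : realType} (w : conductances d R).

(** With [e] arbitrary and [r] depending on [e] this says that the conductances are of smaller order
    than the squared distance; the radius [r] absorbs finitely many exceptional sites. *)
Definition subquadratic := forall e : R, 0 < e -> exists2 r : R, 1 <= r &
  forall x y : Zd d, w x y <= e * (r + bracket R x) ^+ 2.

Hypothesis w_sub : subquadratic.

Local Notation V := (vertex w).
Implicit Types x y : V.

Lemma finite_adj (x : Zd d) : finite_set [set y : Zd d | adj x y].
Proof.
have [n hn] := exists_nat_gt (bracket R x + 1).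
apply: sub_finite_set (finite_ball (d := d) (R := R) n) => y /= /(@bracket_lip _ R).
by rewrite ler_norml => /andP[]; lra.
Qed.

Lemma finite_nbr x : finite_set (nbr x).
Proof.
have -> : nbr x = (@set_val _ (cluster w)) @^-1` [set y | adj (\val x) y] by [].
apply: finite_preimage; last exact: finite_adj.
by move=> a b _ _; exact: val_inj.
Qed.

Lemma finite_vertex_ball (n : nat) : finite_set [set x : V | bracket R (\val x) <= n%:R].
Proof.
have -> : [set x : V | bracket R (\val x) <= n%:R] =
   (@set_val _ (cluster w)) @^-1` [set y | bracket R y <= n%:R] by [].
apply: finite_preimage; last exact: finite_ball.
by move=> a b _ _; exact: val_inj.
Qed.

Definition nbr_seq x : seq V := finmap.enum_fset (fset_set (nbr x)).
Definition ball_seq (n : nat) : seq V :=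
  finmap.enum_fset (fset_set [set x : V | bracket R (\val x) <= n%:R]).

Lemma mem_nbr_seq x y : (y \in nbr_seq x) = adj (\val x) (\val y).
Proof.
have := in_fset_set (finite_nbr x) y; rewrite /nbr_seq => ->.
by apply/idP/idP; rewrite inE.
Qed.

Lemma mem_ball_seq (n : nat) x : (x \in ball_seq n) = (bracket R (\val x) <= n%:R).
Proof.
have := in_fset_set (finite_vertex_ball n) x; rewrite /ball_seq => ->.
by apply/idP/idP; rewrite inE.
Qed.

Lemma size_nbr_seq : exists K : nat, forall x, (size (nbr_seq x) <= K)%N.
Proof.
pose E : seq (Zd d) := finmap.enum_fset (fset_set [set y : Zd d | adj 0 y]).
exists (size E) => x.
rewrite -(size_map (fun y : V => \val y - \val x)); apply: uniq_leq_size.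
  by rewrite map_inj_uniq ?finmap.fset_uniq// => a b /addIr/val_inj.
move=> z /mapP[y]; rewrite mem_nbr_seq => xy ->.
have := in_fset_set (finite_adj 0) (\val y - \val x); rewrite /E => ->.
rewrite inE /= /adj; move: xy; rewrite /adj; congr (_ == _).
apply: eq_bigr => i _; rewrite !mxE sub0r opprB.
by [].
Qed.

Lemma vertex_rate_sub e : 0 < e -> exists2 r : R, 1 <= r &
  forall x, \sum_(y <- nbr_seq x) w (\val x) (\val y) <= e * (r + bracket R (\val x)) ^+ 2.
Proof.
move=> e0; have [K hK] := size_nbr_seq.
have K0 : 0 < K.+1%:R :> R by rewrite ltr0n.
have [r r1 hr] := w_sub (divr_gt0 e0 K0); exists r => // x.
set B := (r + _) ^+ 2; have B0 : 0 <= B by exact: sqr_ge0.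
apply: (@le_trans _ _ (\sum_(y <- nbr_seq x) (e / K.+1%:R * B))).
  by apply: ler_sum => y _; exact: hr.
rewrite big_const_seq count_predT iter_addr_0 -[_ *+ size _]mulr_natr.
rewrite mulrAC ler_wpM2r// mulrAC -mulrA ler_piMr ?(ltW e0)//.
by rewrite ler_pdivrMr// mul1r ler_nat leqW.
Qed.

Lemma vertex_summable : exists (m : nat) (K : R), forall s : seq V, uniq s ->
    \sum_(x <- s) (bracket R (\val x) ^+ m)^-1 <= K.
Proof.
exists (2 * d)%N, (8 ^+ d) => s us.
rewrite -(big_map (fun x : V => \val x) xpredT (fun z => (bracket R z ^+ (2 * d))^-1)).
by apply: bracket_summable; rewrite map_inj_uniq//; exact: val_inj.
Qed.

Definition vgraph : wgraph R := @WGraph R V (fun x y => w (\val x) (\val y)) nbr_seq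
  (fun x => bracket R (\val x)) ball_seq
  (fun x y => cond_ge0 w _ _) (fun x y => cond_sym w _ _)
  (fun x y h => cond_nn w (eq_ind _ (fun b : bool => ~~ b) h _ (mem_nbr_seq x y)))
  (fun x => finmap.fset_uniq _) (fun x => bracket_ge1 _)
  (fun x y h => bracket_lip (eq_ind _ (fun b : bool => b) h _ (mem_nbr_seq x y)))
  (fun n => finmap.fset_uniq _) mem_ball_seq vertex_rate_sub vertex_summable.

Lemma laplacian_lap (u : V -> R) x : laplacian (u : V -> R^o) x = @lap R vgraph u x.
Proof. by rewrite /laplacian fsbig_finite//; exact: finite_nbr. Qed.

Lemma total_rateE x : total_rate x = @rate R vgraph x.
Proof. by rewrite /total_rate fsbig_finite//; exact: finite_nbr. Qed.

End vertex_graph.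

(** * The random walk *)

Section measure_unique.
Local Open Scope ereal_scope.
Context {R : realType}.

(** Rays form the generating family that fits the jump chain, whose law is specified on the events
    [s i < rw_hold i o]. *)
Lemma ray_measure_unique (m1 m2 : {measure set R -> \bar R}) :
  (forall b : R, m1 `]b, +oo[%classic = m2 `]b, +oo[%classic) -> m1 setT < +oo ->
  forall B : set R, measurable B -> m1 B = m2 B.
Proof.
move=> h m1oo B mB.
pose g (n : nat) : set R := `](- n%:R)%R, +oo[%classic.
have mE : @measurable _ R = <<s @RGenOInfty.G R >> by exact: RGenOInfty.measurableE.
apply: (measure_unique (@RGenOInfty.G R) g mE) => //.
- move=> _ _ [a ->] [b ->]; exists (Num.max a b); apply/seteqP; split=> x /=;
    rewrite !in_itv /= !andbT gt_max.
    by move=> [-> ->].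
  by move=> /andP[].
- by move=> n; exists (- n%:R)%R.
- apply/seteqP; split=> // x _; have [n hn] := exists_nat_gt (- x).
  by exists n => //; rewrite /g /= in_itv /= andbT ltrNl.
- by move=> _ [b ->].
- move=> n; apply: le_lt_trans m1oo; apply: le_measure; rewrite ?inE//=.
  exact: measurable_itv.
Qed.

Lemma rect_measure_unique d1 d2 (T1 : measurableType d1) (T2 : measurableType d2)
  (m1 m2 : {measure set (T1 * T2)%type -> \bar R}) :
  (forall A B, measurable A -> measurable B -> m1 (A `*` B) = m2 (A `*` B)) ->
  m1 setT < +oo -> forall Z, measurable Z -> m1 Z = m2 Z.
Proof.
move=> h m1oo Z mZ.
apply: (measure_unique _ (fun _ => setT) (measurable_prod_measurableType T1 T2)) => //.
- move=> _ _ [A mA [B mB <-]] [A' mA' [B' mB' <-]].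
  exists (A `&` A'); first exact: measurableI.
  by exists (B `&` B'); [exact: measurableI|rewrite setXI].
- by move=> n; exists setT => //; exists setT => //; rewrite setXTT.
- by rewrite bigcup_const//; exists 0%N.
- by move=> _ [A mA [B mB <-]]; exact: h.
Qed.

End measure_unique.

Section restricted_law.
Local Open Scope ereal_scope.
Context {R : realType} {d d'} {T : measurableType d} {U : measurableType d'}.

(** The unnormalised law of [f] on the event [H], so that conditioning needs no division. *)
Definition restr_law (mu : {measure set T -> \bar R}) (f : T -> U) (H : set T)
  (mf : measurable_fun setT f) (mH : measurable H) (A : set U) : \bar R :=
  mu (f @^-1` A `&` H).

Variables (mu : probability T R) (f : T -> U) (H : set T).
Variables (mf : measurable_fun setT f) (mH : measurable H).

Let restr_law0 : restr_law mu mf mH set0 = 0.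
Proof. by rewrite /restr_law preimage_set0 set0I measure0. Qed.

Let restr_law_ge0 A : 0 <= restr_law mu mf mH A. Proof. exact: measure_ge0. Qed.

Let restr_law_additive : semi_sigma_additive (restr_law mu mf mH).
Proof.
exact: (@measure_semi_sigma_additive _ _ _ (pushforward (mrestr mu mH) f : {measure set U -> \bar R})).
Qed.

HB.instance Definition _ := isMeasure.Build _ _ _ (restr_law mu mf mH)
  restr_law0 restr_law_ge0 restr_law_additive.

Let restr_law_fin : fin_num_fun (restr_law mu mf mH).
Proof.
move=> A mA; rewrite fin_num_measure//; apply: measurableI => //.
by rewrite -[X in measurable X]setTI; exact: mf.
Qed.

HB.instance Definition _ := Measure_isFinite.Build _ _ _ (restr_law mu mf mH) restr_law_fin.

End restricted_law.

Section law_unique.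
Local Open Scope ereal_scope.
Context {R : realType} {d} {T : measurableType d} (mu : probability T R).
Variables (f g : T -> R) (mf : measurable_fun setT f) (mg : measurable_fun setT g).

(** Proportionality on rectangles whose second side is a ray extends to all Borel sets of pairs, in
    particular to events about the sum of [f] and [g]. *)
Lemma law2_unique (H H' : set T) (r : R) : measurable H -> measurable H' -> (0 <= r)%R ->
  (forall A (b : R), measurable A -> mu (f @^-1` A `&` g @^-1` `]b, +oo[ `&` H) =
     r%:E * mu (f @^-1` A `&` g @^-1` `]b, +oo[ `&` H')) ->
  forall Z : set (R * R), measurable Z ->
    mu ((fun o => (f o, g o)) @^-1` Z `&` H) = r%:E * mu ((fun o => (f o, g o)) @^-1` Z `&` H').
Proof.
move=> mH mH' r0 h Z mZ.
have mfg : measurable_fun setT (fun o => (f o, g o)) by exact: measurable_fun_pair.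
pose r' := NngNum r0.
pose m1 : {measure set (R * R) -> \bar R} := restr_law mu mfg mH.
pose m2 : {measure set (R * R) -> \bar R} := mscale r' (restr_law mu mfg mH').
have m1oo : m1 setT < +oo.
  by rewrite ltey_eq; apply/orP; left; apply: fin_num_measure.
apply: (@rect_measure_unique R _ _ _ _ m1 m2) => // A B mA mB.
have mAT : measurable (f @^-1` A) by rewrite -[X in measurable X]setTI; exact: mf.
pose n1 : {measure set R -> \bar R} := restr_law mu mg (measurableI _ _ mAT mH).
pose n2 : {measure set R -> \bar R} := mscale r' (restr_law mu mg (measurableI _ _ mAT mH')).
have n1oo : n1 setT < +oo.
  by rewrite ltey_eq; apply/orP; left; apply: fin_num_measure.
have := @ray_measure_unique R n1 n2 _ n1oo B mB; rewrite /n1 /n2 /m1 /m2 /= /mscale /restr_law /=.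
have E K : (fun o => (f o, g o)) @^-1` (A `*` B) `&` K = g @^-1` B `&` (f @^-1` A `&` K).
  by apply/seteqP; split=> o /=; [case=> -[]|case=> ? []].
rewrite !E; apply => b.
by have := h A b mA; rewrite !setIA ![g @^-1` _ `&` _]setIC.
Qed.

End law_unique.

Section jump_chain.
Local Open Scope ereal_scope.
Context {d : nat} {R : realType} {w : conductances d R} (X : vsrw w) (x0 : vertex w).
Local Notation V := (vertex w).
Local Notation law := (rw_law X x0).
Local Notation J n := (@jump_time d R w X n).
Local Notation H n := (@rw_hold d R w X n).
Local Notation Y n := (@rw_jump d R w X n).
Implicit Types (y : nat -> V) (s : nat -> R) (A : set R) (t b : R) (n m k : nat).

Lemma jump_time0 o : J 0%N o = 0%R. Proof. by rewrite /jump_time big_ord0. Qed.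

Lemma jump_timeS n o : J n.+1 o = (J n o + H n o)%R.
Proof. by rewrite /jump_time big_ord_recr. Qed.

Lemma jump_time_ge0 n o : (0 <= J n o)%R.
Proof. by apply: sumr_ge0 => i _; apply: ltW; exact: rw_hold_gt0. Qed.

Lemma jump_time_homo n m o : (n <= m)%N -> (J n o <= J m o)%R.
Proof.
move=> /subnK <-; elim: (m - n)%N => //= k IH.
by rewrite addSn jump_timeS (le_trans IH)// lerDl ltW// rw_hold_gt0.
Qed.

Lemma measurable_jump_time n : measurable_fun setT (J n).
Proof.
elim: n => [|n IH].
  by rewrite (_ : J 0%N = cst 0%R); [exact: measurable_cst|apply/funext => o; exact: jump_time0].
rewrite (_ : J n.+1 = (J n \+ H n)%R); last by apply/funext => o; exact: jump_timeS.
by apply: measurable_funD => //; exact: rw_hold_measurable.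
Qed.

Definition path_event y n : set (rw_space X) := [set o | forall i, (i <= n)%N -> Y i o = y i].

Definition hold_event k n s : set (rw_space X) :=
  [set o | forall i, (k <= i)%N -> (i <= n)%N -> (s i < H i o)%R].

Lemma measurable_finite_event (P : nat -> set (rw_space X)) (Q : pred nat) n :
  (forall i, measurable (P i)) -> measurable [set o | forall i, Q i -> (i <= n)%N -> P i o].
Proof.
move=> mP; elim: n => [|n IH].
  have [q0|q0] := boolP (Q 0%N).
    rewrite (_ : [set _ | _] = P 0%N)//; apply/seteqP; split=> o /=.
      by apply.
    by move=> po i _; rewrite leqn0 => /eqP ->.
  rewrite (_ : [set _ | _] = setT)//; apply/seteqP; split=> o //= _ i qi.
  by rewrite leqn0 => /eqP i0; rewrite i0 (negPf q0) in qi.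
have [q0|q0] := boolP (Q n.+1).
  rewrite (_ : [set _ | _] = [set o | forall i, Q i -> (i <= n)%N -> P i o] `&` P n.+1).
    exact: measurableI.
  apply/seteqP; split=> o /=.
    by move=> h; split; [move=> i qi il; apply: h => //; exact: leqW|exact: h].
  by move=> [h1 h2] i qi; rewrite leq_eqVlt ltnS => /predU1P[->//|]; exact: h1.
rewrite (_ : [set _ | _] = [set o | forall i, Q i -> (i <= n)%N -> P i o])//.
apply/seteqP; split=> o /= h i qi il; first by apply: h => //; exact: leqW.
by move: il; rewrite leq_eqVlt ltnS => /predU1P[i0|]; [rewrite i0 (negPf q0) in qi|exact: h].
Qed.

Lemma measurable_jump n (v : V) : measurable (Y n @^-1` [set v]).
Proof. exact: rw_jump_measurable. Qed.

Lemma measurable_path_event y n : measurable (path_event y n).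
Proof.
rewrite (_ : path_event y n = [set o | forall i, xpredT i -> (i <= n)%N -> (Y i @^-1` [set y i]) o]).
  by apply: measurable_finite_event => i; exact: measurable_jump.
by apply/seteqP; split=> o h i /=; [move=> _; exact: h|exact: h].
Qed.

Lemma measurable_hold_gt n b : measurable (H n @^-1` `]b, +oo[).
Proof. by rewrite -[X in measurable X]setTI; apply: rw_hold_measurable => //; exact: measurable_itv. Qed.

Lemma measurable_hold_event k n s : measurable (hold_event k n s).
Proof.
rewrite (_ : hold_event k n s =
    [set o | forall i, (fun i => (k <= i)%N) i -> (i <= n)%N -> (H i @^-1` `]s i, +oo[) o]).
  by apply: measurable_finite_event => i; exact: measurable_hold_gt.
apply/seteqP; split=> o h i ki il /=.
  by rewrite in_itv /= andbT; exact: h.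
by have := h i ki il; rewrite /= in_itv /= andbT.
Qed.

Definition path_weight y n : R := ((y 0%N == x0)%:R *
     \prod_(i < n) (w (\val (y i)) (\val (y i.+1)) / total_rate (y i)))%R.

Lemma law_cylinder y n s : (forall i, (0 <= s i)%R) ->
  law (path_event y n `&` hold_event 0 n s) =
  (path_weight y n * \prod_(0 <= i < n.+1) expR (- (total_rate (y i) * s i)))%:E.
Proof.
move=> s0; rewrite big_mkord /path_weight -(@rw_lawE d R w X x0 n y s s0); congr (law _).
apply/seteqP; split=> o /=.
  by move=> [h1 h2] i il; split; [exact: h1|exact: h2].
by move=> h; split=> i; [move=> il; case: (h i il)|move=> _ il; case: (h i il)].
Qed.

Lemma hold_event0 k n (P : set (rw_space X)) : P `&` hold_event k n (fun=> 0%R) = P.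
Proof. by apply/seteqP; split=> o /=; [case|move=> Po; split=> // i _ _; exact: rw_hold_gt0]. Qed.

Lemma law_path y n : law (path_event y n) = (path_weight y n)%:E.
Proof.
rewrite -(hold_event0 0 n (path_event y n)) law_cylinder// big1 ?mulr1// => i _.
by rewrite mulr0 oppr0 expR0.
Qed.

Lemma hold_event_split k n s b (P : set (rw_space X)) : (k <= n)%N ->
  H k @^-1` `]b, +oo[ `&` (P `&` hold_event k.+1 n s) =
  P `&` hold_event k n (fun i => if i == k then Num.max 0 b else s i)%R.
Proof.
move=> kn; apply/seteqP; split=> o /=.
  rewrite in_itv /= andbT => -[bH [Po h]]; split=> // i ki il.
  case: eqP => [->|/eqP ik]; first by rewrite gt_max rw_hold_gt0.
  by apply: h => //; rewrite ltn_neqAle eq_sym ik.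
move=> [Po h]; split; last split=> //.
  by have := h k (leqnn _) kn; rewrite eqxx in_itv /= andbT gt_max => /andP[].
move=> i ki il; have := h i (ltnW ki) il.
by rewrite gtn_eqF.
Qed.

(** Induction on [k] converts rays for individual holding times into Borel sets for the jump time:
    [J k.+1] is the sum of [J k] and holding time [k], and rays of the latter are covered by the
    case [k] with one threshold changed. *)
Lemma law_hold_indep y n k A s : (k <= n.+1)%N -> measurable A -> (forall i, (0 <= s i)%R) ->
  law (J k @^-1` A `&` (path_event y n `&` hold_event k n s)) =
  (\prod_(k <= i < n.+1) expR (- (total_rate (y i) * s i)))%:E *
  law (J k @^-1` A `&` path_event y n).
Proof.
elim: k A s => [|k IH] A s kn mA s0.
  have [A0|A0] := pselect (A 0%R).
    have -> : J 0%N @^-1` A = setT by apply/seteqP; split=> o //= _; rewrite jump_time0.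
    by rewrite !setTI law_cylinder// law_path -EFinM mulrC.
  have -> : J 0%N @^-1` A = set0 by apply/seteqP; split=> o //=; rewrite jump_time0.
  by rewrite !set0I measure0 mule0.
have mJ := measurable_jump_time k; have mH := rw_hold_measurable (v := X) k.
have mE1 := measurableI _ _ (measurable_path_event y n) (measurable_hold_event k.+1 n s).
have mE2 := measurable_path_event y n.
pose Z : set (R * R) := (fun z => z.1 + z.2)%R @^-1` A.
have mZ : measurable Z.
  rewrite -[X in measurable X]setTI /Z.
  have : measurable_fun setT (fun z : R * R => z.1 + z.2)%R.
    by apply: measurable_funD; [exact: measurable_fst|exact: measurable_snd].
  by apply.
have JE K : J k.+1 @^-1` A `&` K = (fun o => (J k o, H k o)) @^-1` Z `&` K.
  by congr (_ `&` K); apply/seteqP; split=> o; rewrite /Z /= jump_timeS.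
rewrite !JE; apply: law2_unique => //.
  by apply: prodr_ge0 => i _; exact: expR_ge0.
move=> A' b mA'.
(* Thresholds have to be nonnegative; replacing a negative [b] by 0 changes nothing because holding
   times are positive. *)
have b0 : (0 <= Num.max 0 b)%R by rewrite le_max lexx.
rewrite -!setIA hold_event_split//.
have -> : H k @^-1` `]b, +oo[ `&` path_event y n =
    path_event y n `&` hold_event k n (fun i => if i == k then Num.max 0 b else 0)%R.
  by rewrite -(hold_event0 k.+1 n (path_event y n)) hold_event_split// hold_event0.
have kn' : (k <= n.+1)%N by exact: ltnW.
rewrite IH//; last by move=> i; case: ifP.
rewrite [in RHS]IH//; last by move=> i; case: ifP.
rewrite muleA -EFinM; congr (_%:E * _).
rewrite !(big_ltn kn) eqxx [X in (_ * (_ * X))%R]big_nat_cond [X in (_ * (_ * X))%R]big1; last first.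
  move=> i /andP[/andP[ki _] _]; rewrite gtn_eqF//.
  by rewrite mulr0 oppr0 expR0.
rewrite mulr1 mulrC; congr (_ * _)%R; rewrite [LHS]big_nat_cond [RHS]big_nat_cond; apply: eq_bigr => i /andP[/andP[ki _] _].
by rewrite gtn_eqF.
Qed.

(** Given the path, the holding times up to [n] carry no information about the next jump; the
    induction is that of [law_hold_indep]. *)
Lemma law_next_jump_aux y n k A s : (k <= n.+1)%N -> measurable A -> (forall i, (0 <= s i)%R) ->
  law (J k @^-1` A `&` (path_event y n.+1 `&` hold_event k n s)) =
  (w (\val (y n)) (\val (y n.+1)) / total_rate (y n))%:E *
  law (J k @^-1` A `&` (path_event y n `&` hold_event k n s)).
Proof.
have r0 : (0 <= w (\val (y n)) (\val (y n.+1)) / total_rate (y n))%R.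
  apply: divr_ge0; first exact: cond_ge0.
  rewrite /total_rate; apply: (big_ind (fun z => 0 <= z)%R) => //; first exact: addr_ge0.
  by move=> *; exact: cond_ge0.
elim: k A s => [|k IH] A s kn mA s0.
  have [A0|A0] := pselect (A 0%R); last first.
    have -> : J 0%N @^-1` A = set0 by apply/seteqP; split=> o //=; rewrite jump_time0.
    by rewrite !set0I measure0 mule0.
  have -> : J 0%N @^-1` A = setT by apply/seteqP; split=> o //= _; rewrite jump_time0.
  rewrite !setTI law_cylinder//.
  (* The threshold 0 at index [n.+1] is no condition, as holding times are positive; it completes
     the event to a cylinder of length [n.+1]. *)
  pose s' i := (if (i <= n)%N then s i else 0)%R.
  have -> : path_event y n.+1 `&` hold_event 0 n s = path_event y n.+1 `&` hold_event 0 n.+1 s'.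
    apply/seteqP; split=> o [Po h]; split=> // i _ il.
      by rewrite /s'; case: ifP => [in_|_]; [exact: h|exact: rw_hold_gt0].
    by have := h i isT (leqW il); rewrite /s' il.
  rewrite law_cylinder; last by move=> i; rewrite /s'; case: ifP.
  rewrite -EFinM; congr (_%:E).
  have -> : (\prod_(0 <= i < n.+2) expR (- (total_rate (y i) * s' i)) =
      \prod_(0 <= i < n.+1) expR (- (total_rate (y i) * s i)))%R.
    rewrite big_nat_recr //= [in X in (_ * X)%R]/s' ltnn mulr0 oppr0 expR0 mulr1.
    by rewrite big_nat [RHS]big_nat; apply: eq_bigr => i /andP[_ il]; rewrite /s' -ltnS il.
  by rewrite mulrA; congr (_ * _)%R; rewrite /path_weight big_ord_recr /=; ring.
have mJ := measurable_jump_time k; have mH := rw_hold_measurable (v := X) k.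
pose Z : set (R * R) := (fun z => z.1 + z.2)%R @^-1` A.
have mZ : measurable Z.
  rewrite -[X in measurable X]setTI /Z.
  have : measurable_fun setT (fun z : R * R => z.1 + z.2)%R.
    by apply: measurable_funD; [exact: measurable_fst|exact: measurable_snd].
  by apply.
have JE K : J k.+1 @^-1` A `&` K = (fun o => (J k o, H k o)) @^-1` Z `&` K.
  by congr (_ `&` K); apply/seteqP; split=> o; rewrite /Z /= jump_timeS.
rewrite !JE; apply: law2_unique => //.
- by apply: measurableI; [exact: measurable_path_event|exact: measurable_hold_event].
- by apply: measurableI; [exact: measurable_path_event|exact: measurable_hold_event].
move=> A' b mA'.
rewrite -!setIA !hold_event_split//.
apply: IH => //; first exact: ltnW.
by move=> i; case: ifP => // _; rewrite le_max lexx.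
Qed.

Lemma law_next_jump y n A : measurable A ->
  law (J n.+1 @^-1` A `&` path_event y n.+1) =
  (w (\val (y n)) (\val (y n.+1)) / total_rate (y n))%:E *
  law (J n.+1 @^-1` A `&` path_event y n).
Proof.
move=> mA; have := @law_next_jump_aux y n n.+1 A (fun=> 0%R) (leqnn _) mA (fun=> lexx _).
by rewrite !hold_event0.
Qed.

End jump_chain.

(** * The forward equation along a fixed path of vertices *)

Section forward_equation.
Local Open Scope ereal_scope.
Context {d : nat} {R : realType} {w : conductances d R} (X : vsrw w) (x0 : vertex w).
Local Notation V := (vertex w).
Local Notation law := (rw_law X x0).
Local Notation J n := (@jump_time d R w X n).
Local Notation H n := (@rw_hold d R w X n).
Local Notation Y n := (@rw_jump d R w X n).
Local Notation PE y n := (@path_event d R w X y n).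
Local Notation mu := (@lebesgue_measure R).
Implicit Types (y : nat -> V) (A B : set R) (t b s a : R) (n m k : nat).

Definition jumps_at n s : set (rw_space X) := [set o | (J n o <= s < J n.+1 o)%R].

Lemma law_hold_ray y n A b : measurable A ->
  law (H n @^-1` `]b, +oo[ `&` (J n @^-1` A `&` PE y n)) =
  (expR (- (total_rate (y n) * Num.max 0 b)))%:E * law (J n @^-1` A `&` PE y n).
Proof.
move=> mA.
have -> : H n @^-1` `]b, +oo[ `&` (J n @^-1` A `&` PE y n) =
   J n @^-1` A `&` (PE y n `&` hold_event n n (fun i => if i == n then Num.max 0 b else 0)%R).
  rewrite -(hold_event_split (fun=> 0%R))// setICA; congr (_ `&` _).
  by rewrite hold_event0.
rewrite law_hold_indep//; last by move=> i; case: ifP => // _; rewrite le_max lexx.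
by rewrite big_nat1 eqxx.
Qed.

(** The probability that a walk which arrived at time [a] at a vertex of rate [q] has arrived by
    time [s] and is still waiting there. *)
Definition decay (q s a : R) : R := ((0 <= a <= s)%R%:R * expR (- (q * (s - a))))%R.

Lemma decay_ge0 q s a : (0 <= decay q s a)%R.
Proof. by rewrite mulr_ge0 ?expR_ge0. Qed.

Lemma measurable_decay q : measurable_fun setT (fun z : R * R => decay q z.1 z.2).
Proof.
apply: measurable_funM; last first.
  apply: measurableT_comp => //; apply: measurableT_comp => //.
  apply: measurable_funM => //; apply: measurable_funB.
    exact: measurable_fst.
  exact: measurable_snd.
rewrite (_ : (fun z : R * R => _) = \1_[set z : R * R | (0 <= z.2 <= z.1)%R]); last first.
  by apply/funext => z; rewrite indicE mem_setE.
apply: measurable_indic.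
have -> : [set z : R * R | (0 <= z.2 <= z.1)%R] =
   (snd @^-1` `[0%R, +oo[) `&` ((fun z => z.1 - z.2)%R @^-1` `[0%R, +oo[).
  apply/seteqP; split=> z /=; rewrite !in_itv /= !andbT subr_ge0.
    by move=> /andP[].
  by move=> [-> ->].
apply: measurableI; rewrite -[X in measurable X]setTI.
  by apply: measurable_snd => //; exact: measurable_itv.
have : measurable_fun setT (fun z : R * R => z.1 - z.2)%R.
  by apply: measurable_funB; [exact: measurable_fst|exact: measurable_snd].
by apply => //; exact: measurable_itv.
Qed.

Lemma measurable_jumps_at_pair n :
  measurable [set z : rw_space X * R | (J n z.1 <= z.2 < J n.+1 z.1)%R].
Proof.
have mJ k : measurable_fun setT (fun z : rw_space X * R => z.2 - J k z.1)%R.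
  apply: measurable_funB; first exact: measurable_snd.
  by apply: measurableT_comp; [exact: measurable_jump_time|exact: measurable_fst].
have -> : [set z : rw_space X * R | (J n z.1 <= z.2 < J n.+1 z.1)%R] =
   ((fun z => z.2 - J n z.1)%R @^-1` `[0%R, +oo[) `&`
   ((fun z => z.2 - J n.+1 z.1)%R @^-1` `]-oo, 0%R[).
  apply/seteqP; split=> z /=; rewrite !in_itv /= andbT subr_ge0 subr_lt0.
    by move=> /andP[].
  by move=> [-> ->].
by apply: measurableI; rewrite -[X in measurable X]setTI; apply: mJ => //; exact: measurable_itv.
Qed.

Lemma measurable_jumps_at n s : measurable (jumps_at n s).
Proof.
rewrite (_ : jumps_at n s = ysection [set z : rw_space X * R | (J n z.1 <= z.2 < J n.+1 z.1)%R] s).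
  by apply: measurable_ysection; exact: measurable_jumps_at_pair.
by apply/seteqP; split=> o /=; rewrite /ysection /= inE.
Qed.

Lemma measurable_law_jumps_at n (D : set (rw_space X)) : measurable D ->
  measurable_fun setT (fun s => law (jumps_at n s `&` D)).
Proof.
move=> mD; pose Z := [set z : rw_space X * R | (J n z.1 <= z.2 < J n.+1 z.1)%R] `&` (D `*` setT).
have mZ : measurable Z.
  by apply: measurableI; [exact: measurable_jumps_at_pair|exact: measurableX].
rewrite (_ : (fun s => _) = law \o ysection Z); first exact: measurable_fun_ysection.
apply/funext => s /=; congr (law _); apply/seteqP; split=> o /=; rewrite /ysection /= inE.
  by move=> [? ?]; split.
by move=> [? []].
Qed.

Lemma measurable_jump_le n t : measurable (J n @^-1` `]-oo, t]).
Proof. by rewrite -[X in measurable X]setTI; apply: measurable_jump_time => //; exact: measurable_itv. Qed.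

(** Along the path the jump time and the following holding time are independent; integrating out the
    exponential holding time leaves [decay]. *)
Lemma law_jumps_at_path y n s : law (PE y n) != 0 -> law (jumps_at n s `&` PE y n) =
  \int[restr_law law (@measurable_jump_time d R w X n) (@measurable_path_event d R w X y n)]_a
    (decay (total_rate (y n)) s a)%:E.
Proof.
move=> PE0; set q := total_rate (y n).
have mPE := @measurable_path_event d R w X y n.
pose N : {finite_measure set R -> \bar R} := restr_law law (@measurable_jump_time d R w X n) mPE.
pose M : {finite_measure set R -> \bar R} := restr_law law (rw_hold_measurable (v := X) n) mPE.
rewrite -[restr_law _ _ _]/(N : set R -> \bar R).
pose c := fine (law (PE y n)).
have cE : law (PE y n) = c%:E by rewrite fineK// fin_num_measure.
have c0 : (0 <= c)%R by rewrite fine_ge0.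
have cp : (0 < c)%R by rewrite lt_neqAle c0 andbT eq_sym -eqe -cE.
have mJ : measurable_fun setT (J n) by exact: measurable_jump_time.
have mJA A : measurable A -> measurable (J n @^-1` A).
  by move=> mA; rewrite -[X in measurable X]setTI; exact: mJ.
have mfg : measurable_fun setT (fun o => (J n o, H n o)).
  by apply: measurable_fun_pair => //; exact: rw_hold_measurable.
have Mray b : M `]b, +oo[%classic = (expR (- (q * Num.max 0 b)) * c)%:E.
  have := @law_hold_ray y n setT b measurableT.
  by rewrite preimage_setT !setTI EFinM -cE.
(* Both [N] and [M] have total mass [c], so their product is [c] times the joint law on the path
   event. *)
pose P : {measure set (R * R) -> \bar R} := mscale (NngNum c0) (restr_law law mfg mPE).
have prodE Z : measurable Z -> (N \x M) Z = P Z.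
  move=> mZ; apply: product_measure_unique => // A B mA mB.
  have NAfin : N A \is a fin_num by exact: fin_num_measure.
  have NA0 : (0 <= fine (N A))%R by rewrite fine_ge0.
  pose n0 : {finite_measure set R -> \bar R} :=
    restr_law law (rw_hold_measurable (v := X) n) (measurableI _ _ (mJA A mA) mPE).
  pose n1 : {measure set R -> \bar R} := mscale (NngNum c0) n0.
  pose n2 : {measure set R -> \bar R} := mscale (NngNum NA0) M.
  have n1oo : n1 setT < +oo.
    rewrite /n1 /= /mscale; apply: lte_mul_pinfty => //.
    by rewrite ltey_eq; apply/orP; left; apply: fin_num_measure.
  have : n1 B = n2 B.
    apply: ray_measure_unique => // b.
    transitivity (c%:E * law (H n @^-1` `]b, +oo[ `&` (J n @^-1` A `&` PE y n))); first by [].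
    transitivity ((fine (N A))%:E * M `]b, +oo[%classic); last by [].
    rewrite Mray law_hold_ray//.
    rewrite (_ : law (J n @^-1` A `&` PE y n) = (fine (N A))%:E); last by rewrite fineK.
    by rewrite -!EFinM; congr (_%:E); ring.
  move=> n12; transitivity (n1 B); last first.
    rewrite n12; transitivity ((fine (N A))%:E * M B); first by [].
    by rewrite fineK.
  transitivity (c%:E * law ((fun o => (J n o, H n o)) @^-1` (A `*` B) `&` PE y n)); first by [].
  transitivity (c%:E * law (H n @^-1` B `&` (J n @^-1` A `&` PE y n))); last by [].
  congr (_ * law _); apply/seteqP; split=> o /=; first by case=> -[].
  by case=> ? [].
pose Z : set (R * R) := [set z | (0 <= z.1 <= s)%R /\ (s < z.1 + z.2)%R].
have mZ : measurable Z.
  have -> : Z = (fst @^-1` `[0%R, s]) `&` ((fun z => z.1 + z.2)%R @^-1` `]s, +oo[).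
    by apply/seteqP; split=> z /=; rewrite !in_itv /= andbT.
  apply: measurableI; rewrite -[X in measurable X]setTI.
    by apply: measurable_fst => //; exact: measurable_itv.
  have : measurable_fun setT (fun z : R * R => z.1 + z.2)%R.
    by apply: measurable_funD; [exact: measurable_fst|exact: measurable_snd].
  by apply => //; exact: measurable_itv.
have h1 : c%:E * law (jumps_at n s `&` PE y n) = P Z.
  rewrite /P /= /mscale /restr_law /=; congr (_ * law (_ `&` _)).
  apply/seteqP; split=> o; rewrite /jumps_at /Z /= jump_timeS.
    by move=> /andP[-> ->]; rewrite jump_time_ge0.
  by move=> [/andP[_ ->] ->].
have h2 : P Z = \int[N]_a (c%:E * (decay q s a)%:E).
  rewrite -prodE// /product_measure1; apply: eq_integral => a _.
  transitivity (M (xsection Z a)); first by [].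
  have [as_|as_] := boolP (0 <= a <= s)%R.
    have -> : xsection Z a = `](s - a)%R, +oo[%classic.
      apply/seteqP; split=> b; rewrite /xsection /Z /= inE /= in_itv /= andbT.
        by move=> [_]; rewrite ltrBlDl.
      by rewrite ltrBlDl.
    rewrite Mray /decay as_ mul1r -EFinM mulrC; congr (_ * expR (- (q * _)))%:E.
    by apply/max_idPr; rewrite subr_ge0; case/andP: as_.
  have -> : xsection Z a = set0.
    by apply/seteqP; split=> // b; rewrite /xsection /Z /= inE /= => -[]; rewrite (negPf as_).
  by rewrite measure0 /decay (negPf as_) mul0r mule0.
have md : measurable_fun setT (decay q s).
  exact: (measurableT_comp (measurable_decay q) (measurable_pair1 s)).
have cK (z : \bar R) : z = (c^-1)%:E * (c%:E * z) by rewrite muleA -EFinM mulVf ?mul1e// gt_eqF.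
rewrite [LHS]cK [RHS]cK h1 h2 ge0_integralZl//.
- by apply/measurable_EFinP.
- by move=> a _; rewrite lee_fin decay_ge0.
Qed.

Lemma decay_integral (q a t : R) : (0 <= t)%R ->
  \int[mu]_(s in `[0%R, t]) (q * decay q s a)%:E = ((0 <= a <= t)%R%:R - decay q t a)%:E.
Proof.
move=> t0; have [/andP[a0 at_]|nat_] := boolP (0 <= a <= t)%R; last first.
  rewrite [in RHS]/decay (negPf nat_) mul0r subr0 integral0_eq// => s /=.
  rewrite in_itv /= => /andP[s0 st]; rewrite /decay.
  have [/andP[a0 as_]|_] := boolP (0 <= a <= s)%R; last by rewrite mul0r mulr0.
  by rewrite a0 (le_trans as_ st) in nat_.
rewrite {2}/decay a0 at_ !mul1r.
pose f s := (q * expR (- (q * (s - a))))%R.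
transitivity (\int[mu]_(s in `[a, t]) (f s)%:E).
  have -> : `[a, t]%classic = `[0%R, t] `&` `[a, t] :> set R.
    apply/seteqP; split=> s /=; rewrite !in_itv /=.
      by move=> /andP[h1 ->]; rewrite h1 (le_trans a0).
    by move=> [/andP[_ ->] /andP[-> _]].
  rewrite integral_mkcondr; apply: eq_integral => s; rewrite inE /= in_itv /= => /andP[s0 st].
  rewrite patchE mem_setE in_itv /= st andbT /decay a0 /=.
  by case: (a <= s)%R; rewrite ?mul1r// mul0r mulr0.
move: at_; rewrite le_eqVlt => /predU1P[->|at_].
  by rewrite set_itv1 integral_set1 subrr mulr0 oppr0 expR0 subrr.
have dE (x : R) : is_derive x 1%R (fun s : R => expR (- (q * (s - a))))%R (- f x)%R.
  have d1 : is_derive x 1%R (fun s : R => - (q * (s - a)))%R (- (q * (1 - 0)))%R.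
    by apply: is_deriveN; apply: is_deriveZ; exact: is_deriveB.
  have d2 := @is_derive1_comp R (@expR R) (fun s : R => - (q * (s - a)))%R x _ _ (is_derive_expR _) d1.
  by apply: (is_derive_eq d2); rewrite /f; ring.
have dF (x : R) : is_derive x 1%R (fun s : R => - expR (- (q * (s - a))))%R (f x).
  by apply: (is_derive_eq (is_deriveN (dE x))); rewrite opprK.
have cE (x : R) : {for x, continuous (fun s : R => expR (- (q * (s - a))))%R}.
  by apply: differentiable_continuous; apply/derivable1_diffP; case: (dE x).
have cF (x : R) : {for x, continuous (fun s : R => - expR (- (q * (s - a))))%R}.
  by apply: differentiable_continuous; apply/derivable1_diffP; case: (dF x).
rewrite (@continuous_FTC2 _ f (fun s : R => - expR (- (q * (s - a))))%R a t at_).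
- by rewrite subrr mulr0 oppr0 expR0 -EFinB opprK addrC.
- apply: continuous_subspaceT => x; rewrite /f; apply: (@cvgM _ R); first exact: cvg_cst.
  exact: (cE x).
- split.
  + by move=> x _; case: (dF x).
  + exact: cvg_at_right_filter (cF a).
  + exact: cvg_at_left_filter (cF t).
- by move=> x _; rewrite derive1E (@derive_val _ _ _ _ _ _ _ (dF x)).
Qed.

(** Tonelli exchanges the integrals and [decay_integral] evaluates the inner one, that of an
    exponential density. *)
Lemma integral_decay (N : {finite_measure set R -> \bar R}) (q t : R) : (0 <= q)%R -> (0 <= t)%R ->
  \int[mu]_(s in `[0%R, t]) (q%:E * \int[N]_a (decay q s a)%:E) =
  N `[0%R, t]%classic - \int[N]_a (decay q t a)%:E.
Proof.
move=> q0 t0.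
have md s : measurable_fun setT (decay q s).
  exact: (measurableT_comp (measurable_decay q) (measurable_pair1 s)).
have step1 : \int[mu]_(s in `[0%R, t]) (q%:E * \int[N]_a (decay q s a)%:E) =
    \int[mu]_(s in `[0%R, t]) \int[N]_a (q * decay q s a)%:E.
  apply: eq_integral => s _; rewrite -ge0_integralZl//.
  - by apply/measurable_EFinP.
  - by move=> a _; rewrite lee_fin decay_ge0.
pose f (z : R * R) : \bar R := (\1_(`[0%R, t]%classic : set R) z.1 * (q * decay q z.1 z.2))%:E.
have mf : measurable_fun setT f.
  apply/measurable_EFinP; apply: measurable_funM.
    rewrite (_ : (fun z : R * R => \1_(`[0%R, t]%classic : set R) z.1 : R) = \1_(fst @^-1` `[0%R, t])).
      apply: measurable_indic; rewrite -[X in measurable X]setTI.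
      by apply: measurable_fst => //; exact: measurable_itv.
    by apply/funext => z; rewrite !indicE !mem_setE.
  by apply: measurable_funM => //; exact: measurable_decay.
have f0 z : 0 <= f z by rewrite lee_fin !mulr_ge0 ?decay_ge0.
have step2 : \int[mu]_(s in `[0%R, t]) \int[N]_a (q * decay q s a)%:E =
    \int[mu]_s \int[N]_a f (s, a).
  rewrite integral_mkcond; apply: eq_integral => s _; rewrite patchE mem_setE.
  rewrite /f /= indicE mem_setE; case: (s \in _); last first.
    by under eq_integral do rewrite mul0r; rewrite integral0.
  by under [in RHS]eq_integral do rewrite mul1r.
have step3 : \int[mu]_s \int[N]_a f (s, a) = \int[N]_a \int[mu]_s f (s, a).
  exact: (@fubini_tonelli _ _ _ _ _ mu N f mf f0).
have step4 a : \int[mu]_s f (s, a) = ((0 <= a <= t)%R%:R - decay q t a)%:E.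
  rewrite -decay_integral// [RHS]integral_mkcond; apply: eq_integral => s _.
  rewrite patchE mem_setE /f /= indicE mem_setE.
  by case: (s \in _); rewrite ?mul1r ?mul0r.
rewrite step1 step2 step3; under [LHS]eq_integral do rewrite step4.
have mind : measurable_fun setT (fun a => (0 <= a <= t)%R%:R : R).
  rewrite (_ : (fun a => _) = \1_(`[0%R, t]%classic : set R)).
    by apply: measurable_indic; exact: measurable_itv.
  by apply/funext => a; rewrite indicE mem_setE in_itv.
have iN (g : R -> R) : measurable_fun setT g -> (forall a, 0 <= g a <= 1)%R -> N.-integrable setT (EFin \o g).
  move=> mg g01; apply: (@le_integrable _ _ _ N setT measurableT (EFin \o g) (EFin \o cst 1%R)).
  - by apply/measurable_EFinP.
  - by move=> a _ /=; rewrite !lee_fin normr1 ger0_norm; case/andP: (g01 a).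
  - exact: finite_measure_integrable_cst.
rewrite (_ : (fun a => _) = (fun a => (EFin \o (fun a => (0 <= a <= t)%R%:R : R)) a - (EFin \o decay q t) a)); last first.
  by apply/funext => a.
rewrite (integralB measurableT); last 2 first.
- by apply: iN => // a; rewrite ler0n lern1 leq_b1.
- apply: iN => // a; rewrite decay_ge0 /decay /=.
  have [/andP[a0 at_]|_] := boolP (0 <= a <= t)%R; last by rewrite mul0r.
  by rewrite mul1r -expR0 ler_expR oppr_le0 mulr_ge0// subr_ge0.
congr (_ - _); rewrite -[N `[0%R, t]%classic]mul1e -integral_cst//.
rewrite [RHS]integral_mkcond; apply: eq_integral => a _ /=.
by rewrite patchE mem_setE in_itv /=; case: ifP.
Qed.

(** The probability of departure by time [t] is the rate times the expected time spent: both are the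
    arrivals by time [t] minus the walks still waiting. *)
Lemma law_forward_path y n t : (0 <= t)%R ->
  law (J n.+1 @^-1` `]-oo, t] `&` PE y n) =
  \int[mu]_(s in `[0%R, t]) ((total_rate (y n))%:E * law (jumps_at n s `&` PE y n)).
Proof.
move=> t0; set q := total_rate (y n).
have mPE := @measurable_path_event d R w X y n.
have [PE0|PE0] := eqVneq (law (PE y n)) 0.
  have z D : measurable D -> law (D `&` PE y n) = 0.
    by move=> mD; apply: (@subset_measure0 _ _ _ _ _ (PE y n)) => //; exact: measurableI.
  rewrite z; last exact: measurable_jump_le.
  by rewrite integral0_eq// => s _; rewrite z ?mule0//; exact: measurable_jumps_at.
pose N : {finite_measure set R -> \bar R} := restr_law law (@measurable_jump_time d R w X n) mPE.
have q0 : (0 <= q)%R.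
  rewrite /q /total_rate; apply: (big_ind (fun z => 0 <= z)%R) => //; first exact: addr_ge0.
  by move=> *; exact: cond_ge0.
have phiE s : law (jumps_at n s `&` PE y n) = \int[N]_a (decay q s a)%:E.
  exact: law_jumps_at_path.
under eq_integral do rewrite phiE.
rewrite integral_decay// -phiE.
have -> : N `[0%R, t]%classic = law (J n @^-1` `]-oo, t] `&` PE y n).
  transitivity (law (J n @^-1` `[0%R, t] `&` PE y n)); first by [].
  congr (law (_ `&` _)); apply/seteqP; split=> o /=; rewrite !in_itv /=.
    by move=> /andP[].
  by move=> ->; rewrite jump_time_ge0.
have -> : J n @^-1` `]-oo, t] `&` PE y n =
   (J n.+1 @^-1` `]-oo, t] `&` PE y n) `|` (jumps_at n t `&` PE y n).
  apply/seteqP; split=> o; rewrite /jumps_at /= !in_itv /=.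
    move=> [h Po]; have [h'|h'] := leP (J n.+1 o) t; first by left.
    by right; rewrite h.
  move=> [[h Po]|[/andP[h _] Po]]; split=> //.
  by apply: le_trans h; exact: jump_time_homo.
have mA1 : measurable (J n.+1 @^-1` `]-oo, t] `&` PE y n).
  by apply: measurableI => //; exact: measurable_jump_le.
have mA2 : measurable (jumps_at n t `&` PE y n).
  by apply: measurableI => //; exact: measurable_jumps_at.
rewrite measureU//; last first.
  apply/seteqP; split=> o //=; rewrite /jumps_at /= in_itv /=.
  by move=> [[h _] [/andP[_ h'] _]]; move: (lt_le_trans h' h); rewrite ltxx.
by rewrite addeK// fin_num_measure.
Qed.

End forward_equation.

(** * Summation over paths: the forward equation of the walk *)

Section forward_sum.
Local Open Scope ereal_scope.
Context {d : nat} {R : realType} {w : conductances d R} (X : vsrw w) (x0 : vertex w).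
Local Notation V := (vertex w).
Local Notation law := (rw_law X x0).
Local Notation J n := (@jump_time d R w X n).
Local Notation Y n := (@rw_jump d R w X n).
Local Notation PE y n := (@path_event d R w X y n).
Local Notation jumps_at n s := (@jumps_at d R w X n s).
Local Notation mu := (@lebesgue_measure R).
Implicit Types (y : nat -> V) (t s : R) (n k : nat) (E D : set (rw_space X)) (z v : V).

Lemma total_rate_ge0 v : (0 <= total_rate v)%R.
Proof.
rewrite /total_rate; apply: (big_ind (fun r : R => 0 <= r)%R) => //; first exact: addr_ge0.
by move=> *; exact: cond_ge0.
Qed.

(** Vertices are enumerated by the code of their lattice point; a code that belongs to no vertex
    gives the empty event. *)
Definition coded k i : set (rw_space X) := [set o | pickle (\val (Y k o)) = i].

Lemma codedP k i : (exists v, coded k i = Y k @^-1` [set v]) \/ coded k i = set0.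
Proof.
have [[v vi]|h] := pselect (exists v : V, pickle (\val v) = i); [left|right].
  exists v; apply/seteqP; split=> o; rewrite /coded /= -vi; last by move=> ->.
  by move=> /(pcan_inj pickleK) /val_inj.
by apply/seteqP; split=> // o oi; apply: h; exists (Y k o).
Qed.

Lemma measurable_coded k i : measurable (coded k i).
Proof. by have [[v ->]|->] := codedP k i => //; exact: measurable_jump. Qed.

Lemma coded_cover k E : E = \bigcup_i (E `&` coded k i).
Proof.
apply/seteqP; split=> [p Ep|p [i _ []]//].
by exists (pickle (\val (Y k p))).
Qed.

Lemma coded_triv k E : trivIset setT (fun i => E `&` coded k i).
Proof. by move=> i j _ _ [p [[_ /= <-] [_ /= <-]]]. Qed.

Lemma law_coded k E : measurable E -> law E = \sum_(0 <= i <oo) law (E `&` coded k i).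
Proof.
move=> mE; rewrite {1}(coded_cover k E) measure_bigcup//; last exact: coded_triv.
- by apply: eq_eseriesl => i /=; rewrite in_setT.
- by move=> i _; apply: measurableI => //; exact: measurable_coded.
Qed.

Lemma measurable_law_on n D t : measurable D ->
  measurable_fun `[0%R, t] (fun s => law (jumps_at n s `&` D)).
Proof. by move=> mD; apply: (measurable_funS measurableT (@subsetT _ _)); exact: measurable_law_jumps_at. Qed.

Lemma integral_law_coded k n D t : measurable D ->
  \int[mu]_(s in `[0%R, t]) law (jumps_at n s `&` D) =
  \sum_(0 <= i <oo) \int[mu]_(s in `[0%R, t]) law (jumps_at n s `&` (D `&` coded k i)).
Proof.
move=> mD; rewrite -integral_nneseries//; last first.
  by move=> i; apply: measurable_law_on; apply: measurableI => //; exact: measurable_coded.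
apply: eq_integral => s _; rewrite (law_coded k); last first.
  by apply: measurableI => //; exact: measurable_jumps_at.
by apply: eq_eseriesr => i _; rewrite setIA.
Qed.

Lemma past_sum_step E D (c : R) n k t : measurable E -> measurable D -> (0 <= c)%R ->
  (forall v, law (E `&` (D `&` Y k @^-1` [set v])) =
     c%:E * \int[mu]_(s in `[0%R, t]) law (jumps_at n s `&` (D `&` Y k @^-1` [set v]))) ->
  law (E `&` D) = c%:E * \int[mu]_(s in `[0%R, t]) law (jumps_at n s `&` D).
Proof.
move=> mE mD c0 h; rewrite (integral_law_coded k)// (law_coded k); last exact: measurableI.
rewrite -nneseriesZl//; last by move=> i _; apply: integral_ge0.
apply: eq_eseriesr => i _; rewrite -setIA.
have [[v ->]|->] := codedP k i; first exact: h.
rewrite !setI0 measure0 integral0_eq ?mule0// => s _.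
by rewrite setI0 measure0.
Qed.

(** The past is forgotten one vertex at a time, from jump 0 upwards, until only the position after
    jump [n] is prescribed. *)
Lemma past_sum E (c : R) n z t : measurable E -> (0 <= c)%R ->
  (forall y, y n = z -> law (E `&` PE y n) =
     c%:E * \int[mu]_(s in `[0%R, t]) law (jumps_at n s `&` PE y n)) ->
  law (E `&` Y n @^-1` [set z]) =
  c%:E * \int[mu]_(s in `[0%R, t]) law (jumps_at n s `&` Y n @^-1` [set z]).
Proof.
move=> mE c0 h.
pose D y k : set (rw_space X) := [set o | forall i, (k <= i)%N -> (i <= n)%N -> Y i o = y i].
have mD y k : measurable (D y k).
  by apply: (@measurable_finite_event _ _ _ X (fun i => Y i @^-1` [set y i]) (leq k)) => i; exact: measurable_jump.
have key k y : (k <= n)%N -> y n = z -> law (E `&` D y k) =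
    c%:E * \int[mu]_(s in `[0%R, t]) law (jumps_at n s `&` D y k).
  elim: k y => [|k IH] y kn yn.
    have -> : D y 0%N = PE y n by apply/seteqP; split=> o /= ho i; [exact: ho|move=> _; exact: ho].
    exact: h.
  apply: (past_sum_step (k := k)) => // v.
  pose y' i := if i == k then v else y i.
  have -> : D y k.+1 `&` Y k @^-1` [set v] = D y' k.
    apply/seteqP; split=> o /=.
      move=> [ho ov] i ki in_; rewrite /y'; case: eqVneq => [->//|ik].
      by apply: ho => //; rewrite ltn_neqAle eq_sym ik.
    move=> ho; split; last by rewrite ho ?/y' ?eqxx// ltnW.
    by move=> i ki in_; rewrite ho ?/y' ?gtn_eqF// ltnW.
  by apply: IH; [exact: ltnW|rewrite /y' gtn_eqF].
have <- : D (fun=> z) n = Y n @^-1` [set z].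
  apply/seteqP; split=> o /=; first by apply.
  by move=> oz i ni in_; rewrite (_ : i = n)//; apply/eqP; rewrite eqn_leq in_.
exact: key.
Qed.

Lemma law_forward n z t : (0 <= t)%R ->
  law (J n.+1 @^-1` `]-oo, t] `&` Y n @^-1` [set z]) =
  (total_rate z)%:E * \int[mu]_(s in `[0%R, t]) law (jumps_at n s `&` Y n @^-1` [set z]).
Proof.
move=> t0; apply: past_sum; [exact: measurable_jump_le|exact: total_rate_ge0|].
move=> y yn; rewrite law_forward_path// yn ge0_integralZl//.
- exact: (@measurable_law_on n (PE y n) t (@measurable_path_event d R w X y n)).
- by rewrite lee_fin total_rate_ge0.
Qed.

Lemma total_rate0 v v' : total_rate v = 0%R -> w (\val v) (\val v') = 0%R.
Proof.
move=> q0; have [vv|vv] := boolP (adj (\val v) (\val v')); last exact: cond_nn.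
apply/eqP; rewrite eq_le cond_ge0 andbT -q0 /total_rate fsbig_finite//; last exact: finite_nbr.
rewrite -/(nbr_seq v) (big_rem v') ?mem_nbr_seq//= lerDl.
by apply: sumr_ge0 => i _; exact: cond_ge0.
Qed.

Lemma law_forward_next n z z' t : (0 <= t)%R ->
  law (J n.+1 @^-1` `]-oo, t] `&` Y n.+1 @^-1` [set z] `&` Y n @^-1` [set z']) =
  (w (\val z') (\val z))%:E *
  \int[mu]_(s in `[0%R, t]) law (jumps_at n s `&` Y n @^-1` [set z']).
Proof.
move=> t0; apply: past_sum.
- by apply: measurableI; [exact: measurable_jump_le|exact: measurable_jump].
- exact: cond_ge0.
move=> y yn; pose y' i := if i == n.+1 then z else y i.
have PEy : PE y' n = PE y n.
  by apply/seteqP; split=> o h i il; have := h i il; rewrite /y' ltn_eqF.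
have -> : J n.+1 @^-1` `]-oo, t] `&` Y n.+1 @^-1` [set z] `&` PE y n =
    J n.+1 @^-1` `]-oo, t] `&` PE y' n.+1.
  rewrite -setIA; congr (_ `&` _); apply/seteqP; split=> o /=.
    move=> [oz h] i; rewrite /y'; case: eqVneq => [->//|ni].
    by rewrite leq_eqVlt (negPf ni) /=; exact: h.
  move=> h; split; first by have := h n.+1 (leqnn _); rewrite /y' eqxx.
  by move=> i il; have := h i (leqW il); rewrite /y' ltn_eqF.
rewrite law_next_jump; last exact: measurable_itv.
rewrite PEy law_forward_path// ge0_integralZl//; last 2 first.
- exact: (@measurable_law_on n (PE y n) t (@measurable_path_event d R w X y n)).
- by rewrite lee_fin total_rate_ge0.
have [-> ->] : y' n = z' /\ y' n.+1 = z by rewrite /y' eqxx ltn_eqF.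
rewrite yn muleA -EFinM; congr (_%:E * _).
(* At a vertex of rate zero the quotient is 0 by convention, and the conductance vanishes as well,
   so the product is right in both cases. *)
have [q0|q0] := eqVneq (total_rate z') 0%R; last by rewrite divfK.
by rewrite q0 total_rate0// mulr0.
Qed.

Lemma law_split_seq k (s : seq V) E : measurable E -> uniq s ->
  (forall v, v \notin s -> law (E `&` Y k @^-1` [set v]) = 0) ->
  law E = \sum_(v <- s) law (E `&` Y k @^-1` [set v]).
Proof.
elim: s E => [|a s IH] E mE; rewrite ?big_nil ?big_cons /=.
  move=> _ h; rewrite (law_coded k)// eseries0// => i _ _.
  by have [[v ->]|->] := codedP k i; rewrite ?setI0// h.
move=> /andP[as_ us] h.
have mY v : measurable (Y k @^-1` [set v]) by exact: measurable_jump.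
have -> : law E = law (E `&` Y k @^-1` [set a]) + law (E `&` ~` (Y k @^-1` [set a])).
  rewrite -measureU//; last 3 first.
  - exact: measurableI.
  - by apply: measurableI => //; exact: measurableC.
  - by apply/seteqP; split=> // o /= [[_ h1] [_]].
  by rewrite -setIUr setUv setIT.
congr (_ + _).
rewrite (IH (E `&` ~` (Y k @^-1` [set a])))//; last 2 first.
- by apply: measurableI => //; exact: measurableC.
- move=> v vs; have [->|va] := eqVneq v a.
    rewrite (_ : _ `&` _ = set0) ?measure0//.
    by apply/seteqP; split=> // o /= [[_ ?]].
  apply: (@subset_measure0 _ _ _ _ _ (E `&` Y k @^-1` [set v])) => //.
  + by apply: measurableI => //; apply: measurableI => //; exact: measurableC.
  + exact: measurableI.
  + by move=> o [[]].
  + by apply: h; rewrite inE negb_or va.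
rewrite big_seq [RHS]big_seq; apply: eq_bigr => v vs; congr (law _); apply/seteqP; split=> o /=.
  by move=> [[]].
move=> [Eo ov]; split=> //; split=> // oa.
by move: as_; rewrite -oa ov vs.
Qed.

Definition occ n z s := law (jumps_at n s `&` Y n @^-1` [set z]).

(** Both sides are the probability that jump [n.+1] has led to [z] by time [t]: such a walk is still
    there or has left, and it came from a neighbour. *)
Lemma occ_succ n z t : (0 <= t)%R ->
  occ n.+1 z t + (total_rate z)%:E * \int[mu]_(s in `[0%R, t]) occ n.+1 z s =
  \sum_(z' <- nbr_seq z) (w (\val z') (\val z))%:E * \int[mu]_(s in `[0%R, t]) occ n z' s.
Proof.
move=> t0; rewrite /occ -law_forward//.
have mY k v : measurable (Y k @^-1` [set v]) by exact: measurable_jump.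
rewrite -measureU; last 3 first.
- by apply: measurableI => //; exact: measurable_jumps_at.
- by apply: measurableI => //; exact: measurable_jump_le.
- apply/seteqP; split=> o //=; rewrite /= in_itv /=.
  by move=> [[/andP[_ h] _] [h' _]]; move: (lt_le_trans h h'); rewrite ltxx.
have -> : jumps_at n.+1 t `&` Y n.+1 @^-1` [set z] `|`
    J n.+2 @^-1` `]-oo, t] `&` Y n.+1 @^-1` [set z] =
    J n.+1 @^-1` `]-oo, t] `&` Y n.+1 @^-1` [set z].
  rewrite -setIUl; congr (_ `&` _); apply/seteqP; split=> o; rewrite /= !in_itv /=.
    by move=> [/andP[]//|]; apply: le_trans; exact: jump_time_homo.
  by move=> h; have [?|?] := leP (J n.+2 o) t; [right|left; apply/andP].
apply: (etrans (@law_split_seq n (nbr_seq z) _ _ _ _)).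
- by apply: measurableI => //; exact: measurable_jump_le.
- exact: finmap.fset_uniq.
- move=> v; rewrite mem_nbr_seq => vz; rewrite law_forward_next//.
  rewrite cond_sym cond_nn// mul0e//.
- by apply: eq_bigr => z' _; exact: law_forward_next.
Qed.

Lemma occ_zero z t : (0 <= t)%R ->
  occ 0 z t + (total_rate z)%:E * \int[mu]_(s in `[0%R, t]) occ 0 z s = (z == x0)%:R%:E.
Proof.
move=> t0; rewrite /occ -law_forward//.
have mY k v : measurable (Y k @^-1` [set v]) by exact: measurable_jump.
rewrite -measureU; last 3 first.
- by apply: measurableI => //; exact: measurable_jumps_at.
- by apply: measurableI => //; exact: measurable_jump_le.
- apply/seteqP; split=> o //=; rewrite /= in_itv /=.
  by move=> [[/andP[_ h] _] [h' _]]; move: (lt_le_trans h h'); rewrite ltxx.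
transitivity (law (PE (fun=> z) 0)); last by rewrite law_path /path_weight big_ord0 mulr1.
congr (law _); rewrite -setIUl; apply/seteqP; split=> o.
  by move=> [_ oz] i; rewrite leqn0 => /eqP ->.
move=> oz; split; last exact: oz.
have [h|h] := leP (J 1 o) t; [right|left]; rewrite /= ?in_itv /= ?h//.
by apply/andP; rewrite jump_time0.
Qed.

Lemma measurable_walk_at t z : measurable (@walk_at d R w X t z).
Proof.
rewrite (_ : walk_at t z = \bigcup_n (jumps_at n t `&` Y n @^-1` [set z])).
  apply: bigcup_measurable => n _; apply: measurableI; first exact: measurable_jumps_at.
  exact: measurable_jump.
by apply/seteqP; split=> o; [case=> n h1 h2; exists n|case=> n _ [h1 h2]; exists n].
Qed.

Lemma law_walk_at t z : law (@walk_at d R w X t z) = \sum_(0 <= n <oo) occ n z t.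
Proof.
rewrite (_ : walk_at t z = \bigcup_n (jumps_at n t `&` Y n @^-1` [set z])).
  rewrite measure_bigcup//.
  - by apply: eq_eseriesl => n /=; rewrite in_setT.
  - move=> n _; apply: measurableI; first exact: measurable_jumps_at.
    exact: measurable_jump.
  - have key n m o : jumps_at n t o -> jumps_at m t o -> (n <= m)%N.
      move=> /andP[h1 h2] /andP[h3 h4]; rewrite leqNgt; apply/negP => mn.
      by move: (lt_le_trans h4 (le_trans (jump_time_homo o mn) h1)); rewrite ltxx.
    move=> n m _ _ [p [[h1 _] [h2 _]]].
    by apply/eqP; rewrite eqn_leq (key _ _ _ h1 h2) (key _ _ _ h2 h1).
by apply/seteqP; split=> o; [case=> n h1 h2; exists n|case=> n _ [h1 h2]; exists n].
Qed.

Lemma occ_ge0 n z s : 0 <= occ n z s. Proof. exact: measure_ge0. Qed.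

Lemma measurable_occ n z t : measurable_fun `[0%R, t] (occ n z).
Proof. exact: (@measurable_law_on n (Y n @^-1` [set z]) t (@measurable_jump d R w X n z)). Qed.

Lemma measurable_law_walk_at t z : measurable_fun `[0%R, t] (fun s => law (@walk_at d R w X s z)).
Proof.
apply: (eq_measurable_fun (fun s => \sum_(0 <= n <oo) occ n z s)).
  by move=> s _; rewrite law_walk_at.
by apply: ge0_emeasurable_sum => [n s _ _|n _]; [exact: occ_ge0|exact: measurable_occ].
Qed.

Lemma integral_walk_at t z : \int[mu]_(s in `[0%R, t]) law (@walk_at d R w X s z) =
  \sum_(0 <= n <oo) \int[mu]_(s in `[0%R, t]) occ n z s.
Proof.
under eq_integral do rewrite law_walk_at.
by rewrite integral_nneseries// => n; exact: measurable_occ.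
Qed.

(** The balances [occ_zero] and [occ_succ] are summed over the number of jumps. The integrated form
    involves no derivative and makes sense before non-explosion is known. *)
Lemma forward_equation t z : (0 <= t)%R ->
  law (@walk_at d R w X t z) +
  (total_rate z)%:E * \int[mu]_(s in `[0%R, t]) law (@walk_at d R w X s z) =
  (z == x0)%:R%:E + \sum_(z' <- nbr_seq z) (w (\val z') (\val z))%:E *
     \int[mu]_(s in `[0%R, t]) law (@walk_at d R w X s z').
Proof.
move=> t0; rewrite law_walk_at integral_walk_at.
have I0 n z' : 0 <= \int[mu]_(s in `[0%R, t]) occ n z' s by apply: integral_ge0 => s _; exact: occ_ge0.
have T0 z' : 0 <= (total_rate z')%:E by rewrite lee_fin total_rate_ge0.
have W0 z' : 0 <= (w (\val z') (\val z))%:E by rewrite lee_fin cond_ge0.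
rewrite -nneseriesZl//.
rewrite -nneseriesD//; last by move=> n _ _; rewrite mule_ge0.
rewrite nneseries_recl//; last by move=> n _; rewrite adde_ge0 ?occ_ge0// mule_ge0.
rewrite occ_zero//; congr (_ + _).
transitivity (\sum_(0 <= n <oo) \sum_(z' <- nbr_seq z)
    (w (\val z') (\val z))%:E * \int[mu]_(s in `[0%R, t]) occ n z' s).
  rewrite -(nneseries_addn 1); last by move=> n; rewrite adde_ge0 ?occ_ge0// mule_ge0.
  by apply: eq_eseriesr => n _; rewrite addn1 occ_succ.
rewrite nneseries_sum; last by move=> z' n _; rewrite mule_ge0.
by apply: eq_bigr => z' _; rewrite integral_walk_at nneseriesZl.
Qed.

End forward_sum.

(** * The heat kernel of the walk *)

Section walk_kernel.
Context {d : nat} {R : realType} {w : conductances d R} (w_sub : subquadratic w) (X : vsrw w).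
Local Notation V := (vertex w).
Local Notation G := (vgraph w_sub).
Local Notation p := (heat_kernel X).
Local Notation mu := (@lebesgue_measure R).
Implicit Types (t s T : R) (x y z : V).

Lemma heat_kernelE t x z : (p t x z)%:E = rw_law X x (walk_at t z).
Proof. by rewrite fineK// fin_num_measure//; exact: measurable_walk_at. Qed.

Lemma heat_kernel_ge0 t x z : 0 <= p t x z. Proof. exact: fine_ge0. Qed.

Lemma heat_kernel_le1 t x z : p t x z <= 1.
Proof. by rewrite -lee_fin heat_kernelE; exact: probability_le1 (measurable_walk_at X t z). Qed.

Definition walk_in t (r : seq V) : set (rw_space X) := [set o | exists2 y, y \in r & walk_at t y o].

Lemma law_walk_in t x (r : seq V) : uniq r ->
  measurable (walk_in t r) /\ (\sum_(y <- r) p t x y)%:E = rw_law X x (walk_in t r).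
Proof.
have disj y y' o : walk_at (X := X) t y o -> walk_at (X := X) t y' o -> y = y'.
  have key n m : jump_time n o <= t < jump_time n.+1 o -> jump_time m o <= t < jump_time m.+1 o -> (n <= m)%N.
    move=> /andP[h1 h2] /andP[h3 h4]; rewrite leqNgt; apply/negP => mn.
    by move: (lt_le_trans h4 (le_trans (jump_time_homo o mn) h1)); rewrite ltxx.
  move=> [n h1 <-] [m h2 <-]; congr (rw_jump _ o).
  by apply/eqP; rewrite eqn_leq (key _ _ h1 h2) (key _ _ h2 h1).
elim: r => [|a r IH] /=.
  have -> : walk_in t [::] = set0 by apply/seteqP; split=> o // [].
  by rewrite big_nil measure0.
move=> /andP[ar ur]; have [mU IHE] := IH ur.
have -> : walk_in t (a :: r) = walk_at t a `|` walk_in t r.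
  apply/seteqP; split=> o.
    by move=> [y]; rewrite inE => /predU1P[->|yr] h; [left|right; exists y].
  by move=> [h|[y yr h]]; [exists a; rewrite ?mem_head|exists y; rewrite ?inE ?yr ?orbT].
have mW := measurable_walk_at X t a; split; first exact: measurableU.
rewrite big_cons EFinD heat_kernelE IHE measureU//.
apply/seteqP; split=> o // [h [y yr h']]; move: ar.
by rewrite (disj _ _ _ h h') yr.
Qed.

Lemma heat_kernel_sum_le t x : @sum_le R G (p t x) 1.
Proof.
move=> s us; have [mU h] := law_walk_in t x us.
by rewrite -lee_fin h; exact: probability_le1.
Qed.

Lemma heat_kernel_neg t x y : t < 0 -> p t x y = 0.
Proof.
move=> t0; rewrite /heat_kernel (_ : walk_at t y = set0) ?measure0//.
apply/seteqP; split=> o // [n /andP[h _] _].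
by move: (le_lt_trans (le_trans (jump_time_ge0 n o) h) t0); rewrite ltxx.
Qed.

Lemma measurable_heat_kernel T x z : measurable_fun `[0, T] (fun s => p s x z).
Proof.
apply/measurable_EFinP; rewrite (_ : _ \o _ = (fun s => rw_law X x (walk_at s z))).
  exact: measurable_law_walk_at.
by apply/funext => s /=; rewrite heat_kernelE.
Qed.

Lemma heat_kernel_integrable T x z : mu.-integrable `[0, T] (EFin \o (fun s => p s x z)).
Proof.
apply: (@le_integrable _ _ _ _ _ _ _ (EFin \o cst 1)) => //.
- by apply/measurable_EFinP; exact: measurable_heat_kernel.
- move=> s _ /=; rewrite lee_fin normr1 ger0_norm ?heat_kernel_le1//.
  exact: heat_kernel_ge0.
- by apply: continuous_compact_integrable; [exact: segment_compact|exact: within_cst].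
Qed.

Let occ x z t : R := \int[mu]_(s in `[0, t]) p s x z.

Lemma occE x z t : (\int[mu]_(s in `[0%R, t]) rw_law X x (walk_at s z) = (occ x z t)%:E)%E.
Proof.
rewrite /occ /Rintegral fineK; last first.
  by apply: integrable_fin_num => //; exact: heat_kernel_integrable.
by apply: eq_integral => s _; rewrite heat_kernelE.
Qed.

Lemma forward_real t x z : 0 <= t -> p t x z =
  (z == x)%:R + \sum_(y <- nbr_seq z) w (\val y) (\val z) * occ x y t - total_rate z * occ x z t.
Proof.
move=> t0; have := forward_equation X x z t0; rewrite -heat_kernelE occE -EFinM -EFinD.
under eq_bigr do rewrite occE -EFinM.
by rewrite sumEFin -EFinD => -[]; set S := \sum_(_ <- _) _; lra.
Qed.

(** Regularity is bootstrapped from the integrated forward equation: bounded measurable kernels have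
    continuous time integrals, hence the kernels are continuous, hence the integrals are
    differentiable. *)
Lemma heat_kernelP : @heat_kernel_spec R G p.
Proof.
split.
- exact: heat_kernel_ge0.
- exact: heat_kernel_neg.
- move=> x y; rewrite forward_real// /occ set_itv1 Rintegral_set1 mulr0 subr0 eq_sym big1 ?addr0// => i _.
  by rewrite Rintegral_set1 mulr0.
- exact: heat_kernel_sum_le.
(* [T0] may be negative; a positive horizon beyond it keeps every time under consideration in its
   interior. *)
move=> x T0 z; pose T := Num.max T0 0 + 1.
have T0T : T0 < T by rewrite /T ltr_pwDr// le_max lexx.
have Tp : 0 < T by rewrite /T ltr_pwDr// le_max lexx orbT.
pose F t := (z == x)%:R + \sum_(y <- nbr_seq z) w (\val y) (\val z) * occ x y t - total_rate z * occ x z t.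
have cocc y : {within `[0, T], continuous (occ x y)}.
  exact: parameterized_integral_continuous (ltW Tp) (heat_kernel_integrable T x y).
have cp y : {within `[0, T], continuous (fun t => p t x y)}.
  pose Fy t := (y == x)%:R + \sum_(y' <- nbr_seq y) w (\val y') (\val y) * occ x y' t - total_rate y * occ x y t.
  have cF : {within `[0, T], continuous Fy}.
    apply: within_B; last by apply: within_M => //; exact: within_cst.
    apply: within_D; first exact: within_cst.
    by apply: within_sum => i _; apply: within_M => //; exact: within_cst.
  apply: (subspace_eq_continuous _ cF) => t; rewrite inE /= in_itv /= => /andP[t0 _].
  exact: (esym (forward_real x y t0)).
split; first by apply: within_sub (cp z) => t /=; rewrite !in_itv /= => /andP[-> h]; rewrite (le_trans h (ltW T0T)).
move=> t /andP[t0 tT0] _; have tT : 0 < t < T by rewrite t0 (lt_trans tT0).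
have docc y : is_derive t (1:R) (occ x y) (p t x y).
  by have [_ /(_ t tT) + _] := within_primitive Tp (cp y).
have dn : \forall s \near t, F s = p s x z.
  near=> s; apply: esym; apply: forward_real; apply: ltW; near: s.
  exact: lt_nbhsr.
apply: (near_eq_is_derive dn).
have dM c y : is_derive t (1:R) (fun t => c * occ x y t) (c * p t x y).
  exact: (@is_deriveZ R R R (occ x y) c t 1 _ (docc y)).
have dF : is_derive t (1:R) F (0 + \sum_(y <- nbr_seq z) w (\val y) (\val z) * p t x y - total_rate z * p t x z).
  apply: is_deriveB.
  by apply: is_deriveD; apply: is_derive_big => y _.
apply: (is_derive_eq dF); rewrite add0r addr0 (total_rateE w_sub) /lap /rate /=.
rewrite mulr_suml -sumrB -sumrN; apply: eq_bigr => y _; rewrite [w (\val y) _]cond_sym; ring.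
Unshelve. all: by end_near.
Qed.

End walk_kernel.

(** * Extended sums, tempered functions and non-explosion *)

Section box_sums.
Context {d : nat} {R : realType} {w : conductances d R} (w_sub : subquadratic w).
Local Notation V := (vertex w).
Local Notation G := (vgraph w_sub).
Implicit Types (x y : V) (f : V -> R) (B l : R) (N n m : nat).

Lemma seq_in_ball (s : seq V) : exists n, {subset s <= ball_seq w n}.
Proof.
elim: s => [|a s [n hn]]; first by exists 0%N.
have [k hk] := exists_nat_gt (bracket R (\val a)); exists (maxn n k) => y.
rewrite inE => /predU1P[->|ys]; rewrite mem_ball_seq.
  by apply: le_trans (ltW hk) _; rewrite ler_nat leq_maxr.
have := hn y ys; rewrite mem_ball_seq => /le_trans; apply.
by rewrite ler_nat leq_maxl.
Qed.

Lemma esum_sum_le f B : (forall x, 0 <= f x) ->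
  (\esum_(y in [set: V]) (f y)%:E <= B%:E)%E <-> @sum_le R G f B.
Proof.
move=> f0; split=> [h s us|h].
  rewrite -lee_fin -sumEFin; apply: le_trans h.
  by apply: esum_ge; exists [set` s]; [split=> //; exact: finite_seq|rewrite -fsbig_seq].
apply: ub_ereal_sup => _ [A [fA _] <-].
by rewrite fsbig_finite// sumEFin lee_fin; apply: h; exact: finmap.fset_uniq.
Qed.

Lemma esum_box f l : (forall x, 0 <= f x) ->
  \sum_(y <- ball_seq w n) f y @[n --> \oo] --> l ->
  (\esum_(y in [set: V]) (f y)%:E)%E = l%:E.
Proof.
move=> f0 hl; apply/eqP; rewrite eq_le; apply/andP; split.
  apply/esum_sum_le => // s us; have [n0 hn0] := seq_in_ball s.
  apply: (cvgr_to_ge hl); near=> n.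
  apply: (@sum_sub_le R G) => // y /hn0; rewrite !mem_ball_seq => /le_trans; apply.
  by rewrite ler_nat; near: n; exact: nbhs_infty_ge.
have h : @sum_le R G f (fine (\esum_(y in [set: V]) (f y)%:E)%E) \/ (\esum_(y in [set: V]) (f y)%:E)%E = +oo%E.
  have : (0 <= \esum_(y in [set: V]) (f y)%:E)%E by apply: esum_ge0 => y _; rewrite lee_fin.
  case E : (\esum_(y in [set: V]) (f y)%:E)%E => [r| |] //; [left|by right].
  by apply/esum_sum_le => //; rewrite E.
case: h => [h|->]; last by rewrite leey.
set e := (\esum_(y in [set: V]) (f y)%:E)%E in h *.
have [efin|] := boolP (e \is a fin_num); last first.
  rewrite ge0_fin_numE; last by apply: esum_ge0 => y _; rewrite lee_fin.
  by rewrite -leNgt leye_eq => /eqP ->; rewrite leey.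
rewrite -(fineK efin) lee_fin; apply: (cvgr_to_le hl); near=> n.
by apply: h; exact: finmap.fset_uniq.
Unshelve. all: by end_near.
Qed.

Lemma sum_box_cvg f B : (forall x, 0 <= f x) -> @sum_le R G f B ->
  cvgn (fun n => \sum_(y <- ball_seq w n) f y).
Proof.
move=> f0 hB; apply: nondecreasing_is_cvgn.
  apply/nondecreasing_seqP => n; apply: (@sum_sub_le R G) => //; first exact: finmap.fset_uniq.
  by move=> y; rewrite !mem_ball_seq => /le_trans; apply; rewrite ler_nat.
by exists B => _ [n _ <-]; apply: hB; exact: finmap.fset_uniq.
Qed.

Lemma vsum_box f B l : @sum_le R G (fun y => `|f y|) B ->
  \sum_(y <- ball_seq w n) f y @[n --> \oo] --> l -> vsum f = l.
Proof.
move=> hB hl; have hc := sum_box_cvg (fun y => normr_ge0 (f y)) hB.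
set a := limn (fun n => \sum_(y <- ball_seq w n) `|f y|).
have ha : \sum_(y <- ball_seq w n) `|f y| @[n --> \oo] --> a by exact: hc.
have hp y : Num.max (f y) 0 = 2^-1 * (`|f y| + f y).
  by case: (leP (f y) 0) => h; [rewrite ler0_norm|rewrite gtr0_norm]; lra.
have hn y : Num.max (- f y) 0 = 2^-1 * (`|f y| - f y).
  by case: (leP (- f y) 0) => h; [rewrite ger0_norm|rewrite ltr0_norm]; lra.
rewrite /vsum (@esum_box _ (2^-1 * (a + l))); last 2 first.
- by move=> y; rewrite le_max lexx orbT.
- under eq_fun do under eq_bigr do rewrite hp.
  under eq_fun do rewrite -mulr_sumr big_split.
  by apply: cvgM; [exact: cvg_cst|exact: cvgD].
rewrite (@esum_box _ (2^-1 * (a - l))); last 2 first.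
- by move=> y; rewrite le_max lexx orbT.
- under eq_fun do under eq_bigr do rewrite hn.
  under eq_fun do rewrite -mulr_sumr sumrB.
  by apply: cvgM; [exact: cvg_cst|exact: cvgB].
by rewrite /=; lra.
Qed.

Section tempered_growth.
Context {E : normedZmodType R}.
Implicit Types u : V -> E.

Lemma sqnormH_nat n u B : (sqnormH n%:R u <= B%:E)%E <->
  @sum_le R G (fun x => ((gbr (w := G) x) ^+ n)^-1 ^+ 2 * `|u x| ^+ 2) B.
Proof.
rewrite -esum_sum_le; last by move=> x; rewrite mulr_ge0 ?sqr_ge0.
rewrite /sqnormH; under eq_esum => x _.
  rewrite powRN -natrM powR_mulrn ?bracket_ge0// mulnC exprM -exprVn.
  over.
by [].
Qed.

Lemma sqnormH_mono (N M : R) u : N <= M -> (sqnormH M u <= sqnormH N u)%E.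
Proof.
move=> NM; apply: le_esum => x _; rewrite lee_fin ler_wpM2r ?sqr_ge0//.
apply: ler_powR; first exact: bracket_ge1.
by rewrite lerN2 ler_wpM2l.
Qed.

Lemma tempered_poly u : is_tempered u -> poly (G := G) (fun x => `|u x|).
Proof.
move=> [N N0 hN]; have [n hn] := exists_nat_gt N.
have hlt : (sqnormH n%:R u < +oo)%E by apply: le_lt_trans hN; apply: sqnormH_mono; exact: ltW.
have h0 : (0 <= sqnormH n%:R u)%E.
  by apply: esum_ge0 => x _; rewrite lee_fin mulr_ge0 ?sqr_ge0 ?powR_ge0.
pose B := fine (sqnormH n%:R u).
have hB : @sum_le R G (fun x => ((0 + gbr (w := G) x)^-1 ^+ n) ^+ 2 * `|u x| ^+ 2) B.
  under [X in sum_le X]eq_fun do rewrite add0r exprVn.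
  by apply/sqnormH_nat; rewrite fineK// ge0_fin_numE.
exists (Num.sqrt B * (0 + 1) ^+ n), n; split; first by rewrite mulr_ge0 ?sqrtr_ge0// add0r expr1n.
exact: sum_le_growth hB.
Qed.

Lemma growth_sqnormH : exists (m : nat) (K : R), 0 <= K /\ forall u A N n, 0 <= A -> (N + m <= n)%N ->
  growth (G := G) (fun x => `|u x|) A N -> (sqnormH n%:R u <= (A ^+ 2 * K)%:E)%E.
Proof.
have [m [K [K0 hK]]] := @growth_sum_le R G; exists m, K; split=> // u A N n A0 Nn hu.
apply/sqnormH_nat; have := hK _ A N n 0 A0 (lexx _) Nn hu.
by under [X in sum_le X]eq_fun do rewrite add0r exprVn.
Qed.

Lemma poly_tempered u : poly (G := G) (fun x => `|u x|) -> is_tempered u.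
Proof.
move=> [A [N [A0 hA]]]; have [m [K [K0 hK]]] := growth_sqnormH.
exists (N + m)%:R => //; apply: le_lt_trans (hK u A N _ A0 (leqnn _) hA) _.
by rewrite ltry.
Qed.

End tempered_growth.

Lemma poly_norm (xi : V -> R) : poly (G := G) (fun x => `|xi x|) <-> poly (G := G) xi.
Proof.
by split=> -[A [N [A0 hA]]]; exists A, N; split=> // x; have := hA x; rewrite normr_id.
Qed.

Lemma tval_poly (xi : tempered w) : poly (G := G) xi.
Proof. by apply/poly_norm/tempered_poly; exact: temperedP. Qed.

Context (X : vsrw w).
Local Notation p := (heat_kernel X).
Local Notation hp := (heat_kernelP w_sub X).

(** Absolute convergence of the kernel sum allows it to be computed along balls, which is how
    [heat_sg] arises. *)
Lemma rw_semigroupE (t : R) (xi : V -> R) : 0 <= t -> poly (G := G) xi ->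
  rw_semigroup X t xi = heat_sg (p := p) (G := G) t xi.
Proof.
move=> t0 hx; apply/funext => x; have [B hB] := heat_sg_bound hp x hx t0.
rewrite /rw_semigroup; apply: (vsum_box hB); exact: (heat_sg_cvg hp (x := x) hx t0).
Qed.

Lemma tempered_acts : rw_acts_on_tempered X.
Proof.
move=> t t0 xi; have hx := tval_poly xi; split=> [x|].
  have [B hB] := heat_sg_bound hp x hx t0; rewrite /summable.
  apply: (@le_lt_trans _ _ B%:E); last exact: ltry.
  by apply/esum_sum_le => // y; exact: normr_ge0.
rewrite rw_semigroupE//; apply: poly_tempered; apply/poly_norm; exact: (heat_sg_poly hp t0 hx).
Qed.

(** By conservation of mass large balls carry almost all of the law at each integer time [k], so
    almost surely the walk is somewhere at time [k]; an explosion before [k] would leave it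
    nowhere. *)
Lemma walk_nonexplosive : nonexplosive X.
Proof.
move=> x.
have Ik (k : nat) : (rw_law X x).-negligible (\bigcap_n ~` walk_in (X := X) k%:R (ball_seq w n)).
  have mU n : measurable (walk_in (X := X) k%:R (ball_seq w n)).
    by have [] := law_walk_in X k%:R x (finmap.fset_uniq (fset_set [set y : V | bracket R (\val y) <= n%:R])).
  have mI : measurable (\bigcap_n ~` walk_in (X := X) k%:R (ball_seq w n)).
    by apply: bigcap_measurable => // n _; exact: measurableC.
  exists (\bigcap_n ~` walk_in (X := X) k%:R (ball_seq w n)); split=> //.
  have k0 : (0:R) <= k%:R by [].
  have hc := heat_sg_cvg hp (x := x) (poly_cst (G := G) 1) k0; rewrite (heat_sg1 hp k0) in hc.
  apply/eqP; rewrite eq_le measure_ge0 andbT; apply/lee_addgt0Pr => e e0; rewrite add0e.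
  have [n hn] : exists n, 1 - e < \sum_(y <- ball_seq w n) p k%:R x y.
    have /cvgrPdist_lt/(_ e e0)[n _ hn] := hc; exists n; have := hn n (leqnn n).
    rewrite /=; under eq_bigr do rewrite mulr1.
    by rewrite /= ltr_norml => /andP[_]; lra.
  apply: (@le_trans _ _ (rw_law X x (~` walk_in (X := X) k%:R (ball_seq w n)))).
    apply: le_measure; rewrite ?inE//; first exact: measurableC.
    exact: bigcap_inf.
  rewrite probability_setC//.
  have [_ <-] := law_walk_in X k%:R x (finmap.fset_uniq (fset_set [set y : V | bracket R (\val y) <= n%:R])).
  by rewrite -EFinB lee_fin -/(ball_seq w n); lra.
have := negligible_bigcup Ik; apply: negligibleS => o /= ne.
have : (explosion_time o < +oo)%E by rewrite lt_neqAle leey andbT; apply/eqP.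
have [k hk] : exists k : nat, forall n, jump_time n o <= k%:R.
  have h0 : (0 <= explosion_time o)%E.
    apply: ereal_sup_ubound; exists 0%N => //; by rewrite jump_time0.
  have hlt : (explosion_time o < +oo)%E by rewrite lt_neqAle leey andbT; apply/eqP.
  have [k hk] := exists_nat_gt (fine (explosion_time o)); exists k => n.
  apply: le_trans (ltW hk); rewrite -lee_fin fineK ?ge0_fin_numE//.
  by apply: ereal_sup_ubound; exists n.
by move=> _; exists k => // n _ [y _ [m /andP[_]]]; rewrite ltNge hk.
Qed.

End box_sums.

(** * The environment *)

Section environment.
Context {d : nat} {R : realType}.
Local Notation C := (conductances d R).
Implicit Types (x y z u : Zd d) (w : C) (e r : R) (n k : nat).

Lemma measurable_cond x y : measurable_fun [set: C] (fun w : C => w x y).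
Proof.
move=> _ A mA; rewrite setTI; apply: sub_sigma_algebra.
by exists (x, y), A.
Qed.

Lemma measurable_cond_gt (a : R) x y : measurable [set w : C | a < w x y].
Proof.
rewrite (_ : [set _ | _] = (fun w : C => w x y) @^-1` `]a, +oo[).
  by rewrite -[X in measurable X]setTI; apply: measurable_cond => //; exact: measurable_itv.
by apply/seteqP; split=> w; rewrite /= in_itv /= andbT.
Qed.

Lemma sum_pmap (T I : Type) (g : I -> option T) (f : T -> R) (s : seq I) :
  \sum_(i <- s) (if g i is Some z then f z else 0) = \sum_(z <- pmap g s) f z.
Proof.
elim: s => [|i s IH]; first by rewrite !big_nil.
by rewrite big_cons /= IH; case: (g i) => [z|] /=; rewrite ?big_cons ?add0r.
Qed.

(** This count is the origin of the exponent [d / 2] in the moment condition. The cube has half-side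
    [K <= 2 * sqrt U], hence at most [5 * sqrt U] points per side; for [U <= 1] no point
    qualifies. *)
Lemma count_bracket (U : R) (s : seq (Zd d)) : 0 <= U -> uniq s ->
  \sum_(z <- s) (bracket R z ^+ 2 < U)%R%:R <= (5 * Num.sqrt U) ^+ d.
Proof.
move=> U0 us; have [U1|U1] := leP U 1.
  rewrite big1; first by rewrite exprn_ge0// mulr_ge0// sqrtr_ge0.
  move=> z _; rewrite ltNge (le_trans U1)//.
  by rewrite exprn_ege1// bracket_ge1.
have sU : 1 < Num.sqrt U by rewrite -sqrtr1 ltr_sqrt ?(lt_trans ltr01 U1).
pose K := (Num.trunc (Num.sqrt U)).+1.
have KU : K%:R <= 2 * Num.sqrt U.
  have /andP[] := truncn_itv (ltW (lt_trans ltr01 sU)); rewrite /K -natr1; lra.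
have -> : \sum_(z <- s) (bracket R z ^+ 2 < U)%R%:R =
    \sum_(z <- [seq z <- s | bracket R z ^+ 2 < U]) (1 : R).
  by rewrite big_filter [RHS]big_mkcond; apply: eq_bigr => z _; case: ifP.
apply: (@le_trans _ _ (\sum_(f : {ffun 'I_d -> 'I_(2 * K).+1}) (1 : R))).
  apply: (sum_seq_le_cube (F := fun _ => 1 : R)) => //; first exact: filter_uniq.
  move=> z; rewrite mem_filter => /andP[hz _]; apply: cubeP => i; apply: (@coord_le_nat d R).
  apply: ltW; apply: (@lt_trans _ _ (Num.sqrt U)); last by rewrite /K truncnS_gt.
  by rewrite -(@ger0_norm _ (bracket R z)) ?bracket_ge0// -sqrtr_sqr ltr_sqrt// (lt_trans ltr01).
have K5 : (2 * K).+1%:R <= 5 * Num.sqrt U by rewrite -natr1 natrM; lra.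
by rewrite sumr_const card_ffun !card_ord natrX; apply: lerXn2r; rewrite ?nnegrE//; lra.
Qed.

Context (P : probability C R).
Hypothesis P_inv : translation_invariant P.

Definition large_at e u z : set C := [set w | e * bracket R z ^+ 2 < w z (u + z)].

Lemma measurable_large_at e u z : measurable (large_at e u z).
Proof. exact: measurable_cond_gt. Qed.

Lemma large_at_shift e u z : P (large_at e u z) = P [set w | e * bracket R z ^+ 2 < w 0 u].
Proof.
rewrite -[RHS](P_inv z); last exact: measurable_cond_gt.
by congr (P _); apply/seteqP; split=> w; rewrite /large_at /= add0r.
Qed.

Definition large_nth e u n : set C := if pickle_inv n is Some z then large_at e u z else set0.

(** Translation invariance moves each event to the origin. The sum of the probabilities is then the
    expected number of sites [z] with [e * bracket R z ^+ 2 < w 0 u], and this number is at most a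
    multiple of the power of [w 0 u] whose expectation is finite. *)
Lemma large_summable e u : 0 < e -> (\int[P]_w ((w 0 u) `^ (d%:R / 2))%:E < +oo)%E ->
  (\sum_(0 <= n <oo) P (large_nth e u n) < +oo)%E.
Proof.
move=> e0 hm.
pose g n w : R := if pickle_inv n is Some z then (bracket R (z : Zd d) ^+ 2 < w 0%R u / e)%R%:R else 0.
have g0 n w : 0 <= g n w by rewrite /g; case: pickle_inv.
pose D z : set C := [set w | e * bracket R z ^+ 2 < w 0 u].
have mD z : measurable (D z) by exact: measurable_cond_gt.
have gD n z : pickle_inv n = Some z -> g n = \1_(D z).
  move=> nz; apply/funext => w; rewrite /g nz indicE; congr (_%:R).
  rewrite /= ltr_pdivlMr// mulrC; congr (nat_of_bool _).
  by apply/idP/idP; rewrite inE.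
have mg n : measurable_fun setT (fun w => (g n w)%:E).
  apply/measurable_EFinP; case E : (pickle_inv n : option (Zd d)) => [z|].
    by rewrite (gD n z E); exact: measurable_indic.
  rewrite (_ : g n = cst 0); first exact: measurable_cst.
  by apply/funext => w; rewrite /g E.
have PE n : P (large_nth e u n) = (\int[P]_w (g n w)%:E)%E.
  rewrite /large_nth; case E : (pickle_inv n : option (Zd d)) => [z|].
    rewrite large_at_shift -/(D z) -[X in P X]setIT -integral_indic//.
    by apply: eq_integral => w _; rewrite (gD n z E).
  rewrite measure0 integral0_eq// => w _; by rewrite /g E.
under eq_eseriesr do rewrite PE.
rewrite -integral_nneseries//; last by move=> n w _; rewrite lee_fin.
pose M : R := (5 * Num.sqrt e^-1) ^+ d.
have M0 : 0 <= M by rewrite exprn_ge0// mulr_ge0// sqrtr_ge0.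
have mpow : measurable_fun [set: C] (fun w : C => ((w 0 u) `^ (d%:R / 2))%:E).
  apply/measurable_EFinP.
  by apply: (measurableT_comp (f := fun x : R => x `^ (d%:R / 2))); [exact: measurable_powR|exact: measurable_cond].
apply: (@le_lt_trans _ _ (\int[P]_w (M%:E * ((w 0 u) `^ (d%:R / 2))%:E))%E); last first.
  rewrite ge0_integralZl//; first exact: lte_mul_pinfty.
  by move=> w _; rewrite lee_fin powR_ge0.
apply: ge0_le_integral => //.
- by move=> w _; apply: nneseries_ge0 => n _ _; rewrite lee_fin.
- by apply: ge0_emeasurable_sum => // n w _ _; rewrite lee_fin.
- by apply: measurable_funeM.
move=> w _; apply: lime_le; first by apply: is_cvg_nneseries => n _ _; rewrite lee_fin.
near=> n; rewrite sumEFin -EFinM lee_fin /g.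
rewrite (sum_pmap (fun n => pickle_inv n : option (Zd d)) (fun z => (bracket R (z : Zd d) ^+ 2 < w 0%R u / e)%R%:R)).
apply: le_trans (count_bracket _ _) _.
- by rewrite divr_ge0// ?cond_ge0// ltW.
- by apply: (pmap_uniq (@pickle_invK _)); exact: iota_uniq.
rewrite [_ / 2]mulrC powRrM powR12_sqrt ?cond_ge0// powR_mulrn ?sqrtr_ge0//.
by rewrite sqrtrM ?cond_ge0// /M -exprMn mulrAC -mulrA.
Unshelve. all: by end_near.
Qed.

Lemma direction_subquadratic e u : 0 < e -> (\int[P]_w ((w 0%R u) `^ (d%:R / 2))%:E < +oo)%E ->
  {ae P, forall w : C, exists2 r, 1 <= r & forall z, w z (u + z) <= e * (r + bracket R z) ^+ 2}.
Proof.
move=> e0 hm.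
have mL n : measurable (large_nth e u n).
  rewrite /large_nth; case: pickle_inv => // z; exact: measurable_large_at.
have h0 := lim_sup_set_cvg0 mL (large_summable e0 hm).
exists (lim_sup_set (large_nth e u)); split=> //.
  by apply: bigcap_measurable => // n _; apply: bigcup_measurable => k _; exact: mL.
move=> w; apply: contra_notP => nw.
have [n hn] : exists n, forall k, (n <= k)%N -> ~ large_nth e u k w.
  apply: contra_notP nw => hn n _.
  have [k nk hk] : exists2 k, (n <= k)%N & large_nth e u k w.
    apply: contra_notP hn => hk; exists n => k nk hk'; apply: hk; by exists k.
  by exists k.
pose s : seq (Zd d) := pmap pickle_inv (iota 0 n).
have S0 : 0 <= \sum_(z <- s) w z (u + z) / e.
  by apply: sumr_ge0 => z _; rewrite divr_ge0// ?cond_ge0// ltW.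
(* Finitely many bad sites remain; their conductances, divided by [e], are absorbed into the
   radius. *)
exists (1 + \sum_(z <- s) w z (u + z) / e); first by rewrite lerDl.
move=> z; have b1 := @bracket_ge1 d R z; have [nz|zn] := leqP n (pickle z).
  have := hn _ nz; rewrite /large_nth pickleK_inv /large_at /= => /negP; rewrite -leNgt => /le_trans; apply.
  rewrite ler_pM2l// lerXn2r ?nnegrE; lra.
have zs : z \in s.
  rewrite /s mem_pmap; apply/mapP; exists (pickle z); last by rewrite pickleK_inv.
  by rewrite mem_iota.
have : w z (u + z) / e <= \sum_(z <- s) w z (u + z) / e.
  rewrite (big_rem z) //= lerDl; apply: sumr_ge0 => y _.
  by rewrite divr_ge0// ?cond_ge0// ltW.
set S := \sum_(z <- s) _ in S0 *; rewrite ler_pdivrMr// mulrC => /le_trans; apply.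
rewrite ler_pM2l//; nra.
Qed.

Lemma ae_subquadratic : (forall x y, (\int[P]_w ((w x y) `^ (d%:R / 2))%:E < +oo)%E) ->
  {ae P, forall w : C, subquadratic w}.
Proof.
move=> hm.
have h k n : {ae P, forall w : C, if pickle_inv n is Some u then
    exists2 r : R, 1 <= r & forall z, w z (u + z) <= (k.+1%:R^-1 : R) * (r + bracket R z) ^+ 2 else True}.
  case: pickle_inv => [u|]; last by apply: aeW.
  by apply: direction_subquadratic => //; rewrite invr_gt0.
have {}h : {ae P, forall (w : C) k n, if pickle_inv n is Some u then
    exists2 r : R, 1 <= r & forall z, w z (u + z) <= (k.+1%:R^-1 : R) * (r + bracket R z) ^+ 2 else True}.
  by apply: ae_foralln => k; apply: ae_foralln => n; exact: h.
apply: filterS h => w h e e0.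
have [k hk] := exists_nat_gt e^-1.
have ke : k.+1%:R^-1 <= e.
  rewrite invf_ple ?posrE// ?ltr0n//; apply: le_trans (ltW hk) _; by rewrite ler_nat.
have hu u : exists2 r : R, 1 <= r & forall z, w z (u + z) <= e * (r + bracket R z) ^+ 2.
  have := h k (pickle u); rewrite pickleK_inv => -[r r1 hr]; exists r => // z.
  apply: le_trans (hr z) _; rewrite ler_wpM2r// sqr_ge0//.
(* So far there is one radius per direction. An edge has one of finitely many directions, so the
   radii can be added. *)
have hs (s : seq (Zd d)) : exists2 r : R, 1 <= r &
    forall u, u \in s -> forall z, w z (u + z) <= e * (r + bracket R z) ^+ 2.
  elim: s => [|u s [r r1 hr]]; first by exists 1.
  have [r' r'1 hr'] := hu u; exists (r + r'); first lra.
  move=> v; rewrite inE => /predU1P[->|vs] z; have b0 := @bracket_ge0 d R z.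
    apply: le_trans (hr' z) _; rewrite ler_pM2l// lerXn2r ?nnegrE; lra.
  apply: le_trans (hr v vs z) _; rewrite ler_pM2l// lerXn2r ?nnegrE; lra.
have [r r1 hr] := hs (finmap.enum_fset (fset_set [set y : Zd d | adj 0 y])); exists r => // x y.
have [xy|xy] := boolP (adj x y); last first.
  by rewrite cond_nn// mulr_ge0// ?sqr_ge0// ltW.
have := hr (y - x) _ x; rewrite subrK; apply.
rewrite in_fset_set; last exact: (@finite_adj d R 0).
rewrite inE /=; move: xy; rewrite /adj; congr (_ == _); apply: eq_bigr => i _.
by rewrite !mxE sub0r opprB.
Qed.

End environment.

(** * Tempered eigenfunctions *)

Section eigenvalue.
Context {d : nat} {R : realType} {w : conductances d R} (w_sub : subquadratic w).
Local Notation V := (vertex w).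
Local Notation G := (vgraph w_sub).

(** Stated for a real-linear functional so that it applies to the real and to the imaginary part. *)
Lemma laplacian_linear (E : lmodType R) (f : E -> R) (u : V -> E) (x : V) :
  (forall a b, f (a + b) = f a + f b) -> (forall c a, f (c *: a) = c * f a) ->
  f (laplacian u x) = @lap R G (fun y => f (u y)) x.
Proof.
move=> fD fZ; have f0 : f 0 = 0 by rewrite -(scale0r (0 : E)) fZ mul0r.
rewrite /laplacian fsbig_finite//; last exact: finite_nbr.
rewrite (big_morph f fD f0); apply: eq_bigr => y _.
by rewrite fZ fD -scaleN1r fZ mulN1r.
Qed.

Lemma Rcomplex_sqr_norm (z : Rcomplex R) : `|z| ^+ 2 = complex.Re z ^+ 2 + complex.Im z ^+ 2.
Proof. by case: z => a b; rewrite /Num.norm /= sqr_sqrtr// addr_ge0// sqr_ge0. Qed.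

Lemma no_tempered_eigenfunction (lambda : Rcomplex R) (psi : V -> Rcomplex R) :
  ~ (exists2 r : R, 0 <= r & lambda = real_complex R r) -> is_tempered psi ->
  (forall x, laplacian psi x = lambda * psi x) -> forall x, psi x = 0.
Proof.
move=> hl /(tempered_poly w_sub) [A [N [A0 hA]]] hpsi.
have [m [K [K0 hK]]] := @growth_sqnormH d R w w_sub (Rcomplex R).
have /(sqnormH_nat w_sub) hS := hK psi A N _ A0 (leqnn _) hA.
have ReD (a b : Rcomplex R) : complex.Re (a + b) = complex.Re a + complex.Re b by case: a b => ? ? [].
have ImD (a b : Rcomplex R) : complex.Im (a + b) = complex.Im a + complex.Im b by case: a b => ? ? [].
have ReZ (c : R) (a : Rcomplex R) : complex.Re (c *: a) = c * complex.Re a by case: a.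
have ImZ (c : R) (a : Rcomplex R) : complex.Im (c *: a) = c * complex.Im a by case: a.
have hRe x : @lap R G (fun y => complex.Re (psi y)) x = complex.Re lambda * complex.Re (psi x) - complex.Im lambda * complex.Im (psi x).
  rewrite -(@laplacian_linear (Rcomplex R) (@complex.Re R) psi x ReD ReZ) hpsi.
  by case: lambda (psi x) {hl hpsi} => a b [a' b'].
have hIm x : @lap R G (fun y => complex.Im (psi y)) x = complex.Im lambda * complex.Re (psi x) + complex.Re lambda * complex.Im (psi x).
  rewrite -(@laplacian_linear (Rcomplex R) (@complex.Im R) psi x ImD ImZ) hpsi.
  by case: lambda (psi x) {hl hpsi hRe} => a b [a' b'] /=; rewrite addrC.
have hnot : ~ (0 <= complex.Re lambda /\ complex.Im lambda = 0).
  move=> [h1 h2]; apply: hl; exists (complex.Re lambda) => //; move: h2.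
  by case: lambda {hpsi h1 hRe hIm} => a b /= ->.
have hS' : @sum_le R G (fun x => (gbr (w := G) x ^+ (N + m))^-1 ^+ 2 *
    (complex.Re (psi x) ^+ 2 + complex.Im (psi x) ^+ 2)) (A ^+ 2 * K).
  by move: hS; under [X in sum_le X]eq_fun do rewrite Rcomplex_sqr_norm.
move=> x; have := no_eigenfunction hnot hRe hIm hS' x; case: (psi x) => a b /= [-> ->] //.
Qed.

End eigenvalue.

(** * Invariant measures *)

Section expectation.
Context {dT : measure_display} {T : measurableType dT} {R : realType} {P : probability T R}.
Implicit Types (f g : T -> R) (a b c : R).

Definition itg f := P.-integrable setT (EFin \o f).
Definition Ex f : R := \int[P]_x f x.

Lemma itgD f g : itg f -> itg g -> itg (fun x => f x + g x).
Proof. by move=> hf hg; have := integrableD measurableT hf hg. Qed.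

Lemma itgZ c f : itg f -> itg (fun x => c * f x).
Proof. by move=> hf; have := integrableZl measurableT c hf. Qed.

Lemma itgN f : itg f -> itg (fun x => - f x).
Proof. by move=> /(itgZ (-1)); under eq_fun do rewrite mulN1r. Qed.

Lemma itgB f g : itg f -> itg g -> itg (fun x => f x - g x).
Proof. by move=> hf hg; apply: itgD => //; exact: itgN. Qed.

Lemma itg_cst c : itg (fun _ => c).
Proof. exact: finite_measure_integrable_cst. Qed.

Lemma itg_sum (I : eqType) (s : seq I) (F : I -> T -> R) :
  (forall i, i \in s -> itg (F i)) -> itg (fun x => \sum_(i <- s) F i x).
Proof.
elim: s => [|i s IH] h.
  by under eq_fun do rewrite big_nil; exact: itg_cst.
under eq_fun do rewrite big_cons.
apply: itgD; first by apply: h; rewrite mem_head.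
by apply: IH => j js; apply: h; rewrite inE js orbT.
Qed.

Lemma itg_le f g : measurable_fun setT f -> (forall x, `|f x| <= g x) -> itg g -> itg f.
Proof.
move=> mf fg hg; apply: (le_integrable measurableT _ _ hg); first exact/measurable_EFinP.
by move=> x _ /=; rewrite lee_fin (le_trans (fg x))// ler_norm.
Qed.

Lemma ExD f g : itg f -> itg g -> Ex (fun x => f x + g x) = Ex f + Ex g.
Proof. by move=> hf hg; rewrite /Ex RintegralD. Qed.

Lemma ExZ c f : itg f -> Ex (fun x => c * f x) = c * Ex f.
Proof. by move=> hf; rewrite /Ex RintegralZl. Qed.

Lemma ExN f : itg f -> Ex (fun x => - f x) = - Ex f.
Proof. by move=> hf; have := ExZ (-1) hf; under eq_fun do rewrite mulN1r; rewrite mulN1r. Qed.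

Lemma ExB f g : itg f -> itg g -> Ex (fun x => f x - g x) = Ex f - Ex g.
Proof. by move=> hf hg; rewrite ExD ?ExN//; exact: itgN. Qed.

Lemma Ex_cst c : Ex (fun _ => c) = c.
Proof. rewrite /Ex /Rintegral integral_cst//=.
by rewrite [X in (_ * X)%E]probability_setT mule1. Qed.

Lemma Ex_sum (I : eqType) (s : seq I) (F : I -> T -> R) :
  (forall i, i \in s -> itg (F i)) -> Ex (fun x => \sum_(i <- s) F i x) = \sum_(i <- s) Ex (F i).
Proof.
elim: s => [|i s IH] h.
  by under eq_fun do rewrite big_nil; rewrite Ex_cst big_nil.
under eq_fun do rewrite big_cons; rewrite ExD ?IH ?big_cons//.
- by move=> j js; apply: h; rewrite inE js orbT.
- by apply: h; rewrite mem_head.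
- by apply: itg_sum => j js; apply: h; rewrite inE js orbT.
Qed.

Lemma Ex_le f g : itg f -> itg g -> (forall x, f x <= g x) -> Ex f <= Ex g.
Proof. by move=> hf hg fg; apply: le_Rintegral. Qed.

Lemma Ex_ge0 f : (forall x, 0 <= f x) -> 0 <= Ex f.
Proof. by move=> f0; apply: Rintegral_ge0 => x _. Qed.

Lemma itg_mul f g : measurable_fun setT f -> measurable_fun setT g ->
  itg (fun x => f x ^+ 2) -> itg (fun x => g x ^+ 2) -> itg (fun x => f x * g x).
Proof.
move=> mf mg hf hg; apply: (itg_le _ _ (itgD hf hg)); first exact: measurable_funM.
move=> x; rewrite ler_norml; apply/andP; split; have := sqr_ge0 (f x + g x); have := sqr_ge0 (f x - g x);
  have := sqr_ge0 (f x); have := sqr_ge0 (g x); nra.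
Qed.

Lemma Ex_cauchy_schwarz f g : measurable_fun setT f -> measurable_fun setT g ->
  itg (fun x => f x ^+ 2) -> itg (fun x => g x ^+ 2) ->
  Ex (fun x => f x * g x) ^+ 2 <= Ex (fun x => f x ^+ 2) * Ex (fun x => g x ^+ 2).
Proof.
move=> mf mg hf hg; have hfg := itg_mul mf mg hf hg.
set A := Ex (fun x => f x ^+ 2); set B := Ex (fun x => g x ^+ 2); set C := Ex _.
have A0 : 0 <= A by apply: Ex_ge0 => x; exact: sqr_ge0.
have B0 : 0 <= B by apply: Ex_ge0 => x; exact: sqr_ge0.
have q (a b : R) : 0 <= a ^+ 2 * A + 2 * a * b * C + b ^+ 2 * B.
  have : 0 <= Ex (fun x => (a * f x + b * g x) ^+ 2) by apply: Ex_ge0 => x; exact: sqr_ge0.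
  have -> : (fun x => (a * f x + b * g x) ^+ 2) =
    (fun x => (a ^+ 2 * f x ^+ 2 + (2 * a * b) * (f x * g x)) + b ^+ 2 * g x ^+ 2).
    by apply/funext => x; ring.
  by rewrite !ExD ?ExZ//; try exact: itgZ; apply: itgD; exact: itgZ.
have [A00|A00] := eqVneq A 0; last first.
  have Ap : 0 < A by rewrite lt_neqAle eq_sym A00.
  have := q (- C) A.
  have -> : (- C) ^+ 2 * A + 2 * - C * A * C + A ^+ 2 * B = A * (A * B - C ^+ 2) by ring.
  by rewrite pmulr_rge0// subr_ge0.
rewrite A00 mul0r; have [->|C0] := eqVneq C 0; first by rewrite expr0n.
(* For [A = 0] the form is affine in its first argument, and this value would make it negative. *)
have := q (- (B + 1) / C) 1; rewrite A00 mulr0 add0r.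
have -> : 2 * (- (B + 1) / C) * 1 * C + 1 ^+ 2 * B = - 2 * (B + 1) + B by field.
lra.
Qed.

(** The dominating function is extended-valued because the weighted norm it is applied to can be
    infinite at some points. *)
Lemma Ex_dominated (f : nat -> T -> R) g (D : T -> \bar R) :
  (forall n, measurable_fun setT (f n)) -> (forall x, f n x @[n --> \oo] --> g x) ->
  P.-integrable setT D -> (forall n x, (`|f n x|%:E <= D x)%E) ->
  itg g /\ Ex (f n) @[n --> \oo] --> Ex g.
Proof.
move=> mf fg iD fD; have mg : measurable_fun setT g.
  by apply: (measurable_fun_cvg (h := f)) => // x _; exact: fg.
have c1 : {ae P, forall x, setT x -> (f n x)%:E @[n --> \oo] --> (g x)%:E}.
  apply: aeW => x _; apply: cvg_EFin; last exact: fg.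
  by near=> n.
have c2 : {ae P, forall x (n : nat), setT x -> (`|(f n x)%:E| <= D x)%E}.
  by apply: aeW => x n _; exact: fD.
have [ig _ hc] := dominated_convergence (f_ := fun n x => (f n x)%:E) (f := EFin \o g) measurableT
   (fun n => (measurable_EFinP _ _).2 (mf n)) ((measurable_EFinP _ _).2 mg) c1 iD c2.
split=> //; apply: fine_cvg; rewrite fineK; first exact: hc.
exact: integrable_fin_num ig.
Unshelve. all: by end_near.
Qed.

End expectation.

(** * Countably many vertices: null sets and measurability *)

Section countable_vertex.
Context {d : nat} {R : realType} {w : conductances d R}.
Local Notation V := (vertex w).
Context {dT : measure_display} {T : measurableType dT}.

Lemma measurable_forall_vertex (A : V -> set T) : (forall v, measurable (A v)) ->
  measurable [set t | forall v, A v t].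
Proof.
move=> mA; have -> : [set t | forall v, A v t] =
    \bigcap_n [set t | forall v : V, pickle (\val v) = n -> A v t].
  by apply/seteqP; split=> t h v; [move=> _ v' _; exact: h|exact: (h _ I v)].
apply: bigcap_measurable => // n _.
have [[v vn]|h] := pselect (exists v : V, pickle (\val v) = n).
  rewrite (_ : [set _ | _] = A v)//; apply/seteqP; split=> t /=; first by apply.
  by move=> h v'; rewrite -vn => /(pcan_inj pickleK) /val_inj ->.
rewrite (_ : [set _ | _] = setT)//; apply/seteqP; split=> // t _ v vn.
by exfalso; apply: h; exists v.
Qed.

Lemma ae_forall_vertex (mu : {measure set T -> \bar R}) (A : V -> set T) :
  (forall v, {ae mu, forall t, A v t}) -> {ae mu, forall t v, A v t}.
Proof.
move=> hA.
have h : {ae mu, forall t (n : nat) (v : V), pickle (\val v) = n -> A v t}.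
  apply: ae_foralln => n.
  have [[v vn]|h] := pselect (exists v : V, pickle (\val v) = n).
    apply: filterS (hA v) => t At v'; rewrite -vn => /(pcan_inj pickleK) /val_inj -> //.
  by apply: aeW => t v vn; exfalso; apply: h; exists v.
by apply: filterS h => t ht v; exact: (ht _ v erefl).
Qed.

Context (w_sub : subquadratic w).
Local Notation G := (vgraph w_sub).

Lemma esum_box_cvg (f : V -> R) : (forall x, 0 <= f x) ->
  (\sum_(y <- ball_seq w n) f y)%:E @[n --> \oo] --> (\esum_(y in [set: V]) (f y)%:E)%E.
Proof.
move=> f0; set e := (\esum_(y in _) _)%E.
have nd : {homo (fun n => (\sum_(y <- ball_seq w n) f y)%:E) : n m / (n <= m)%N >-> (n <= m)%E}.
  move=> n m nm; rewrite lee_fin; apply: (@sum_sub_le R G) => //; first exact: finmap.fset_uniq.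
  by move=> y; rewrite !mem_ball_seq => /le_trans; apply; rewrite ler_nat.
have := ereal_nondecreasing_cvgn nd; rewrite (_ : ereal_sup _ = e)//.
apply/eqP; rewrite eq_le; apply/andP; split.
  apply: ub_ereal_sup => _ [n _ <-]; rewrite /e -sumEFin.
  apply: esum_ge; exists [set` ball_seq w n]; first by split=> //; exact: finite_seq.
  by rewrite -fsbig_seq//; exact: finmap.fset_uniq.
apply: ub_ereal_sup => _ [A [fA _] <-].
have [n hn] := seq_in_ball (finmap.enum_fset (fset_set A)).
apply: le_trans (ereal_sup_ubound (x := (\sum_(y <- ball_seq w n) f y)%:E) _); last by exists n.
by rewrite fsbig_finite// sumEFin lee_fin; apply: (@sum_sub_le R G).
Qed.

Lemma measurable_sqnormH (N : R) (F : V -> T -> R) : (forall x, measurable_fun setT (F x)) ->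
  measurable_fun setT (fun t => sqnormH N (F ^~ t)).
Proof.
move=> mF; rewrite /sqnormH.
apply: (emeasurable_fun_cvg (fun n t => (\sum_(y <- ball_seq w n)
   bracket R (\val y) `^ (- (2 * N)) * `|F y t| ^+ 2)%:E)).
  move=> n; apply/measurable_EFinP; apply: measurable_sum => y.
  by apply: measurable_funM => //; apply: measurable_funX; apply: measurableT_comp.
move=> t _; apply: (@esum_box_cvg (fun y => bracket R (\val y) `^ (- (2 * N)) * `|F y t| ^+ 2)).
by move=> y; rewrite mulr_ge0 ?sqr_ge0 ?powR_ge0.
Qed.

Lemma measurable_tval (x : V) : measurable_fun [set: tempered w] (fun xi : tempered w => xi x).
Proof. by move=> _ A mA; rewrite setTI; apply: sub_sigma_algebra; exists x, A. Qed.

Lemma measurable_tempered (F : T -> tempered w) : (forall x, measurable_fun setT (fun t => F t x)) ->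
  measurable_fun setT F.
Proof.
move=> mF; apply: (@measurability _ _ _ _ _ _ (tempered_cylinders (w := w))) => //.
by move=> _ [_ [x [B [mB ->]]] <-]; exact: mF.
Qed.

End countable_vertex.

(** * Covariances of iterated Laplacians *)

Section covariance.
Context {R : realType}.

(** Removes an auxiliary weight of arbitrary exponent once the bound no longer depends on its scale
    [D]. *)
Lemma le_of_weight (g A B D0 : R) m : 0 <= g -> 0 <= A ->
  (forall D : R, 0 < D -> D0 <= D -> (D / (D + g)) ^+ m * A <= B) -> A <= B.
Proof.
move=> g0 A0 h; have [n0 hn0] := exists_nat_gt D0.
apply: (@le_of_lim_inv _ _ _ (m%:R * g * A) n0) => n nn0; set D : R := n.+1%:R.
have Dp : 0 < D by rewrite ltr0n.
have DD : D0 <= D by apply: le_trans (ltW hn0) _; rewrite ler_nat ltnW.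
have z01 : 0 <= D / (D + g) <= 1 by rewrite divr_ge0 ?ler_pdivrMr; lra.
have hz : 1 - D / (D + g) <= g / D.
  have -> : 1 - D / (D + g) = g / (D + g) by field; lra.
  by rewrite ler_wpM2l// lef_pV2 ?posrE; lra.
rewrite -lerBlDr; apply: le_trans (h D Dp DD).
apply: le_trans (ler_wpM2r A0 (bernoulli m z01)).
have -> : m%:R * g * A / D = m%:R * (g / D) * A by ring.
by rewrite mulrBl mul1r lerB// ler_wpM2r// ler_wpM2l.
Qed.

(** [c k l x y] abstracts the expectation of the [k]-fold Laplacian at [x] times the [l]-fold
    Laplacian at [y]. The hypotheses record what invariance, the Cauchy-Schwarz inequality and
    [stationary_energy] give for it. *)
Context {G : wgraph R} (c : nat -> nat -> G -> G -> R) (N : nat) (M : R).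
Implicit Types (x y : G) (k l m n : nat).

Hypothesis c_sym : forall k l x y, c k l x y = c l k y x.
Hypothesis c_lap : forall k l x y, c k.+1 l x y = lap (fun z => c k l z y) x.
Hypothesis c_anti0 : forall x y, c 1 0 x y = - c 0 1 x y.
Hypothesis c_ge0 : forall k x, 0 <= c k k x x.
Hypothesis c_cs : forall k l x y, c k l x y ^+ 2 <= c k k x x * c l l y y.
Hypothesis c_energy : forall k n th eta (C : R),
  0 < C -> (forall x, x \notin gbox G n -> th x = 0) -> grad_le th eta C ->
  2 * (\sum_(x <- gbox G n.+1) th x ^+ 2 * c k.+1 k.+1 x x) <=
  C * (2 * (\sum_(x <- gbox G n.+1) th x ^+ 2 * c k k.+1 x x) +
       C * \sum_(x <- gbox G n.+1) eta x ^+ 2 * c k k x x) +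
  \sum_(x <- gbox G n.+1) eta x ^+ 2 * c k.+1 k.+1 x x +
  dsum (gbox G n.+1) (fun x y => th x * th y * (c k.+1 k x x + c k.+1 k y y) -
    (th x ^+ 2 - th x * th y + th y ^+ 2) * (c k.+1 k x y + c k.+1 k y x)).
Hypothesis c_bound : sum_le (fun x => ((gbr x) ^+ N)^-1 ^+ 2 * c 0 0 x x) M.

(** Applying the Laplacian in [x] or in [y] to the relation preserves it, so it spreads from
    [c_anti0] to all orders. On the diagonal, together with [c_sym], it makes [c k.+1 k] vanish. *)
Lemma c_anti k l x y : c k.+1 l x y = - c k l.+1 x y.
Proof.
elim: l k x y => [|l IHl] k x y.
  elim: k x y => [|k IH] x y; first exact: c_anti0.
  rewrite c_lap; under [X in lap X]eq_fun do rewrite IH.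
  rewrite (_ : (fun z => - c k 1 z y) = (fun z => -1 * c k 1 z y)); last by apply/funext => z; rewrite mulN1r.
  by rewrite lapZ mulN1r -c_lap.
rewrite c_sym c_lap; under [X in lap X]eq_fun do rewrite c_sym IHl c_sym.
rewrite (_ : (fun z => - c l.+1 k z x) = (fun z => -1 * c l.+1 k z x)); last by apply/funext => z; rewrite mulN1r.
by rewrite lapZ mulN1r -c_lap c_sym.
Qed.

Lemma c_diag k x : c k.+1 k x x = 0.
Proof. by have := c_anti k k x x; rewrite [in RHS]c_sym; lra. Qed.

(** Moving one Laplacian across turns [c k.+1 k.+1] into minus [c k k.+2], to which Cauchy-Schwarz
    applies. *)
Lemma c_logconvex k x : c k.+1 k.+1 x x ^+ 2 <= c k k x x * c k.+2 k.+2 x x.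
Proof. by rewrite [in X in X <= _]c_anti [in X in X <= _]c_sym sqrrN c_sym; exact: c_cs. Qed.

Lemma c_energy0 k n th eta (C : R) :
  0 < C -> (forall x, x \notin gbox G n -> th x = 0) -> grad_le th eta C ->
  2 * (\sum_(x <- gbox G n.+1) th x ^+ 2 * c k.+1 k.+1 x x) <=
  C ^+ 2 * (\sum_(x <- gbox G n.+1) eta x ^+ 2 * c k k x x) +
  \sum_(x <- gbox G n.+1) eta x ^+ 2 * c k.+1 k.+1 x x.
Proof.
move=> C0 th0 hg; apply: le_trans (c_energy k C0 th0 hg) _.
rewrite big1; last by move=> x _; rewrite c_sym c_diag mulr0.
rewrite mulr0 add0r mulrA -expr2 (_ : dsum _ _ = 0) ?addr0//.
rewrite /dsum big1// => x _; rewrite big1// => y _.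
by rewrite !c_diag addr0 mulr0 sub0r (c_anti k k x y) (c_sym k) addNr mulr0 oppr0 mulr0.
Qed.

Lemma c_growth k l : exists A n, 0 <= A /\ forall x y, `|c k l x y| <= A * gbr x ^+ n * gbr y ^+ n.
Proof.
have base : exists A n, 0 <= A /\ forall x y, `|c 0 0 x y| <= A * gbr x ^+ n * gbr y ^+ n.
  have M0 := sum_le_ge0 c_bound; exists M, N; split=> // x y.
  have h z : c 0 0 z z <= M * (gbr z ^+ N) ^+ 2.
    have := sum_le_pt z c_bound; have g0 : 0 < gbr z ^+ N by rewrite exprn_gt0// gbr_gt0.
    by rewrite exprVn mulrC ler_pdivrMr// exprn_gt0.
  have gx : 0 <= gbr x ^+ N by rewrite exprn_ge0// ltW// gbr_gt0.
  have gy : 0 <= gbr y ^+ N by rewrite exprn_ge0// ltW// gbr_gt0.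
  rewrite -ler_sqr ?nnegrE//; last by rewrite !mulr_ge0.
  rewrite real_normK ?num_real//; apply: le_trans (c_cs 0 0 x y) _.
  have -> : (M * gbr x ^+ N * gbr y ^+ N) ^+ 2 = (M * (gbr x ^+ N) ^+ 2) * (M * (gbr y ^+ N) ^+ 2) by ring.
  by apply: ler_pM.
have step k' l' : (exists A n, 0 <= A /\ forall x y, `|c k' l' x y| <= A * gbr x ^+ n * gbr y ^+ n) ->
    exists A n, 0 <= A /\ forall x y, `|c k'.+1 l' x y| <= A * gbr x ^+ n * gbr y ^+ n.
  move=> [A [n [A0 hA]]]; have [K [K0 hK]] := @lap_growth R G n.
  exists (A * K), (n + 2)%N; split; first exact: mulr_ge0.
  move=> x y; rewrite c_lap; have gy : 0 <= gbr y ^+ n by rewrite exprn_ge0// ltW// gbr_gt0.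
  have h1 : growth (fun z => c k' l' z y) (A * gbr y ^+ n) n by move=> z; rewrite mulrAC.
  apply: le_trans (hK _ _ _ h1 x) _; first exact: mulr_ge0.
  have -> : A * gbr y ^+ n * K * gbr x ^+ (n + 2) = (A * K * gbr x ^+ (n + 2)) * gbr y ^+ n by ring.
  rewrite ler_wpM2l//; first by rewrite !mulr_ge0// exprn_ge0// ltW// gbr_gt0.
  by rewrite ler_weXn2l ?gbr_ge1// leq_addr.
elim: k => [|k]; last exact: step.
elim: l => [//|l IH].
have [A [n [A0 hA]]] := step l 0%N ltac:(by have [A [n [A0 hA]]] := IH; exists A, n; split=> // x y; rewrite c_sym mulrAC).
by exists A, n; split=> // x y; rewrite c_sym mulrAC.
Qed.

(** Each Laplacian raises the growth, so the exponent needed for finiteness may increase with [K].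
    Only finiteness is kept from here. *)
Lemma c_summable K : exists m0, forall j, (j <= K)%N -> forall r D (m : nat), 1 <= r -> r <= D -> (m0 <= m)%N ->
  exists S, sum_le (fun x => weight r D 0 N m x ^+ 2 * c j j x x) S.
Proof.
have one j : exists m0, forall r D (m : nat), 1 <= r -> r <= D -> (m0 <= m)%N ->
    exists S, sum_le (fun x => weight r D 0 N m x ^+ 2 * c j j x x) S.
  have [A [n [A0 hA]]] := c_growth j j; have [m0 [K' [K'0 hK]]] := @growth_sum_le R G.
  exists (n + m0)%N => r D m r1 rD hm.
  have hg : growth (fun x => Num.sqrt (c j j x x)) (Num.sqrt A) n.
    move=> x; rewrite ger0_norm ?sqrtr_ge0//.
    have gx : 0 <= gbr x ^+ n by rewrite exprn_ge0// ltW// gbr_gt0.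
    have -> : gbr x ^+ n = Num.sqrt ((gbr x ^+ n) ^+ 2) by rewrite sqrtr_sqr ger0_norm.
    rewrite -sqrtrM// ler_wsqrtr// expr2 mulrA.
    by apply: le_trans (hA x x); exact: ler_norm.
  exists (Num.sqrt A ^+ 2 * K').
  have D0 : 0 <= D by lra.
  apply: sum_le_mono (hK _ _ n m D (sqrtr_ge0 _) D0 hm hg) => x.
  rewrite sqr_sqrtr// ler_wpM2r// /weight expr0 mul1r; have b1 := gbr_ge1 x.
  have w0 : 0 <= (D + gbr x)^-1 ^+ m by rewrite exprn_ge0// invr_ge0; lra.
  have v0 : 0 <= (r + gbr x)^-1 ^+ N by rewrite exprn_ge0// invr_ge0; lra.
  rewrite ler_sqr ?nnegrE ?mulr_ge0//.
  rewrite ler_piMl// exprn_ile1 ?invr_ge0 ?invf_le1; lra.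
elim: K => [|K [m1 h1]].
  by have [m0 h] := one 0%N; exists m0 => j; rewrite leqn0 => /eqP ->.
have [m2 h2] := one K.+1; exists (maxn m1 m2) => j.
rewrite leq_eqVlt ltnS => /predU1P[->|jK] r D m r1 rD; rewrite geq_max => /andP[hm1 hm2].
  exact: h2.
exact: h1.
Qed.

Lemma c_energy_step k eta (C S : R) : 0 < C -> admissible eta C ->
  sum_le (fun x => eta x ^+ 2 * c k k x x) S ->
  (exists S', sum_le (fun x => eta x ^+ 2 * c k.+1 k.+1 x x) S') ->
  sum_le (fun x => eta x ^+ 2 * c k.+1 k.+1 x x) (C ^+ 2 * S).
Proof.
move=> C0 [eta0 [L0 hL]] hS [S' hS'].
have -> : C ^+ 2 * S = 2 * (C ^+ 2 * S / 2) by field.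
apply: sum_le_halving hS' => S1 hS1.
have f0 x : 0 <= eta x ^+ 2 * c k.+1 k.+1 x x by rewrite mulr_ge0 ?sqr_ge0.
apply: (sum_le_cut (L0 := L0.+1)) => // L LL.
have [th0 hg hle] := cut_setup hL LL.
have := c_energy0 k C0 th0 hg.
have h1 : \sum_(x <- gbox G L.+1) eta x ^+ 2 * c k k x x <= S by apply: hS; exact: gbox_uniq.
have h2 : \sum_(x <- gbox G L.+1) eta x ^+ 2 * c k.+1 k.+1 x x <= S1 by apply: hS1; exact: gbox_uniq.
have -> : \sum_(x <- gbox G L.+1) cut L x ^+ 2 * (eta x ^+ 2 * c k.+1 k.+1 x x) =
    \sum_(x <- gbox G L.+1) (eta x * cut L x) ^+ 2 * c k.+1 k.+1 x x.
  by apply: eq_bigr => x _; ring.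
have := ler_wpM2l (sqr_ge0 C) h1; lra.
Qed.

(** Each Laplacian costs a factor [C ^+ 2]. The auxiliary exponent [m] depends on [k] but disappears
    with [D], while [r] comes from [weight_admissible_unif] and is the same for all [k]; a radius
    depending on [k] could spoil the geometric rate. *)
Lemma c_decay (C : R) : 0 < C -> exists2 r : R, 0 <= r & forall k x,
  c k k x x <= (C ^+ 2) ^+ k * (M * ((r + gbr x) ^+ N) ^+ 2).
Proof.
move=> C0; have [r r1 hr] := @weight_admissible_unif R G N C C0; exists r; first lra.
move=> k x; have [m hm] := c_summable k; have [D0 rD0 hD0] := hr m.
have b1 := gbr_ge1 x; have rx : 0 < (r + gbr x) ^+ N by rewrite exprn_gt0//; lra.
rewrite mulrA -ler_pdivrMr; last by rewrite exprn_gt0.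
apply: (@le_of_weight (gbr x) _ _ D0 (m * 2)%N); [lra| |].
  by rewrite divr_ge0 ?sqr_ge0.
move=> D Dp DD; have rD : r <= D by lra.
have key j : (j <= k)%N -> sum_le (fun y => weight r D 0 N m y ^+ 2 * c j j y y)
    ((C ^+ 2) ^+ j * (M * (D^-1 ^+ m) ^+ 2)).
  elim: j => [_|j IH jk]; last first.
    rewrite exprS -mulrA; apply: c_energy_step => //; first exact: hD0.
      by apply: IH; exact: ltnW.
    exact: hm.
  rewrite expr0 mul1r; have := sum_leZ (sqr_ge0 (D^-1 ^+ m)) c_bound.
  rewrite mulrC; apply: sum_le_mono => y; have by1 := gbr_ge1 y.
  rewrite mulrA ler_wpM2r// -exprMn /weight expr0 mul1r mulrC.
  have i1 : 0 <= (D + gbr y)^-1 ^+ m by rewrite exprn_ge0// invr_ge0; lra.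
  have i2 : 0 <= (r + gbr y)^-1 ^+ N by rewrite exprn_ge0// invr_ge0; lra.
  have i3 : 0 <= D^-1 ^+ m by rewrite exprn_ge0// invr_ge0; lra.
  rewrite -exprVn ler_sqr ?nnegrE ?mulr_ge0//; last by rewrite exprn_ge0// invr_ge0; lra.
  apply: ler_pM => //; apply: lerXn2r; rewrite ?nnegrE ?invr_ge0; try lra.
    by rewrite lef_pV2 ?posrE; lra.
  by rewrite lef_pV2 ?posrE; lra.
have := sum_le_pt x (key k (leqnn _)).
have Dm : 0 < D ^+ m by rewrite exprn_gt0.
have h : (D ^+ m) ^+ 2 * (weight r D 0 N m x ^+ 2 * c k k x x) =
    (D / (D + gbr x)) ^+ (m * 2) * (c k k x x / ((r + gbr x) ^+ N) ^+ 2).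
  rewrite /weight expr0 mul1r exprM expr_div_n !exprVn; field.
  by rewrite !expf_neq0//; lra.
rewrite -h => /(ler_wpM2l (sqr_ge0 (D ^+ m))) /le_trans; apply.
rewrite exprVn le_eqVlt; apply/orP; left; apply/eqP; field.
by rewrite gt_eqF.
Qed.

(** By log-convexity the ratios of consecutive diagonal terms are at least the first ratio [q], so
    the terms grow at least like [q ^+ k]; [c_decay] with [C ^+ 2 = q / 2] contradicts this. *)
Lemma c_zero x : c 1 1 x x = 0.
Proof.
apply/eqP; rewrite eq_le c_ge0 andbT leNgt; apply/negP => a1.
have a0 : 0 < c 0 0 x x.
  rewrite lt_neqAle c_ge0 andbT; apply/eqP => a0.
  have := c_logconvex 0 x; rewrite -a0 mul0r.
  have : 0 < c 1 1 x x ^+ 2 by rewrite exprn_gt0.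
  lra.
pose q := c 1 1 x x / c 0 0 x x; have q0 : 0 < q by rewrite divr_gt0.
have hk k : 0 < c k k x x /\ q * c k k x x <= c k.+1 k.+1 x x.
  elim: k => [|k [p1 p2]]; first by split=> //; rewrite /q divfK// gt_eqF.
  have p3 : 0 < c k.+1 k.+1 x x by apply: lt_le_trans p2; exact: mulr_gt0.
  split=> //; have := c_logconvex k x.
  move=> h; rewrite -(ler_pM2l p1); apply: le_trans h.
  by rewrite mulrA (mulrC (c k k x x)) expr2 ler_wpM2r ?(ltW p3).
have hp k : q ^+ k * c 0 0 x x <= c k k x x.
  elim: k => [|k IH]; first by rewrite expr0 mul1r.
  rewrite exprS -mulrA; apply: le_trans (hk k).2; by rewrite ler_wpM2l// ltW.
have C0 : 0 < Num.sqrt (q / 2) by rewrite sqrtr_gt0 divr_gt0.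
have [r r0 hr] := c_decay C0.
set B := M * ((r + gbr x) ^+ N) ^+ 2 in hr.
have hB k : 2 ^+ k * c 0 0 x x <= B.
  have := le_trans (hp k) (hr k x); rewrite sqr_sqrtr; last by rewrite ltW// divr_gt0.
  have -> : q ^+ k * c 0 0 x x = (q / 2) ^+ k * (2 ^+ k * c 0 0 x x).
    by rewrite mulrA -exprMn divfK.
  by rewrite ler_pM2l// exprn_gt0// divr_gt0.
have [k hk'] := exists_nat_gt (B / c 0 0 x x).
have := hB k; rewrite -ler_pdivlMr// => h.
have : (k%:R : R) <= 2 ^+ k by rewrite -natrX ler_nat ltnW// ltn_expl.
lra.
Qed.

End covariance.

(** * The heat semigroup at short times *)

Section short_time.
Context {R : realType} {G : wgraph R} {p : R -> G -> G -> R}.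
Hypothesis hp : heat_kernel_spec p.
Implicit Types (x y : G) (xi : G -> R) (t : R).
Local Notation heat_sg := (heat_sg (p := p)).

Lemma heat_sg_derive xi x t : poly xi -> 0 < t ->
  is_derive t (1:R) (fun t => heat_sg t xi x) (- lap (heat_sg t xi) x).
Proof.
move=> hx t0; have [cP _ eP] := heat_sg_mild hp hx.
have d1 := path_integral_heat cP eP x t0.
have d2 := is_deriveD d1 (is_derive_cst (xi x) t (1:R)).
have -> : (fun t => heat_sg t xi x) = (fun t => heat_sg t xi x - xi x) \+ cst (xi x).
  by apply/funext => s /=; rewrite subrK.
by apply: (is_derive_eq d2); rewrite addr0.
Qed.

Lemma heat_sg_heat_on xi T : poly xi -> heat_on T [::] (fun t => heat_sg t xi) (fun _ _ => 0).
Proof.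
move=> hx x; have [cP _ eP] := heat_sg_mild hp hx; split; first exact: cP.
by move=> t /andP[t0 _] _; rewrite addr0; exact: heat_sg_derive.
Qed.

(** [B] does not depend on [xi], so the bound can be integrated against a law. The exponent [n] is
    kept: the summability of the evolved function that the energy bound requires comes from a factor
    of scale [D]. *)
Lemma heat_sg_sq_bound n : exists B : R, 0 <= B /\ forall xi s, poly xi ->
  sum_le (fun x => ((gbr x) ^+ n)^-1 ^+ 2 * xi x ^+ 2) s ->
  forall t, 0 <= t <= 1 -> growth (heat_sg t xi) (B * Num.sqrt s) n.
Proof.
have [r r1 hr] := @weight_admissible_unif R G n 1 ltr01.
exists (Num.sqrt (2 * expR 4) * (r + 1) ^+ n); split.
  by rewrite mulr_ge0 ?sqrtr_ge0// exprn_ge0//; lra.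
move=> xi s hx hs t t01 x; have s0 := sum_le_ge0 hs.
have [cP [N' /(_ 1 ler01)[A1 [A10 hA1]]] eP] := heat_sg_mild hp hx.
have [m0 [K [K0 hK]]] := @growth_sum_le R G; pose m := (N' + m0)%N.
have [D0 rD0 hD0] := hr m.
have gx := gbr_ge1 x; have rx : 0 < (r + gbr x) ^+ n by rewrite exprn_gt0//; lra.
have key : heat_sg t xi x ^+ 2 / ((r + gbr x) ^+ n) ^+ 2 <= 2 * s * expR 4.
  apply: (@le_of_weight R (gbr x) _ _ D0 (m * 2)%N); [lra| |].
    by rewrite divr_ge0 ?sqr_ge0.
  move=> D Dp DD; have rD : r <= D by lra.
  have wle y : 0 <= (D + gbr y)^-1 ^+ m /\ 0 <= (r + gbr y)^-1 ^+ n <= 1 /\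
      (r + gbr y)^-1 ^+ n <= (gbr y ^+ n)^-1 /\ (D + gbr y)^-1 ^+ m <= D^-1 ^+ m.
    have gy := gbr_ge1 y.
    split; first by rewrite exprn_ge0// invr_ge0; lra.
    split; first by rewrite exprn_ge0 ?exprn_ile1 ?invr_ge0 ?invf_le1; lra.
    split; rewrite -?exprVn; apply: lerXn2r; rewrite ?nnegrE ?invr_ge0; try lra.
      by rewrite lef_pV2 ?posrE; lra.
    by rewrite lef_pV2 ?posrE; lra.
  have wE y : weight r D 0 n m y = (r + gbr y)^-1 ^+ n * (D + gbr y)^-1 ^+ m by rewrite /weight expr0 mul1r.
  have := @heat_bound R G 1 [::] (fun t => heat_sg t xi) (fun _ _ => 0) (weight r D 0 n m) 1
    (s * (D^-1 ^+ m) ^+ 2) 0 (A1 ^+ 2 * K) ler01 (hD0 D DD) (heat_sg_heat_on 1 hx).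
  rewrite mul0r addr0 => hb.
  have {}hb : sum_le (fun y => weight r D 0 n m y ^+ 2 * heat_sg t xi y ^+ 2)
     (2 * (s * (D^-1 ^+ m) ^+ 2) * expR (2 * (1 + 1) * t)).
    apply: hb t01.
    - rewrite mulrC; apply: sum_le_mono (sum_leZ (sqr_ge0 (D^-1 ^+ m)) hs) => y.
      have [w1 [/andP[w2 _] [w3 w4]]] := wle y.
      rewrite /= (heat_sg0 hp)// [leRHS]mulrA; apply: ler_wpM2r; first exact: sqr_ge0.
      rewrite -exprMn wE mulrC.
      by rewrite ler_sqr ?nnegrE ?mulr_ge0 ?(le_trans w1 w4) ?(le_trans w2 w3)// ler_pM.
    - by move=> q _ s' _; rewrite big1// => y _; rewrite expr0n mulr0.
    - move=> q q01; have D0' : 0 <= D by lra.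
      apply: sum_le_mono (hK _ _ _ m D A10 D0' (leqnn _) (hA1 q q01)) => y.
      have [w1 [/andP[w2 w2'] _]] := wle y.
      by rewrite ler_wpM2r ?sqr_ge0// ler_sqr ?nnegrE ?wE ?mulr_ge0// ler_piMl.
  have := sum_le_pt x hb.
  have Dm : 0 < D ^+ m by rewrite exprn_gt0.
  have h : (D ^+ m) ^+ 2 * (weight r D 0 n m x ^+ 2 * heat_sg t xi x ^+ 2) =
      (D / (D + gbr x)) ^+ (m * 2) * (heat_sg t xi x ^+ 2 / ((r + gbr x) ^+ n) ^+ 2).
    rewrite wE exprM expr_div_n !exprVn; field.
    by rewrite !expf_neq0//; lra.
  rewrite -h => /(ler_wpM2l (sqr_ge0 (D ^+ m))) /le_trans; apply.
  have -> : (D ^+ m) ^+ 2 * (2 * (s * (D^-1 ^+ m) ^+ 2) * expR (2 * (1 + 1) * t)) =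
      2 * s * expR (2 * (1 + 1) * t).
    by rewrite exprVn; field; rewrite gt_eqF.
  by rewrite ler_wpM2l ?mulr_ge0// ler_expR; case/andP: t01 => _; lra.
have rx2 : 0 < ((r + gbr x) ^+ n) ^+ 2 by rewrite (exprn_gt0 2 rx).
move: key; rewrite ler_pdivrMr// => key.
have gxn : 0 <= gbr x ^+ n by rewrite exprn_ge0//; lra.
have rn : 0 <= (r + 1) ^+ n by rewrite exprn_ge0//; lra.
rewrite -ler_sqr ?nnegrE//; last by rewrite !mulr_ge0 ?sqrtr_ge0.
rewrite real_normK ?num_real//; apply: le_trans key _.
have -> : (Num.sqrt (2 * expR 4) * (r + 1) ^+ n * Num.sqrt s * gbr x ^+ n) ^+ 2 =
  Num.sqrt (2 * expR 4) ^+ 2 * Num.sqrt s ^+ 2 * ((r + 1) ^+ n * gbr x ^+ n) ^+ 2 by ring.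
rewrite !sqr_sqrtr ?mulr_ge0 ?expR_ge0// -exprMn [2 * s * _]mulrAC ler_wpM2l ?mulr_ge0 ?expR_ge0//.
have q0 : 0 <= r + gbr x by lra.
have q1 : r + gbr x <= (r + 1) * gbr x by nra.
have q2 := le_trans q0 q1.
by rewrite ler_sqr ?nnegrE ?exprn_ge0//; apply: lerXn2r; rewrite ?nnegrE.
Qed.

(** Supplies the dominating function for difference quotients at time 0. The time derivative is a
    Laplacian, whence two more powers. *)
Lemma heat_sg_short n : exists B : R, 0 <= B /\ forall xi s, poly xi ->
  sum_le (fun x => ((gbr x) ^+ n)^-1 ^+ 2 * xi x ^+ 2) s ->
  forall t x, 0 <= t <= 1 -> `|heat_sg t xi x| <= B * Num.sqrt s * gbr x ^+ (n + 2) /\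
    `|heat_sg t xi x - xi x| <= B * Num.sqrt s * gbr x ^+ (n + 2) * t.
Proof.
have [B [B0 hB]] := heat_sg_sq_bound n; have [K [K0 hK]] := @lap_growth R G n.
exists (B + B * K); split; first by rewrite addr_ge0// mulr_ge0.
move=> xi s hx hs t x t01; have hg := hB xi s hx hs; have gx := gbr_ge1 x.
have s0 : 0 <= Num.sqrt s by exact: sqrtr_ge0.
have gn : 0 <= gbr x ^+ (n + 2) by rewrite exprn_ge0//; lra.
have Bs : 0 <= B * Num.sqrt s by exact: mulr_ge0.
split.
  apply: le_trans (hg t t01 x) _.
  have gnn : gbr x ^+ n <= gbr x ^+ (n + 2) by rewrite ler_weXn2l// leq_addr.
  apply: le_trans (ler_wpM2l Bs gnn) _; rewrite ler_wpM2r// ler_wpM2r// lerDl.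
  exact: mulr_ge0.
have [cP _ eP] := heat_sg_mild hp hx.
have h := @approx_primitive R (fun t => heat_sg t xi x) (fun t => - lap (heat_sg t xi) x)
   (fun _ => 0) [::] 1 (B * Num.sqrt s * K * gbr x ^+ (n + 2)) (cP x 1) (@within_cst R _ 0).
have := h _ t t01; rewrite Rintegral_cst// mul0r subr0 (heat_sg0 hp)// => h'.
apply: le_trans (h' _) _.
  move=> q /andP[q0 q1] _; split; first exact: heat_sg_derive.
  rewrite subr0 normrN; apply: (hK _ _ Bs _ x); apply: hg.
  by rewrite !ltW.
case/andP: t01 => t0 _; rewrite ler_wpM2r// ler_wpM2r//.
by rewrite mulrAC ler_wpM2r// lerDr.
Qed.

Lemma heat_sg_slope xi x : poly xi ->
  (xi x - heat_sg j.+1%:R^-1 xi x) * j.+1%:R @[j --> \oo] --> lap xi x.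
Proof.
move=> hx; have [cP _ eP] := heat_sg_mild hp hx.
apply/cvgrPdist_le => e e0.
have cl : {within `[0, 1], continuous (fun s : R => lap (heat_sg s xi) x)}.
  by apply: lap_within => y; exact: cP.
have : lap (heat_sg s xi) x @[s --> within `[0, 1] (nbhs (0:R))] --> lap xi x.
  have h0 : `[0, 1]%classic (0 : R) by rewrite /= in_itv /= lexx ler01.
  have -> : lap xi x = lap (heat_sg 0 xi) x by rewrite (heat_sg0 hp).
  by have /subspace_continuousP/(_ 0 h0) := cl; exact.
move=> /cvgrPdist_le/(_ e e0); rewrite near_withinE => -[dl /= dl0 hd].
have [j0 hj0] := exists_nat_gt dl^-1; exists (j0 + 1)%N => // j /= jj; set t : R := j.+1%:R^-1.
have jp : 0 < (j.+1%:R : R) by rewrite ltr0n.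
have t0 : 0 < t by rewrite invr_gt0.
have t1 : t <= 1 by rewrite invf_le1// ler1n.
have td : t < dl.
  rewrite /t invf_plt ?posrE//; apply: lt_le_trans hj0 _.
  by rewrite ler_nat (leq_trans _ (leqW jj))// leq_addr.
have ct : {within `[0, t], continuous (fun s => heat_sg s xi x)} by exact: cP.
have h := @approx_primitive R (fun t => heat_sg t xi x) (fun t => - lap (heat_sg t xi) x)
   (fun _ => - lap xi x) [::] t e ct (@within_cst R _ _).
have := h _ t; rewrite Rintegral_cst//= lebesgue_measure_itv /= lte_fin t0 oppr0 adde0 /=.
rewrite (heat_sg0 hp)// (ltW t0) lexx => /(_ _ isT) h'.
have {}h' : `|heat_sg t xi x - xi x - - lap xi x * t| <= e * t.
  apply: h' => q /andP[q0 qt] _; split; first exact: heat_sg_derive.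
  rewrite opprK addrC; apply: hd => /=; last by rewrite in_itv /= (ltW q0) (le_trans (ltW qt)).
  by rewrite sub0r normrN gtr0_norm// (lt_trans qt).
have -> : lap xi x - (xi x - heat_sg t xi x) * j.+1%:R =
    (heat_sg t xi x - xi x - - lap xi x * t) * j.+1%:R.
  by rewrite /t; field; rewrite gt_eqF.
by rewrite normrM (gtr0_norm jp) -ler_pdivlMr.
Qed.

End short_time.

(** * Invariant laws with finite second moments *)

Section invariant_measure.
Context {d : nat} {R : realType} {w : conductances d R} (w_sub : subquadratic w) (X : vsrw w).
Local Notation V := (vertex w).
Local Notation G := (vgraph w_sub).
Local Notation p := (heat_kernel X).
Local Notation hp := (heat_kernelP w_sub X).
Local Notation heat_sg := (heat_sg (G := G) (p := p)).
Local Notation E := (tempered w).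
Implicit Types (x y : V) (t : R) (xi : E) (k l n : nat).

Lemma tempered_eq xi (eta : E) : (forall x, xi x = eta x) -> xi = eta.
Proof.
case: xi eta => [u hu] [v hv] /= uv; have {}uv : u = v by apply/funext.
by rewrite -{v}uv in hv *; congr Tempered; exact: Prop_irrelevance.
Qed.

Lemma heat_flow_tempered t xi : 0 <= t -> is_tempered (heat_sg t xi).
Proof.
move=> t0; apply: (poly_tempered (w_sub := w_sub)); apply/poly_norm.
by apply: (heat_sg_poly hp t0); exact: tval_poly.
Qed.

Definition heat_flow t (t0 : 0 <= t) xi : E := Tempered (heat_flow_tempered xi t0).

Lemma measurable_heat_sg t x : 0 <= t -> measurable_fun [set: E] (fun xi : E => heat_sg t xi x).
Proof.
move=> t0; apply: (measurable_fun_cvg (h := fun n xi => \sum_(y <- gbox G n) p t x y * xi y)).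
  move=> n; apply: measurable_sum => y; apply: measurable_funM => //; exact: measurable_tval.
by move=> xi _; exact: (heat_sg_cvg hp (tval_poly w_sub xi) t0).
Qed.

Lemma measurable_heat_flow t (t0 : 0 <= t) : measurable_fun setT (heat_flow t0).
Proof. by apply: measurable_tempered => x; exact: measurable_heat_sg. Qed.

Definition iter_lap k (u : V -> R) : V -> R := iter k (@lap R G) u.

Lemma iter_lapS k u x : iter_lap k.+1 u x = @lap R G (iter_lap k u) x.
Proof. by []. Qed.

Lemma measurable_iter_lap k x : measurable_fun [set: E] (fun xi : E => iter_lap k xi x).
Proof.
elim: k x => [|k IH] x; first exact: measurable_tval.
apply: measurable_sum => y; apply: measurable_funM => //.
by apply: measurable_funB; [exact: (IH x)|exact: (IH y)].
Qed.

Context (rho : probability E R) (n : nat).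
Hypothesis rho_inv : rw_invariant X rho.
Local Notation S xi := (sqnormH n%:R (tval xi)).
Hypothesis S_finite : (\int[rho]_xi S xi < +oo)%E.

Lemma S_ge0 xi : (0 <= S xi)%E.
Proof. by apply: esum_ge0 => x _; rewrite lee_fin mulr_ge0 ?sqr_ge0 ?powR_ge0. Qed.

Lemma S_integrable : rho.-integrable setT (fun xi => S xi).
Proof.
apply/integrableP; split.
  by apply: (measurable_sqnormH w_sub n%:R (F := fun x (xi : E) => xi x)) => x; exact: measurable_tval.
by under eq_integral do rewrite gee0_abs ?S_ge0//.
Qed.

(** Where the weighted norm is infinite there is nothing to prove; this lets later bounds assume a
    real value [s]. *)
Lemma S_bound (C : R) (f : E -> R) : 0 < C -> (forall xi s,
    @sum_le R G (fun x => ((gbr (w := G) x) ^+ n)^-1 ^+ 2 * xi x ^+ 2) s -> `|f xi| <= C * s) ->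
  forall xi, (`|f xi|%:E <= C%:E * S xi)%E.
Proof.
move=> C0 h xi; have := S_ge0 xi; case ES : (S xi) => [s| |] // _; last first.
  by rewrite gt0_muley ?leey// lte_fin.
rewrite -EFinM lee_fin; apply: h.
have : (S xi <= s%:E)%E by rewrite ES.
move=> /(sqnormH_nat w_sub); apply: sum_le_mono => x.
by rewrite real_normK ?num_real.
Qed.

Lemma itg_of_bound (C : R) (f : E -> R) : 0 < C -> measurable_fun setT f ->
  (forall xi, (`|f xi|%:E <= C%:E * S xi)%E) -> itg (P := rho) f.
Proof.
move=> C0 mf h; apply: (le_integrable measurableT _ _ (integrableZl measurableT C S_integrable)).
  exact/measurable_EFinP.
move=> xi _ /=; rewrite abseM (@gee0_abs _ C%:E) ?lee_fin ?(ltW C0)//.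
by rewrite gee0_abs ?S_ge0.
Qed.

Lemma coord_bound xi s x : @sum_le R G (fun x => ((gbr (w := G) x) ^+ n)^-1 ^+ 2 * xi x ^+ 2) s ->
  xi x ^+ 2 <= (gbr (w := G) x ^+ n) ^+ 2 * s.
Proof.
move=> h; have := @sum_le_pt R G _ _ x h; have g0 : 0 < gbr (w := G) x ^+ n by rewrite exprn_gt0// gbr_gt0.
by rewrite exprVn mulrC ler_pdivrMr ?(exprn_gt0 2 g0) // mulrC.
Qed.

Lemma itg_iter_lap k l x y : itg (P := rho) (fun xi => iter_lap k xi x * iter_lap l xi y).
Proof.
have base a b : itg (P := rho) (fun xi => iter_lap 0 xi a * iter_lap 0 xi b).
  have g0 z : 0 < (gbr (w := G) z ^+ n) ^+ 2 by rewrite !exprn_gt0// gbr_gt0.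
  apply: (@itg_of_bound ((gbr (w := G) a ^+ n) ^+ 2 + (gbr (w := G) b ^+ n) ^+ 2)).
  - exact: addr_gt0.
  - by apply: measurable_funM; exact: measurable_tval.
  apply: S_bound; first exact: addr_gt0.
  move=> xi s hs; have h1 := coord_bound a hs; have h2 := coord_bound b hs.
  rewrite mulrDl; apply: le_trans (lerD h1 h2); rewrite /iter_lap /=.
  rewrite ler_norml; apply/andP; split; have := sqr_ge0 (xi a + xi b); have := sqr_ge0 (xi a - xi b);
    have := sqr_ge0 (xi a); have := sqr_ge0 (xi b); nra.
have base2 a b j : itg (P := rho) (fun xi => iter_lap 0 xi a * iter_lap j xi b).
  elim: j b => [|j IH] b; first exact: base.
  rewrite (_ : (fun _ => _) = (fun xi : E => \sum_(z <- gnb (w := G) b) gw (w := G) b z *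
      (iter_lap 0 xi a * iter_lap j xi b - iter_lap 0 xi a * iter_lap j xi z))).
    by apply: itg_sum => z _; apply: itgZ; exact: itgB.
  by apply/funext => xi; rewrite iter_lapS /lap mulr_sumr; apply: eq_bigr => z _; ring.
elim: k x => [|k IH] x; first exact: base2.
rewrite (_ : (fun _ => _) = (fun xi : E => \sum_(z <- gnb (w := G) x) gw (w := G) x z *
    (iter_lap k xi x * iter_lap l xi y - iter_lap k xi z * iter_lap l xi y))).
  by apply: itg_sum => z _; apply: itgZ; exact: itgB.
by apply/funext => xi; rewrite iter_lapS /lap mulr_suml; apply: eq_bigr => z _; ring.
Qed.

Definition cov k l x y : R := Ex (P := rho) (fun xi => iter_lap k xi x * iter_lap l xi y).

Lemma cov_sym k l x y : cov k l x y = cov l k y x.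
Proof. by rewrite /cov; under eq_fun do rewrite mulrC. Qed.

Lemma cov_lap k l x y : cov k.+1 l x y = @lap R G (fun z => cov k l z y) x.
Proof.
rewrite /cov (_ : (fun _ => _) = (fun xi : E => \sum_(z <- gnb (w := G) x) gw (w := G) x z *
    (iter_lap k xi x * iter_lap l xi y - iter_lap k xi z * iter_lap l xi y))); last first.
  by apply/funext => xi; rewrite iter_lapS /lap mulr_suml; apply: eq_bigr => z _; ring.
rewrite Ex_sum; last by move=> z _; apply: itgZ; apply: itgB; exact: itg_iter_lap.
apply: eq_bigr => z _; rewrite ExZ ?ExB//; try exact: itg_iter_lap.
by apply: itgB; exact: itg_iter_lap.
Qed.

Lemma cov_ge0 k x : 0 <= cov k k x x.
Proof. by apply: Ex_ge0 => xi; rewrite -expr2 sqr_ge0. Qed.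

Lemma cov_cs k l x y : cov k l x y ^+ 2 <= cov k k x x * cov l l y y.
Proof.
apply: Ex_cauchy_schwarz; try exact: measurable_iter_lap.
  exact: (itg_iter_lap k k x x).
exact: (itg_iter_lap l l y y).
Qed.

Lemma cov_bound : @sum_le R G (fun x => ((gbr (w := G) x) ^+ n)^-1 ^+ 2 * cov 0 0 x x)
  (fine (\int[rho]_xi S xi)).
Proof.
move=> s us; pose F x (xi : E) := ((gbr (w := G) x) ^+ n)^-1 ^+ 2 * (iter_lap 0 xi x * iter_lap 0 xi x).
have iF x : itg (P := rho) (F x) by apply: itgZ; exact: itg_iter_lap.
have -> : \sum_(x <- s) ((gbr (w := G) x) ^+ n)^-1 ^+ 2 * cov 0 0 x x = Ex (P := rho) (fun xi => \sum_(x <- s) F x xi).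
  rewrite Ex_sum//; apply: eq_bigr => x _; rewrite ExZ//; exact: itg_iter_lap.
have Sfin : (\int[rho]_xi S xi)%E \is a fin_num.
  by rewrite ge0_fin_numE//; apply: integral_ge0 => xi _; exact: S_ge0.
have isum : itg (P := rho) (fun xi => \sum_(x <- s) F x xi) by apply: itg_sum.
rewrite /Ex /Rintegral; apply: fine_le => //; first exact: integrable_fin_num.
apply: ge0_le_integral => //.
- move=> xi _; rewrite lee_fin; apply: sumr_ge0 => x _; by rewrite mulr_ge0 ?sqr_ge0// -expr2 sqr_ge0.
- exact: measurable_int isum.
- exact: measurable_int S_integrable.
move=> xi _; case ES : (S xi) => [r| |] /=; rewrite ?leey//; last by have := S_ge0 xi; rewrite ES.
have : (S xi <= r%:E)%E by rewrite ES.
rewrite lee_fin => /(sqnormH_nat w_sub)/(_ s us); rewrite le_eqVlt => h.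
rewrite le_eqVlt; move: h; congr (_ || _); [congr (_ == _)|congr (_ < _)];
  by apply: eq_bigr => x _; rewrite real_normK ?num_real// expr2.
Qed.

Lemma cov_energy k (m : nat) (th eta : V -> R) (C : R) :
  0 < C -> (forall x, x \notin gbox G m -> th x = 0) -> @grad_le R G th eta C ->
  2 * (\sum_(x <- gbox G m.+1) th x ^+ 2 * cov k.+1 k.+1 x x) <=
  C * (2 * (\sum_(x <- gbox G m.+1) th x ^+ 2 * cov k k.+1 x x) +
       C * \sum_(x <- gbox G m.+1) eta x ^+ 2 * cov k k x x) +
  \sum_(x <- gbox G m.+1) eta x ^+ 2 * cov k.+1 k.+1 x x +
  dsum (gbox G m.+1) (fun x y : G => th x * th y * (cov k.+1 k x x + cov k.+1 k y y) -
    (th x ^+ 2 - th x * th y + th y ^+ 2) * (cov k.+1 k x y + cov k.+1 k y x)).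
Proof.
move=> C0 th0 hg.
pose Z i j x y (xi : E) := iter_lap i xi x * iter_lap j xi y.
have iZ i j x y : itg (P := rho) (Z i j x y) by exact: itg_iter_lap.
pose F a i j (xi : E) := \sum_(x <- gbox G m.+1) a x ^+ 2 * Z i j x x xi.
have iF a i j : itg (P := rho) (F a i j) by apply: itg_sum => x _; exact: itgZ.
have EF a i j : Ex (P := rho) (F a i j) = \sum_(x <- gbox G m.+1) a x ^+ 2 * cov i j x x.
  rewrite Ex_sum; last by move=> x _; exact: itgZ.
  by apply: eq_bigr => x _; rewrite ExZ.
pose D (xi : E) := \sum_(x <- gbox G m.+1) \sum_(y <- gbox G m.+1) gw (w := G) x y *
   (th x * th y * (Z k.+1 k x x xi + Z k.+1 k y y xi) -
    (th x ^+ 2 - th x * th y + th y ^+ 2) * (Z k.+1 k x y xi + Z k.+1 k y x xi)).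
have iD0 x y : itg (P := rho) (fun xi => th x * th y * (Z k.+1 k x x xi + Z k.+1 k y y xi) -
    (th x ^+ 2 - th x * th y + th y ^+ 2) * (Z k.+1 k x y xi + Z k.+1 k y x xi)).
  by apply: itgB; apply: itgZ; exact: itgD.
have iD1 x : itg (P := rho) (fun xi => \sum_(y <- gbox G m.+1) gw (w := G) x y *
   (th x * th y * (Z k.+1 k x x xi + Z k.+1 k y y xi) -
    (th x ^+ 2 - th x * th y + th y ^+ 2) * (Z k.+1 k x y xi + Z k.+1 k y x xi))).
  by apply: itg_sum => y _; exact: itgZ.
have iD : itg (P := rho) D by apply: itg_sum => x _.
have ED : Ex (P := rho) D = dsum (gbox G m.+1) (fun x y : G => th x * th y * (cov k.+1 k x x + cov k.+1 k y y) -
    (th x ^+ 2 - th x * th y + th y ^+ 2) * (cov k.+1 k x y + cov k.+1 k y x)).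
  rewrite /D Ex_sum//; apply: eq_bigr => x _; rewrite Ex_sum; last by move=> y _; exact: itgZ.
  apply: eq_bigr => y _; rewrite ExZ// ExB; try (by apply: itgZ; exact: itgD).
  by rewrite !ExZ ?ExD//; exact: itgD.
have h xi : 2 * F th k.+1 k.+1 xi <=
    C * (2 * F th k k.+1 xi + C * F eta k k xi) + F eta k.+1 k.+1 xi + D xi.
  exact: (@stationary_energy R G m th eta C (iter_lap k xi) (iter_lap k.+1 xi) C0 th0 hg (fun x => erefl)).
have i1 : itg (P := rho) (fun xi => 2 * F th k k.+1 xi + C * F eta k k xi) by apply: itgD; exact: itgZ.
have i2 : itg (P := rho) (fun xi => C * (2 * F th k k.+1 xi + C * F eta k k xi) + F eta k.+1 k.+1 xi).
  by apply: itgD => //; exact: itgZ.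
have := Ex_le (itgZ 2 (iF th k.+1 k.+1)) (itgD i2 iD) h.
rewrite ExZ// ExD// ED ExD//; last exact: itgZ.
rewrite [Ex (fun xi => C * _)]ExZ// ExD//; try exact: itgZ.
by rewrite !ExZ// !EF.
Qed.

(** [rw_invariant] speaks of the existence of a tempered image; [heat_flow] supplies that image, so
    invariance becomes equality with a push-forward. *)
Lemma invariant_Ex t (t0 : 0 <= t) (f : E -> R) : measurable_fun setT f ->
  itg (P := rho) (f \o heat_flow t0) -> Ex (P := rho) (f \o heat_flow t0) = Ex (P := rho) f.
Proof.
move=> mf hf; rewrite /Ex /Rintegral; congr fine.
have mh := measurable_heat_flow t0.
have := @integral_pushforward _ _ _ _ _ _ mh rho setT (EFin \o f).
rewrite preimage_setT => /(_ _ hf measurableT) <-; last exact/measurable_EFinP.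
apply: eq_measure_integral => A mA _; apply: (etrans _ (rho_inv t0 mA)); rewrite /pushforward; congr (rho _).
apply/seteqP; split=> xi /=.
  move=> h; exists (heat_flow t0 xi) => //.
  by rewrite (rw_semigroupE (w_sub := w_sub))//; exact: tval_poly.
move=> [eta Aeta]; rewrite (rw_semigroupE (w_sub := w_sub))//; last exact: tval_poly.
move=> e; suff -> : heat_flow t0 xi = eta by [].
by apply: tempered_eq => x; rewrite /= e.
Qed.

(** Along the times [1 / (j + 1)] the difference quotients of the product [xi x * xi y] have mean
    zero by invariance and are dominated by a multiple of the weighted norm; [g] is their limit. *)
Lemma cov_anti0 x y : cov 1 0 x y = - cov 0 1 x y.
Proof.
have [B [B0 hB]] := heat_sg_short hp n.
pose tm j : R := j.+1%:R^-1.
have tm0 j : 0 <= tm j by rewrite invr_ge0.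
have tm1 j : 0 <= tm j <= 1 by rewrite tm0 invf_le1// ler1n.
pose u j z (xi : E) := heat_sg (tm j) xi z.
pose f j (xi : E) := (xi x * xi y - u j x xi * u j y xi) * j.+1%:R.
have mu_ j z : measurable_fun setT (u j z) by exact: measurable_heat_sg.
have mf j : measurable_fun setT (f j).
  apply: measurable_funM => //; apply: measurable_funB; apply: measurable_funM => //; exact: measurable_tval.
(* [q z] bounds at once the value at [z], its evolution and its difference quotient, in units of the
   square root of the weighted norm. *)
pose q z := B * gbr (w := G) z ^+ (n + 2) + gbr (w := G) z ^+ n.
have gx z : 1 <= gbr (w := G) z by exact: gbr_ge1.
have ge z k : 0 < gbr (w := G) z ^+ k by rewrite exprn_gt0// gbr_gt0.
have q0 z : 0 < q z by rewrite ltr_wpDl// mulr_ge0// ltW.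
pose C := 2 * q x * q y; have C0 : 0 < C by rewrite !mulr_gt0.
have bnd (xi : E) s : @sum_le R G (fun x => ((gbr (w := G) x) ^+ n)^-1 ^+ 2 * xi x ^+ 2) s -> forall j z,
    [/\ `|xi z| <= q z * Num.sqrt s, `|u j z xi| <= q z * Num.sqrt s
      & `|xi z - u j z xi| * j.+1%:R <= q z * Num.sqrt s].
  move=> hs j z; have s0 := sum_le_ge0 hs; have ss0 := sqrtr_ge0 s.
  have [h1 h2] := hB _ _ (tval_poly w_sub xi) hs _ z (tm1 j).
  have jp : 0 < (j.+1%:R : R) by rewrite ltr0n.
  have h3 : `|xi z| <= gbr (w := G) z ^+ n * Num.sqrt s.
    have g1 := ltW (ge z n); have g2 := mulr_ge0 g1 ss0.
    have h := coord_bound z hs; rewrite -ler_sqr ?nnegrE//.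
    by rewrite real_normK ?num_real// exprMn sqr_sqrtr.
  have g1 := ge z n; have g2 := ge z (n + 2)%N.
  have p1 : 0 <= B * gbr (w := G) z ^+ (n + 2) * Num.sqrt s by rewrite !mulr_ge0// ltW.
  have p2 : 0 <= gbr (w := G) z ^+ n * Num.sqrt s by rewrite !mulr_ge0// ltW.
  have p3 : B * Num.sqrt s * gbr (w := G) z ^+ (n + 2) = B * gbr (w := G) z ^+ (n + 2) * Num.sqrt s by ring.
  rewrite /q !mulrDl; split.
  - by apply: le_trans h3 _; rewrite lerDr.
  - by apply: le_trans h1 _; rewrite p3 lerDl.
  - rewrite distrC -ler_pdivlMr//; apply: le_trans h2 _; rewrite p3 -/(tm j).
    by rewrite ler_wpM2r// lerDl.
have fb j xi : (`|f j xi|%:E <= C%:E * S xi)%E.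
  apply: S_bound => // {}xi s hs; have s0 := sum_le_ge0 hs; have ss0 := sqrtr_ge0 s.
  have [a1 a2 a3] := bnd xi s hs j x; have [b1 b2 b3] := bnd xi s hs j y.
  have -> : f j xi = (xi x - u j x xi) * j.+1%:R * xi y + u j x xi * ((xi y - u j y xi) * j.+1%:R).
    by rewrite /f; ring.
  apply: le_trans (ler_normD _ _) _; rewrite !normrM normr_nat.
  have sE : s = Num.sqrt s * Num.sqrt s by rewrite -expr2 sqr_sqrtr.
  have -> : C * s = (q x * Num.sqrt s) * (q y * Num.sqrt s) + (q x * Num.sqrt s) * (q y * Num.sqrt s).
    by rewrite /C {1}sE; ring.
  by apply: lerD; apply: ler_pM => //; rewrite mulr_ge0.
have if_ j : itg (P := rho) (f j) by exact: itg_of_bound (fb j).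
have ixy : itg (P := rho) (fun xi : E => xi x * xi y) by exact: (itg_iter_lap 0 0 x y).
have iu j : itg (P := rho) (fun xi => u j x xi * u j y xi).
  rewrite (_ : (fun _ => _) = (fun xi : E => xi x * xi y - (tm j) * f j xi)).
    by apply: itgB => //; exact: itgZ.
  by apply/funext => xi; rewrite /f /tm; field; rewrite gt_eqF// ltr0n.
have Ef j : Ex (P := rho) (f j) = 0.
  rewrite /f; under eq_fun do rewrite mulrC; rewrite ExZ; last exact: itgB.
  rewrite ExB//; have := @invariant_Ex _ (tm0 j) (fun xi : E => xi x * xi y) _ (iu j).
  rewrite /comp /= => ->; first by rewrite subrr mulr0.
  by apply: measurable_funM; exact: measurable_tval.
pose g (xi : E) := iter_lap 1 xi x * iter_lap 0 xi y + iter_lap 0 xi x * iter_lap 1 xi y.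
have cf xi : f j xi @[j --> \oo] --> g xi.
  have -> : f ^~ xi = (fun j => (xi x - u j x xi) * j.+1%:R * xi y + u j x xi * ((xi y - u j y xi) * j.+1%:R)).
    by apply/funext => j; rewrite /f; ring.
  have hx := tval_poly w_sub xi.
  have s1 := heat_sg_slope hp (x := x) hx; have s2 := heat_sg_slope hp (x := y) hx.
  have cu : u j x xi @[j --> \oo] --> xi x.
    have -> : (fun j => u j x xi) = (fun j => xi x - ((xi x - heat_sg j.+1%:R^-1 xi x) * j.+1%:R) * (harmonic j)).
      by apply/funext => j; rewrite /u /tm /harmonic /= mulfK ?pnatr_eq0 // subKr.
    rewrite -[X in _ --> X]subr0 -[X in _ - X](mulr0 (@lap R G xi x)).
    by apply: cvgB; [exact: cvg_cst|apply: cvgM => //; exact: cvg_harmonic].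
  apply: cvgD; first by apply: cvgM => //; exact: cvg_cst.
  exact: cvgM cu s2.
have mg : measurable_fun setT g.
  by apply: measurable_funD; apply: measurable_funM; exact: measurable_iter_lap.
have [_ hc] := Ex_dominated mf cf (integrableZl measurableT C S_integrable) fb.
have : Ex (P := rho) g = 0.
  by move: hc; under eq_fun do rewrite Ef; move=> h; apply: (cvg_unique _ h) => //; exact: cvg_cst.
rewrite ExD; try exact: itg_iter_lap.
by rewrite -/(cov 1 0 x y) -/(cov 0 1 x y); lra.
Qed.

Lemma ae_harmonic x : {ae rho, forall xi : E, @lap R G xi x = 0}.
Proof.
have h := @c_zero R G cov n _ cov_sym cov_lap cov_anti0 cov_ge0 cov_cs cov_energy cov_bound x.
have m1 := measurable_iter_lap 1 x.
have hi : (\int[rho]_xi `|((iter_lap 1 xi x) ^+ 2)%:E| = 0)%E.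
  transitivity (\int[rho]_xi ((iter_lap 1 xi x) ^+ 2)%:E)%E.
    by apply: eq_integral => xi _; rewrite gee0_abs// lee_fin sqr_ge0.
  move: h; rewrite /cov /Ex /Rintegral => h.
  by rewrite -[LHS]fineK ?[fine _]h//; apply: integrable_fin_num => //; exact: (itg_iter_lap 1 1 x x).
have /ae_eq_integral_abs : measurable_fun setT (fun xi : E => ((iter_lap 1 xi x) ^+ 2)%:E).
  by apply/measurable_EFinP; exact: measurable_funX.
move=> /(_ rho measurableT) [/(_ hi) + _]; apply: filterS => xi /(_ I) [] /eqP.
by rewrite sqrf_eq0 => /eqP.
Qed.

(** A harmonic tempered function is itself a solution constant in time, and solutions of polynomial
    growth are unique. *)
Lemma ae_stationary t : 0 <= t -> {ae rho, forall xi : E, rw_semigroup X t xi = xi}.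
Proof.
move=> t0; have := ae_forall_vertex ae_harmonic; apply: filterS => xi h.
have hx := tval_poly w_sub xi; rewrite (rw_semigroupE (w_sub := w_sub))//; apply/esym.
apply: (heat_sg_unique hp hx _ t0 (Phi := fun _ => xi)); split.
- by move=> x T; exact: within_cst.
- have [A [N [A0 hA]]] := hx; exists N => T _; exists A; split=> //.
- move=> s x _; under eq_Rintegral do rewrite h.
  by rewrite Rintegral_cst// mul0r subr0.
Qed.

Lemma stationary_one t : 0 <= t -> rho [set xi : E | rw_semigroup X t xi = xi] = 1%E.
Proof.
move=> t0; have mA : measurable [set xi : E | rw_semigroup X t xi = xi].
  rewrite (_ : [set _ | _] = [set xi : E | forall x, heat_sg t xi x - xi x = 0]).
    apply: measurable_forall_vertex => x.
    rewrite -[X in measurable X]setTI.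
    have : measurable_fun setT (fun xi : E => heat_sg t xi x - xi x).
      by apply: measurable_funB; [exact: measurable_heat_sg|exact: measurable_tval].
    by move=> /(_ measurableT [set 0]); apply; exact: measurable_set1.
  apply/seteqP; split=> xi /=; have hx := tval_poly w_sub xi; rewrite (rw_semigroupE (w_sub := w_sub))//.
    by move=> e x; rewrite e subrr.
  by move=> e; apply/funext => x; have /eqP := e x; rewrite subr_eq0 => /eqP.
have [N [mN N0 hN]] := ae_stationary t0.
apply/eqP; rewrite eq_le probability_le1//=.
have := probability_setC rho mA; have -> : rho (~` [set xi : E | rw_semigroup X t xi = xi]) = 0%E.
  by apply: (@subset_measure0 _ _ _ _ _ N) => //; exact: measurableC.
move=> /esym; set a := rho _ => h; rewrite leNgt; apply/negP => a1.
have afin : a \is a fin_num by exact: fin_num_measure.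
by move: h a1; rewrite -(fineK afin) -EFinB lte_fin => -[]; lra.
Qed.

End invariant_measure.

Lemma no_invariant_measure {d : nat} {R : realType} {w : conductances d R} (w_sub : subquadratic w)
  (X : vsrw w) (rho : probability (tempered w) R) (T N : R) : rw_invariant X rho -> 0 < T ->
  (rho [set xi : tempered w | rw_semigroup X T xi = xi] < 1)%E -> 0 <= N ->
  (\int[rho]_xi sqnormH N (xi : vertex w -> R) < +oo)%E -> False.
Proof.
move=> hinv T0 hT N0 hN; have [n hn] := exists_nat_gt N.
have mS M : measurable_fun setT (fun xi : tempered w => sqnormH M (tval xi)).
  by apply: (measurable_sqnormH w_sub M (F := fun x (xi : tempered w) => xi x)) => x; exact: measurable_tval.
have hS : (\int[rho]_xi sqnormH n%:R (tval xi) < +oo)%E.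
  apply: le_lt_trans hN; apply: ge0_le_integral => //.
  - by move=> xi _; apply: esum_ge0 => x _; rewrite lee_fin mulr_ge0 ?sqr_ge0 ?powR_ge0.
  - by move=> xi _; apply: sqnormH_mono; exact: ltW.
have e := stationary_one w_sub hinv hS (ltW T0).
by have := eq_ind _ (fun z : \bar R => (z < 1)%E) hT _ e; rewrite ltxx.
Qed.

(** * Brownian increments *)

Section normal.
Context {R : realType}.
Local Notation mu := (@lebesgue_measure R).

Lemma normal_prob_integral (s : R) (f : R -> \bar R) : measurable_fun setT f -> (forall x, 0 <= f x)%E ->
  (\int[normal_prob 0%R s]_x f x = \int[mu]_x (f x * (normal_pdf 0%R s x)%:E))%E.
Proof.
move=> mf f0; have dom := normal_prob_dominates (0 : R) s.
rewrite -(Radon_Nikodym_SigmaFinite.change_of_variables dom)//.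
have irn := Radon_Nikodym_SigmaFinite.f_integrable dom.
have ipdf := integrable_normal_pdf (0 : R) s.
have ae : ae_eq mu setT (Radon_Nikodym_SigmaFinite.f (normal_prob 0 s) mu) (fun x => (normal_pdf 0 s x)%:E).
  apply: integral_ae_eq => //; first exact: measurable_int ipdf.
  by move=> E _ mE; rewrite -Radon_Nikodym_SigmaFinite.f_integral.
apply: ae_eq_integral => //.
- by apply: emeasurable_funM => //; exact: measurable_int irn.
- by apply: emeasurable_funM => //; exact: measurable_int ipdf.
- by apply: filterS ae => x h /h ->.
Qed.

Lemma normal_fun_even (s x : R) : normal_pdf 0 s (- x) = normal_pdf 0 s x \/ s = 0.
Proof.
have [->|s0] := eqVneq s 0; [by right|left].
by rewrite !normal_pdfE// /normal_fun !subr0 sqrrN.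
Qed.

Lemma normal_sym (s : R) (A : set R) : s != 0 -> measurable A ->
  normal_prob 0 s (-%R @^-1` A) = normal_prob 0 s A.
Proof.
move=> s0 mA.
have mN : measurable_fun [set: measurableTypeR R] (-%R : measurableTypeR R -> R) by exact: oppr_measurable.
have mI : measurable_fun [set: measurableTypeR R] (fun x : measurableTypeR R => x : R) by exact: measurable_id.
have h := ray_measure_unique (m1 := pushforward (normal_prob (0 : R) s) (fun x : measurableTypeR R => x : R))
  (m2 := pushforward (normal_prob (0 : R) s) (-%R : measurableTypeR R -> R)).
apply/esym; apply: h mA; last first.
  exact: (eq_ind_r (fun z : \bar R => (z < +oo)%E) (ltry 1) (@probability_setT _ _ _ (normal_prob (0 : R) s))).
move=> b; transitivity (normal_prob 0 s `]b, +oo[%classic); first by [].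
transitivity (normal_prob 0 s `]-oo, - b[%classic); last first.
  congr (normal_prob 0 s _).
  by apply/seteqP; split=> x /=; rewrite !in_itv /= andbT ltrNr.
rewrite /normal_prob /=.
have mpdf (D : set R) : measurable_fun D (fun x => (normal_pdf 0 s x)%:E).
  by apply: (measurable_funS measurableT (@subsetT _ _)); apply/measurable_EFinP; exact: measurable_normal_pdf.
rewrite (integral_itv_obnd_cbnd (mpdf _)) (integral_itv_bndo_bndc (mpdf _)).
rewrite (ge0_integration_by_substitutionNy (G := normal_pdf 0 s)).
- apply: eq_integral => x _ /=; congr (_%:E).
  by have [->|] := normal_fun_even s x => // /eqP; rewrite (negPf s0).
- by apply: continuous_subspaceT; exact: continuous_normal_pdf.
- by move=> x _; exact: normal_pdf_ge0.
Qed.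

(** Only the order of magnitude in [v] matters. With [u = x ^+ 2 / (4 * v)] and
    [u * expR (- u) <= 1], the integrand is at most [4 * sqrt 2 * v] times the density of variance
    [2 * v], and [4 * sqrt 2 <= 6]. *)
Lemma normal_second_moment (v : R) : 0 < v ->
  (\int[normal_prob 0%R (Num.sqrt v)]_x (x ^+ 2)%:E <= (6 * v)%:E)%E.
Proof.
move=> v0; pose s := Num.sqrt v; pose s2 := Num.sqrt (2 * v).
have s0 : s != 0 by rewrite sqrtr_eq0 -ltNge.
have s20 : s2 != 0 by rewrite sqrtr_eq0 -ltNge mulr_gt0.
have sv : s ^+ 2 = v by rewrite sqr_sqrtr// ltW.
have s2v : s2 ^+ 2 = 2 * v by rewrite sqr_sqrtr// mulr_ge0// ltW.
rewrite normal_prob_integral//; last 2 first.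
- by apply/measurable_EFinP; exact: measurable_funX.
- by move=> x; rewrite lee_fin sqr_ge0.
pose K : R := 4 * Num.sqrt 2 * v.
have K0 : 0 <= K by rewrite !mulr_ge0 ?sqrtr_ge0// ltW.
apply: (@le_trans _ _ (\int[mu]_x (K%:E * (normal_pdf 0%R s2 x)%:E))%E).
  apply: ge0_le_integral => //.
  - by move=> x _; rewrite mule_ge0 ?lee_fin ?sqr_ge0 ?normal_pdf_ge0.
  - apply: emeasurable_funM; apply/measurable_EFinP; first exact: measurable_funX.
    exact: measurable_normal_pdf.
  - by apply: measurable_funeM; apply/measurable_EFinP; exact: measurable_normal_pdf.
  move=> x _; rewrite -!EFinM lee_fin !normal_pdfE// /normal_fun !subr0 -/s sv s2v.
  have peakE : normal_peak s = Num.sqrt 2 * normal_peak s2.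
    rewrite /normal_peak sv s2v.
    have -> : 2 * v * pi *+ 2 = 2 * (v * pi *+ 2) by rewrite mulrnAr mulrA.
    by rewrite sqrtrM// invfM mulrA divff ?mul1r//.
  have p0 : 0 <= Num.sqrt 2 * normal_peak s2 by rewrite mulr_ge0 ?sqrtr_ge0 ?normal_peak_ge0.
  rewrite peakE /K.
  pose u := x ^+ 2 / (4 * v); have u0 : 0 <= u by rewrite divr_ge0 ?sqr_ge0// mulr_ge0// ltW.
  have -> : - x ^+ 2 / (v *+ 2) = - u + - u by rewrite /u -mulr_natr; field; rewrite gt_eqF.
  have -> : - x ^+ 2 / (2 * v *+ 2) = - u by rewrite /u -mulr_natr; field; rewrite gt_eqF.
  have -> : x ^+ 2 = 4 * v * u by rewrite /u; field; rewrite gt_eqF.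
  rewrite expRD; have e0 := expR_ge0 (- u).
  have ue : u * expR (- u) <= 1.
    rewrite expRN ler_pdivrMr ?expR_gt0// mul1r; apply: le_trans (expR_ge1Dx u); lra.
  have -> : 4 * v * u * (Num.sqrt 2 * normal_peak s2 * (expR (- u) * expR (- u))) =
    (4 * v * (Num.sqrt 2 * normal_peak s2) * expR (- u)) * (u * expR (- u)) by ring.
  have -> : 4 * Num.sqrt 2 * v * (normal_peak s2 * expR (- u)) =
    4 * v * (Num.sqrt 2 * normal_peak s2) * expR (- u) by ring.
  by apply: ler_piMr => //; do 3 apply: mulr_ge0 => //; exact: ltW.
rewrite ge0_integralZl//; last 2 first.
- by apply/measurable_EFinP; exact: measurable_normal_pdf.
- by move=> x _; rewrite lee_fin normal_pdf_ge0.
rewrite integral_normal_pdf mule1 lee_fin /K ler_wpM2r ?(ltW v0)//.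
have h : (4 * Num.sqrt 2) ^+ 2 <= (6 : R) ^+ 2 by rewrite exprMn sqr_sqrtr//; lra.
by rewrite -ler_sqr ?nnegrE ?mulr_ge0 ?sqrtr_ge0.
Qed.

End normal.

(** * Orthogonality in mean square *)

Section orthogonal.
Context {dO : measure_display} {Omega : measurableType dO} {R : realType} {Q : probability Omega R}.
Implicit Types (Y D : Omega -> R).
Local Notation Ex := (Ex (P := Q)).
Local Notation itg := (itg (P := Q)).

(** The joint law does not change with the sign of [D], so the product has the same mean as its
    negative. Orthogonality thus follows from the symmetry of the Gaussian law, without integrating
    against it. *)
Lemma Ex_sym_zero Y D : measurable_fun setT Y -> measurable_fun setT D ->
  (forall A A' : set R, measurable A -> measurable A' ->
     Q (Y @^-1` A `&` D @^-1` A') = Q (Y @^-1` A `&` D @^-1` (-%R @^-1` A'))) ->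
  itg (fun o => Y o * D o) -> Ex (fun o => Y o * D o) = 0.
Proof.
move=> mY mD h iYD.
pose f1 o := (Y o, D o); pose f2 o := (Y o, - D o).
have m1 : measurable_fun setT f1 by exact: measurable_fun_pair.
have m2 : measurable_fun setT f2 by apply: measurable_fun_pair => //; exact: measurable_funN.
pose k (z : R * R) : \bar R := (z.1 * z.2)%:E.
have mk : measurable_fun setT k.
  by apply/measurable_EFinP; apply: measurable_funM; [exact: measurable_fst|exact: measurable_snd].
have e (Z : set (R * R)) : measurable Z -> pushforward Q f1 Z = pushforward Q f2 Z.
  apply: (rect_measure_unique (m1 := pushforward Q f1) (m2 := pushforward Q f2)); last first.
    exact: (eq_ind_r (fun z : \bar R => (z < +oo)%E) (ltry 1) (@probability_setT _ _ _ Q)).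
  move=> A A' mA mA'; rewrite /pushforward.
  transitivity (Q (Y @^-1` A `&` D @^-1` A')); first by [].
  by rewrite h.
have iN : Q.-integrable setT (k \o f2).
  have := itgN iYD; rewrite /itg; congr (_.-integrable setT _).
  by apply/funext => o; rewrite /k /f2 /= mulrN.
have e1 : (\int[pushforward Q f1]_y k y = \int[Q]_x (k \o f1) x)%E.
  exact: (integral_pushforward m1 mk iYD measurableT).
have e2 : (\int[pushforward Q f2]_y k y = \int[Q]_x (k \o f2) x)%E.
  exact: (integral_pushforward m2 mk iN measurableT).
have : (\int[Q]_x (k \o f1) x = \int[Q]_x (k \o f2) x)%E.
  by rewrite -e1 -e2; apply: eq_measure_integral => Z mZ _; exact: e.
move=> e3; have : Ex (fun o => Y o * D o) = Ex (fun o => - (Y o * D o)).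
  rewrite /Ex /Rintegral; congr fine; rewrite e3; apply: eq_integral => o _.
  by rewrite /k /f2 /= mulrN.
by rewrite ExN//; lra.
Qed.

Lemma Ex_orthogonal_sum (I : eqType) (s : seq I) (D : I -> Omega -> R) (c : I -> R) : uniq s ->
  (forall i, measurable_fun setT (D i)) -> (forall i, itg (fun o => D i o ^+ 2)) ->
  (forall i j, i != j -> Ex (fun o => D i o * D j o) = 0) ->
  itg (fun o => (\sum_(i <- s) c i * D i o) ^+ 2) /\
  Ex (fun o => (\sum_(i <- s) c i * D i o) ^+ 2) = \sum_(i <- s) c i ^+ 2 * Ex (fun o => D i o ^+ 2).
Proof.
move=> us mD iD h; elim: s us => [|a s IH] /=.
  by under eq_fun do rewrite big_nil expr0n; rewrite big_nil Ex_cst; split=> //; exact: itg_cst.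
move=> /andP[as_ us]; have [IH1 IH2] := IH us.
have iDD i j : itg (fun o => D i o * D j o) by exact: itg_mul.
have icr : itg (fun o => \sum_(i <- s) (2 * c a * c i) * (D a o * D i o)).
  by apply: itg_sum => i _; exact: itgZ.
have -> : (fun o => (\sum_(i <- a :: s) c i * D i o) ^+ 2) =
  (fun o => c a ^+ 2 * D a o ^+ 2 + \sum_(i <- s) (2 * c a * c i) * (D a o * D i o) +
     (\sum_(i <- s) c i * D i o) ^+ 2).
  apply/funext => o; rewrite big_cons.
  have -> : \sum_(i <- s) (2 * c a * c i) * (D a o * D i o) = 2 * (c a * D a o) * \sum_(i <- s) c i * D i o.
    by rewrite mulr_sumr; apply: eq_bigr => i _; ring.
  by ring.
have i1 : itg (fun o => c a ^+ 2 * D a o ^+ 2) by exact: itgZ.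
split; first by apply: itgD => //; exact: itgD.
rewrite ExD//; last exact: itgD.
rewrite ExD// ExZ// IH2 big_cons Ex_sum; last by move=> i _; exact: itgZ.
rewrite [X in _ + X + _](_ : _ = 0) ?addr0// big_seq big1// => i is_.
rewrite ExZ// h ?mulr0//; by apply: contraNneq as_ => ->.
Qed.

End orthogonal.

(** * Increments of the Brownian motions *)

Section increments.
Context {d : nat} {R : realType} {dO : measure_display} {Omega : measurableType dO}.
Context {Q : probability Omega R} {F : R -> set (set Omega)} {B : Zd d -> R -> Omega -> R}.
Hypothesis hF : complete_filtration Q F.
Hypothesis hB : brownian_motions Q F B.
Implicit Types (x y : Zd d) (s t h : R).
Local Notation Ex := (Ex (P := Q)).
Local Notation itg := (itg (P := Q)).

Definition adapted t (f : Omega -> R) := forall A, measurable A -> F t (f @^-1` A).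

Local Notation OF t := (g_sigma_algebraType (F t)).

(** Turns adaptedness into measurability on a retyped space, so that the closure properties of
    measurable functions apply. *)
Lemma adaptedP t (f : Omega -> R) : 0 <= t -> adapted t f <-> measurable_fun [set: OF t] (f : OF t -> R).
Proof.
move=> t0; have [/(_ t t0) sF _ _ _] := hF.
have E : @measurable _ (OF t) = F t by exact: sigma_algebra_id.
split=> [h _ A mA|h A mA]; first by rewrite setTI E; exact: h.
by have := h measurableT A mA; rewrite setTI E.
Qed.

Lemma adapted_B x s t : 0 <= s -> s <= t -> adapted t (B x s).
Proof.
move=> s0 st A mA; have [h _ _ _] := hB; have [_ _ hm _] := hF.
by apply: (hm s t) => //; exact: h.
Qed.

Lemma adapted_measurable t (f : Omega -> R) : 0 <= t -> adapted t f -> measurable_fun setT f.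
Proof. by move=> t0 h _ A mA; rewrite setTI; have [_ hm _ _] := hF; apply: (hm t t0); exact: h. Qed.

Lemma measurable_B x t : 0 <= t -> measurable_fun setT (B x t).
Proof. by move=> t0; apply: (adapted_measurable t0); exact: adapted_B. Qed.

Definition inc x s t (o : Omega) : R := B x t o - B x s o.

Lemma adapted_inc x s t u : 0 <= s -> s <= t -> t <= u -> adapted u (inc x s t).
Proof.
move=> s0 st tu; have u0 : 0 <= u by lra.
apply/(adaptedP _ u0); apply: measurable_funB; apply/(adaptedP _ u0); apply: adapted_B; lra.
Qed.

Lemma measurable_inc x s t : 0 <= s -> s <= t -> measurable_fun setT (inc x s t).
Proof. by move=> s0 st; apply: measurable_funB; apply: measurable_B; lra. Qed.

Lemma inc_law (H : set Omega) x s t (A : set R) : 0 <= s -> s < t -> F s H -> measurable A ->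
  Q (H `&` inc x s t @^-1` A) = (Q H * normal_prob 0 (Num.sqrt (t - s)) A)%E.
Proof.
move=> s0 st FH mA; have [_ _ _ h] := hB.
have := h s t s0 st H [:: x] (fun _ => A) FH isT (fun _ => mA).
rewrite big_seq1 fineK; last exact: fin_num_measure.
move=> <-; congr (Q (_ `&` _)); apply/seteqP; split=> o /=.
  by move=> hA y; rewrite inE => /eqP ->.
by apply; rewrite mem_head.
Qed.

Lemma F_setT s : 0 <= s -> F s setT.
Proof.
move=> s0; have [/(_ s s0)[h0 hC _] _ _ _] := hF.
by rewrite -setC0 -setTD; exact: hC.
Qed.

Lemma sqrt_neq0 s t : s < t -> Num.sqrt (t - s) != 0.
Proof. by move=> st; rewrite sqrtr_eq0 -ltNge subr_gt0. Qed.

Lemma inc_second_moment x s t : 0 <= s -> s < t ->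
  itg (fun o => inc x s t o ^+ 2) /\ Ex (fun o => inc x s t o ^+ 2) <= 6 * (t - s).
Proof.
move=> s0 st; have mi := measurable_inc x s0 (ltW st).
have e : (\int[Q]_o (inc x s t o ^+ 2)%:E <= (6 * (t - s))%:E)%E.
  apply: le_trans (normal_second_moment _); last by rewrite subr_gt0.
  have <- : (\int[pushforward Q (inc x s t)]_z (z ^+ 2)%:E = \int[Q]_o (inc x s t o ^+ 2)%:E)%E.
    apply: (ge0_integral_pushforward mi Q (f := fun z : R => (z ^+ 2)%:E) measurableT).
      by apply/measurable_EFinP; exact: measurable_funX.
    by move=> z _; rewrite lee_fin sqr_ge0.
  pose nu := normal_prob (0 : R) (Num.sqrt (t - s)).
  have mI : measurable_fun [set: measurableTypeR R] (fun x : measurableTypeR R => x : R) by exact: measurable_id.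
  have <- : (\int[pushforward nu (fun x : measurableTypeR R => x : R)]_z (z ^+ 2)%:E = \int[nu]_z (z ^+ 2)%:E)%E.
    apply: (ge0_integral_pushforward mI nu (f := fun z : R => (z ^+ 2)%:E) measurableT).
      by apply/measurable_EFinP; exact: measurable_funX.
    by move=> z _; rewrite lee_fin sqr_ge0.
  rewrite le_eqVlt; apply/orP; left; apply/eqP; apply: eq_measure_integral => A mA _.
  transitivity (Q (setT `&` inc x s t @^-1` A)); first by rewrite setTI.
  by rewrite (inc_law x s0 st (F_setT s0) mA) probability_setT mul1e.
have i : itg (fun o => inc x s t o ^+ 2).
  apply/integrableP; split; first by apply/measurable_EFinP; exact: measurable_funX.
  under eq_integral do rewrite /= ger0_norm ?sqr_ge0//.
  by apply: le_lt_trans e _; rewrite ltry.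
split=> //; rewrite /Ex /Rintegral -lee_fin fineK//; exact: integrable_fin_num.
Qed.

Lemma inc_past_orthogonal x s t (Y : Omega -> R) : 0 <= s -> s < t -> adapted s Y ->
  itg (fun o => Y o ^+ 2) -> Ex (fun o => Y o * inc x s t o) = 0.
Proof.
move=> s0 st aY iY; have mY := adapted_measurable s0 aY; have mi := measurable_inc x s0 (ltW st).
apply: Ex_sym_zero => //; last by apply: itg_mul => //; have [] := inc_second_moment x s0 st.
move=> A A' mA mA'.
have mA'' : measurable (-%R @^-1` A' : set R).
  by rewrite -[X in measurable X]setTI; exact: oppr_measurable.
by rewrite !inc_law ?normal_sym ?sqrt_neq0//; exact: aY.
Qed.

Lemma inc_pair_orthogonal x y s t : x != y -> 0 <= s -> s < t ->
  Ex (fun o => inc x s t o * inc y s t o) = 0.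
Proof.
move=> xy s0 st; have mi z := measurable_inc z s0 (ltW st).
apply: Ex_sym_zero => //; last first.
  by apply: itg_mul => //; [have [] := inc_second_moment x s0 st|have [] := inc_second_moment y s0 st].
move=> A A' mA mA'.
have mA'' : measurable (-%R @^-1` A' : set R).
  by rewrite -[X in measurable X]setTI; exact: oppr_measurable.
have key (A2 : set R) : measurable A2 -> Q (inc x s t @^-1` A `&` inc y s t @^-1` A2) =
    (fine (normal_prob 0 (Num.sqrt (t - s)) A) * fine (normal_prob 0 (Num.sqrt (t - s)) A2))%:E.
  move=> mA2; have [_ _ _ h] := hB; pose AA z := if z == x then A else A2.
  have mAA z : measurable (AA z) by rewrite /AA; case: ifP.
  have us : uniq [:: x; y] by rewrite /= inE xy.
  have := h s t s0 st setT [:: x; y] AA (F_setT s0) us mAA.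
  have [AAx AAy] : AA x = A /\ AA y = A2 by rewrite /AA eqxx eq_sym (negPf xy).
  rewrite probability_setT mul1e big_cons big_seq1 AAx AAy => <-.
  rewrite setTI; congr (Q _); apply/seteqP; split=> o /=.
    by move=> [h1 h2] z; rewrite !inE => /orP[/eqP ->|/eqP ->]; rewrite ?AAx ?AAy.
  move=> hz; split; first by have := hz x; rewrite mem_head AAx; exact.
  by have := hz y; rewrite !inE eqxx orbT AAy; exact.
by rewrite !key// normal_sym ?sqrt_neq0.
Qed.

Definition grid_inc (h : R) (a : nat * Zd d) (o : Omega) : R := inc a.2 (a.1%:R * h) (a.1.+1%:R * h) o.

Lemma grid_step (h : R) (j : nat) : 0 < h -> 0 <= j%:R * h /\ j%:R * h < j.+1%:R * h.
Proof. by move=> h0; rewrite mulr_ge0 ?(ltW h0)// ltr_pM2r// ltr_nat. Qed.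

Lemma measurable_grid_inc h a : 0 < h -> measurable_fun setT (grid_inc h a).
Proof. by move=> h0; have [g1 g2] := grid_step a.1 h0; apply: measurable_inc => //; exact: ltW. Qed.

Lemma grid_inc_moment h a : 0 < h -> itg (fun o => grid_inc h a o ^+ 2) /\
  Ex (fun o => grid_inc h a o ^+ 2) <= 6 * h.
Proof.
move=> h0; have [g1 g2] := grid_step a.1 h0; have [i1 i2] := inc_second_moment a.2 g1 g2.
split=> //; apply: le_trans i2 _; rewrite -mulrBl -natr1; lra.
Qed.

(** For different time slots the earlier increment is known when the later one starts; within one
    slot the sites differ. *)
Lemma grid_inc_orthogonal h a b : 0 < h -> a != b -> Ex (fun o => grid_inc h a o * grid_inc h b o) = 0.
Proof.
move=> h0; wlog : a b / (a.1 <= b.1)%N => [wl ab|].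
  have [ab1|ba1] := leqP a.1 b.1; first exact: wl.
  by under eq_fun do rewrite mulrC; apply: wl; [exact: ltnW|rewrite eq_sym].
rewrite leq_eqVlt => /predU1P[ab1|ab1] ab.
  have [g1 g2] := grid_step a.1 h0; rewrite /grid_inc -ab1.
  apply: inc_pair_orthogonal => //; apply: contraNneq ab => ab2.
  by case: a b ab1 ab2 {g1 g2} => ? ? [? ?] /= -> ->.
have [g1 g2] := grid_step a.1 h0; have [g3 g4] := grid_step b.1 h0.
apply: inc_past_orthogonal => //; last by have [] := grid_inc_moment a h0.
by apply: adapted_inc => //; [exact: ltW|rewrite ler_wpM2r ?(ltW h0)// ler_nat].
Qed.

End increments.

(** * Compact intervals and dyadic meshes *)

Section segment.
Context {R : realType}.
Implicit Types (r s t T e a : R).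

(** A form of compactness: a property that spreads between any two points close to a common one
    reaches the end of the segment. It yields uniform continuity, and bounds for trajectories over
    compact time intervals. *)
Lemma segment_induction (P : R -> Prop) T : 0 <= T -> P 0 ->
  (forall t, 0 <= t <= T -> exists2 e, 0 < e & forall r s, 0 <= r -> r <= s -> s <= T ->
     `|r - t| < e -> `|s - t| < e -> P r -> P s) -> P T.
Proof.
move=> T0 P0 h; pose E := [set s | 0 <= s <= T /\ P s].
have hE : has_sup E.
  split; first by exists 0; split=> //; rewrite lexx.
  by exists T => s [/andP[_ ?] _].
pose t := sup E.
have t0 : 0 <= t by apply: (sup_upper_bound hE); split=> //; rewrite lexx.
have tT : t <= T.
  rewrite leNgt; apply/negP => Tt; have tT0 : 0 < t - T by rewrite subr_gt0.
  by have [r [/andP[r0 rT] _]] := sup_adherent tT0 hE; rewrite -/t; lra.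
have [|e e0 he] := h t; first by rewrite t0.
have [r [/andP[r0 rT] Pr] tr] := sup_adherent e0 hE; rewrite -/t in tr.
have rt : r <= t by apply: (sup_upper_bound hE); split=> //; rewrite r0.
have step s : t <= s -> s <= T -> s < t + e -> P s.
  move=> ts sT se; apply: (he r s) => //; [lra|rewrite ltr_norml; apply/andP; split; lra|].
  by rewrite ltr_norml; apply/andP; split; lra.
have [hT|hT] := ltP T (t + e); first exact: step.
have : E (t + e / 2) by split; [apply/andP; split; lra|apply: step; lra].
by move=> /(sup_upper_bound hE); rewrite -/t; lra.
Qed.

Lemma within_eps (A : set R) (f : R -> R) t e : {within A, continuous f} -> A t -> 0 < e ->
  exists2 eta, 0 < eta & forall s, A s -> `|s - t| < eta -> `|f s - f t| <= e.
Proof.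
move=> /subspace_continuousP cf At e0; have /cvgrPdist_le /(_ e e0) := cf t At.
rewrite near_withinE => /nbhs_ballP[eta /= eta0 h]; exists eta => // s As st.
by rewrite distrC; apply: h => //; rewrite /ball /= distrC.
Qed.

Lemma eps_within (A : set R) (f : R -> R) :
  (forall t e, A t -> 0 < e ->
     exists2 eta, 0 < eta & forall s, A s -> `|s - t| < eta -> `|f s - f t| <= e) ->
  {within A, continuous f}.
Proof.
move=> h; apply/subspace_continuousP => t At; apply/cvgrPdist_le => e e0.
have [eta eta0 he] := h t e At e0.
rewrite near_withinE; apply/nbhs_ballP; exists eta => //= s st As.
by rewrite distrC; apply: he => //; rewrite distrC.
Qed.

Lemma segment_uniform (f : R -> R) T e : 0 <= T -> 0 < e -> {within `[0, T], continuous f} ->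
  exists2 del, 0 < del & forall s t, 0 <= s <= T -> 0 <= t <= T -> `|s - t| <= del -> `|f s - f t| <= e.
Proof.
move=> T0 e0 cf.
pose P r := exists2 del, 0 < del &
  forall s t, 0 <= s <= r -> 0 <= t <= r -> `|s - t| <= del -> `|f s - f t| <= e.
apply: (@segment_induction P) => //.
  exists 1 => // s t /andP[s0 s1] /andP[t0 t1] _.
  have -> : s = t by lra.
  by rewrite subrr normr0 ltW.
move=> t tT; have At : `[0, T]%classic t by rewrite /= in_itv.
have [eta eta0 he] := within_eps cf At (divr_gt0 e0 (ltr0n R 2)).
exists (eta / 2); first by rewrite divr_gt0.
move=> r s r0 rs sT; rewrite !ltr_norml => /andP[rt1 rt2] /andP[st1 st2] [del del0 hd].
exists (Num.min del (eta / 2)); first by rewrite lt_min del0 divr_gt0.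
have near_t u : 0 <= u <= s -> `|u - t| < eta -> `|f u - f t| <= e / 2.
  by move=> us ut; apply: he => //; rewrite /= in_itv /=; lra.
have key u v : 0 <= u <= s -> 0 <= v <= s -> r < u -> `|u - v| <= eta / 2 -> `|f u - f v| <= e.
  move=> us vs ru; rewrite ler_norml => /andP[uv1 uv2].
  have h1 := near_t u us; have h2 := near_t v vs.
  have {}h1 : `|f u - f t| <= e / 2 by apply: h1; rewrite ltr_norml; apply/andP; split; lra.
  have {}h2 : `|f v - f t| <= e / 2 by apply: h2; rewrite ltr_norml; apply/andP; split; lra.
  have -> : f u - f v = (f u - f t) - (f v - f t) by ring.
  by apply: le_trans (ler_normB _ _) _; lra.
move=> u v us vs; rewrite le_min => /andP[uv1 uv2].
have [ur|ru] := leP u r; last exact: key.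
have [vr|rv] := leP v r; last by rewrite distrC; apply: key => //; rewrite distrC.
by apply: hd => //; lra.
Qed.

Definition mesh (n : nat) : R := (2 ^ n)%:R^-1.

Lemma mesh_gt0 n : 0 < mesh n. Proof. by rewrite invr_gt0 ltr0n expn_gt0. Qed.

Lemma mesh_le1 n : mesh n <= 1.
Proof. by rewrite invf_le1 ?ler1n ?ltr0n expn_gt0. Qed.

Lemma mesh_double n k : mesh n = (2 ^ k)%:R * mesh (n + k).
Proof.
by rewrite /mesh expnD natrM invfM mulrC -mulrA mulVf ?mulr1// pnatr_eq0 -lt0n expn_gt0.
Qed.

Lemma mesh_small e : 0 < e -> exists n0, forall n, (n0 <= n)%N -> mesh n <= e.
Proof.
move=> e0; have [n0 hn0] := exists_nat_gt e^-1; exists n0 => n n0n.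
rewrite /mesh invf_ple ?posrE ?ltr0n ?expn_gt0//; apply: le_trans (ltW hn0) _.
by rewrite ler_nat; apply: leq_trans n0n _; exact: ltnW (ltn_expl n (ltnSn 1)).
Qed.

Lemma truncn_mesh t n : 0 <= t ->
  (Num.truncn (t / mesh n))%:R * mesh n <= t < (Num.truncn (t / mesh n)).+1%:R * mesh n.
Proof.
move=> t0; have m0 := mesh_gt0 n; have q0 : 0 <= t / mesh n by rewrite divr_ge0// ltW.
by have /andP[h1 h2] := Num.Theory.truncn_itv q0; rewrite -ler_pdivlMr// -ltr_pdivrMr// h1 h2.
Qed.

Lemma dyadic_bound (b : R -> R) T a : {within `[0, T], continuous b} ->
  (forall n j, j%:R * mesh n <= T -> `|b (j%:R * mesh n)| <= a) ->
  forall t, 0 <= t <= T -> `|b t| <= a.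
Proof.
move=> cb h t /andP[t0 tT]; apply: le_of_le_add => e e0.
have At : `[0, T]%classic t by rewrite /= in_itv /= t0.
have [eta eta0 he] := within_eps cb At e0.
have [n0 hn0] := mesh_small (divr_gt0 eta0 (ltr0n R 2)); have hm := hn0 n0 (leqnn _).
have /andP[k1 k2] := truncn_mesh n0 t0; set k := Num.truncn _ in k1 k2.
have m0 := mesh_gt0 n0; have kp : 0 <= k%:R * mesh n0 by rewrite mulr_ge0// ltW.
rewrite -natr1 mulrDl mul1r in k2.
have h1 : `|b (k%:R * mesh n0)| <= a by apply: h; exact: le_trans k1 tT.
have h2 : `|b (k%:R * mesh n0) - b t| <= e.
  apply: he; first by rewrite /= in_itv /= kp (le_trans k1).
  by rewrite ltr_norml; apply/andP; split; lra.
have -> : b t = b (k%:R * mesh n0) - (b (k%:R * mesh n0) - b t) by ring.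
by apply: le_trans (ler_normB _ _) _; exact: lerD.
Qed.

End segment.

(** * Kolmogorov's inequality and a regular version of the noise *)

Section maximal.
Context {d : nat} {R : realType} {dO : measure_display} {Omega : measurableType dO}.
Context {Q : probability Omega R} {F : R -> set (set Omega)} {B : Zd d -> R -> Omega -> R}.
Hypothesis hF : complete_filtration Q F.
Hypothesis hB : brownian_motions Q F B.
Implicit Types (x y : Zd d) (s t h a : R) (k n T : nat).
Local Notation Ex := (Ex (P := Q)).
Local Notation itg := (itg (P := Q)).
Local Notation adapted := (adapted (F := F)).
Local Notation inc := (inc (B := B)).
Local Notation grid_inc := (grid_inc (B := B)).

Lemma adapted_mono s t (f : Omega -> R) : 0 <= s -> s <= t -> adapted s f -> adapted t f.
Proof. by move=> s0 st h A mA; have [_ _ hm _] := hF; apply: (hm s t) => //; exact: h. Qed.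

(* The random walk [inc x 0 (k h)] stopped when it first leaves ]-a, a[. *)
Fixpoint stopped x h a k (o : Omega) : R :=
  if k is k'.+1 then
    stopped x h a k' o + \1_(`]- a, a[%classic) (stopped x h a k' o) * grid_inc h (k', x) o
  else 0.

Lemma adapted_stopped x h a k : 0 < h -> adapted (k%:R * h) (stopped x h a k).
Proof.
move=> h0; elim: k => [|k IH].
  by apply/(adaptedP hF _ (mulr_ge0 (ler0n _ _) (ltW h0))); exact: measurable_cst.
have [g1 g2] := grid_step k h0.
have k0 : 0 <= k.+1%:R * h by lra.
have m1 := (adaptedP hF _ k0).1 (adapted_mono g1 (ltW g2) IH).
apply/(adaptedP hF _ k0); apply: measurable_funD => //; apply: measurable_funM.
  by apply: (measurableT_comp (f := \1_(`]- a, a[%classic) : R -> R)) => //; exact: measurable_indic.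
by apply/(adaptedP hF _ k0); apply: (adapted_inc hF hB) => //; exact: ltW.
Qed.

Lemma indic_sq_le (A : set R) (z c : R) : (\1_A z * c) ^+ 2 <= c ^+ 2.
Proof. by rewrite indicE; case: (z \in A); rewrite ?mul1r// mul0r expr0n sqr_ge0. Qed.

(** Whether the walk still moves is decided by the past, so each new increment is orthogonal to the
    position reached and adds at most its own second moment. *)
Lemma stopped_moment x h a k : 0 < h -> itg (fun o => stopped x h a k o ^+ 2) /\
  Ex (fun o => stopped x h a k o ^+ 2) <= 6 * (k%:R * h).
Proof.
move=> h0; elim: k => [|k [IH1 IH2]].
  rewrite /= [X in itg X](_ : _ = fun _ => 0); last by apply/funext => o; rewrite expr0n.
  rewrite [X in Ex X](_ : _ = fun _ => 0); last by apply/funext => o; rewrite expr0n.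
  by rewrite Ex_cst mul0r mulr0; split=> //; exact: itg_cst.
have [g1 g2] := grid_step k h0.
pose Z := stopped x h a k; pose D := grid_inc h (k, x); pose J o : R := \1_(`]- a, a[%classic) (Z o).
have aZ : adapted (k%:R * h) Z by exact: adapted_stopped.
have aJ : adapted (k%:R * h) J.
  have mi : measurable_fun setT (\1_(`]- a, a[%classic) : R -> R) by exact: measurable_indic.
  by apply/(adaptedP hF _ g1); apply: (measurableT_comp mi); exact/(adaptedP hF _ g1).
have aZJ : adapted (k%:R * h) (fun o => J o * Z o).
  by apply/(adaptedP hF _ g1); apply: measurable_funM; exact/(adaptedP hF _ g1).
have mJ := adapted_measurable hF g1 aJ; have mZJ := adapted_measurable hF g1 aZJ.
have mD : measurable_fun setT D by exact: (measurable_grid_inc hF hB).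
have [iD eD] := grid_inc_moment hF hB (k, x) h0.
have iZJ : itg (fun o => (J o * Z o) ^+ 2).
  apply: (itg_le _ _ IH1); first exact: measurable_funX.
  by move=> o; rewrite ger0_norm ?sqr_ge0//; exact: indic_sq_le.
have iJD : itg (fun o => (J o * D o) ^+ 2).
  apply: (itg_le _ _ iD); first by apply: measurable_funX; exact: measurable_funM.
  by move=> o; rewrite ger0_norm ?sqr_ge0//; exact: indic_sq_le.
have eJD : Ex (fun o => (J o * D o) ^+ 2) <= 6 * h.
  by apply: le_trans eD; apply: Ex_le => // o; exact: indic_sq_le.
have e0 : Ex (fun o => (J o * Z o) * D o) = 0 by exact: (inc_past_orthogonal hF hB x g1 g2 aZJ iZJ).
have iC : itg (fun o => (J o * Z o) * D o) by exact: itg_mul.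
have iC2 : itg (fun o => 2 * ((J o * Z o) * D o)) by exact: itgZ.
have -> : (fun o => stopped x h a k.+1 o ^+ 2) =
    (fun o => Z o ^+ 2 + 2 * ((J o * Z o) * D o) + (J o * D o) ^+ 2).
  by apply/funext => o; rewrite /= -/(Z o) -/(J o) -/(D o); ring.
split; first by apply: itgD => //; exact: itgD.
rewrite ExD//; last exact: itgD.
have -> : 6 * (k.+1%:R * h) = 6 * (k%:R * h) + 6 * h by rewrite -[k.+1%:R]natr1; ring.
rewrite ExD// ExZ// e0 mulr0 addr0; exact: lerD.
Qed.

(** Once outside the interval the stopped walk is frozen, so an exceedance at an earlier grid time
    is still visible at the end. *)
Lemma stopped_exceeds x h a k o : 0 < a ->
  (exists2 j, (j <= k)%N & a <= `|inc x 0 (j%:R * h) o|) -> a <= `|stopped x h a k o|.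
Proof.
move=> a0 [j jk ha].
have : a <= `|stopped x h a k o| \/ (stopped x h a k o = inc x 0 (k%:R * h) o /\
    forall j, (j <= k)%N -> `|inc x 0 (j%:R * h) o| < a).
  elim: k {j jk ha} => [|k IH].
    right; split=> [|j]; first by rewrite /inc mul0r subrr.
    by rewrite leqn0 => /eqP ->; rewrite /inc mul0r subrr normr0.
  case: IH => [IH|[IH1 IH2]].
    left; rewrite /= indicE memNset ?mul0r ?addr0//= in_itv /= -ltr_norml.
    by apply/negP; rewrite -leNgt.
  have e : stopped x h a k.+1 o = inc x 0 (k.+1%:R * h) o.
    rewrite /= indicE mem_set ?mul1r; last by rewrite /= in_itv /= -ltr_norml IH1; exact: IH2.
    by rewrite IH1 /grid_inc /inc /=; ring.
  rewrite e; have [h1|h1] := leP a `|inc x 0 (k.+1%:R * h) o|; [by left|right].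
  by split=> // j; rewrite leq_eqVlt => /predU1P[->//|]; rewrite ltnS; exact: IH2.
by case=> // -[_ /(_ j jk)]; rewrite ltNge ha.
Qed.

Definition exceed x a T n : set Omega :=
  [set o | exists2 j, (j <= T * 2 ^ n)%N & a <= `|inc x 0 (j%:R * mesh n) o|].

Lemma measurable_exceed x a T n : measurable (exceed x a T n).
Proof.
pose E j := (fun o => `|inc x 0 (j%:R * mesh n) o|) @^-1` `[a, +oo[%classic.
have -> : exceed x a T n = \bigcup_(j in `I_(T * 2 ^ n).+1) E j.
  apply/seteqP; split=> o.
    by move=> [j jT h]; exists j => //; rewrite /E /= in_itv /= andbT.
  by move=> [j /= jT]; rewrite /E /= in_itv /= andbT => h; exists j.
apply: bigcup_measurable => j _; rewrite /E -[X in measurable X]setTI.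
have : measurable_fun setT (fun o => `|inc x 0 (j%:R * mesh n) o|).
  apply: (measurableT_comp (f := fun z : R => `|z|)) => //.
  by apply: (measurable_inc hF hB) => //; rewrite mulr_ge0// ltW// mesh_gt0.
by apply.
Qed.

Lemma exceed_prob x a T n : 0 < a -> (Q (exceed x a T n) <= (6 * T%:R / a ^+ 2)%:E)%E.
Proof.
move=> a0; have mE := measurable_exceed x a T n; have m0 := mesh_gt0 (R := R) n.
pose k := (T * 2 ^ n)%N; pose Z := stopped x (mesh n) a k.
have [iZ eZ] := stopped_moment x a k m0; rewrite -/Z in iZ eZ.
have kE : k%:R * mesh n = T%:R :> R.
  by rewrite /k /mesh natrM -mulrA mulfV ?mulr1// pnatr_eq0 -lt0n expn_gt0.
rewrite kE in eZ; have a2 : 0 < a ^+ 2 by rewrite exprn_gt0.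
have -> : Q (exceed x a T n) = (\int[Q]_o (\1_(exceed x a T n) o)%:E)%E by rewrite integral_indic ?setIT.
have iZa : itg (fun o => (a ^+ 2)^-1 * Z o ^+ 2) by exact: itgZ.
apply: (@le_trans _ _ (\int[Q]_o ((a ^+ 2)^-1 * Z o ^+ 2)%:E)%E).
  apply: ge0_le_integral => //.
  - by apply/measurable_EFinP; exact: measurable_indic.
  - exact: measurable_int iZa.
  move=> o _; rewrite lee_fin indicE; case: (boolP (o \in _)) => [/set_mem ho|_]; last first.
    by rewrite mulr_ge0 ?sqr_ge0// invr_ge0 ltW.
  rewrite mulrC ler_pdivlMr// mul1r -[X in _ <= X]real_normK ?num_real// lerXn2r ?nnegrE ?(ltW a0)//.
  exact: stopped_exceeds.
have := ExZ (a ^+ 2)^-1 iZ; rewrite /Ex /Rintegral => e.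
rewrite -[X in (X <= _)%E]fineK; last exact: integrable_fin_num.
by rewrite e lee_fin mulrC ler_wpM2r ?invr_ge0 ?(ltW a2).
Qed.

Definition excess x a T : set Omega := \bigcup_n exceed x a T n.

(** The dyadic grids are nested, so the bound of [exceed_prob], which is uniform in the mesh, passes
    to the union. *)
Lemma excess_prob x a T : 0 < a -> (Q (excess x a T) <= (6 * T%:R / a ^+ 2)%:E)%E.
Proof.
move=> a0.
have nd : nondecreasing_seq (exceed x a T).
  apply/nondecreasing_seqP => n; apply/subsetPset => o [j jT h].
  exists (j * 2)%N; first by rewrite expnSr mulnA leq_mul2r jT orbT.
  rewrite natrM -mulrA; have := mesh_double (R := R) n 1; rewrite addn1 expn1 => <-.
  exact: h.
have c := nondecreasing_cvg_mu (mu := Q) (fun n => measurable_exceed x a T n)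
  (bigcup_measurable (fun n _ => measurable_exceed x a T n)) nd.
rewrite -(cvg_lim _ c)//; apply: lime_le; first by apply/cvg_ex; eexists; exact: c.
by apply: nearW => n; exact: exceed_prob.
Qed.

Definition unbounded T (c : R) : set Omega := \bigcup_k
  (if pickle_inv k is Some x then excess x (c * bracket R (x : Zd d) ^+ d) T else set0).

Lemma measurable_excess x a T : measurable (excess x a T).
Proof. by apply: bigcup_measurable => n _; exact: measurable_exceed. Qed.

Lemma measurable_unbounded T c : measurable (unbounded T c).
Proof. by apply: bigcup_measurable => k _; case: pickle_inv => // x; exact: measurable_excess. Qed.

(** The height [c * bracket R x ^+ d] at site [x] is chosen so that its inverse square is summable
    by [bracket_summable]. *)
Lemma unbounded_prob T c : 0 < c -> (Q (unbounded T c) <= (6 * T%:R * 8 ^+ d / c ^+ 2)%:E)%E.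
Proof.
move=> c0; pose U k := if pickle_inv k is Some x then
  excess x (c * bracket R (x : Zd d) ^+ d) T else set0.
have mU k : measurable (U k) by rewrite /U; case: pickle_inv => // x; exact: measurable_excess.
apply: (@le_trans _ _ (\sum_(k <oo) Q (U k))%E).
  by apply: measure_sigma_subadditive => //; exact: measurable_unbounded.
pose g (z : Zd d) : R := 6 * T%:R / c ^+ 2 * (bracket R z ^+ (2 * d))^-1.
have hU k : (Q (U k) <= (if pickle_inv k is Some z then g z else 0)%:E)%E.
  rewrite /U; case: pickle_inv => [z|]; last by rewrite measure0.
  have b0 : 0 < bracket R (z : Zd d) ^+ d by rewrite exprn_gt0// (lt_le_trans ltr01)// bracket_ge1.
  apply: le_trans (excess_prob z T (mulr_gt0 c0 b0)) _; rewrite lee_fin /g.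
  by rewrite exprMn invfM mulrA -exprM [(d * 2)%N]mulnC.
apply: lime_le; first by apply: is_cvg_nneseries => n _ _; exact: measure_ge0.
apply: nearW => n; apply: (@le_trans _ _ (\sum_(0 <= k < n) (if pickle_inv k is Some z then g z else 0)%:E)%E).
  by apply: lee_sum => k _; exact: hU.
rewrite sumEFin lee_fin (sum_pmap (fun n => pickle_inv n : option (Zd d)) g) -mulr_sumr.
have us : uniq (pmap (fun n => pickle_inv n : option (Zd d)) (index_iota 0 n)).
  by apply: (pmap_uniq (@pickle_invK _)); exact: iota_uniq.
have := @bracket_summable d R _ us; set S := \sum_(_ <- _) _ => hS.
rewrite [X in _ <= X]mulrAC; apply: ler_wpM2l => //.
by rewrite divr_ge0 ?sqr_ge0// mulr_ge0.
Qed.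

Definition good_path (b : Zd d -> R -> R) := [/\ forall x, b x 0 = 0,
  forall x, {within `[0, +oo[, continuous (b x)}
  & forall t, 0 <= t -> exists C : R, 0 <= C /\
      forall s x, 0 <= s <= t -> `|b x s| <= C * bracket R x ^+ d].

Lemma ae_forall_Zd (A : Zd d -> set Omega) : (forall x, {ae Q, forall o, A x o}) ->
  {ae Q, forall o x, A x o}.
Proof.
move=> h; have : {ae Q, forall o (k : nat), if pickle_inv k is Some x then A x o else True}.
  by apply: ae_foralln => k; case: pickle_inv => [x|]; [exact: h|exact: aeW].
by apply: filterS => o ho x; have := ho (pickle x); rewrite pickleK_inv.
Qed.

Lemma ae_bounded T : {ae Q, forall o, exists n : nat, ~ unbounded T n.+1%:R o}.
Proof.
exists (\bigcap_n unbounded T n.+1%:R); split.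
- by apply: bigcapT_measurable => n; exact: measurable_unbounded.
- set H := \bigcap_n _; have mH : measurable H.
    by apply: bigcapT_measurable => n; exact: measurable_unbounded.
  pose K : R := 6 * T%:R * 8 ^+ d; have K0 : 0 <= K by rewrite mulr_ge0 ?mulr_ge0 ?exprn_ge0.
  have fH : Q H \is a fin_num by exact: fin_num_measure.
  suff : fine (Q H) <= 0.
    move=> h; apply/eqP; rewrite -(fineK fH) eqe eq_le h /=; exact: fine_ge0.
  apply: (@le_of_lim_inv R _ _ K 0) => n _; rewrite add0r -lee_fin (fineK fH).
  apply: (@le_trans _ _ (Q (unbounded T n.+1%:R))).
    apply: le_measure; rewrite ?inE//; first exact: measurable_unbounded.
    by move=> o /(_ n I).
  apply: le_trans (unbounded_prob T _) _ => //; rewrite lee_fin -/K ler_wpM2l// lef_pV2 ?posrE ?exprn_gt0//.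
  by rewrite expr2 ler_peMr// ler1n.
by move=> o ho n _; apply: contra_notP ho => ho; exists n.
Qed.

Lemma ae_good_path : {ae Q, forall o, good_path (fun x t => B x t o)}.
Proof.
have [_ h0 hc _] := hB.
have a0 := ae_forall_Zd h0; have ac := ae_forall_Zd hc.
have ab : {ae Q, forall o (T : nat), exists n : nat, ~ unbounded T n.+1%:R o}.
  by apply: ae_foralln; exact: ae_bounded.
apply: filterS3 a0 ac ab => o b0 bc bb; split=> // t t0.
have [T hT] := exists_nat_gt t; have [n hn] := bb T.
exists n.+1%:R; split=> // s x /andP[s0 st].
have bT : {within `[0, T%:R], continuous (B x ^~ o)}.
  by apply: continuous_subspaceW (bc x) => u /=; rewrite !in_itv /= => /andP[->].
apply: (dyadic_bound bT); last by rewrite s0 (le_trans st) ?ltW.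
move=> m j hj; rewrite leNgt; apply/negP => hlt; apply: hn; exists (pickle x) => //.
rewrite pickleK_inv; exists m => //; exists j.
  by move: hj; rewrite /mesh ler_pdivrMr ?ltr0n ?expn_gt0// -natrM ler_nat.
by rewrite /inc b0 subr0 ltW.
Qed.

(** Setting the noise to zero on a null set makes every path good; adaptedness survives because
    [F 0] contains the measurable null sets. *)
Definition cut_noise (N : set Omega) x t o : R := \1_(~` N) o * B x t o.

Lemma measurable_inc_event s t (xs : seq (Zd d)) (A : Zd d -> set R) : 0 <= s -> s <= t ->
  (forall x, measurable (A x)) -> measurable [set o | forall x, x \in xs -> A x (inc x s t o)].
Proof.
move=> s0 st mA; elim: xs => [|x xs IH].
  by rewrite (_ : mkset _ = setT)//; apply/seteqP; split.
have -> : [set o | forall y, y \in x :: xs -> A y (inc y s t o)] =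
    inc x s t @^-1` A x `&` [set o | forall y, y \in xs -> A y (inc y s t o)].
  apply/seteqP; split=> o /=.
    by move=> h; split=> [|y ys]; apply: h; rewrite inE ?eqxx// ys orbT.
  by move=> [h1 h2] y; rewrite inE => /predU1P[->//|]; exact: h2.
apply: measurableI => //; rewrite -[X in measurable X]setTI.
by apply: (measurable_inc hF hB) => //; exact: measurableT.
Qed.

Lemma eq_off_null (N U U' : set Omega) : measurable N -> Q N = 0%E -> measurable U -> measurable U' ->
  (forall o, ~ N o -> U o <-> U' o) -> Q U = Q U'.
Proof.
move=> mN QN mU mU' h.
have key (V V' : set Omega) : measurable V -> measurable V' -> (forall o, ~ N o -> V o -> V' o) ->
    (Q V <= Q V')%E.
  move=> mV mV' hV; rewrite -(measureU0 mV' mN QN); apply: le_measure; rewrite ?inE//.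
    exact: measurableU.
  by move=> o Vo; have [No|No] := pselect (N o); [right|left; exact: hV].
by apply/eqP; rewrite eq_le !key// => o No; case: (h o No).
Qed.

End maximal.

Lemma cut_noise_brownian {d : nat} {R : realType} {dO : measure_display} {Omega : measurableType dO}
  {Q : probability Omega R} {F : R -> set (set Omega)} {B : Zd d -> R -> Omega -> R} (N : set Omega) :
  complete_filtration Q F -> brownian_motions Q F B -> measurable N -> Q N = 0%E ->
  brownian_motions Q F (cut_noise (B := B) N).
Proof.
move=> hF hB mN QN; have [b1 b2 b3 b4] := hB.
have cutE x t o : ~ N o -> cut_noise (B := B) N x t o = B x t o.
  by move=> No; rewrite /cut_noise indicE mem_set ?mul1r.
have off : {ae Q, forall o, ~ N o} by exists N; split=> // o /contrapT.
have cA x t : 0 <= t -> adapted (F := F) t (cut_noise (B := B) N x t).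
  move=> t0; apply/(adaptedP hF _ t0); apply: measurable_funM; last first.
    by apply/(adaptedP hF _ t0); exact: (adapted_B hF hB).
  apply/(adaptedP hF _ t0) => A mA; have [_ _ hm hn] := hF; apply: (hm 0 t) => //.
  have F0N : F 0 N by exact: hn.
  suff : adapted (F := F) 0 (\1_(~` N) : Omega -> R) by apply.
  apply/(adaptedP hF _ (lexx 0)); apply: measurable_indic.
  have [/(_ 0 (lexx 0)) sF _ _ _] := hF.
  have E : @measurable _ (g_sigma_algebraType (F 0)) = F 0 by exact: sigma_algebra_id.
  by apply: measurableC; rewrite E.
split.
- by move=> x t A t0 mA; exact: cA.
- by move=> x; apply: filterS2 off (b2 x) => o No; rewrite cutE.
- by move=> x; apply: filterS2 off (b3 x) => o No; under [X in _ -> continuous X]eq_fun do rewrite cutE//.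
move=> s t s0 st H xs A FH us mA; rewrite -b4//.
have mH : measurable H by have [_ hm _ _] := hF; exact: (hm s s0).
apply: (eq_off_null mN QN).
- apply: measurableI => //; elim: xs {us} => [|x xs IH].
    by rewrite (_ : mkset _ = setT)//; apply/seteqP; split.
  pose D y o := cut_noise (B := B) N y t o - cut_noise (B := B) N y s o.
  have -> : [set o | forall y, y \in x :: xs -> A y (D y o)] =
      D x @^-1` A x `&` [set o | forall y, y \in xs -> A y (D y o)].
    apply/seteqP; split=> o /=.
      by move=> h; split=> [|y ys]; apply: h; rewrite inE ?eqxx// ys orbT.
    by move=> [h1 h2] y; rewrite inE => /predU1P[->//|]; exact: h2.
  apply: measurableI => //; rewrite -[X in measurable X]setTI.
  have mD : measurable_fun setT (D x).
    have t0 : 0 <= t by lra.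
    by apply: measurable_funB; [apply: (adapted_measurable hF t0)|apply: (adapted_measurable hF s0)]; exact: cA.
  by apply: mD.
- by apply: measurableI => //; exact: (measurable_inc_event hF hB _ s0 (ltW st) mA).
by move=> o No /=; split=> -[Ho h]; split=> // x xs'; have := h x xs'; rewrite !cutE.
Qed.

Lemma good_modification {d : nat} {R : realType} {dO : measure_display} {Omega : measurableType dO}
  {Q : probability Omega R} {F : R -> set (set Omega)} {B : Zd d -> R -> Omega -> R} :
  complete_filtration Q F -> brownian_motions Q F B ->
  exists B' : Zd d -> R -> Omega -> R, [/\ brownian_motions Q F B',
    forall o, good_path (fun x t => B' x t o) & {ae Q, forall o, forall x t, B' x t o = B x t o}].
Proof.
move=> hF hB; have [N [mN QN hN]] := ae_good_path hF hB.
exists (cut_noise (B := B) N); split; first exact: cut_noise_brownian.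
- move=> o; have [No|No] := pselect (N o); last first.
    have -> : (fun x t => cut_noise (B := B) N x t o) = (fun x t => B x t o).
      by apply/funext => x; apply/funext => t; rewrite /cut_noise indicE mem_set ?mul1r.
    by apply: contrapT => h; apply: No; exact: hN.
  have -> : (fun x t => cut_noise (B := B) N x t o) = (fun _ _ => 0).
    apply/funext => x; apply/funext => t; by rewrite /cut_noise indicE memNset ?mul0r//=.
  split; [by []|by move=> x; apply: continuous_subspaceT => z; exact: cvg_cst|move=> t t0].
  by exists 0; split=> // s x _; rewrite normr0 mul0r.
exists N; split=> // o /=; apply: contra_notP => No x t.
by rewrite /cut_noise indicE mem_set ?mul1r.
Qed.

(** * Discretised noise paths *)

Section noise_source.
Context {d : nat} {R : realType} {w : conductances d R} (w_sub : subquadratic w).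
Local Notation V := (vertex w).
Local Notation G := (vgraph w_sub).
Implicit Types (x y : V) (t T h : R) (b : Zd d -> R -> R) (n k : nat).

(** Level [n] has [4 ^ n] steps of length [1 / 2 ^ n], so the grid becomes finer and also reaches up
    to time [2 ^ n]. An increment is released at the end of its time slot, when it is known. *)
Definition path_src (ys : seq V) b n : source G :=
  [seq ((j.+1%:R * mesh n, y), b (\val y) (j.+1%:R * mesh n) - b (\val y) (j%:R * mesh n))
     | j <- iota 0 (4 ^ n), y <- ys].

Definition noise_src b n : source G := path_src (ball_seq w n) b n.

Lemma path_src_nonneg ys b n : src_nonneg (path_src ys b n).
Proof.
by move=> e /allpairsP[[j y] [_ _ ->]] /=; rewrite mulr_ge0// ltW// mesh_gt0.
Qed.

Lemma sum_path_src ys b n (f : R * G * R -> R) : \sum_(e <- path_src ys b n) f e =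
  \sum_(j < 4 ^ n) \sum_(y <- ys) f ((j.+1%:R * mesh n, y),
     b (\val y) (j.+1%:R * mesh n) - b (\val y) (j%:R * mesh n)).
Proof. rewrite /path_src big_allpairs_dep -(big_mkord xpredT (fun j => \sum_(y <- ys) f ((j.+1%:R * mesh n, y),
  b (\val y) (j.+1%:R * mesh n) - b (\val y) (j%:R * mesh n)))).
by rewrite /index_iota subn0. Qed.

Lemma telescope_heaviside (f : nat -> R) n k t : 0 <= t ->
  \sum_(j < k) (f j.+1 - f j) * heaviside (j.+1%:R * mesh n) t =
  f (minn k (Num.truncn (t / mesh n))) - f 0%N.
Proof.
move=> t0; have m0 := mesh_gt0 (R := R) n; have q0 : 0 <= t / mesh n by rewrite divr_ge0// ltW.
elim: k => [|k IH]; first by rewrite big_ord0 min0n subrr.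
rewrite big_ord_recr /= IH /heaviside -ler_pdivlMr// -Num.Theory.truncn_ge_nat//.
set K := Num.truncn _; have [kK|kK] := leqP K k.
  by rewrite mulr0 addr0 !(minn_idPr _)// leqW.
rewrite mulr1 (minn_idPl kK); ring.
Qed.

(** The time at which the discretised path reads the noise: the last grid point up to [t], capped at
    the end of the grid. *)
Definition grid_time n t : R := (minn (4 ^ n) (Num.truncn (t / mesh n)))%:R * mesh n.

Lemma grid_time_le n t : 0 <= t -> 0 <= grid_time n t <= t.
Proof.
move=> t0; have m0 := mesh_gt0 (R := R) n; have /andP[h1 _] := truncn_mesh n t0.
rewrite /grid_time mulr_ge0 ?(ltW m0)//=; apply: le_trans h1.
by rewrite ler_pM2r// ler_nat geq_minr.
Qed.

Lemma grid_time_close n t : 0 <= t -> t <= (2 ^ n)%:R -> t - grid_time n t <= mesh n.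
Proof.
move=> t0 tn; have m0 := mesh_gt0 (R := R) n; have /andP[h1 h2] := truncn_mesh n t0.
rewrite /grid_time (minn_idPr _); last first.
  rewrite -(ler_nat R); have q0 : 0 <= t / mesh n by rewrite divr_ge0// ltW.
  apply: le_trans (_ : t / mesh n <= _); first by have /andP[] := Num.Theory.truncn_itv q0.
  rewrite ler_pdivrMr// (_ : (4 ^ n)%:R * mesh n = (2 ^ n)%:R)//.
  by rewrite -[4%N]/(2 ^ 2)%N -expnM mulSn mul1n expnD natrM -mulrA mulfV ?mulr1// pnatr_eq0 -lt0n expn_gt0.
by rewrite -natr1 mulrDl mul1r in h2; lra.
Qed.

Lemma path_src_path ys b n t x : 0 <= t -> uniq ys ->
  src_path (path_src ys b n) t x = (x \in ys)%:R * (b (\val x) (grid_time n t) - b (\val x) 0).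
Proof.
move=> t0 us; rewrite /src_path sum_path_src /=.
transitivity (\sum_(j < 4 ^ n) (x \in ys)%:R * ((b (\val x) (j.+1%:R * mesh n) - b (\val x) (j%:R * mesh n)) *
    heaviside (j.+1%:R * mesh n) t)).
  apply: eq_bigr => j _; rewrite -(@sum_pick R G ys x (fun y => (b (\val y) (j.+1%:R * mesh n) -
    b (\val y) (j%:R * mesh n)) * heaviside (j.+1%:R * mesh n) t) us).
  by apply: eq_bigr => y _; rewrite [X in _ * X]mulrC mulrA.
rewrite -mulr_sumr (telescope_heaviside (fun j => b (\val x) (j%:R * mesh n)))//.
by rewrite mul0r.
Qed.

Lemma eventually_seq (P : nat -> V -> Prop) (s : seq V) :
  (forall x, exists n0, forall n, (n0 <= n)%N -> P n x) ->
  exists n0, forall n x, (n0 <= n)%N -> x \in s -> P n x.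
Proof.
move=> h; elim: s => [|a s [n0 IH]]; first by exists 0%N.
have [n1 h1] := h a; exists (maxn n0 n1) => n x; rewrite geq_max => /andP[hn0 hn1].
by rewrite inE => /predU1P[->|xs]; [exact: h1|exact: IH].
Qed.

Lemma good_path_within b (x : Zd d) T : good_path b -> {within `[0, T], continuous (b x)}.
Proof.
move=> [_ bc _]; apply: continuous_subspaceW (bc x) => u /=.
by rewrite !in_itv /= => /andP[->].
Qed.

Lemma grid_time_uniform b (x : Zd d) T (e : R) : good_path b -> 0 <= T -> 0 < e ->
  exists n0, forall n, (n0 <= n)%N -> forall t, 0 <= t <= T -> `|b x (grid_time n t) - b x t| <= e.
Proof.
move=> gb T0 e0; have cb : {within `[0, T], continuous (b x)} by exact: good_path_within.
have [del del0 hd] := segment_uniform T0 e0 cb.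
have [n3 hn3] := mesh_small del0; have [n4 hn4] := exists_nat_gt T.
exists (maxn n3 n4) => n; rewrite geq_max => /andP[hn3n hn4n] t /andP[t0 tT].
have /andP[g0 gt] := grid_time_le n t0.
apply: hd; rewrite ?g0 ?t0 ?(le_trans gt)//.
rewrite distrC ger0_norm ?subr_ge0//; apply: le_trans (grid_time_close t0 _) (hn3 n hn3n).
apply: le_trans tT (le_trans (ltW hn4) _); rewrite ler_nat; apply: leq_trans hn4n _.
exact: ltnW (ltn_expl n (ltnSn 1)).
Qed.

(** On a fixed ball uniform continuity of finitely many paths suffices; outside it, growth of order
    [d] and one more power make the error small by [growth_tail]. Hence the exponent [d.+1]. *)
Lemma noise_src_cvg b : good_path b ->
  src_cvg (noise_src b) (fun t x => b (\val x) t) d.+1.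
Proof.
move=> gb; split=> [n|T e T0 e0]; first exact: path_src_nonneg.
have [b0 bc bb] := gb; have [C [C0 hC]] := bb T T0.
have [n1 hn1] := exists_nat_gt (2 * C / e).
have n1p : (0 < n1)%N by rewrite -(ltr_nat R); apply: le_lt_trans hn1; rewrite divr_ge0 ?mulr_ge0// ltW.
have [n2 hn2] : exists n0, forall n x, (n0 <= n)%N -> x \in ball_seq w n1 ->
    forall t, 0 <= t <= T -> `|b (\val x) (grid_time n t) - b (\val x) t| <= e.
  by apply: eventually_seq => x; exact: grid_time_uniform.
exists (maxn n1 n2) => n t; rewrite geq_max => /andP[hn1n hn2n] tT x.
have /andP[t0 tT'] := tT; have /andP[g0 gt] := grid_time_le n t0.
have us : uniq (ball_seq w n) by exact: (@gbox_uniq R G n).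
rewrite /noise_src path_src_path// b0 subr0.
have gp : 0 < gbr (w := G) x ^+ d by rewrite exprn_gt0// gbr_gt0.
have [xn|xn] := boolP (x \in ball_seq w n1).
  have xn' : x \in ball_seq w n.
    by move: xn; rewrite !mem_ball_seq => /le_trans; apply; rewrite ler_nat.
  rewrite xn' mul1r; apply: le_trans (hn2 n x hn2n xn t tT) _.
  by rewrite ler_peMr ?(ltW e0)// gbr_pow_ge1.
have hb : `|(x \in ball_seq w n)%:R * b (\val x) (grid_time n t) - b (\val x) t| <=
    2 * C * gbr (w := G) x ^+ d.
  apply: le_trans (ler_normB _ _) _.
  have h1 : `|b (\val x) (grid_time n t)| <= C * gbr (w := G) x ^+ d.
    by apply: hC; rewrite g0 (le_trans gt).
  have h2 : `|b (\val x) t| <= C * gbr (w := G) x ^+ d by exact: hC.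
  rewrite normrM normr_nat; case: (x \in ball_seq w n); rewrite ?mul1r ?mul0r.
    by move: h1 h2; set u := C * _; rewrite -mulrA -/u; lra.
  by move: h2; set u := C * _; rewrite -mulrA -/u => h2; have := normr_ge0 (b (\val x) t); lra.
have := @growth_tail R G (fun _ => (x \in ball_seq w n)%:R * b (\val x) (grid_time n t) - b (\val x) t)
  (2 * C) d n1 x (mulr_ge0 (ler0n _ 2) C0) n1p hb xn.
move=> /le_trans; apply; rewrite ler_wpM2r ?exprn_ge0 ?(ltW (gbr_gt0 x))//.
by move: hn1; rewrite ltr_pdivrMr// => /ltW; rewrite ler_pdivrMr ?ltr0n// [n1%:R * _]mulrC.
Qed.

Lemma good_path_time_continuous b : good_path b -> time_continuous (G := G) (fun t x => b (\val x) t).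
Proof. by move=> gb x T; exact: good_path_within. Qed.

(** The noise at the single vertex [y]; the limit of its responses will be the Wiener integral
    indexed by [y]. *)
Lemma vertex_src_cvg b y : good_path b ->
  src_cvg (path_src [:: y] b) (fun t x => (x == y)%:R * b (\val x) t) 0.
Proof.
move=> gb; split=> [n|T e T0 e0]; first exact: path_src_nonneg.
have [n0 hn0] := grid_time_uniform (\val y) gb T0 e0; exists n0 => n t n0n tT x.
have /andP[t0 _] := tT; have [b0 _ _] := gb.
rewrite path_src_path// inE b0 subr0 expr0 mulr1.
have [->|_] := eqVneq x y; last by rewrite !mul0r subrr normr0 ltW.
by rewrite !mul1r; exact: hn0.
Qed.

End noise_source.

Lemma ereal_cvg0 {R : realType} {T : Type} {Fl : set_system T} {FF : Filter Fl} (f : T -> \bar R) :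
  (forall x, 0 <= f x)%E -> (forall e : R, 0 < e -> \forall x \near Fl, (f x <= e%:E)%E) ->
  f @ Fl --> 0%E.
Proof.
move=> f0 h; apply/fine_cvgP; split.
  have := h 1 ltr01; apply: filterS => x fx; rewrite ge0_fin_numE//.
  exact: le_lt_trans fx (ltry _).
apply/cvgrPdist_le => e e0; apply: filterS (h e e0) => x fx /=.
have ff : f x \is a fin_num by rewrite ge0_fin_numE//; exact: le_lt_trans fx (ltry _).
by rewrite sub0r normrN ger0_norm ?fine_ge0// -lee_fin fineK.
Qed.

Lemma ereal_cvg0_le {R : realType} (D : set R) (t : R) (f : R -> \bar R) (e : R) :
  f s @[s --> within D (nbhs t)] --> 0%E -> 0 < e -> \forall s \near within D (nbhs t), (f s <= e%:E)%E.
Proof.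
move=> /fine_cvgP[h1 /cvgrPdist_le h2] e0; apply: filterS2 h1 (h2 e e0) => x ff.
by rewrite sub0r normrN /= => h; rewrite -(fineK ff) lee_fin; exact: le_trans (ler_norm _) h.
Qed.

(** * Trajectories in weighted spaces *)

Section trajectories.
Context {d : nat} {R : realType} {w : conductances d R} (w_sub : subquadratic w).
Local Notation V := (vertex w).
Local Notation G := (vgraph w_sub).
Implicit Types (x y : V) (t s T : R) (f : R -> V -> R) (N n m : nat) (u : V -> R).

Definition growth_within f N := forall T, 0 <= T -> exists A : R, 0 <= A /\
  forall t, 0 <= t <= T -> growth (G := G) (f t) A N.

Lemma sqnormH_ge0 (M : R) u : (0 <= sqnormH M u)%E.
Proof. by apply: esum_ge0 => x _; rewrite lee_fin mulr_ge0 ?sqr_ge0 ?powR_ge0. Qed.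

Lemma growth_norm u (A : R) N : growth (G := G) u A N -> growth (G := G) (fun x => `|u x|) A N.
Proof. by move=> h x; rewrite normr_id. Qed.

Lemma sqnormH_growth n u (c : R) : 0 <= c -> (sqnormH n%:R u <= (c ^+ 2)%:E)%E -> growth (G := G) u c n.
Proof.
move=> c0 /(sqnormH_nat w_sub n) h x; have := @sum_le_pt R G _ _ x h.
have b0 : 0 < gbr (w := G) x ^+ n by rewrite exprn_gt0// gbr_gt0.
rewrite -exprMn mulrC ler_sqr ?nnegrE//; last by rewrite mulr_ge0 ?invr_ge0 ?(ltW b0).
by rewrite ler_pdivrMr.
Qed.

Lemma tempered_of_poly u : poly (G := G) u -> is_tempered u.
Proof. move=> h; have h' := (poly_norm w_sub u).2 h.
exact: (@poly_tempered _ _ _ w_sub R u h'). Qed.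

Lemma finite_radius (P : R -> V -> Prop) (s : seq V) t :
  (forall x, exists2 eta, 0 < eta & forall r, 0 <= r -> `|r - t| < eta -> P r x) ->
  exists2 eta, 0 < eta & forall r x, 0 <= r -> `|r - t| < eta -> x \in s -> P r x.
Proof.
move=> h; elim: s => [|a s [e1 e10 IH]]; first by exists 1.
have [e2 e20 h2] := h a; exists (Num.min e1 e2); first by rewrite lt_min e10.
move=> r x r0; rewrite lt_min => /andP[r1 r2]; rewrite inE => /predU1P[->|xs]; first exact: h2.
exact: IH.
Qed.

(** Coordinatewise continuity becomes continuity in norm at the price of powers: one for the tail
    outside a ball, the others for square summability. *)
Lemma growth_cont_H N : exists m, forall f n, time_continuous (G := G) f -> growth_within f N ->
  (m <= n)%N -> cont_H n%:R f.
Proof.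
have [m [K [K0 hK]]] := growth_sqnormH w_sub (E := R); exists (N.+1 + m)%N => f n cf gf Nn.
split=> t t0.
  have [A [A0 hA]] := gf t t0.
  have := hK _ A N n A0 _ (growth_norm (hA t _)); rewrite t0 lexx => h.
  apply: le_lt_trans (ltry (A ^+ 2 * K)); apply: h => //.
  by apply: leq_trans Nn; rewrite leq_add2r.
apply: ereal_cvg0 => [r|e e0]; first exact: sqnormH_ge0.
have T0 : 0 <= t + 1 by rewrite addr_ge0.
have [A [A0 hA]] := gf _ T0.
pose z := Num.min 1 (e / (K + 1)); have K1 : 0 < K + 1 by lra.
have z0 : 0 < z by rewrite lt_min ltr01 divr_gt0.
have zK : z ^+ 2 * K <= e.
  have z1 : z <= 1 by rewrite ge_min lexx.
  have z2 : z * (K + 1) <= e by rewrite -ler_pdivlMr// ge_min lexx orbT.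
  nra.
have [n1 hn1] := exists_nat_gt (2 * A / z).
have n1p : (0 < n1)%N by rewrite -(ltr_nat R); apply: le_lt_trans hn1; rewrite divr_ge0 ?mulr_ge0// ltW.
have [eta eta0 heta] : exists2 eta, 0 < eta & forall r x, 0 <= r -> `|r - t| < eta ->
    x \in ball_seq w n1 -> r <= t + 1 -> `|f r x - f t x| <= z.
  apply: (finite_radius (P := fun r x => r <= t + 1 -> `|f r x - f t x| <= z)) => x.
  have At : `[0, t + 1]%classic t by rewrite /= in_itv /= t0 lerDl ler01.
  have [eta eta0 h] := within_eps (cf x (t + 1)) At z0; exists eta => // r r0 rt rT.
  by apply: h => //; rewrite /= in_itv /= r0.
rewrite near_withinE; apply/nbhs_ballP; exists (Num.min eta 1); first by rewrite /= lt_min eta0 ltr01.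
move=> r /=; rewrite /ball /= distrC lt_min => /andP[rt rt1]; rewrite in_itv /= andbT => r0.
have rT : r <= t + 1 by move: rt1; rewrite ltr_norml => /andP[_ h]; lra.
have gd : growth (G := G) (f r \- f t) z N.+1.
  move=> x; have [xn|xn] := boolP (x \in ball_seq w n1).
    apply: le_trans (heta r x r0 rt xn rT) _.
    by rewrite ler_peMr ?(ltW z0)// gbr_pow_ge1.
  have hx : `|f r x - f t x| <= 2 * A * gbr (w := G) x ^+ N.
    apply: le_trans (ler_normB _ _) _.
    have h1 : `|f r x| <= A * gbr (w := G) x ^+ N by apply: hA; rewrite r0.
    have h2 : `|f t x| <= A * gbr (w := G) x ^+ N by apply: hA; rewrite t0 lerDl ler01.
    by move: h1 h2; set q := A * _; rewrite -mulrA -/q; lra.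
  have := @growth_tail R G (fun x => f r x - f t x) (2 * A) N n1 x (mulr_ge0 (ler0n _ 2) A0) n1p hx xn.
  move=> /le_trans; apply; rewrite ler_wpM2r ?exprn_ge0 ?(ltW (gbr_gt0 x))//.
  by move: hn1; rewrite ltr_pdivrMr// => /ltW; rewrite ler_pdivrMr ?ltr0n// [n1%:R * _]mulrC.
apply: le_trans (hK _ z N.+1 n (ltW z0) Nn (growth_norm gd)) _.
by rewrite lee_fin.
Qed.

Lemma cont_H_tempered (M : R) (phi : R -> tempered w) : 0 <= M -> cont_H M (fun t => phi t : V -> R) ->
  cont_tempered phi.
Proof.
move=> M0 [_ h] t t0 U [_ /(_ M M0) [e e0 he]].
have := ereal_cvg0_le (h t t0) (divr_gt0 e0 (ltr0n R 2)); apply: filterS => s hs.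
by apply: he; apply: le_lt_trans hs _; rewrite lte_fin; lra.
Qed.

Lemma measurable_restrict_sqnorm (M t : R) f : (forall x, measurable_fun `[0, t] (fun s => f s x)) ->
  measurable_fun `[0, t] (fun s => (Num.sqrt (fine (sqnormH M (f s))))%:E).
Proof.
move=> mf; apply/measurable_EFinP.
have mD : measurable (`[0, t]%classic : set R) by exact: measurable_itv.
pose Fx x : R -> R := (fun s => f s x) \_ `[0, t].
have mFx x : measurable_fun setT (Fx x).
  by apply: ((measurable_restrict _ mD measurableT).1 _); rewrite setTI; exact: mf.
have m1 : measurable_fun [set: R] (fun s => sqnormH M (Fx ^~ s)).
  exact: (measurable_sqnormH w_sub M (F := Fx)).
apply: (eq_measurable_fun (fun s => Num.sqrt (fine (sqnormH M (Fx ^~ s))))).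
  move=> s sD; congr (Num.sqrt (fine (sqnormH M _))); apply/funext => x.
  by rewrite /Fx patchE sD.
have ms : measurable_fun setT (Num.sqrt : R -> R).
  by apply: continuous_measurable_fun; exact: sqrt_continuous.
have mf' : measurable_fun setT (fine : \bar R -> R) by exact: fine_measurable.
by apply: (measurable_funS measurableT) => //; exact: (measurableT_comp ms (measurableT_comp mf' m1)).
Qed.

(** The exponent accommodates both the Laplacian of the solution, which grows with two more powers,
    and the noise. *)
Lemma mild_sde_in_H N N' : exists m, forall (phi0 : tempered w) (phi : R -> tempered w) (b : R -> V -> R) n,
  mild_sol (G := G) (fun t x => phi0 x + Num.sqrt 2 * b t x) (fun t => phi t : V -> R) ->
  growth_within (fun t => phi t) N -> growth_within b N' -> (m <= n)%N ->
  sde_in_H n%:R phi0 phi b.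
Proof.
have [m [K [K0 hK]]] := growth_sqnormH w_sub (E := R).
have [L [L0 hL]] := @lap_growth R G N.
exists ((N + 2 + m) + (N' + m))%N => phi0 phi b n [cphi _ ephi] gphi gb mn t t0.
have [A' [A'0 hA']] := gb t t0; have [A [A0 hA]] := gphi t t0.
have tt : 0 <= t <= t by rewrite t0 lexx.
have N1 : (N' + m <= n)%N by apply: leq_trans mn; exact: leq_addl.
have N2 : (N + 2 + m <= n)%N by apply: leq_trans mn; exact: leq_addr.
split.
  by apply: le_lt_trans (hK _ A' N' n A'0 N1 (growth_norm (hA' t tt))) (ltry _).
have bnd s : 0 <= s <= t -> (sqnormH n%:R (@lap R G (phi s)) <= ((A * L) ^+ 2 * K)%:E)%E.
  move=> st; apply: (hK _ (A * L) (N + 2)%N) => //; first by rewrite mulr_ge0.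
  by apply: growth_norm; apply: hL => //; exact: hA.
have mlap x : measurable_fun `[0, t] (fun s => @lap R G (phi s) x).
  by have := measurable_int _ (@lap_integrable R G _ t x cphi) => /measurable_EFinP.
exists (fun x => \int[lebesgue_measure]_(s in `[0, t]) @lap R G (phi s) x); last first.
  by move=> x; rewrite ephi//; ring.
rewrite [X in is_Hintegral _ _ X _](_ : _ = (fun s => @lap R G (phi s))); last first.
  by apply/funext => s; apply/funext => x; exact: (laplacian_lap w_sub).
split.
- exact: mlap.
- by move=> s; rewrite in_itv /= => st; apply: le_lt_trans (bnd s st) (ltry _).
- pose c : R := Num.sqrt ((A * L) ^+ 2 * K).
  apply: (@le_lt_trans _ _ (\int[lebesgue_measure]_(s in `[0%R, t]) c%:E)%E).
    apply: ge0_le_integral => //.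
    - exact: (measurable_restrict_sqnorm _ mlap).
    move=> s /=; rewrite in_itv /= => st; rewrite lee_fin ler_sqrt ?mulr_ge0 ?sqr_ge0//.
    by rewrite -lee_fin fineK ?bnd// ge0_fin_numE ?sqnormH_ge0//; exact: le_lt_trans (bnd s st) (ltry _).
  have := @integral_cst _ _ _ (@lebesgue_measure R) `[0, t]%classic (measurable_itv _) c%:E; rewrite /cst => ->.
  have lt : (@lebesgue_measure R (`[0%R, t]%classic : set R) < +oo)%E.
    by rewrite lebesgue_measure_itv /=; case: ifP => _; rewrite -?EFinB ltry.
  by apply: lte_mul_pinfty; rewrite ?lee_fin ?sqrtr_ge0.
- by [].
Qed.

(** Brings an arbitrary solution within reach of [mild_unique]. Continuity in norm bounds it near
    each time, and [segment_induction] makes the bound uniform on compact time intervals. *)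
Lemma sde_in_H_mild n (M : R) (phi0 : tempered w) (phi : R -> tempered w) (b : R -> V -> R) :
  cont_H n%:R (fun t => phi t : V -> R) -> sde_in_H M phi0 phi b ->
  mild_sol (G := G) (fun t x => phi0 x + Num.sqrt 2 * b t x) (fun t => phi t : V -> R).
Proof.
move=> [hfin hc] hs.
have near_growth t c : 0 <= t -> 0 < c -> exists2 eta, 0 < eta & forall r, 0 <= r -> `|r - t| < eta ->
    growth (G := G) (phi r \- phi t) c n.
  move=> t0 c0; have := ereal_cvg0_le (hc t t0) (exprn_gt0 2 c0); rewrite near_withinE.
  move=> /nbhs_ballP[eta /= eta0 h]; exists eta => // r r0 rt.
  apply: sqnormH_growth; first exact: ltW.
  by apply: h; rewrite ?in_itv /= ?andbT// /ball /= distrC.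
have pt_growth t : 0 <= t -> exists2 c, 0 <= c & growth (G := G) (phi t) c n.
  move=> t0; exists (Num.sqrt (fine (sqnormH n%:R (phi t : V -> R)))); first exact: sqrtr_ge0.
  apply: sqnormH_growth; first exact: sqrtr_ge0.
  rewrite sqr_sqrtr ?fine_ge0 ?sqnormH_ge0// fineK// ge0_fin_numE ?sqnormH_ge0//; exact: hfin.
split.
- move=> x T; apply: eps_within => t e; rewrite /= in_itv /= => /andP[t0 tT] e0.
  have b0 : 0 < gbr (w := G) x ^+ n by rewrite exprn_gt0// gbr_gt0.
  have [eta eta0 h] := near_growth t _ t0 (divr_gt0 e0 b0); exists eta => // s.
  rewrite in_itv /= => /andP[s0 _] st; have := h s s0 st x.
  by rewrite divfK ?gt_eqF.
- exists n => T T0.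
  pose P r := exists A : R, 0 <= A /\ forall t, 0 <= t <= r -> growth (G := G) (phi t) A n.
  apply: (@segment_induction _ P) => //.
    have [c c0 hc0] := pt_growth 0 (lexx 0); exists c; split=> // t /andP[t1 t2].
    by have -> : t = 0 by lra.
  move=> t /andP[t0 tT]; have [eta eta0 h] := near_growth t 1 t0 ltr01; exists eta => // r s r0 rs sT rt st.
  move=> [A [A0 hA]]; have [c c0 hc0] := pt_growth t t0; exists (A + (1 + c)); split; first lra.
  move=> v /andP[v0 vs]; have [vr|rv] := leP v r.
    by apply: growth_weak (hA v _); rewrite ?v0//; lra.
  have vt : `|v - t| < eta by move: rt st; rewrite !ltr_norml => /andP[? ?] /andP[? ?]; apply/andP; split; lra.
  have := growthD (h v v0 vt) hc0; under [X in growth X]eq_fun do rewrite /= subrK.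
  by apply: growth_weak => //; lra.
- move=> t x t0; have [_ [I [_ _ _ hI] e]] := hs t t0; rewrite e hI.
  have -> : \int[lebesgue_measure]_(s in `[0, t]) laplacian (phi s) x =
      \int[lebesgue_measure]_(s in `[0, t]) @lap R G (phi s) x.
    by apply: eq_Rintegral => s _; exact: (laplacian_lap w_sub).
  by ring.
Qed.

End trajectories.

(** * The stochastic differential equation *)

Section solution.
Context {d : nat} {R : realType} {w : conductances d R} (w_sub : subquadratic w) (X : vsrw w).
Context {dO : measure_display} {Omega : measurableType dO}.
Context {Q : probability Omega R} {F : R -> set (set Omega)} {B : Zd d -> R -> Omega -> R}.
Hypothesis hF : complete_filtration Q F.
Hypothesis hB : brownian_motions Q F B.
Hypothesis good : forall o, good_path (fun x t => B x t o).
Local Notation V := (vertex w).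
Local Notation G := (vgraph w_sub).
Local Notation p := (heat_kernel X).
Local Notation hp := (heat_kernelP w_sub X).
Local Notation heat_sg := (heat_sg (G := G) (p := p)).
Local Notation adapted := (adapted (F := F)).
Implicit Types (x y : V) (t s : R) (o : Omega) (n : nat).

Definition noise_path o (y : Zd d) (t : R) : R := B y t o.

(** The stochastic convolution, constructed path by path and without the factor [Num.sqrt 2]. *)
Definition noise_sol t o x : R := src_sol (G := G) (p := p) (noise_src w_sub (noise_path o)) t x.

Lemma noise_sol_cvg t o x : 0 <= t ->
  src_resp (G := G) (p := p) (noise_src w_sub (noise_path o) n) t x @[n --> \oo] --> noise_sol t o x.
Proof. by move=> t0; exact: (src_sol_cvg hp (noise_src_cvg w_sub (good o))). Qed.

Lemma noise_sol_mild o : mild_sol (G := G) (fun t x => B (\val x) t o) (fun t => noise_sol t o).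
Proof.
have h : good_path (noise_path o) := good o.
by have := src_sol_mild hp (noise_src_cvg w_sub h) (good_path_time_continuous (w_sub := w_sub) h); apply.
Qed.

Lemma noise_sol_growth o : growth_within w_sub (fun t => noise_sol t o) (resp_exp hp d.+1).
Proof. exact: (src_sol_growth hp (noise_src_cvg w_sub (good o))). Qed.

Lemma noise_growth o : growth_within w_sub (fun t x => B (\val x) t o) d.
Proof.
move=> T T0; have [_ _ /(_ T T0) [C [C0 hC]]] := good o; exists C; split=> // t tT x.
exact: hC.
Qed.

Lemma noise_sol_poly t o : 0 <= t -> poly (G := G) (noise_sol t o).
Proof.
move=> t0; have [A [A0 hA]] := noise_sol_growth o t0; exists A, (resp_exp hp d.+1); split=> //.
by apply: hA; rewrite t0 lexx.
Qed.

Lemma noise_respE t o x n : src_resp (G := G) (p := p) (noise_src w_sub (noise_path o) n) t x =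
  \sum_(j < 4 ^ n) \sum_(y <- ball_seq w n)
     p (t - j.+1%:R * mesh n) x y * grid_inc (B := B) (mesh n) (j : nat, \val y) o.
Proof.
rewrite /src_resp sum_path_src; apply: eq_bigr => j _; apply: eq_bigr => y _ /=.
by rewrite mulrC.
Qed.

(** Increments released after [t] meet the kernel at a negative time, where it vanishes; all others
    are known at time [t]. *)
Lemma adapted_noise_sol t x : 0 <= t -> adapted t (fun o => noise_sol t o x).
Proof.
move=> t0; apply/(adaptedP hF _ t0).
apply: (measurable_fun_cvg (h := (fun n o =>
  src_resp (G := G) (p := p) (noise_src w_sub (noise_path o) n) t x) :
    nat -> g_sigma_algebraType (F t) -> R)); last first.
  by move=> o _; exact: noise_sol_cvg.
move=> n; under eq_fun do rewrite noise_respE.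
apply: measurable_sum => j; apply: measurable_sum => y.
have [h1 h2] := grid_step j (mesh_gt0 (R := R) n).
have [jt|tj] := leP (j.+1%:R * mesh n) t; last first.
  under eq_fun do rewrite (hk_neg hp) ?mul0r ?subr_lt0//; exact: measurable_cst.
apply: measurable_funM; first exact: measurable_cst.
by apply/(adaptedP hF _ t0); apply: (adapted_inc hF hB) => //; exact: ltW.
Qed.

(** A [tempered] value carries a proof of temperedness, available here for nonnegative times;
    clamping makes the fields below total in time. *)
Definition clamp t : R := Num.max 0 t.
Lemma clamp_ge0 t : 0 <= clamp t. Proof. by rewrite le_max lexx. Qed.
Lemma clampE t : 0 <= t -> clamp t = t. Proof. by move=> t0; rewrite /clamp max_r. Qed.

Definition noise_field t o : tempered w :=
  Tempered (tempered_of_poly (noise_sol_poly o (clamp_ge0 t))).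

Lemma evolve_poly t (phi0 : tempered w) (eta : tempered w) :
  poly (G := G) (fun x => heat_sg (clamp t) phi0 x + Num.sqrt 2 * eta x).
Proof.
apply: polyD; first exact: (heat_sg_poly hp (clamp_ge0 t) (tval_poly w_sub phi0)).
by apply: polyZ; exact: tval_poly.
Qed.

(** The solution as a function of its starting point and of the accumulated noise. It is jointly
    measurable, and the Markov property is expressed through it. *)
Definition evolve t (phi0 : tempered w) (eta : tempered w) : tempered w :=
  Tempered (tempered_of_poly (evolve_poly t phi0 eta)).

Lemma evolveE t (phi0 eta : tempered w) x : 0 <= t ->
  evolve t phi0 eta x = heat_sg t phi0 x + Num.sqrt 2 * eta x.
Proof.
move=> t0; transitivity (heat_sg (clamp t) phi0 x + Num.sqrt 2 * eta x); first by [].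
by rewrite clampE.
Qed.

Definition sde_sol (phi0 : tempered w) t o : tempered w := evolve t phi0 (noise_field t o).

Lemma sde_solE (phi0 : tempered w) t o x : 0 <= t -> sde_sol phi0 t o x = heat_sg t phi0 x + Num.sqrt 2 * noise_sol t o x.
Proof. by move=> t0; rewrite /sde_sol /= clampE. Qed.

Lemma mild_clamp beta (f : R -> V -> R) (g : R -> V -> R) : (forall t x, 0 <= t -> f t x = g t x) ->
  mild_sol (G := G) beta f -> mild_sol (G := G) beta g.
Proof.
move=> fg [cf gf ef]; split.
- move=> x T; have := cf x T; apply: subspace_eq_continuous => t; rewrite inE /= in_itv /= => /andP[t0 _].
  exact: fg.
- have [N hN] := gf; exists N => T T0; have [A [A0 hA]] := hN T T0; exists A; split=> // t tT x.
  by rewrite -fg; [exact: hA|case/andP: tT].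
move=> t x t0; rewrite -fg// ef//; congr (_ - _); apply: eq_Rintegral => s.
rewrite inE /= in_itv /= => /andP[s0 _]; apply: eq_bigr => y _; by rewrite !fg.
Qed.

Lemma sde_sol_mild (phi0 : tempered w) o : mild_sol (G := G) (fun t x => phi0 x + Num.sqrt 2 * B (\val x) t o)
  (fun t => sde_sol phi0 t o : V -> R).
Proof.
have h := mild_lin 1 (Num.sqrt 2) (heat_sg_mild hp (tval_poly w_sub phi0)) (noise_sol_mild o).
apply: (mild_clamp (f := fun t x => 1 * heat_sg t phi0 x + Num.sqrt 2 * noise_sol t o x)).
  by move=> t x t0; rewrite sde_solE// mul1r.
by apply: eq_mild h => // t x _; rewrite mul1r.
Qed.

Lemma sde_sol_growth (phi0 : tempered w) : exists N, forall o, growth_within w_sub (fun t => sde_sol phi0 t o) N.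
Proof.
have [_ [N hN] _] := heat_sg_mild hp (tval_poly w_sub phi0).
exists (N + resp_exp hp d.+1)%N => o T T0.
have [A [A0 hA]] := hN T T0; have [A' [A'0 hA']] := noise_sol_growth o T0.
exists (A + Num.sqrt 2 * A'); split; first by rewrite addr_ge0// mulr_ge0 ?sqrtr_ge0.
move=> t tT; have t0 : 0 <= t by case/andP: tT.
have g1 := growth_weak A0 (lexx A) (leq_addr (resp_exp hp d.+1) N) (hA t tT).
have g2 := growth_weak A'0 (lexx A') (leq_addl N (resp_exp hp d.+1)) (hA' t tT).
have := growthD g1 (growthZ (Num.sqrt 2) g2); rewrite (ger0_norm (sqrtr_ge0 2)) => h x.
by rewrite sde_solE//; exact: h.
Qed.

Lemma sde_sol_adapted (phi0 : tempered w) t (A : set (tempered w)) : 0 <= t -> measurable A ->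
  F t (sde_sol phi0 t @^-1` A).
Proof.
move=> t0 mA; have [/(_ t t0) sF _ _ _] := hF.
have E : @measurable _ (g_sigma_algebraType (F t)) = F t by exact: sigma_algebra_id.
have : measurable_fun [set: g_sigma_algebraType (F t)] (sde_sol phi0 t : g_sigma_algebraType (F t) -> tempered w).
  apply: measurable_tempered => x.
  rewrite (_ : (fun o => _) = (fun o => heat_sg t phi0 x + Num.sqrt 2 * noise_sol t o x)); last first.
    by apply/funext => o; exact: sde_solE.
  apply: measurable_funD; first exact: measurable_cst.
  apply: measurable_funM; first exact: measurable_cst.
  by apply/(adaptedP hF _ t0); exact: adapted_noise_sol.
by move=> /(_ measurableT A mA); rewrite setTI E.
Qed.

Lemma sde_sol_solution (phi0 : tempered w) : sde_solution Q F B phi0 (sde_sol phi0).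
Proof.
have [N hN] := sde_sol_growth phi0.
have [m1 h1] := growth_cont_H w_sub N; have [m2 h2] := mild_sde_in_H w_sub N d.
have cH n o : (m1 <= n)%N -> cont_H n%:R (fun t => sde_sol phi0 t o : V -> R).
  by move=> hn; apply: h1 => //; have [] := sde_sol_mild phi0 o.
split.
- by move=> t A; exact: sde_sol_adapted.
- by move=> o; apply: (cont_H_tempered (ler0n _ m1)); exact: cH.
exists (m1 + m2)%N; apply: aeW => o; split; first by apply: cH; exact: leq_addr.
apply: h2; [exact: sde_sol_mild|exact: hN|exact: noise_growth|].
by rewrite -addnA addnCA leq_addr.
Qed.

Lemma sde_sol_unique (phi0 : tempered w) phi' : sde_solution Q F B phi0 phi' ->
  {ae Q, forall o, forall t : R, 0 <= t -> phi' t o = sde_sol phi0 t o}.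
Proof.
move=> [_ _ [N]]; apply: filterS => o [h1 h2] t t0; apply: tempered_eq => x.
by have := mild_unique (sde_in_H_mild w_sub h1 h2) (sde_sol_mild phi0 o); move=> /(_ t x t0).
Qed.

Local Notation Ex := (Ex (P := Q)).
Local Notation itg := (itg (P := Q)).
Local Notation grid_inc := (grid_inc (B := B)).
Local Notation mu := (@lebesgue_measure R).

Lemma sum_blocks (g : nat -> R) J K :
  \sum_(j < J) \sum_(i < K) g (j * K + i)%N = \sum_(l < J * K) g l.
Proof.
elim: J => [|J IH]; first by rewrite mul0n !big_ord0.
by rewrite big_ord_recr IH mulSn addnC big_split_ord.
Qed.

Lemma sum_telescope (f : nat -> R) a K : \sum_(i < K) (f (a + i).+1 - f (a + i)%N) = f (a + K)%N - f a.
Proof.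
elim: K => [|K IH]; first by rewrite big_ord0 addn0 subrr.
by rewrite big_ord_recr IH /= addnS; ring.
Qed.

Lemma sum_widen (f : nat -> R) M M' : (M <= M')%N -> (forall j, (M <= j)%N -> f j = 0) ->
  \sum_(j < M) f j = \sum_(j < M') f j.
Proof.
move=> MM h; rewrite (big_ord_widen M' f MM) big_mkcond; apply: eq_bigr => j _.
by case: ltnP => // /h.
Qed.

Lemma sum_cvg (I : Type) (s : seq I) (f : nat -> I -> R) (l : I -> R) :
  (forall i, f n i @[n --> \oo] --> l i) -> \sum_(i <- s) f n i @[n --> \oo] --> \sum_(i <- s) l i.
Proof.
move=> h; elim: s => [|a s IH].
  by under eq_fun do rewrite big_nil; rewrite big_nil; exact: cvg_cst.
by under eq_fun do rewrite big_cons; rewrite big_cons; exact: cvgD.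
Qed.

(** Mean-square bounds that hold from some index on survive pointwise limits, without convergence in
    mean square being known. *)
Lemma fatou_sq (f : nat -> Omega -> R) (g : Omega -> R) (b : R) n0 :
  (forall n, measurable_fun setT (f n)) -> (forall o, f n o @[n --> \oo] --> g o) ->
  (forall n, (n0 <= n)%N -> itg (fun o => f n o ^+ 2) /\ Ex (fun o => f n o ^+ 2) <= b) ->
  (\int[Q]_o (g o ^+ 2)%:E <= b%:E)%E.
Proof.
move=> mf fg fb; pose u n o := (f (n + n0)%N o ^+ 2)%:E.
have mu' n : measurable_fun setT (u n) by apply/measurable_EFinP; exact: measurable_funX.
have ub n : (\int[Q]_o u n o <= b%:E)%E.
  have [i e] := fb _ (leq_addl n n0); move: e; rewrite /Ex /Rintegral -lee_fin fineK//.
  exact: integrable_fin_num.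
have ug o : u n o @[n --> \oo] --> (g o ^+ 2)%:E.
  apply: cvg_EFin; first by apply: nearW.
  have h1 : f (n + n0)%N o @[n --> \oo] --> g o by rewrite (cvg_shiftn n0 (fun n => f n o)).
  rewrite (_ : fine \o u ^~ o = (fun n => f (n + n0)%N o * f (n + n0)%N o)); last first.
    by apply/funext => n; rewrite /u /= expr2.
  by rewrite expr2; have := cvgM h1 h1; apply.
have h : (\int[Q]_o limn_einf (u ^~ o) <= limn_einf (fun n => \int[Q]_o u n o))%E.
  by apply: fatou => // n o _; rewrite /u lee_fin sqr_ge0.
have -> : (\int[Q]_o (g o ^+ 2)%:E = \int[Q]_o limn_einf (u ^~ o))%E.
  apply: eq_integral => o _; rewrite is_cvg_limn_einfE; last by apply/cvg_ex; eexists; exact: ug.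
  by apply/esym/cvg_lim.
apply: le_trans h _; rewrite limn_einf_lim; apply: lime_le; first exact: is_cvg_einfs.
apply: nearW => n; apply: le_trans (ub n); apply: ereal_inf_lbound; by exists n => /=.
Qed.

(** One half of the Ito isometry, with the constant 6 of [normal_second_moment] in place of 1. *)
Lemma vertex_sum_moment h (s : seq (nat * V)) (c : nat * V -> R) : 0 < h -> uniq s ->
  itg (fun o => (\sum_(a <- s) c a * grid_inc h (a.1, \val a.2) o) ^+ 2) /\
  Ex (fun o => (\sum_(a <- s) c a * grid_inc h (a.1, \val a.2) o) ^+ 2) <= 6 * h * \sum_(a <- s) c a ^+ 2.
Proof.
move=> h0 us.
have ort (a b : nat * V) : a != b ->
    Ex (fun o => grid_inc h (a.1, \val a.2) o * grid_inc h (b.1, \val b.2) o) = 0.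
  by move=> ab; apply: (grid_inc_orthogonal hF hB).
have [i e] := Ex_orthogonal_sum c us
  (fun a : nat * V => measurable_grid_inc hF hB (a.1, \val a.2) h0)
  (fun a => (grid_inc_moment hF hB (a.1, \val a.2) h0).1) ort.
split=> //; rewrite e mulr_sumr; apply: ler_sum => a _; rewrite mulrC ler_wpM2r ?sqr_ge0//.
by have [] := grid_inc_moment hF hB (a.1, \val a.2) h0.
Qed.

Lemma mesh4 n : (4 ^ n)%:R * mesh n = (2 ^ n)%:R :> R.
Proof.
by rewrite -[4%N]/(2 ^ 2)%N -expnM mulSn mul1n expnD natrM -mulrA mulfV ?mulr1// pnatr_eq0 -lt0n expn_gt0.
Qed.

Lemma sum_heaviside m (u : R) : 0 <= u ->
  \sum_(l < 4 ^ m) mesh m * heaviside (l.+1%:R * mesh m) u = grid_time m u.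
Proof.
move=> u0; have := telescope_heaviside (fun j => j%:R * mesh m) m (4 ^ m) u0.
rewrite mul0r subr0 -/(grid_time m u) => <-; apply: eq_bigr => l _; congr (_ * _).
by rewrite -mulrBl -natr1; ring.
Qed.

Lemma sum_heaviside_ge m (u : R) : u <= (2 ^ m)%:R ->
  u - mesh m <= \sum_(l < 4 ^ m) mesh m * heaviside (l.+1%:R * mesh m) u.
Proof.
move=> um; have m0 := mesh_gt0 (R := R) m; have [u0|u0] := leP 0 u.
  by rewrite sum_heaviside//; have := grid_time_close u0 um; lra.
apply: (@le_trans _ _ 0); first lra.
by apply: sumr_ge0 => l _; rewrite mulr_ge0 ?(ltW m0).
Qed.

(** * Wiener integrals and the mild formula *)

Section mild.
Variables (t : R) (x : V).
Hypothesis t0 : 0 <= t.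

Definition coef n j y : R := p (t - j.+1%:R * mesh n) x y.

Definition approx (ys : seq V) n o : R :=
  src_resp (G := G) (p := p) (path_src w_sub ys (noise_path o) n) t x.

Lemma approxE ys n o : approx ys n o =
  \sum_(j < 4 ^ n) \sum_(y <- ys) coef n j y * grid_inc (mesh n) (j : nat, \val y) o.
Proof.
rewrite /approx /src_resp sum_path_src; apply: eq_bigr => j _; apply: eq_bigr => y _ /=.
by rewrite mulrC.
Qed.

Lemma measurable_approx ys n : measurable_fun setT (approx ys n).
Proof.
have -> : approx ys n = (fun o => \sum_(j < 4 ^ n) \sum_(y <- ys)
    coef n j y * grid_inc (mesh n) (j : nat, \val y) o) by apply/funext => o; exact: approxE.
apply: measurable_sum => j; apply: measurable_sum => y.
by apply: measurable_funM => //; apply: (measurable_grid_inc hF hB); exact: mesh_gt0.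
Qed.

Lemma coef_late n j y : t < j.+1%:R * mesh n -> coef n j y = 0.
Proof. by move=> h; apply: (hk_neg hp); rewrite subr_lt0. Qed.

Lemma coef_out n j y : t <= (2 ^ n)%:R -> (4 ^ n <= j)%N -> coef n j y = 0.
Proof.
move=> tn nj; apply: coef_late; apply: le_lt_trans tn _; rewrite -mesh4 ltr_pM2r ?mesh_gt0//.
by rewrite ltr_nat ltnS.
Qed.

Lemma grid_refine n k j (y : Zd d) o : grid_inc (mesh n) (j, y) o =
  \sum_(i < 2 ^ k) grid_inc (mesh (n + k)) ((j * 2 ^ k + i)%N, y) o.
Proof.
pose f l := B y (l%:R * mesh (n + k)) o.
transitivity (f (j * 2 ^ k + 2 ^ k)%N - f (j * 2 ^ k)%N); last first.
  by rewrite -(sum_telescope f (j * 2 ^ k) (2 ^ k)).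
rewrite /grid_inc /inc /f /= (mesh_double n k) !mulrA -!natrM.
by rewrite mulSn [(2 ^ k + _)%N]addnC.
Qed.

(** Written on the finer grid, the coarse approximation evaluates the kernel at the end of the
    coarse slot. The difference of two levels is then a single sum over orthogonal increments. *)
Lemma approx_refine n k y o : t <= (2 ^ n)%:R -> approx [:: y] n o =
  \sum_(l < 4 ^ (n + k)) coef n (l %/ 2 ^ k) y * grid_inc (mesh (n + k)) (l : nat, \val y) o.
Proof.
move=> tn; rewrite approxE; under eq_bigr do rewrite big_seq1.
rewrite (sum_widen (f := fun j => coef n j y * grid_inc (mesh n) (j, \val y) o) (M' := (4 ^ n * 2 ^ k)%N)).
- have -> : (4 ^ (n + k) = 4 ^ n * 2 ^ k * 2 ^ k)%N.
    by rewrite expnD -mulnA -expnMn.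
  rewrite -(sum_blocks (fun l => coef n (l %/ 2 ^ k) y * grid_inc (mesh (n + k)) (l, \val y) o)).
  apply: eq_bigr => j _; rewrite (grid_refine n k) mulr_sumr; apply: eq_bigr => i _.
  by rewrite divnMDl ?expn_gt0// divn_small// addn0.
- by rewrite leq_pmulr// expn_gt0.
by move=> j nj; rewrite coef_out// mul0r.
Qed.

Lemma heat_kernel_lip y : exists L : R, 0 <= L /\ forall a b, 0 <= a -> 0 <= b ->
  `|p a x y - p b x y| <= L * `|a - b|.
Proof.
pose L := rate (G := G) y; have L0 : 0 <= L by apply: sumr_ge0 => z _; exact: gw_ge0.
exists L; split=> //.
have key a b : 0 <= a -> a < b -> `|p b x y - p a x y| <= L * (b - a).
  move=> a0 ab; have [cp dp] := hk_heat hp x b y.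
  have cab : {within `[a, b], continuous (fun s => p s x y)}.
    apply: continuous_subspaceW cp => s /=; rewrite !in_itv /= => /andP[sa ->].
    by rewrite (le_trans a0 sa).
  have dab s : s \in `]a, b[ -> is_derive s 1 (fun s => p s x y) (- @lap R G (p s x) y + 0).
    by rewrite in_itv /= => /andP[sa sb]; apply: dp; rewrite // sb (le_lt_trans a0 sa).
  have [c _ ->] := MVT ab dab cab.
  rewrite addr0 normrM normrN (ger0_norm (ltW (_ : 0 < b - a))) ?subr_gt0//.
  rewrite ler_wpM2r ?subr_ge0 ?(ltW ab)//.
  apply: le_trans (ler_norm_sum _ _ _) _; apply: ler_sum => z _.
  rewrite normrM (ger0_norm (gw_ge0 _ _)) ler_piMr ?gw_ge0//.
  have := hk_le1 hp c x y; have := hk_le1 hp c x z; have := hk_ge0 hp c x y; have := hk_ge0 hp c x z.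
  by rewrite ler_norml => *; apply/andP; split; lra.
move=> a b a0 b0; have [ab|ba|->] := ltgtP a b; last by rewrite !subrr normr0 mulr0.
  by rewrite distrC [`|a - b|]distrC (gtr0_norm (_ : 0 < b - a)) ?subr_gt0//; exact: key.
by rewrite (gtr0_norm (_ : 0 < a - b)) ?subr_gt0//; exact: key.
Qed.

Definition lip y : R := sval (cid (heat_kernel_lip y)).
Lemma lip_ge0 y : 0 <= lip y. Proof. by rewrite /lip; case: cid => L []. Qed.
Lemma lipP y a b : 0 <= a -> 0 <= b -> `|p a x y - p b x y| <= lip y * `|a - b|.
Proof. by rewrite /lip; case: cid => L [/= _]; exact. Qed.

(** The two kernel times differ by at most [mesh n], so the Lipschitz bound applies while both are
    nonnegative. If the coarse slot ends after [t], its coefficient is 0; the difference of step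
    functions accounts for these fine slots, which end within [mesh n] before [t]. *)
Lemma coef_diff_sq n k l y : (coef n (l %/ 2 ^ k) y - coef (n + k) l y) ^+ 2 <=
  lip y ^+ 2 * mesh n ^+ 2 * heaviside (l.+1%:R * mesh (n + k)) t +
  (heaviside (l.+1%:R * mesh (n + k)) t - heaviside (l.+1%:R * mesh (n + k)) (t - mesh n)).
Proof.
pose a := (l %/ 2 ^ k).+1%:R * mesh n : R; pose b := l.+1%:R * mesh (n + k) : R.
have m0 := mesh_gt0 (R := R) n; have m1 := mesh_gt0 (R := R) (n + k).
have k0 : (0 < 2 ^ k)%N by rewrite expn_gt0.
have aE : a = ((l %/ 2 ^ k).+1 * 2 ^ k)%:R * mesh (n + k).
  by rewrite /a (mesh_double n k) mulrA -natrM.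
have ba : b <= a by rewrite aE /b ler_pM2r// ler_nat; exact: ltn_ceil.
have ab : a - mesh n < b.
  rewrite aE /b (mesh_double n k) -mulrBl ltr_pM2r// mulSn natrD addrC addKr ltr_nat ltnS.
  exact: leq_trunc_div.
rewrite -/b /heaviside /coef -/a -/b.
have [bt|tb] := leP b t; last first.
  rewrite (hk_neg hp) ?subr_lt0 ?(lt_le_trans tb)// (hk_neg hp) ?subr_lt0//.
  have -> : (b <= t - mesh n) = false by apply/negbTE; rewrite -ltNge; lra.
  by rewrite !subrr expr0n mulr0 addr0.
rewrite mulr1; have [at_|ta] := leP a t.
  have := lipP y (_ : 0 <= t - a) (_ : 0 <= t - b); rewrite !subr_ge0 => /(_ at_ bt) h.
  have h2 : (p (t - a) x y - p (t - b) x y) ^+ 2 <= lip y ^+ 2 * mesh n ^+ 2.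
    rewrite -exprMn -[X in X <= _]real_normK ?num_real// lerXn2r ?nnegrE ?mulr_ge0 ?lip_ge0 ?(ltW m0)//.
    apply: le_trans h _; rewrite ler_wpM2l ?lip_ge0// ler_norml; apply/andP; split; lra.
  apply: le_trans h2 _; rewrite lerDl subr_ge0; by case: (b <= t - mesh n).
rewrite (hk_neg hp) ?subr_lt0// sub0r sqrrN [b <= t - mesh n]leNgt (_ : t - mesh n < b) /=; last lra.
rewrite subr0; have := hk_le1 hp (t - b) x y; have := hk_ge0 hp (t - b) x y.
have := sqr_ge0 (lip y * mesh n); rewrite exprMn => *; nra.
Qed.

(** The first summand is the Lipschitz error over time [t]. The second covers the slots next to [t]:
    [mesh n] for their range and at most another [mesh n] for rounding to the grid. *)
Definition err n y : R := 6 * (lip y ^+ 2 * mesh n ^+ 2 * t + 2 * mesh n).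

Lemma err_small y (e : R) : 0 < e -> exists n0, forall n, (n0 <= n)%N -> err n y <= e /\ t <= (2 ^ n)%:R.
Proof.
move=> e0; pose c := 6 * (lip y ^+ 2 * t + 2).
have c0 : 0 < c by rewrite mulr_gt0// ltr_wpDl// mulr_ge0// sqr_ge0.
have [n1 h1] := mesh_small (divr_gt0 e0 c0); have [n2 h2] := exists_nat_gt t.
exists (maxn n1 n2) => n; rewrite geq_max => /andP[/h1 hn hn2]; split; last first.
  apply: le_trans (ltW h2) _; rewrite ler_nat; apply: leq_trans hn2 _.
  exact: ltnW (ltn_expl n (ltnSn 1)).
have m0 := mesh_gt0 (R := R) n; have m1 := mesh_le1 (R := R) n.
move: hn; rewrite ler_pdivlMr// => hn; apply: le_trans hn; rewrite /err /c.
have : lip y ^+ 2 * mesh n ^+ 2 * t <= lip y ^+ 2 * mesh n * t.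
  rewrite ler_wpM2r// ler_wpM2l ?sqr_ge0// expr2; nra.
by move=> *; lra.
Qed.

Lemma approx_diff n k y : t <= (2 ^ n)%:R ->
  itg (fun o => (approx [:: y] n o - approx [:: y] (n + k) o) ^+ 2) /\
  Ex (fun o => (approx [:: y] n o - approx [:: y] (n + k) o) ^+ 2) <= err n y.
Proof.
move=> tn; have m0 := mesh_gt0 (R := R) n; have m1 := mesh_gt0 (R := R) (n + k).
pose c (a : nat * V) := coef n (a.1 %/ 2 ^ k) y - coef (n + k) a.1 y.
pose s : seq (nat * V) := [seq (l, y) | l <- iota 0 (4 ^ (n + k))].
have us : uniq s by rewrite map_inj_uniq ?iota_uniq// => ? ? [].
have sE (f : nat * V -> R) : \sum_(a <- s) f a = \sum_(l < 4 ^ (n + k)) f (l : nat, y).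
  by rewrite big_map -(big_mkord xpredT (fun l => f (l, y))) /index_iota subn0.
have -> : (fun o => (approx [:: y] n o - approx [:: y] (n + k) o) ^+ 2) =
    (fun o => (\sum_(a <- s) c a * grid_inc (mesh (n + k)) (a.1, \val a.2) o) ^+ 2).
  apply/funext => o; congr (_ ^+ 2); rewrite sE (approx_refine k y o tn) approxE -sumrB.
  by apply: eq_bigr => l _; rewrite big_seq1 /c mulrBl.
have [i e] := vertex_sum_moment c m1 us; split=> //; apply: le_trans e _.
rewrite -mulrA /err ler_wpM2l// sE mulr_sumr.
apply: (@le_trans _ _ (\sum_(l < 4 ^ (n + k)) (lip y ^+ 2 * mesh n ^+ 2 *
    (mesh (n + k) * heaviside (l.+1%:R * mesh (n + k)) t) +
    (mesh (n + k) * heaviside (l.+1%:R * mesh (n + k)) t -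
     mesh (n + k) * heaviside (l.+1%:R * mesh (n + k)) (t - mesh n))))).
  apply: ler_sum => l _; apply: le_trans (ler_wpM2l (ltW m1) (coef_diff_sq n k l y)) _.
  by rewrite mulrDr mulrBr mulrCA.
rewrite big_split /= -mulr_sumr sumrB sum_heaviside//.
have /andP[g1 g2] := grid_time_le (n + k) t0.
have nk : mesh (n + k) <= mesh n :> R.
  by rewrite (mesh_double n k) ler_peMl ?(ltW m1)// ler1n expn_gt0.
have tnk : t - mesh n <= (2 ^ (n + k))%:R.
  apply: (@le_trans _ _ t); first lra.
  by apply: le_trans tn _; rewrite ler_nat leq_exp2l// leq_addr.
have := sum_heaviside_ge tnk; set S := \sum_(_ < _) _ => hS.
have : lip y ^+ 2 * mesh n ^+ 2 * grid_time (n + k) t <= lip y ^+ 2 * mesh n ^+ 2 * t.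
  by rewrite ler_wpM2l// mulr_ge0 ?sqr_ge0.
by move=> *; lra.
Qed.

Definition wiener y o : R := src_sol (G := G) (p := p) (path_src w_sub [:: y] (noise_path o)) t x.

Lemma wiener_cvg y o : approx [:: y] n o @[n --> \oo] --> wiener y o.
Proof.
have h : good_path (noise_path o) := good o.
exact: (src_sol_cvg hp (vertex_src_cvg w_sub y h)).
Qed.

Lemma wiener_error n y : t <= (2 ^ n)%:R ->
  (\int[Q]_o ((wiener y o - approx [:: y] n o) ^+ 2)%:E <= (err n y)%:E)%E.
Proof.
move=> tn; under eq_integral do rewrite -sqrrN opprB.
apply: (@fatou_sq (fun m o => approx [:: y] n o - approx [:: y] m o) _ _ n).
- by move=> m; apply: measurable_funB; exact: measurable_approx.
- by move=> o; apply: cvgB; [exact: cvg_cst|exact: wiener_cvg].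
by move=> m nm; rewrite -(subnKC nm); exact: approx_diff.
Qed.

(** Slots that end after [t] are dropped because [is_wiener_integral] confines the steps to the time
    interval; their coefficients vanish, so sums are unchanged. *)
Definition wiener_steps n y : seq (R * R * R) :=
  [seq ((j%:R * mesh n, j.+1%:R * mesh n), coef n j y)
     | j <- [seq j <- iota 0 (4 ^ n) | j.+1%:R * mesh n <= t]].

Lemma sum_wiener_steps n y (f : R * R -> R) : \sum_(c <- wiener_steps n y) c.2 * f c.1 =
  \sum_(j < 4 ^ n) coef n j y * f (j%:R * mesh n, j.+1%:R * mesh n).
Proof.
rewrite big_map big_filter big_mkcond /=.
rewrite -(big_mkord xpredT (fun j => coef n j y * f (j%:R * mesh n, j.+1%:R * mesh n))) /index_iota subn0.
by apply: eq_bigr => j _; case: leP => // h; rewrite coef_late// mul0r.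
Qed.

Lemma wiener_stepE n y (s : R) : t <= (2 ^ n)%:R -> 0 < s -> s <= t ->
  exists j : nat, [/\ j%:R * mesh n < s, s <= j.+1%:R * mesh n
    & step_fun (wiener_steps n y) s = coef n j y].
Proof.
move=> tn s0 st; have m0 := mesh_gt0 (R := R) n.
have ex : exists j : nat, s <= j.+1%:R * mesh n.
  have /andP[_ h] := truncn_mesh n (ltW s0); by exists (Num.truncn (s / mesh n)); exact: ltW.
have [j sj jmin] := ex_minnP ex.
have js : j%:R * mesh n < s.
  case: j {sj} jmin => [|j] jmin; first by rewrite mul0r.
  by rewrite ltNge; apply/negP => /jmin; rewrite ltnn.
exists j; split=> //.
have jn : (j < 4 ^ n)%N.
  rewrite -(ltr_nat R) -(ltr_pM2r m0) mesh4; apply: lt_le_trans js _; exact: le_trans st tn.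
rewrite /step_fun (sum_wiener_steps n y (fun z => \1_(`]z.1, z.2]) s)) (bigD1 (Ordinal jn))//=.
rewrite indicE mem_set; last by rewrite /= in_itv /= js.
rewrite mulr1 big1 ?addr0// => i ij; rewrite indicE memNset ?mulr0//= in_itv /= => /andP[i1 i2].
have : (i < j.+1)%N by rewrite -(ltr_nat R) -(ltr_pM2r m0); exact: lt_le_trans i1 sj.
have : (j < i.+1)%N by rewrite -(ltr_nat R) -(ltr_pM2r m0); exact: lt_le_trans js i2.
rewrite !ltnS => ji ij'; move/eqP: ij; apply; apply/val_inj => /=; apply/eqP.
by rewrite eqn_leq ij' ji.
Qed.

(** Two exceptional sets escape the Lipschitz bound: the slot reaching past [t], whose coefficient
    is 0, and the point 0, which lies in no half-open slot and has measure zero. *)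
Lemma wiener_step_error n y (s : R) : t <= (2 ^ n)%:R -> 0 <= s <= t ->
  (step_fun (wiener_steps n y) s - p (t - s) x y) ^+ 2 <=
  lip y ^+ 2 * mesh n ^+ 2 + (\1_(`[t - mesh n, t]%classic) s + 4 * \1_([set 0%R]) s).
Proof.
move=> tn /andP[s0 st]; have m0 := mesh_gt0 (R := R) n.
have c0 : 0 <= lip y ^+ 2 * mesh n ^+ 2 by rewrite mulr_ge0 ?sqr_ge0.
have i1 : 0 <= \1_(`[t - mesh n, t]%classic) s :> R by rewrite indicE.
have i2 : 0 <= \1_([set 0%R]) s :> R by rewrite indicE.
have [pl pg] := (hk_le1 hp (t - s) x y, hk_ge0 hp (t - s) x y).
move: s0; rewrite le_eqVlt => /predU1P[s0|s0].
  have -> : step_fun (wiener_steps n y) s = 0.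
    rewrite /step_fun (sum_wiener_steps n y (fun z => \1_(`]z.1, z.2]) s)) big1// => j _.
    rewrite indicE memNset ?mulr0//= in_itv /= -s0 => /andP[+ _].
    by rewrite ltNge mulr_ge0 ?(ltW m0).
  rewrite sub0r sqrrN [X in _ + (_ + 4 * X)]indicE mem_set//= mulr1; nra.
have [j [j1 j2 ->]] := wiener_stepE y tn s0 st.
have jm : j.+1%:R * mesh n = j%:R * mesh n + mesh n :> R by rewrite -[j.+1%:R]natr1 mulrDl mul1r.
have [jt|tj] := leP (j.+1%:R * mesh n) t.
  have := lipP y (_ : 0 <= t - j.+1%:R * mesh n) (_ : 0 <= t - s); rewrite !subr_ge0 => /(_ jt st) h.
  apply: (@le_trans _ _ (lip y ^+ 2 * mesh n ^+ 2)); last lra.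
  rewrite -exprMn -[X in X <= _]real_normK ?num_real// lerXn2r ?nnegrE ?mulr_ge0 ?lip_ge0 ?(ltW m0)//.
  apply: le_trans h _; rewrite ler_wpM2l ?lip_ge0// ler_norml; apply/andP; split; lra.
rewrite coef_late// sub0r sqrrN [X in _ + (X + _)]indicE mem_set /=; first nra.
by rewrite in_itv /= st andbT; lra.
Qed.

Lemma measurable_step_error n y :
  measurable_fun `[0, t] (fun s => (step_fun (wiener_steps n y) s - p (t - s) x y) ^+ 2).
Proof.
apply: measurable_funX; apply: measurable_funB.
  apply: (measurable_funS measurableT) => //.
  have -> : step_fun (wiener_steps n y) = (fun s => \sum_(j < 4 ^ n) coef n j y *
      \1_(`]j%:R * mesh n, j.+1%:R * mesh n]) s).
    by apply/funext => s; exact: (sum_wiener_steps n y (fun z => \1_(`]z.1, z.2]) s)).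
  by apply: measurable_sum => j; apply: measurable_funM => //; exact: measurable_indic.
apply: (@measurable_comp _ _ _ _ _ _ `[0, t]%classic (fun s => p s x y)).
- exact: measurable_itv.
- by move=> _ [s /= + <-]; rewrite !in_itv /= => /andP[? ?]; apply/andP; split; lra.
- exact: measurable_heat_kernel.
by apply: measurable_funB.
Qed.

Lemma wiener_steps_cvg y : (\int[mu]_(s in `[0%R, t])
  ((step_fun (wiener_steps n y) s - p (t - s) x y) ^+ 2)%:E)%E @[n --> \oo] --> 0%E.
Proof.
apply: ereal_cvg0 => [n|e e0]; first by apply: integral_ge0 => s _; rewrite lee_fin sqr_ge0.
have [n0 hn0] := err_small y e0; exists n0 => // n /= /hn0 [en tn].
have m0 := mesh_gt0 (R := R) n; apply: le_trans (_ : _ <= (err n y)%:E)%E _; last by rewrite lee_fin.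
pose c := lip y ^+ 2 * mesh n ^+ 2; have c0 : 0 <= c by rewrite mulr_ge0 ?sqr_ge0.
have mI : measurable (`[0%R, t]%classic : set R) by exact: measurable_itv.
have mi (A : set R) : measurable A -> measurable_fun `[0, t] (fun s => (\1_A s : R)%:E).
  by move=> mA; apply/measurable_EFinP; exact: measurable_indic.
apply: (@le_trans _ _ (\int[mu]_(s in `[0%R, t]) (c%:E + ((\1_(`[t - mesh n, t]%classic) s)%:E +
    (4%:E * (\1_([set 0%R]) s)%:E)))%E)%E).
  apply: ge0_le_integral => //.
  - by move=> s _; rewrite lee_fin sqr_ge0.
  - by apply/measurable_EFinP; exact: measurable_step_error.
  - apply: emeasurable_funD => //; apply: emeasurable_funD; first exact: mi.
    by apply: measurable_funeM; apply: mi.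
  by move=> s /=; rewrite in_itv /= => st; rewrite -EFinM -!EFinD lee_fin; exact: wiener_step_error.
have i0 (A : set R) s : (0 <= (\1_A s : R)%:E)%E by rewrite lee_fin indicE.
have mt : measurable (`[t - mesh n, t]%classic : set R) by exact: measurable_itv.
have m1 := mi _ mt.
have m2 : measurable_fun `[0, t] (fun s => (4%:E * (\1_([set 0%R]) s : R)%:E)%E).
  by apply: measurable_funeM; exact: mi.
have n1 (s : R) : `[0, t]%classic s -> (0 <= (\1_(`[t - mesh n, t]%classic) s : R)%:E)%E by move=> _; exact: i0.
have n2 (s : R) : `[0, t]%classic s -> (0 <= 4%:E * (\1_([set 0%R]) s : R)%:E)%E by move=> _; rewrite mule_ge0.
have m12 := emeasurable_funD m1 m2.
have n12 (s : R) : `[0, t]%classic s -> (0 <= (\1_(`[t - mesh n, t]%classic) s : R)%:E +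
  4%:E * (\1_([set 0%R]) s : R)%:E)%E by move=> st; rewrite adde_ge0 ?n1 ?n2.
rewrite (ge0_integralD mu mI (f1 := fun=> c%:E) _ _ n12 m12)//.
rewrite (ge0_integralD mu mI n1 m1 n2 m2).
rewrite ge0_integralZl//; last exact: mi.
rewrite !integral_indic//.
have l1 : (mu (`[0%R, t]%classic : set R) <= t%:E)%E.
  rewrite lebesgue_measure_itv /= lte_fin; case: ifP => _; first by rewrite oppr0 adde0.
  by rewrite lee_fin.
have l2 : (mu (`[(t - mesh n)%R, t]%classic `&` `[0%R, t]%classic : set R) <= (mesh n)%:E)%E.
  apply: (@le_trans _ _ (mu (`[(t - mesh n)%R, t]%classic : set R))).
    by apply: le_measure; rewrite ?inE; [apply: measurableI|by []|exact: subIsetl].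
  rewrite lebesgue_measure_itv /= lte_fin; case: ifP => _; last by rewrite lee_fin ltW.
  by rewrite -EFinB lee_fin; lra.
have l3 : mu ([set 0%R] `&` `[0%R, t]%classic : set R) = 0%E.
  apply/eqP; rewrite -measure_le0 -(lebesgue_measure_set1 (0 : R)).
  by apply: le_measure; rewrite ?inE; [apply: measurableI|exact: measurable_set1|exact: subIsetl].
have lc : (\int[mu]_(s in `[0%R, t]) c%:E <= (c * t)%:E)%E.
  have := @integral_cst _ _ _ mu `[0%R, t]%classic mI c%:E; rewrite /cst => ->.
  have gen (z : \bar R) : (0 <= z -> z <= t%:E -> c%:E * z <= (c * t)%:E)%E.
    by move=> z0 zt; rewrite (EFinM c t); apply: lee_pmul => //; rewrite lee_fin.
  by apply: gen; [exact: measure_ge0|exact: l1].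
apply: (@le_trans _ _ ((c * t)%:E + ((mesh n)%:E + 4%:E * 0))%E).
  apply: leeD; [exact: lc|apply: leeD; [exact: l2|]].
  apply: lee_pmul; [by rewrite lee_fin|exact: measure_ge0|exact: lexx|].
  exact: (eq_ind_r (fun z => (z <= 0)%E) (lexx 0%E) l3).
by rewrite mule0 adde0 -EFinD lee_fin /err -/c; have := mulr_ge0 c0 t0; lra.
Qed.

Lemma measurable_wiener y : measurable_fun setT (wiener y).
Proof.
apply: (measurable_fun_cvg (h := fun n => approx [:: y] n)).
  by move=> n; exact: measurable_approx.
by move=> o _; exact: wiener_cvg.
Qed.

Lemma wiener_integral y : is_wiener_integral Q (B (\val y)) t (fun s => p (t - s) x y) (wiener y).
Proof.
split; first exact: measurable_wiener.
exists (fun n => wiener_steps n y); split; last 2 first.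
- exact: wiener_steps_cvg.
- apply: ereal_cvg0 => [n|e e0]; first by apply: integral_ge0 => o _; rewrite lee_fin sqr_ge0.
  have [n0 hn0] := err_small y e0; exists n0 => // n /= /hn0 [en tn].
  have -> : (\int[Q]_o ((wiener y o - step_integral (B (\val y)) (wiener_steps n y) o) ^+ 2)%:E =
      \int[Q]_o ((wiener y o - approx [:: y] n o) ^+ 2)%:E)%E.
    apply: eq_integral => o _; congr (((_ - _) ^+ 2)%:E).
    rewrite /step_integral (sum_wiener_steps n y (fun z => B (\val y) z.2 o - B (\val y) z.1 o)) approxE.
    by apply: eq_bigr => j _; rewrite big_seq1.
  by apply: le_trans (wiener_error y tn) _; rewrite lee_fin.
move=> n c /mapP[j]; rewrite mem_filter => /andP[jt _] ->/=; have [h1 h2] := grid_step j (mesh_gt0 (R := R) n).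
by rewrite h1 jt ltW.
Qed.

(** Outside the ball of radius [M] the squares of the kernel sum to at most [C / M], by [hk_decay]
    with exponent 1 and uniformly in time up to [t]. The remainder after finitely many vertices is
    therefore small at every level of discretisation, and Fatou's lemma passes to the limit. *)
Lemma noise_sol_sum : is_L2_sum Q wiener (fun o => noise_sol t o x).
Proof.
split; first by apply: (adapted_measurable hF t0); exact: adapted_noise_sol.
move=> e e0; have [r [r1 hr]] := hk_decay hp 1.
pose C := 2 * ((r + gbr (w := G) x) ^+ 1) ^+ 2 * expR (4 * t).
have C0 : 0 <= C by rewrite mulr_ge0 ?expR_ge0// mulr_ge0 ?sqr_ge0.
have [M hM] := exists_nat_gt (6 * t * C / e + 1).
have q0 : 0 <= 6 * t * C / e by rewrite divr_ge0 ?(ltW e0)// mulr_ge0// mulr_ge0.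
have M1 : 1 < M%:R :> R by lra.
exists [set y | y \in ball_seq w M]; first exact: finite_seq.
move=> A fA hA; pose rs := finmap.enum_fset (fset_set A).
have urs : uniq rs by exact: finmap.fset_uniq.
have mrs y : (y \in rs) = (y \in A) by rewrite /rs in_fset_set.
have tail s : 0 <= s <= t -> sum_le (G := G) (fun y => (y \notin ball_seq w M)%:R * p s x y ^+ 2) (C / M%:R).
  move=> /andP[s0 st] l ul.
  have h := hr x s s0 l ul.
  rewrite ler_pdivlMr; last lra.
  rewrite mulr_suml; apply: le_trans (_ : _ <= 2 * ((r + gbr (w := G) x) ^+ 1) ^+ 2 * expR (4 * s)) _.
    apply: le_trans h; apply: ler_sum => y _; rewrite exprMn expr1.
    have p2 := sqr_ge0 (p s x y); have b1 := gbr_ge1 (w := G) y.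
    case: (boolP (y \in ball_seq w M)) => [_|]; first by rewrite /= !mul0r mulr_ge0// sqr_ge0.
    rewrite mem_ball_seq -ltNge mul1r mulrC => yM; rewrite ler_wpM2r//.
    have yM' : M%:R < gbr (w := G) y by exact: yM.
    nra.
  by rewrite /C ler_wpM2l ?ler_expR ?ler_pM2l// mulr_ge0 ?sqr_ge0.
have [n1 hn1] := seq_in_ball rs.
pose f n o := src_resp (G := G) (p := p) (noise_src w_sub (noise_path o) n) t x -
  \sum_(y <- rs) approx [:: y] n o.
have b : (\int[Q]_o ((noise_sol t o x - \sum_(y <- rs) wiener y o) ^+ 2)%:E <= (6 * (t * (C / M%:R)))%:E)%E.
  apply: (@fatou_sq f _ _ n1).
  - move=> n; apply: measurable_funB; first exact: (measurable_approx (ball_seq w n)).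
    by apply: measurable_sum => y; exact: measurable_approx.
  - move=> o; apply: cvgB; first exact: noise_sol_cvg.
    by apply: sum_cvg => y; exact: wiener_cvg.
  move=> n nn; have m0 := mesh_gt0 (R := R) n.
  pose l := [seq y <- ball_seq w n | y \notin rs].
  have ul : uniq l by apply: filter_uniq; exact: (@gbox_uniq R G n).
  pose s : seq (nat * V) := [seq (j, y) | j <- iota 0 (4 ^ n), y <- l].
  have us : uniq s by apply: allpairs_uniq; rewrite ?iota_uniq// => -[? ?] [? ?].
  pose c (a : nat * V) := coef n a.1 a.2.
  have sE (g : nat * V -> R) : \sum_(a <- s) g a = \sum_(j < 4 ^ n) \sum_(y <- l) g (j : nat, y).
    by rewrite /s big_allpairs_dep -(big_mkord xpredT (fun j => \sum_(y <- l) g (j, y))) /index_iota subn0.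
  have -> : (fun o => f n o ^+ 2) =
      (fun o => (\sum_(a <- s) c a * grid_inc (mesh n) (a.1, \val a.2) o) ^+ 2).
    apply/funext => o; congr (_ ^+ 2); rewrite /f -/(approx (ball_seq w n) n o) sE approxE.
    under [X in _ - X]eq_bigr do rewrite approxE.
    rewrite [X in _ - X]exchange_big -sumrB; apply: eq_bigr => j _ /=.
    under [X in _ - X]eq_bigr do rewrite big_seq1.
    rewrite /l big_filter [X in X - _](bigID (mem rs)) /= addrC; apply/eqP; rewrite subr_eq addrC; apply/eqP.
    rewrite addrC; congr (_ + _); rewrite -big_filter; apply: perm_big; apply: uniq_perm => //.
      by apply: filter_uniq; exact: (@gbox_uniq R G n).
    move=> y; rewrite mem_filter; case: (boolP (y \in rs)) => //= /hn1; rewrite !mem_ball_seq => yn.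
    by rewrite (le_trans yn)// ler_nat.
  have [i e1] := vertex_sum_moment c m0 us; split=> //; apply: le_trans e1 _.
  rewrite -mulrA ler_wpM2l// sE mulr_sumr.
  apply: (@le_trans _ _ (\sum_(j < 4 ^ n) C / M%:R * (mesh n * heaviside (j.+1%:R * mesh n) t))).
    apply: ler_sum => j _; rewrite mulrCA ler_wpM2l ?(ltW m0)//= /heaviside /c /coef /=.
    have [jt|tj] := leP (j.+1%:R * mesh n) t; last first.
      rewrite mulr0 big1// => y _; by rewrite (hk_neg hp) ?subr_lt0// expr0n.
    rewrite mulr1; have := tail (t - j.+1%:R * mesh n) _ l ul; rewrite subr_ge0 jt lerBlDr lerDl.
    have q : true && (0 <= j.+1%:R * mesh n :> R) by rewrite mulr_ge0 ?(ltW m0).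
    move=> /(_ q) hq; apply: le_trans hq.
    rewrite big_seq [X in _ <= X]big_seq; apply: ler_sum => y; rewrite mem_filter => /andP[yr _].
    have -> : y \notin ball_seq w M.
      by apply: contra yr => yM; rewrite mrs; apply/mem_set; exact: hA.
    by rewrite mul1r.
  rewrite -mulr_sumr sum_heaviside// mulrC ler_wpM2r ?divr_ge0//.
  by have /andP[] := grid_time_le n t0.
have -> : (\int[Q]_o ((noise_sol t o x - (\sum_(y \in A) wiener y o)%R) ^+ 2)%:E =
    \int[Q]_o ((noise_sol t o x - \sum_(y <- rs) wiener y o) ^+ 2)%:E)%E.
  by apply: eq_integral => o _; rewrite fsbig_finite.
apply: le_lt_trans b _; rewrite lte_fin.
have -> : 6 * (t * (C / M%:R)) = 6 * t * C / M%:R by rewrite !mulrA.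
rewrite ltr_pdivrMr; last lra.
have : 6 * t * C / e < M%:R by lra.
by rewrite ltr_pdivrMr// [M%:R * e]mulrC.
Qed.

End mild.

Lemma sde_sol_mild_formula (phi0 : tempered w) : mild_formula Q X B phi0 (sde_sol phi0).
Proof.
move=> t x t0; exists (wiener t x), (fun o => noise_sol t o x); split.
- by move=> y; exact: wiener_integral.
- exact: noise_sol_sum.
apply: aeW => o; rewrite sde_solE//; congr (_ + _).
by rewrite (rw_semigroupE (w_sub := w_sub) X t0 (tval_poly w_sub phi0)).
Qed.

(** * Restarting the solution and the Markov property *)

Lemma good_shift b (s : R) : 0 <= s -> good_path b -> good_path (fun (y : Zd d) r => b y (s + r) - b y s).
Proof.
move=> s0 [b0 bc bb]; split.
- by move=> y; rewrite addr0 subrr.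
- move=> y; apply: eps_within => u e; rewrite /= in_itv /= andbT => u0 e0.
  have su : `[0, +oo[%classic (s + u) by rewrite /= in_itv /= andbT addr_ge0.
  have [eta eta0 h] := within_eps (bc y) su e0; exists eta => // v; rewrite in_itv /= andbT => v0 vu.
  have -> : b y (s + v) - b y s - (b y (s + u) - b y s) = b y (s + v) - b y (s + u) by ring.
  apply: h; first by rewrite /= in_itv /= andbT addr_ge0.
  by have -> : s + v - (s + u) = v - u by ring.
move=> u u0; have [C [C0 hC]] := bb (s + u) (addr_ge0 s0 u0).
exists (C + C); split; first by rewrite addr_ge0.
move=> v y /andP[v0 vu]; apply: le_trans (ler_normB _ _) _; rewrite mulrDl.
by apply: lerD; apply: hC; rewrite ?addr_ge0 ?s0 ?lerD2l ?lerDl.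
Qed.

Definition shift_path s o (y : Zd d) (r : R) : R := B y (s + r) o - B y s o.

Definition shift_sol s t o x : R := src_sol (G := G) (p := p) (noise_src w_sub (shift_path s o)) t x.

Lemma good_shift_path s o : 0 <= s -> good_path (shift_path s o).
Proof. by move=> s0; exact: (good_shift s0 (good o)). Qed.

Lemma shift_sol_cvg s t o x : 0 <= s -> 0 <= t ->
  src_resp (G := G) (p := p) (noise_src w_sub (shift_path s o) n) t x @[n --> \oo] --> shift_sol s t o x.
Proof. by move=> s0 t0; exact: (src_sol_cvg hp (noise_src_cvg w_sub (good_shift_path o s0))). Qed.

Lemma shift_sol_mild s o : 0 <= s ->
  mild_sol (G := G) (fun t x => B (\val x) (s + t) o - B (\val x) s o) (fun t => shift_sol s t o).
Proof.
move=> s0; have h := good_shift_path o s0.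
by have := src_sol_mild hp (noise_src_cvg w_sub h) (good_path_time_continuous (w_sub := w_sub) h); apply.
Qed.

Lemma shift_sol_poly s t o : 0 <= s -> 0 <= t -> poly (G := G) (shift_sol s t o).
Proof. by move=> s0 t0; have [_ g _] := shift_sol_mild o s0; exact: (loc_growth_poly t0 g). Qed.

Definition shift_field s t o : tempered w :=
  Tempered (tempered_of_poly (shift_sol_poly o (clamp_ge0 s) (clamp_ge0 t))).

Lemma shift_fieldE s t o x : 0 <= s -> 0 <= t -> shift_field s t o x = shift_sol s t o x.
Proof.
move=> s0 t0; transitivity (shift_sol (clamp s) (clamp t) o x); first by [].
by rewrite !clampE.
Qed.

Lemma shift_sol0 t o x : shift_sol 0 t o x = noise_sol t o x.
Proof.
rewrite /shift_sol /noise_sol; congr (src_sol (noise_src w_sub _) t x).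
apply/funext => y; apply/funext => r; rewrite /shift_path add0r.
by have [-> _ _] := good o; rewrite subr0.
Qed.

Lemma shift_field0 t o : shift_field 0 t o = noise_field t o.
Proof. by apply: tempered_eq => x /=; rewrite clampE//; exact: shift_sol0. Qed.

(** Both sides solve the equation restarted at [s], one by [mild_shift], the other by linearity;
    uniqueness identifies them. *)
Lemma sde_sol_shift (phi0 : tempered w) s t o : 0 <= s -> 0 <= t ->
  sde_sol phi0 (s + t) o = evolve t (sde_sol phi0 s o) (shift_field s t o).
Proof.
move=> s0 t0; apply: tempered_eq => x.
have cB : time_continuous (G := G) (fun t x => phi0 x + Num.sqrt 2 * B (\val x) t o).
  move=> y T; apply: eps_within => u e uT e0.
  have gb : good_path (noise_path o) := good o.
  have cb : {within `[0, T], continuous (noise_path o (\val y))} by exact: good_path_within.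
  have e2 : 0 < e / Num.sqrt 2 by rewrite divr_gt0// sqrtr_gt0.
  have [eta eta0 h] := within_eps cb uT e2; exists eta => // v vT vu.
  have -> : phi0 y + Num.sqrt 2 * B (\val y) v o - (phi0 y + Num.sqrt 2 * B (\val y) u o) =
    Num.sqrt 2 * (B (\val y) v o - B (\val y) u o) by ring.
  by rewrite normrM (ger0_norm (sqrtr_ge0 2)) mulrC -ler_pdivlMr ?sqrtr_gt0//; exact: h.
have h1 := mild_shift s0 cB (sde_sol_mild phi0 o).
have h2 := mild_lin 1 (Num.sqrt 2) (heat_sg_mild hp (tval_poly w_sub (sde_sol phi0 s o))) (shift_sol_mild o s0).
have h3 : mild_sol (G := G) (fun r y => 1 * sde_sol phi0 s o y +
    Num.sqrt 2 * (B (\val y) (s + r) o - B (\val y) s o)) (fun r => sde_sol phi0 (s + r) o : V -> R).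
  by apply: eq_mild h1 => // r y _; ring.
have := mild_unique h3 h2; move=> /(_ t x t0) ->.
by rewrite evolveE// shift_fieldE// mul1r.
Qed.

Lemma measurable_noise_field t : measurable_fun setT (noise_field t).
Proof.
apply: measurable_tempered => x; have := adapted_noise_sol x (clamp_ge0 t).
exact: (adapted_measurable hF (clamp_ge0 t)).
Qed.

Lemma measurable_evolve t : measurable_fun [set: tempered w * tempered w] (fun z => evolve t z.1 z.2).
Proof.
apply: measurable_tempered => x /=; apply: measurable_funD.
  apply: (measurableT_comp (f := fun xi : tempered w => heat_sg (clamp t) xi x)).
    exact: (measurable_heat_sg w_sub X x (clamp_ge0 t)).
  exact: measurable_fst.
apply: measurable_funM; first exact: measurable_cst.
by apply: (measurableT_comp (f := fun xi : tempered w => xi x)); [exact: measurable_tval|exact: measurable_snd].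
Qed.

Definition shift_inc s h (a : nat * Zd d) (o : Omega) : R :=
  inc (B := B) a.2 (s + a.1%:R * h) (s + a.1.+1%:R * h) o.

Lemma shift_step s h j : 0 <= s -> 0 < h -> 0 <= s + j%:R * h /\ s + j%:R * h < s + j.+1%:R * h.
Proof. by move=> s0 h0; have [h1 h2] := grid_step j h0; split; [exact: addr_ge0|rewrite ltrD2l]. Qed.

Lemma measurable_shift_inc s h a : 0 <= s -> 0 < h -> measurable_fun setT (shift_inc s h a).
Proof.
move=> s0 h0; have [h1 h2] := shift_step a.1 s0 h0.
by apply: (measurable_inc hF hB) => //; exact: ltW.
Qed.

Lemma F_setI u (A A' : set Omega) : 0 <= u -> F u A -> F u A' -> F u (A `&` A').
Proof.
move=> u0; have [/(_ u u0) sF _ _ _] := hF.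
have E : @measurable _ (g_sigma_algebraType (F u)) = F u by exact: sigma_algebra_id.
by rewrite -E; exact: measurableI.
Qed.

Lemma rect_cons (I : eqType) (T : Type) (i : I) l (A : I -> set R) (f : I -> T -> R) :
  [set o | forall k, k \in i :: l -> A k (f k o)] =
  f i @^-1` A i `&` [set o | forall k, k \in l -> A k (f k o)].
Proof.
apply/seteqP; split=> o /=.
  by move=> h; split=> [|k kl]; apply: h; rewrite inE ?eqxx// kl orbT.
by move=> [h1 h2] k; rewrite inE => /predU1P[->//|]; exact: h2.
Qed.

Lemma rect_nil (I : eqType) (T : Type) (A : I -> set R) (f : I -> T -> R) :
  [set o | forall k, k \in [::] -> A k (f k o)] = setT.
Proof. by apply/seteqP; split. Qed.

Lemma measurable_rect (I : eqType) dT (T : measurableType dT) (l : seq I) (A : I -> set R) (f : I -> T -> R) :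
  (forall i, measurable (A i)) -> (forall i, measurable_fun setT (f i)) ->
  measurable [set o | forall k, k \in l -> A k (f k o)].
Proof.
move=> mA mf; elim: l => [|i l IH]; first by rewrite rect_nil.
rewrite rect_cons; apply: measurableI => //; rewrite -[X in measurable X]setTI; exact: mf.
Qed.

Lemma F_rect u (l : seq (Zd d)) (A : Zd d -> set R) (f : Zd d -> Omega -> R) : 0 <= u ->
  (forall i, measurable (A i)) -> (forall i, adapted u (f i)) ->
  F u [set o | forall k, k \in l -> A k (f k o)].
Proof.
move=> u0 mA af; elim: l => [|i l IH]; first by rewrite rect_nil; exact: (F_setT hF u0).
by rewrite rect_cons; apply: F_setI => //; exact: af.
Qed.

(** A full block of time slots and sites, whose probability can be computed one slot at a time; an
    arbitrary finite family is padded with [setT] to such a block. *)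
Definition slots s h J (ys : seq (Zd d)) (A : nat * Zd d -> set R) : set Omega :=
  [set o | forall j, (j < J)%N -> forall z, z \in ys -> A (j, z) (shift_inc s h (j, z) o)].

Lemma slotsS s h J ys A : slots s h J.+1 ys A =
  slots s h J ys A `&` [set o | forall z, z \in ys -> A (J, z) (shift_inc s h (J, z) o)].
Proof.
apply/seteqP; split=> o /=.
  by move=> hh; split=> [j jJ|]; apply: hh => //; exact: leqW.
by move=> [h1 h2] j; rewrite ltnS leq_eqVlt => /predU1P[->//|]; exact: h1.
Qed.

(** The part of the block before slot [J] belongs to the past at the start of that slot, as Brownian
    independence requires. The starting time [s] leaves no trace in the product. *)
Lemma slots_prob s h J ys A (H : set Omega) : 0 <= s -> 0 < h -> uniq ys ->
  (forall a, measurable (A a)) -> F s H ->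
  F (s + J%:R * h) (H `&` slots s h J ys A) /\
  Q (H `&` slots s h J ys A) = (Q H * (\prod_(j < J) \prod_(z <- ys)
    fine (normal_prob 0 (Num.sqrt h) (A (j : nat, z))))%:E)%E.
Proof.
move=> s0 h0 us mA FH; elim: J => [|J [IH1 IH2]].
  have -> : slots s h 0 ys A = setT by apply/seteqP; split.
  by rewrite setIT mul0r addr0 big_ord0 mule1.
have [g1 g2] := shift_step J s0 h0; have g3 : 0 <= s + J.+1%:R * h by exact: le_trans g1 (ltW g2).
rewrite slotsS setIA; split.
  apply: F_setI => //; first by have [_ _ hm _] := hF; exact: (hm _ _ g1 (ltW g2)).
  apply: (F_rect (f := fun z => shift_inc s h (J, z)) _ g3 (fun z => mA (J, z))) => z.
  by apply: (adapted_inc hF hB) => //; exact: ltW.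
have [_ _ _ hQ] := hB; have := hQ _ _ g1 g2 _ ys (fun z => A (J, z)) IH1 us (fun z => mA (J, z)).
have -> : s + J.+1%:R * h - (s + J%:R * h) = h by rewrite -[J.+1%:R]natr1; ring.
rewrite IH2 => e; rewrite big_ord_recr /= EFinM muleA -e; congr (Q _).
Qed.

Lemma bigmax_fst (T : eqType) (l : seq (nat * T)) a : a \in l -> (a.1 <= \max_(b <- l) b.1)%N.
Proof.
elim: l => [//|b l IH]; rewrite inE big_cons leq_max => /predU1P[->|/IH ->]; first by rewrite leqnn.
by rewrite orbT.
Qed.

Lemma slots_of_rect s h (l : seq (nat * Zd d)) (A : nat * Zd d -> set R) :
  [set o | forall a, a \in l -> A a (shift_inc s h a o)] =
  slots s h (\max_(a <- l) a.1).+1 (undup [seq a.2 | a <- l]) (fun a => if a \in l then A a else setT).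
Proof.
apply/seteqP; split=> o /= hh.
  by move=> j _ y _; case: ifP => // /hh.
move=> [j z] al; have jl : (j <= \max_(a <- l) a.1)%N := bigmax_fst al.
have := hh j; rewrite ltnS => /(_ jl z); rewrite mem_undup al; apply.
by apply/mapP; exists (j, z).
Qed.

Lemma rect_indep s h (H : set Omega) (l : seq (nat * Zd d)) (A : nat * Zd d -> set R) : 0 <= s -> 0 < h -> F s H ->
  (forall a, measurable (A a)) ->
  Q (H `&` [set o | forall a, a \in l -> A a (shift_inc s h a o)]) =
  (Q H * Q [set o | forall a, a \in l -> A a (shift_inc 0%R h a o)])%E.
Proof.
move=> s0 h0 FH mA; rewrite !slots_of_rect.
set A' := fun a => if a \in l then A a else setT.
have mA' a : measurable (A' a) by rewrite /A'; case: ifP.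
have us := undup_uniq [seq a.2 | a <- l].
rewrite (slots_prob _ s0 h0 us mA' FH).2; congr (_ * _)%E.
rewrite -[X in _ = Q X]setTI (slots_prob _ (lexx 0) h0 us mA' (F_setT hF (lexx 0))).2.
by rewrite probability_setT mul1e.
Qed.

Lemma cylinder_measure_unique (I : eqType) dT (T : measurableType dT) (ev : I -> T -> R)
  (m1 m2 : {measure set T -> \bar R}) : @measurable _ T = <<s cylinders ev >> ->
  (m1 setT < +oo)%E ->
  (forall (l : seq I) (A : I -> set R), (forall i, measurable (A i)) ->
     m1 [set z | forall i, i \in l -> A i (ev i z)] = m2 [set z | forall i, i \in l -> A i (ev i z)]) ->
  forall Z, measurable Z -> m1 Z = m2 Z.
Proof.
move=> mE mfin h; pose rect (l : seq I) (A : I -> set R) : set T := [set z | forall i, i \in l -> A i (ev i z)].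
pose GG : set (set T) := [set Z | exists (l : seq I) (A : I -> set R),
  (forall i, measurable (A i)) /\ Z = rect l A].
have mev i : measurable_fun setT (ev i).
  by move=> _ A mA; rewrite setTI mE; apply: sub_sigma_algebra; exists i, A.
apply: (measure_unique GG (fun _ => setT)).
- apply/seteqP; split.
    rewrite mE; apply: smallest_sub; first exact: smallest_sigma_algebra.
    move=> _ [i [A [mA ->]]]; apply: sub_sigma_algebra; exists [:: i], (fun _ => A); split=> //.
    apply/seteqP; split=> z /=; first by move=> hz k; rewrite inE => /eqP ->.
    by move=> /(_ i (mem_head _ _)).
  apply: smallest_sub; first by rewrite mE; exact: smallest_sigma_algebra.
  by move=> _ [l [A [mA ->]]]; exact: measurable_rect.
- move=> _ _ [l [A [mA ->]]] [l' [A' [mA' ->]]].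
  exists (l ++ l'), (fun i => (if i \in l then A i else setT) `&` (if i \in l' then A' i else setT)); split.
    by move=> i; apply: measurableI; case: ifP.
  apply/seteqP; split=> z /=.
    by move=> [h1 h2] i _; split; case: ifP => // ?; [exact: h1|exact: h2].
  move=> hz; split=> i il; have := hz i; rewrite mem_cat il ?orbT => /(_ isT) [h1 h2].
    by move: h1.
  by move: h2.
- by move=> _; exists [::], (fun _ => setT); split=> //; apply/seteqP; split.
- by apply/seteqP; split=> // z _; exists 0%N.
- by move=> _ [l [A [mA ->]]]; exact: h.
by [].
Qed.

(** Independence from [H] and equality in law with [f0] form a single identity between finite
    measures, so finite rectangles suffice to check it. *)
Lemma indep_of_rect (I : eqType) dT (T : measurableType dT) (ev : I -> T -> R) (f f0 : Omega -> T)
  (H : set Omega) : @measurable _ T = <<s cylinders ev >> ->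
  measurable H -> measurable_fun setT f -> measurable_fun setT f0 ->
  (forall (l : seq I) (A : I -> set R), (forall i, measurable (A i)) ->
     Q (H `&` [set o | forall i, i \in l -> A i (ev i (f o))]) =
     (Q H * Q [set o | forall i, i \in l -> A i (ev i (f0 o))])%E) ->
  forall Z, measurable Z -> Q (H `&` f @^-1` Z) = (Q H * Q (f0 @^-1` Z))%E.
Proof.
move=> mE mH mf mf0 h Z mZ.
have q0 : 0 <= fine (Q H) by exact: fine_ge0.
have qE : Q H = (fine (Q H))%:E by rewrite fineK//; exact: fin_num_measure.
have e := @cylinder_measure_unique I dT T ev (pushforward (mrestr Q mH) f)
  (mscale (NngNum q0) (pushforward Q f0)) mE.
refine (etrans _ (etrans (e mf mf0 _ _ Z mZ) _)).
- by rewrite /pushforward /mrestr setIC.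
- have e0 : pushforward (mrestr Q mH) f setT = Q H by rewrite /pushforward /mrestr preimage_setT setTI.
  exact: (eq_ind_r (fun z : \bar R => (z < +oo)%E) (eq_ind_r (fun z : \bar R => (z < +oo)%E) (ltry _) qE) e0).
- move=> l A mA; refine (etrans _ (etrans (h l A mA) _)); first by rewrite /pushforward /mrestr setIC.
  by rewrite {1}qE.
by rewrite [in RHS]qE.
Qed.

(** [gridT] holds the increments for one mesh, [fieldT] below those for all dyadic meshes, each as
    one point of a product space with its cylinder sigma-algebra. *)
Definition gridT : Type := nat * Zd d -> R.
HB.instance Definition _ := Pointed.on gridT.
Definition grid_ev (a : nat * Zd d) (v : gridT) : R := v a.
Definition fieldT : Type := nat * (nat * Zd d) -> R.
HB.instance Definition _ := Pointed.on fieldT.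
Definition field_ev (a : nat * (nat * Zd d)) (v : fieldT) : R := v a.
Local Notation GT := (g_sigma_algebraType (cylinders grid_ev)).
Local Notation FT := (g_sigma_algebraType (cylinders field_ev)).

Lemma measurable_into (I : Type) dT dS (S : measurableType dS) (T : measurableType dT) (ev : I -> T -> R)
  (f : S -> T) : @measurable _ T = <<s cylinders ev >> ->
  (forall i, measurable_fun setT (fun u => ev i (f u))) -> measurable_fun setT f.
Proof.
move=> mE mf; apply: (@measurability _ _ _ _ _ _ (cylinders ev)) => //.
by move=> _ [_ [i [A [mA ->]]] <-]; exact: mf.
Qed.

Lemma measurable_grid_ev a : measurable_fun [set: GT] (grid_ev a).
Proof. by move=> _ A mA; rewrite setTI; apply: sub_sigma_algebra; exists a, A. Qed.

Lemma measurable_field_ev a : measurable_fun [set: FT] (field_ev a).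
Proof. by move=> _ A mA; rewrite setTI; apply: sub_sigma_algebra; exists a, A. Qed.

Definition grid_field s h o : GT := fun a => shift_inc s h a o.

Lemma measurable_grid_field s h : 0 <= s -> 0 < h -> measurable_fun setT (grid_field s h).
Proof.
move=> s0 h0; apply: (measurable_into (ev := grid_ev : nat * Zd d -> GT -> R)) => // a.
exact: measurable_shift_inc.
Qed.

Lemma grid_field_indep s h (H : set Omega) (Z : set GT) : 0 <= s -> 0 < h -> F s H -> measurable Z ->
  Q (H `&` grid_field s h @^-1` Z) = (Q H * Q (grid_field 0%R h @^-1` Z))%E.
Proof.
move=> s0 h0 FH; apply: (indep_of_rect (ev := grid_ev : nat * Zd d -> GT -> R)) => //.
- by have [_ hm _ _] := hF; exact: (hm s s0).
- exact: measurable_grid_field.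
- exact: measurable_grid_field.
by move=> l A mA; exact: rect_indep.
Qed.

Definition dyadic_field s o : FT := fun a => shift_inc s (mesh a.1) a.2 o.

Lemma measurable_dyadic_field s : 0 <= s -> measurable_fun setT (dyadic_field s).
Proof.
move=> s0; apply: (measurable_into (ev := field_ev : nat * (nat * Zd d) -> FT -> R)) => // a.
by apply: measurable_shift_inc => //; exact: mesh_gt0.
Qed.

(** Increments for different meshes are not independent. Finitely many of them are, however, sums of
    increments for the finest mesh that occurs, where independence is available. *)
Definition coarsen N (v : GT) (a : nat * (nat * Zd d)) : R :=
  \sum_(i < 2 ^ (N - a.1)) grid_ev ((a.2.1 * 2 ^ (N - a.1) + i)%N, a.2.2) v.

Lemma coarsenE N s a o : (a.1 <= N)%N -> dyadic_field s o a = coarsen N (grid_field s (mesh N) o) a.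
Proof.
move=> aN; case: a aN => n [j y] /= nN; rewrite /dyadic_field /coarsen /grid_ev /grid_field /=.
set k := (N - n)%N; have -> : mesh N = mesh (n + k) :> R by rewrite subnKC.
pose f l := B y (s + l%:R * mesh (n + k)) o.
transitivity (f (j * 2 ^ k + 2 ^ k)%N - f (j * 2 ^ k)%N); last first.
  by rewrite -(sum_telescope f (j * 2 ^ k) (2 ^ k)).
rewrite /shift_inc /inc /f /= (mesh_double n k) !mulrA -!natrM.
by rewrite mulSn [(2 ^ k + _)%N]addnC.
Qed.

Lemma dyadic_field_indep s (H : set Omega) (Z : set FT) : 0 <= s -> F s H -> measurable Z ->
  Q (H `&` dyadic_field s @^-1` Z) = (Q H * Q (dyadic_field 0%R @^-1` Z))%E.
Proof.
move=> s0 FH; apply: (indep_of_rect (ev := field_ev : nat * (nat * Zd d) -> FT -> R)) => //.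
- by have [_ hm _ _] := hF; exact: (hm s s0).
- exact: measurable_dyadic_field.
- exact: measurable_dyadic_field.
move=> l A mA; pose N := (\max_(a <- l) a.1)%N.
pose Zl : set GT := [set v | forall a, a \in l -> A a (coarsen N v a)].
have mZl : measurable Zl.
  apply: (measurable_rect l (f := fun a v => coarsen N v a) mA) => a.
  by apply: measurable_sum => i; exact: measurable_grid_ev.
have e r : [set o | forall a, a \in l -> A a (field_ev a (dyadic_field r o))] = grid_field r (mesh N) @^-1` Zl.
  apply/seteqP; split=> o /= hh a al.
    by rewrite -coarsenE; [exact: hh|exact: bigmax_fst].
  by rewrite /field_ev (coarsenE (N := N)); [exact: hh|exact: bigmax_fst].
by rewrite !e; apply: grid_field_indep => //; exact: mesh_gt0.
Qed.

Definition field_resp t x n (v : FT) : R := \sum_(j < 4 ^ n) \sum_(y <- ball_seq w n)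
  p (t - j.+1%:R * mesh n) x y * field_ev (n, (j : nat, \val y)) v.

(** An upper limit is measurable and defined for every array of increments, including those that
    come from no path; on the actual noise it is the limit. *)
Definition field_sol t x (v : FT) : R := fine (limn_esup (fun n => (field_resp t x n v)%:E)).

Lemma measurable_field_sol t x : measurable_fun setT (field_sol t x).
Proof.
have mf : measurable_fun setT (fine : \bar R -> R) by exact: fine_measurable.
apply: (measurableT_comp mf); apply: measurable_fun_limn_esup => n; apply/measurable_EFinP.
apply: measurable_sum => j; apply: measurable_sum => y; apply: measurable_funM; first exact: measurable_cst.
exact: measurable_field_ev.
Qed.

Lemma field_solE s t x o : 0 <= s -> 0 <= t -> shift_sol s t o x = field_sol t x (dyadic_field s o).
Proof.
move=> s0 t0; have h := shift_sol_cvg (o := o) (x := x) s0 t0.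
have e n : src_resp (G := G) (p := p) (noise_src w_sub (shift_path s o) n) t x = field_resp t x n (dyadic_field s o).
  rewrite /src_resp sum_path_src; apply: eq_bigr => j _; apply: eq_bigr => y _ /=.
  rewrite mulrC; congr (_ * _); rewrite /field_ev /dyadic_field /shift_inc /inc /shift_path /=; ring.
have h' : (field_resp t x n (dyadic_field s o))%:E @[n --> \oo] --> (shift_sol s t o x)%:E.
  by apply: cvg_EFin; [exact: nearW|under eq_fun do rewrite /= -e].
rewrite /field_sol is_cvg_limn_esupE; last by apply/cvg_ex; eexists; exact: h'.
by rewrite (cvg_lim _ h').
Qed.

Lemma measurable_shift_field s t : 0 <= s -> 0 <= t -> measurable_fun setT (shift_field s t).
Proof.
move=> s0 t0; apply: measurable_tempered => x /=; rewrite !clampE//.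
rewrite (_ : (fun o => _) = (fun o => field_sol t x (dyadic_field s o))); last first.
  by apply/funext => o; exact: field_solE.
by apply: measurableT_comp; [exact: measurable_field_sol|exact: measurable_dyadic_field].
Qed.

(** The noise accumulated after [s] is a measurable function of the dyadic increments after [s], and
    it is the same function for every [s]. *)
Lemma shift_field_indep s t (H : set Omega) (Z : set (tempered w)) : 0 <= s -> 0 <= t -> F s H -> measurable Z ->
  Q (H `&` shift_field s t @^-1` Z) = (Q H * Q (noise_field t @^-1` Z))%E.
Proof.
move=> s0 t0 FH.
have msh := measurable_shift_field s0 t0.
apply: (indep_of_rect (ev := fun (x : V) (xi : tempered w) => xi x)) => //.
- by have [_ hm _ _] := hF; exact: (hm s s0).
- exact: measurable_noise_field.
move=> l A mA; pose Zl : set FT := [set v | forall x, x \in l -> A x (field_sol t x v)].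
have mZl : measurable Zl by apply: (measurable_rect l mA) => x; exact: measurable_field_sol.
have e r : 0 <= r -> [set o | forall x, x \in l -> A x (shift_field r t o x)] = dyadic_field r @^-1` Zl.
  move=> r0; apply/seteqP; split=> o /= hh x xl; have := hh x xl; by rewrite ?clampE// -field_solE.
rewrite e// (_ : [set o | forall x, x \in l -> A x (noise_field t o x)] = dyadic_field 0 @^-1` Zl).
  exact: dyadic_field_indep.
by rewrite -e//; apply/seteqP; split=> o hh x xl; [rewrite shift_field0|rewrite -shift_field0]; exact: (hh x xl).
Qed.

Definition semig t (K : tempered w -> R) (phi0 : tempered w) : R := Ex (fun o => K (sde_sol phi0 t o)).

Lemma measurable_sde_sol (phi0 : tempered w) t : measurable_fun setT (sde_sol phi0 t).
Proof.
have mp : measurable_fun setT (fun o => (phi0, noise_field t o)).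
  by apply: measurable_fun_pair; [exact: measurable_cst|exact: measurable_noise_field].
rewrite (_ : sde_sol phi0 t = (fun z => evolve t z.1 z.2) \o (fun o => (phi0, noise_field t o)))//.
exact: (measurableT_comp (measurable_evolve t) mp).
Qed.

Lemma itg_bounded (K : tempered w -> R) (f : Omega -> tempered w) : bounded_measurable K ->
  measurable_fun setT f -> itg (fun o => K (f o)).
Proof.
move=> [mK [M hM]] mf; apply: (itg_le _ (fun o => hM (f o)) (itg_cst M)).
exact: (measurableT_comp mK mf).
Qed.

(** With [M] a bound of the absolute value of [K], adding it makes integrands nonnegative, so that
    Tonelli's theorem applies to functions of either sign. *)
Lemma shifted_integral (K : tempered w -> R) (M : R) (f : Omega -> tempered w) : bounded_measurable K ->
  measurable_fun setT f -> (\int[Q]_o (K (f o) + M)%:E = (Ex (fun o => K (f o)) + M)%:E)%E.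
Proof.
move=> bK mf; have i := itg_bounded bK mf.
have iM : itg (fun o => K (f o) + M) by apply: itgD => //; exact: itg_cst.
have := ExD i (itg_cst M); rewrite Ex_cst => <-.
by rewrite /Ex /Rintegral fineK//; exact: integrable_fin_num.
Qed.

Lemma bounded_semig t (K : tempered w -> R) : bounded_measurable K -> bounded_measurable (semig t K).
Proof.
move=> bK; have [mK [M hM]] := bK; split; last first.
  exists M => xi; have i := itg_bounded bK (measurable_sde_sol xi t).
  rewrite ler_norml; apply/andP; split.
    rewrite -(Ex_cst (P := Q) (- M)); apply: Ex_le => //; first exact: itg_cst.
    by move=> o; have := hM (sde_sol xi t o); rewrite ler_norml => /andP[].
  rewrite -(Ex_cst (P := Q) M); apply: Ex_le => //; first exact: itg_cst.
  by move=> o; have := hM (sde_sol xi t o); rewrite ler_norml => /andP[].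
pose k (z : tempered w * Omega) : \bar R := (K (evolve t z.1 (noise_field t z.2)) + M)%:E.
have mk : measurable_fun setT k.
  apply/measurable_EFinP; apply: measurable_funD; last exact: measurable_cst.
  apply: (measurableT_comp mK).
  apply: (measurableT_comp (measurable_evolve t) (g := fun z : tempered w * Omega => (z.1, noise_field t z.2))).
  apply: measurable_fun_pair; first exact: measurable_fst.
  by apply: (measurableT_comp (measurable_noise_field t)); exact: measurable_snd.
have k0 z : (0 <= k z)%E.
  by rewrite lee_fin; have := hM (evolve t z.1 (noise_field t z.2)); rewrite ler_norml => /andP[? _]; lra.
have := measurable_fun_fubini_tonelli_F (m2 := Q) k mk k0.
rewrite (_ : fubini_F Q k = (fun xi => (semig t K xi + M)%:E)); last first.
  by apply/funext => xi; rewrite /fubini_F /k -(shifted_integral M bK (measurable_sde_sol xi t)).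
move=> /measurable_EFinP m; rewrite (_ : semig t K = (fun xi => semig t K xi + M - M)); last first.
  by apply/funext => xi; rewrite addrK.
by apply: measurable_funB => //; exact: measurable_cst.
Qed.

(** The pair of the solution at [s] and the later noise has a product law, checked on rectangles by
    [shift_field_indep]; integrating out the noise leaves [semig t K] at the solution. *)
Lemma semigD s t (K : tempered w -> R) : 0 <= s -> 0 <= t -> bounded_measurable K ->
  semig (s + t) K = semig s (semig t K).
Proof.
move=> s0 t0 bK; apply/funext => phi0; have [mK [M hM]] := bK.
have bS := bounded_semig t bK.
pose k (z : tempered w * tempered w) : \bar R := (K (evolve t z.1 z.2) + M)%:E.
have mk : measurable_fun setT k.
  apply/measurable_EFinP; apply: measurable_funD; last exact: measurable_cst.
  exact: (measurableT_comp mK (measurable_evolve t)).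
have k0 z : (0 <= k z)%E.
  by rewrite lee_fin; have := hM (evolve t z.1 z.2); rewrite ler_norml => /andP[? _]; lra.
have ms := measurable_sde_sol phi0 s.
have msh := measurable_shift_field s0 t0.
pose f1 o := (sde_sol phi0 s o, shift_field s t o).
pose f2 (z : Omega * Omega) := (sde_sol phi0 s z.1, noise_field t z.2).
have mf1 : measurable_fun setT f1 by exact: measurable_fun_pair.
have mf2 : measurable_fun setT f2.
  apply: measurable_fun_pair.
    by apply: (measurableT_comp ms); exact: measurable_fst.
  by apply: (measurableT_comp (measurable_noise_field t)); exact: measurable_snd.
have law (Z : set (tempered w * tempered w)) : measurable Z ->
    pushforward Q f1 Z = pushforward (Q \x Q)%E f2 Z.
  apply: (rect_measure_unique (m1 := pushforward Q f1) (m2 := pushforward (Q \x Q)%E f2)); last first.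
    exact: (eq_ind_r (fun z : \bar R => (z < +oo)%E) (ltry 1) (@probability_setT _ _ _ Q)).
  move=> A A' mA mA'; rewrite /pushforward.
  transitivity (Q (sde_sol phi0 s @^-1` A `&` shift_field s t @^-1` A')); first by [].
  rewrite shift_field_indep//; last exact: sde_sol_adapted.
  transitivity ((Q \x Q)%E ((sde_sol phi0 s @^-1` A) `*` (noise_field t @^-1` A'))); last by [].
  rewrite product_measure1E//; rewrite -[X in measurable X]setTI; [exact: ms|exact: measurable_noise_field].
have e1 : (\int[pushforward Q f1]_z k z = \int[Q]_o k (f1 o))%E.
  by apply: (ge0_integral_pushforward mf1 Q (f := k) measurableT mk) => z _; exact: k0.
have e2 : (\int[pushforward (Q \x Q)%E f2]_z k z = \int[(Q \x Q)%E]_z k (f2 z))%E.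
  by apply: (ge0_integral_pushforward mf2 (Q \x Q)%E (f := k) measurableT mk) => z _; exact: k0.
have e3 : (\int[Q]_o k (f1 o) = \int[(Q \x Q)%E]_z k (f2 z))%E.
  by rewrite -e1 -e2; apply: eq_measure_integral => Z mZ _; exact: law.
have e4 : (\int[(Q \x Q)%E]_z k (f2 z) = \int[Q]_o (semig t K (sde_sol phi0 s o) + M)%:E)%E.
  rewrite (fubini_tonelli1 (fun z => k (f2 z))); last 2 first.
  - exact: (measurableT_comp mk mf2).
  - by move=> z; exact: k0.
  apply: eq_integral => o _; rewrite /fubini_F /k /f2 /=.
  exact: (shifted_integral M bK (measurable_sde_sol (sde_sol phi0 s o) t)).
have : (semig (s + t) K phi0 + M)%:E = (semig s (semig t K) phi0 + M)%:E.
  rewrite /semig -(shifted_integral M bK (measurable_sde_sol phi0 (s + t))).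
  rewrite -(shifted_integral M bS ms) -e4 -e3; apply: eq_integral => o _.
  by rewrite /k /f1 /= (sde_sol_shift phi0 o s0 t0).
by move=> [] /addIr.
Qed.

Lemma semig0 (K : tempered w -> R) : semig 0 K = K.
Proof.
apply/funext => phi0; rewrite /semig -[RHS](Ex_cst (P := Q)); congr (Ex _).
apply/funext => o; congr K; apply: tempered_eq => x; rewrite sde_solE//.
rewrite (heat_sg0 hp (tval_poly w_sub phi0)) (mild0 (G := G) x (noise_sol_mild o)).
by have [-> _ _] := good o; rewrite mulr0 addr0.
Qed.

Lemma semig_solution t (K : tempered w -> R) (phi0 : tempered w) phi : 0 <= t -> bounded_measurable K ->
  sde_solution Q F B phi0 phi -> ((semig t K phi0)%:E = \int[Q]_o (K (phi t o))%:E)%E.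
Proof.
move=> t0 bK hphi; have [mK _] := bK; have [ad _ _] := hphi.
have mphi : measurable_fun setT (phi t).
  by move=> _ A mA; rewrite setTI; have [_ hm _ _] := hF; apply: (hm t t0); exact: ad.
have i := itg_bounded bK (measurable_sde_sol phi0 t).
rewrite /semig /Ex /Rintegral fineK; last exact: integrable_fin_num.
apply: ae_eq_integral => //.
- by apply/measurable_EFinP; exact: (measurableT_comp mK (measurable_sde_sol phi0 t)).
- by apply/measurable_EFinP; exact: (measurableT_comp mK mphi).
by apply: filterS (sde_sol_unique hphi) => o ho _; rewrite ho.
Qed.

Lemma good_well_defined : well_defined_semigroup Q X F B.
Proof.
split.
  split; [exact: (walk_nonexplosive w_sub X)|exact: (tempered_acts w_sub X)|].
  move=> phi0; exists (sde_sol phi0); split; [exact: sde_sol_solution| |exact: sde_sol_mild_formula].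
  by move=> phi'; exact: sde_sol_unique.
exists semig; split.
- by move=> t K phi0 phi; exact: semig_solution.
- by move=> t K _; exact: bounded_semig.
- by move=> K _; exact: semig0.
- by move=> s t K; exact: semigD.
Qed.

End solution.

(** * Return from the regular version to the given noise *)

Section transfer.
Context {d : nat} {R : realType} {w : conductances d R} (X : vsrw w).
Context {dO : measure_display} {Omega : measurableType dO}.
Context {Q : probability Omega R} {F : R -> set (set Omega)}.
Implicit Types (B : Zd d -> R -> Omega -> R).

Lemma sde_solution_ae B B' (phi0 : tempered w) phi : {ae Q, forall o, forall x t, B x t o = B' x t o} ->
  sde_solution Q F B phi0 phi -> sde_solution Q F B' phi0 phi.
Proof.
move=> hBB [h1 h2 [N hN]]; split=> //; exists N; apply: filterS2 hBB hN => o e [hc hs]; split=> //.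
have -> // : (fun t (x : vertex w) => B' (\val x) t o) = (fun t x => B (\val x) t o).
by apply/funext => t; apply/funext => x; rewrite e.
Qed.

Lemma measurable_step_integral (b : R -> Omega -> R) (t : R) (h : seq (R * R * R)) :
  (forall s, 0 <= s -> measurable_fun setT (b s)) ->
  (forall c, c \in h -> 0 <= c.1.1 /\ c.1.1 <= c.1.2 <= t) ->
  measurable_fun setT (step_integral b h).
Proof.
move=> mb; elim: h => [|c h IH] hh.
  rewrite (_ : step_integral b [::] = cst 0); first exact: measurable_cst.
  by apply/funext => o; rewrite /step_integral big_nil.
rewrite (_ : step_integral b (c :: h) = (fun o => c.2 * (b c.1.2 o - b c.1.1 o) + step_integral b h o)); last first.
  by apply/funext => o; rewrite /step_integral big_cons.
have [c1 /andP[c2 _]] := hh c (mem_head _ _).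
apply: measurable_funD; last by apply: IH => c' hc'; apply: hh; rewrite inE hc' orbT.
by apply: measurable_funM; [exact: measurable_cst|apply: measurable_funB; apply: mb => //; exact: le_trans c1 c2].
Qed.

Lemma wiener_integral_ae (b b' : R -> Omega -> R) (t : R) (g : R -> R) I :
  (forall s, 0 <= s -> measurable_fun setT (b s)) -> (forall s, 0 <= s -> measurable_fun setT (b' s)) ->
  {ae Q, forall o, forall s, b s o = b' s o} ->
  is_wiener_integral Q b t g I -> is_wiener_integral Q b' t g I.
Proof.
move=> mb mb' hbb [mI [h [h1 h2 h3]]]; split=> //; exists h; split=> //.
rewrite (_ : (fun n => \int[Q]_o ((I o - step_integral b' (h n) o) ^+ 2)%:E)%E =
  (fun n => \int[Q]_o ((I o - step_integral b (h n) o) ^+ 2)%:E)%E)//.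
apply/funext => n; apply: ae_eq_integral => //.
- apply/measurable_EFinP; apply: measurable_funX; apply: measurable_funB => //.
  exact: (measurable_step_integral mb' (h1 n)).
- apply/measurable_EFinP; apply: measurable_funX; apply: measurable_funB => //.
  exact: (measurable_step_integral mb (h1 n)).
apply: filterS hbb => o e _; congr (((_ - _) ^+ 2)%:E).
by apply: eq_bigr => c _; rewrite !e.
Qed.

(** Solutions, uniqueness and stochastic integrals are all defined up to null sets, so they carry
    over between two versions of the noise that agree almost surely at all sites and times. *)
Lemma well_defined_ae B B' : complete_filtration Q F -> brownian_motions Q F B -> brownian_motions Q F B' ->
  {ae Q, forall o, forall x t, B' x t o = B x t o} ->
  well_defined_semigroup Q X F B' -> well_defined_semigroup Q X F B.
Proof.
move=> hF hB hB' e [[h1 h2 h3] [T [t1 t2 t3 t4]]].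
have e' : {ae Q, forall o, forall x t, B x t o = B' x t o} by apply: filterS e => o h x t; rewrite h.
split; last first.
  by exists T; split=> // t K phi0 phi t0 bK hphi; apply: t1 => //; exact: sde_solution_ae hphi.
split=> // phi0; have [phi [p1 p2 p3]] := h3 phi0; exists phi; split.
- exact: sde_solution_ae p1.
- by move=> phi' hphi; apply: p2; exact: sde_solution_ae hphi.
move=> t x t0; have [I [Z [i1 i2 i3]]] := p3 t x t0; exists I, Z; split=> // y.
apply: wiener_integral_ae (i1 y) => [s s0|s s0|].
- exact: (measurable_B hF hB').
- exact: (measurable_B hF hB).
by apply: filterS e => o h s; rewrite h.
Qed.

End transfer.

Theorem theorem2p13 (R : realType) (d : nat) (d_gt0 : (0 < d)%N)
  (P : probability (conductances d R) R)
  (P_invariant : translation_invariant P)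
  (P_ergodic : ergodic P)
  (unique_infinite_component :
    {ae P, forall w, exists! C : set (Zd d), infinite_component w C})
  (moment : forall x y : Zd d,
    (\int[P]_w ((w x y) `^ (d%:R / 2))%:E < +oo)%E)
  (dO : measure_display) (Omega : measurableType dO) (Q : probability Omega R)
  (F : R -> set (set Omega)) (B : Zd d -> R -> Omega -> R)
  (F_filtration : complete_filtration Q F)
  (B_brownian : brownian_motions Q F B) :
  {ae P, forall w : conductances d R,
    (forall X : vsrw w, well_defined_semigroup Q X F B) /\
    (forall lambda : Rcomplex R,
       ~ (exists2 r : R, 0 <= r & lambda = real_complex R r) ->
       forall psi : vertex w -> Rcomplex R, is_tempered psi ->
         (forall x, laplacian psi x = lambda * psi x) ->
         forall x, psi x = 0) /\
    (forall X : vsrw w,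
       ~ exists rho : probability (tempered w) R,
           [/\ rw_invariant X rho,
               exists2 T : R, 0 < T &
                 (rho [set xi : tempered w |
                         rw_semigroup X T xi = xi] < 1)%E
             & exists2 N : R, 0 <= N &
                 (\int[rho]_xi sqnormH N (xi : vertex w -> R) < +oo)%E])}.
Proof.
apply: filterS (ae_subquadratic P_invariant moment) => w w_sub; split; last split.
- move=> X; have [B' [hB' good e]] := good_modification F_filtration B_brownian.
  apply: (well_defined_ae F_filtration B_brownian hB' e).
  exact: (good_well_defined w_sub X F_filtration hB' good).
- by move=> lambda hl psi htemp heig x; exact: (no_tempered_eigenfunction w_sub hl htemp heig).
move=> X [rho [hinv [T T0 hT] [N N0 hN]]].
exact: (no_invariant_measure w_sub hinv T0 hT N0 hN).
Qed.
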